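(* Let $\mathcal A$ be an approximately unital operator algebra and let $Y$ be a $\sigma\Delta$-$\mathcal A$-rigged module, presented by a completely isometric homomorphism $a:\mathcal A\to a(\mathcal A)\subseteq\mathbb B(H)$ and a $\sigma$-TRO $M\subseteq\mathbb B(H,K)$ with $M^\star M\,a(\mathcal A)\subseteq a(\mathcal A)$ and $Y\cong\overline{[M\,a(\mathcal A)]}$ (completely isometrically, as right $\mathcal A$-modules). Let $\mathcal A_0=\overline{[M^\star M\,a(\mathcal A)\,M^\star M]}$ and $\mathcal B=\overline{[M\,a(\mathcal A)\,M^\star]}$. Then $Y$ has a restriction $Z$ which is a bimodule of BMP equivalence and which implements a stable isomorphism over the operator algebras $\mathcal A_0$ and $\mathcal B$; that is, $Z$ is a $\mathcal B$-$\mathcal A_0$-operator bimodule, there is an $\mathcal A_0$-$\mathcal B$-operator bimodule $X$ with $\mathcal B\cong Z\otimes^h_{\mathcal A_0}X$ and $\mathcal A_0\cong X\otimes^h_{\mathcal B}Z$, and $\mathcal A_0$ and $\mathcal B$ are stably isomorphic.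
   Context: Approximately unital means having a contractive approximate identity. $\mathbb B(H,K)$ is the space of bounded operators $H\to K$; $\overline{[Z\,X]}$, $\overline{[Z\,W\,X]}$ denote norm closures of linear spans of products. A linear subspace $M\subseteq\mathbb B(H,K)$ is a TRO if $MM^\star M\subseteq M$. A norm closed TRO $M$ is a $\sigma$-TRO if there are sequences $(m_i),(n_j)$ in $M$ with $\lim_n\sum_{i=1}^n m_im_i^\star m=m$ and $\lim_t\sum_{j=1}^t m\,n_j^\star n_j=m$ for all $m\in M$, and $\|\sum_{i=1}^n m_im_i^\star\|\le1$, $\|\sum_{j=1}^t n_j^\star n_j\|\le1$ for all $n,t$. A right $\mathcal A$-module $Y$ (an operator space) is a $\sigma\Delta$-$\mathcal A$-rigged module if it admits a presentation by $a$ and $M$ as in the claim. For such a presentation, the operator space $Z=\overline{[M\,a(\mathcal A)\,M^\star M]}\subseteq\mathbb B(H,K)$ is called a restriction of $Y$. $\otimes^h_{\mathcal C}$ is the balanced Haagerup tensor product over $\mathcal C$ (the quotient of the Haagerup tensor product by the closed span of the elements $zc\otimes x-z\otimes cx$); $\cong$ between operator spaces is completely isometric isomorphism. Operator algebras $\mathcal C,\mathcal D$ are stably isomorphic if $K_\infty(\mathcal C)\cong K_\infty(\mathcal D)$ via a completely isometric algebra isomorphism, where $K_\infty(X)\cong X\otimes\mathcal K$ is the norm closure of the finitely supported $\infty\times\infty$ matrices over $X$ and $\mathcal K$ the compact operators on an infinite dimensional separable Hilbert space. *)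

(* Defs.v *)
From HB Require Import structures.
From mathcomp Require Import all_boot all_order all_algebra sesquilinear complex.
From mathcomp Require Import all_classical all_reals all_analysis.

Set Implicit Arguments.
Unset Strict Implicit.
Unset Printing Implicit Defensive.

Import Order.TTheory GRing.Theory Num.Theory.
Import numFieldNormedType.Exports.

Local Open Scope classical_set_scope.
Local Open Scope complex_scope.
Local Open Scope ring_scope.

(* Scalars are the complex numbers R[i]. Vector spaces are subsets of an ambient
   lmodType; maps between them are total functions on the ambient type, whose
   values outside of the given subsets are irrelevant. *)

Definition linear_subspace (R : realType) (V : lmodType R[i]) (S : set V) : Prop :=
  S 0 /\ forall (c : R[i]) (x y : V), S x -> S y -> S (c *: x + y).

Definition linear_on (R : realType) (V W : lmodType R[i]) (S : set V)
    (f : V -> W) : Prop :=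
  forall (c : R[i]) (x y : V), S x -> S y -> f (c *: x + y) = c *: f x + f y.

Definition bilinear_on (R : realType) (U V W : lmodType R[i])
    (S : set U) (T : set V) (f : U -> V -> W) : Prop :=
  (forall y, T y -> linear_on S (f ^~ y)) /\
  (forall x, S x -> linear_on T (f x)).

Definition lspan (R : realType) (V : lmodType R[i]) (S : set V) : set V :=
  [set x | exists (n : nat) (c : 'I_n -> R[i]) (s : 'I_n -> V),
     (forall i, S (s i)) /\ x = \sum_(i < n) c i *: s i].

Definition mx_in (V : Type) (S : set V) (p q : nat) (x : 'M[V]_(p, q)) : Prop :=
  forall i j, S (x i j).

(* The "matrix product" of x and y along a (bilinear) operation f. *)
Definition mxop (U V : Type) (W : nmodType) (f : U -> V -> W) (p r q : nat)
    (x : 'M[U]_(p, r)) (y : 'M[V]_(r, q)) : 'M[W]_(p, q) :=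
  \matrix_(i, j) \sum_(k < r) f (x i k) (y k j).

Definition complete_for (R : realType) (V : zmodType) (nrm : V -> R)
    (S : set V) : Prop :=
  forall u : nat -> V, (forall n, S (u n)) ->
    (forall e : R, 0 < e -> exists N : nat, forall m n : nat,
       (N <= m)%N -> (N <= n)%N -> nrm (u m - u n) < e) ->
    exists2 l : V, S l & nrm (u n - l) @[n --> \oo] --> (0 : R).

(* A subset [mcar] of a vector space together with candidate norms on all
   rectangular matrix spaces; the norms are meaningful on matrices with entries
   in [mcar] only. *)
Record mspace (R : realType) := MSpace {
  mamb :> lmodType R[i];
  mcar : set mamb;
  mnorm : forall p q : nat, 'M[mamb]_(p, q) -> R }.

Arguments mcar {R} m.
Arguments mnorm {R} m {p q} _.

Definition nrm (R : realType) (X : mspace R) (x : X) : R :=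
  mnorm X (const_mx x : 'M[X]_(1, 1)).

Definition mclosure (R : realType) (X : mspace R) (S : set X) : set X :=
  [set x | mcar X x /\
     forall e : R, 0 < e -> exists2 s, S s & nrm (x - s) < e].

Definition clspan (R : realType) (X : mspace R) (S : set X) : set X :=
  mclosure (lspan S).

(* The modulus, as a real number: the library's norm on R[i] is R[i]-valued. *)
Definition cabs (R : realType) (z : R[i]) : R := complex.Re `|z|.

(* The norm of a scalar matrix as an operator from l^2_q to l^2_p. *)
Definition scalar_mxnorm (R : realType) (p q : nat) (a : 'M[R[i]]_(p, q)) : R :=
  inf [set c : R | 0 <= c /\ forall v : 'I_q -> R[i],
    \sum_(i < p) (cabs (\sum_(j < q) a i j * v j)) ^+ 2 <=
    c ^+ 2 * \sum_(j < q) (cabs (v j)) ^+ 2].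

(* Complete operator spaces, by Ruan's axioms (stated for rectangular
   matrices). *)
Record operator_space (R : realType) (X : mspace R) : Prop := OperatorSpace {
  os_subspace : linear_subspace (mcar X);
  os_norm0 : forall p q (x : 'M[X]_(p, q)), mx_in (mcar X) x ->
    (mnorm X x = 0 <-> x = 0);
  os_triangle : forall p q (x y : 'M[X]_(p, q)),
    mx_in (mcar X) x -> mx_in (mcar X) y ->
    mnorm X (x + y) <= mnorm X x + mnorm X y;
  os_norm_ge0 : forall p q (x : 'M[X]_(p, q)), mx_in (mcar X) x ->
    0 <= mnorm X x;
  os_normZ : forall p q (c : R[i]) (x : 'M[X]_(p, q)), mx_in (mcar X) x ->
    mnorm X (map_mx ( *:%R c) x) = cabs c * mnorm X x;
  os_scalar_mx : forall p p' q' q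
      (a : 'M[R[i]]_(p, p')) (x : 'M[X]_(p', q')) (b : 'M[R[i]]_(q', q)),
    mx_in (mcar X) x ->
    mnorm X (mxop (fun v c => c *: v) (mxop (fun c v => c *: v) a x) b) <=
      scalar_mxnorm a * mnorm X x * scalar_mxnorm b;
  os_direct_sum : forall p q p' q' (x : 'M[X]_(p, q)) (y : 'M[X]_(p', q')),
    mx_in (mcar X) x -> mx_in (mcar X) y ->
    mnorm X (block_mx x 0 0 y) = Num.max (mnorm X x) (mnorm X y);
  os_complete : complete_for (@nrm R X) (mcar X) }.

Definition completely_isometric (R : realType) (X Y : mspace R) (f : X -> Y) : Prop :=
  [/\ forall x, mcar X x -> mcar Y (f x),
      linear_on (mcar X) f
    & forall p q (x : 'M[X]_(p, q)), mx_in (mcar X) x ->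
        mnorm Y (map_mx f x) = mnorm X x].

Definition completely_isometric_iso (R : realType) (X Y : mspace R) (f : X -> Y) : Prop :=
  completely_isometric f /\ f @` mcar X = mcar Y.

Definition ciso (R : realType) (X Y : mspace R) : Prop :=
  exists f : X -> Y, completely_isometric_iso f.

(* The inner product is linear in its first variable. *)
Record hilbert (R : realType) := Hilbert {
  hcar :> lmodType R[i];
  hdot : {dot hcar for Num.conj};
  hilbert_complete :
    complete_for (fun x : hcar => Num.sqrt (complex.Re (hdot x x))) setT }.

Definition hnorm (R : realType) (H : hilbert R) (x : H) : R :=
  Num.sqrt (complex.Re (hdot H x x)).

Definition bounded_op (R : realType) (H K : hilbert R) : set (H -> K) :=
  [set T | linear T /\ exists c : R, forall x, hnorm (T x) <= c * hnorm x].

(* The norm of a matrix of operators, acting from H^q to K^p. *)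
Definition opnorm (R : realType) (H K : hilbert R) (p q : nat)
    (T : 'M[H -> K]_(p, q)) : R :=
  inf [set c : R | 0 <= c /\ forall x : 'I_q -> H,
    \sum_(i < p) (hnorm (\sum_(j < q) T i j (x j))) ^+ 2 <=
    c ^+ 2 * \sum_(j < q) (hnorm (x j)) ^+ 2].

Definition concrete_space (R : realType) (H K : hilbert R) (S : set (H -> K)) :
    mspace R :=
  @MSpace R (H -> K) S (@opnorm R H K).

Definition BO (R : realType) (H K : hilbert R) : mspace R :=
  concrete_space (@bounded_op R H K).

(* Well defined on bounded operators, by the Riesz representation theorem. *)
Definition adjoint (R : realType) (H K : hilbert R) (T : H -> K) : K -> H :=
  xget 0 [set S : K -> H | forall x y, hdot K (T x) y = hdot H x (S y)].

Definition adjoints (R : realType) (H K : hilbert R) (M : set (H -> K)) :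
    set (K -> H) :=
  [set adjoint T | T in M].

Definition op_products (U V W : Type) (S : set (V -> W)) (T : set (U -> V)) :
    set (U -> W) :=
  [set h | exists f g, [/\ S f, T g & h = f \o g]].

Definition closed_span (R : realType) (H K : hilbert R) (S : set (H -> K)) :
    set (H -> K) :=
  @clspan R (BO H K) S.

Record malgebra (R : realType) := MAlgebra {
  malg :> mspace R;
  mmul : malg -> malg -> malg }.

Arguments mmul {R} m _ _.

Definition concrete_algebra (R : realType) (H : hilbert R) (S : set (H -> H)) :
    malgebra R :=
  @MAlgebra R (concrete_space S) (fun f g : H -> H => f \o g).

Definition multiplicative_on (R : realType) (A B : malgebra R) (f : A -> B) : Prop :=
  forall x y, mcar A x -> mcar A y -> f (mmul A x y) = mmul B (f x) (f y).

Definition completely_isometric_representation (R : realType) (A : malgebra R)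
    (H : hilbert R) (a : A -> H -> H) : Prop :=
  @completely_isometric R A (BO H H) a /\
  @multiplicative_on R A (concrete_algebra (@bounded_op R H H)) a.

(* Abstract operator algebras: completely isometrically isomorphic to a norm
   closed subalgebra of some B(H), not necessarily unital. *)
Record operator_algebra (R : realType) (A : malgebra R) : Prop := OperatorAlgebra {
  oa_space : operator_space A;
  oa_closed : forall x y, mcar A x -> mcar A y -> mcar A (mmul A x y);
  oa_bilinear : bilinear_on (mcar A) (mcar A) (mmul A);
  oa_assoc : forall x y z, mcar A x -> mcar A y -> mcar A z ->
    mmul A x (mmul A y z) = mmul A (mmul A x y) z;
  oa_represented : exists (H : hilbert R) (a : A -> H -> H),
    completely_isometric_representation a }.

(* Contractive approximate identities, as filters instead of nets. *)
Definition approximately_unital (R : realType) (A : malgebra R) : Prop :=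
  exists F : set_system A, [/\ ProperFilter F,
    F [set e | mcar A e /\ nrm e <= 1]
    & forall x, mcar A x ->
        nrm (mmul A e x - x) @[e --> F] --> (0 : R) /\
        nrm (mmul A x e - x) @[e --> F] --> (0 : R)].

Record right_module (R : realType) (A : malgebra R) (Y : mspace R)
    (r : Y -> A -> Y) : Prop := RightModule {
  rm_closed : forall y a, mcar Y y -> mcar A a -> mcar Y (r y a);
  rm_bilinear : bilinear_on (mcar Y) (mcar A) r;
  rm_assoc : forall y a b, mcar Y y -> mcar A a -> mcar A b ->
    r y (mmul A a b) = r (r y a) b }.

Record left_module (R : realType) (A : malgebra R) (Y : mspace R)
    (l : A -> Y -> Y) : Prop := LeftModule {
  lm_closed : forall a y, mcar A a -> mcar Y y -> mcar Y (l a y);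
  lm_bilinear : bilinear_on (mcar A) (mcar Y) l;
  lm_assoc : forall a b y, mcar A a -> mcar A b -> mcar Y y ->
    l (mmul A a b) y = l a (l b y) }.

(* Complete contractivity of a bilinear map in the sense of Christensen and
   Sinclair, i.e. on the Haagerup tensor product. *)
Definition completely_contractive2 (R : realType) (X Y Z : mspace R)
    (f : X -> Y -> Z) : Prop :=
  forall p r q (x : 'M[X]_(p, r)) (y : 'M[Y]_(r, q)),
    mx_in (mcar X) x -> mx_in (mcar Y) y ->
    mnorm Z (mxop f x y) <= mnorm X x * mnorm Y y.

Record operator_bimodule (R : realType) (B A : malgebra R) (Z : mspace R)
    (l : B -> Z -> Z) (r : Z -> A -> Z) : Prop := OperatorBimodule {
  ob_space : operator_space Z;
  ob_left : left_module l;
  ob_right : right_module r;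
  ob_commute : forall b z a, mcar B b -> mcar Z z -> mcar A a ->
    l b (r z a) = r (l b z) a;
  ob_left_contractive : completely_contractive2 l;
  ob_right_contractive : completely_contractive2 r }.

(* [x] and [y] (of sizes p x r and r x q) represent the matrix over the
   algebraic tensor product with entries \sum_k x_ik (x) y_kj, and every p x q
   matrix over the algebraic tensor product is of this form. Two
   representatives are identified when no bilinear form separates them. *)
Definition same_tensor (R : realType) (X Y : mspace R) (p r r' q : nat)
    (x : 'M[X]_(p, r)) (y : 'M[Y]_(r, q))
    (x' : 'M[X]_(p, r')) (y' : 'M[Y]_(r', q)) : Prop :=
  forall phi : X -> Y -> R[i]^o, bilinear_on (mcar X) (mcar Y) phi ->
    mxop phi x y = mxop phi x' y'.

Definition haagerup_norm (R : realType) (X Y : mspace R) (p r q : nat)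
    (x : 'M[X]_(p, r)) (y : 'M[Y]_(r, q)) : R :=
  inf [set c : R | exists (r' : nat) (x' : 'M[X]_(p, r')) (y' : 'M[Y]_(r', q)),
    [/\ mx_in (mcar X) x', mx_in (mcar Y) y', same_tensor x y x' y'
      & c = mnorm X x' * mnorm Y y']].

(* (W, t) is the completion of the algebraic tensor product of X and Y for the
   Haagerup norms. *)
Record is_haagerup (R : realType) (X Y W : mspace R) (t : X -> Y -> W) : Prop :=
  IsHaagerup {
  ht_space : operator_space W;
  ht_closed : forall x y, mcar X x -> mcar Y y -> mcar W (t x y);
  ht_bilinear : bilinear_on (mcar X) (mcar Y) t;
  ht_norm : forall p r q (x : 'M[X]_(p, r)) (y : 'M[Y]_(r, q)),
    mx_in (mcar X) x -> mx_in (mcar Y) y ->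
    mnorm W (mxop t x y) = haagerup_norm x y;
  ht_dense : clspan [set w | exists x y, [/\ mcar X x, mcar Y y & w = t x y]]
             = mcar W }.

Record is_quotient (R : realType) (W : mspace R) (N : set W) (Q : mspace R)
    (q : W -> Q) : Prop := IsQuotient {
  qt_space : operator_space Q;
  qt_linear : linear_on (mcar W) q;
  qt_image : q @` mcar W = mcar Q;
  qt_kernel : forall w, mcar W w -> (q w = 0 <-> N w);
  qt_norm : forall m n (v : 'M[Q]_(m, n)), mx_in (mcar Q) v ->
    mnorm Q v = inf [set c : R | exists w : 'M[W]_(m, n),
      [/\ mx_in (mcar W) w, map_mx q w = v & c = mnorm W w]] }.

(* Q is the quotient of the Haagerup tensor product of Z and X by the closed
   span of the elements zc (x) x - z (x) cx. *)
Definition is_balanced_haagerup (R : realType) (C : malgebra R) (Z X : mspace R)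
    (r : Z -> C -> Z) (l : C -> X -> X) (Q : mspace R) : Prop :=
  exists (W : mspace R) (t : Z -> X -> W) (q : W -> Q),
    is_haagerup t /\
    is_quotient
      (clspan [set w | exists z c x, [/\ mcar Z z, mcar C c, mcar X x
                         & w = t (r z c) x - t z (l c x)]]) q.

Definition iso_balanced_haagerup (R : realType) (B : mspace R) (C : malgebra R)
    (Z X : mspace R) (r : Z -> C -> Z) (l : C -> X -> X) : Prop :=
  exists2 Q : mspace R, is_balanced_haagerup r l Q & ciso B Q.

Definition BMP_bimodule (R : realType) (B A : malgebra R) (Z : mspace R)
    (l : B -> Z -> Z) (r : Z -> A -> Z) : Prop :=
  operator_bimodule l r /\
  exists (X : mspace R) (l' : A -> X -> X) (r' : X -> B -> X),
    [/\ operator_bimodule l' r',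
        iso_balanced_haagerup B r l'
      & iso_balanced_haagerup A r' l].

(* A p x q matrix of infinite matrices, cut down to a p x q block matrix with
   n x n blocks. *)
Definition truncation (V : Type) (p q n : nat)
    (x : 'M[nat -> nat -> V]_(p, q)) :=
  \mxblock_(i < p, j < q) (\matrix_(k < n, l < n) x i j k l : 'M[V]_(n, n)).

Definition Minf_norm (R : realType) (X : mspace R) (p q : nat)
    (x : 'M[nat -> nat -> X]_(p, q)) : R :=
  sup [set c : R | exists n : nat, c = mnorm X (truncation n x)].

(* Infinite matrices whose finite truncations are uniformly bounded. *)
Definition Minf (R : realType) (X : mspace R) : mspace R :=
  @MSpace R (nat -> nat -> X)
    [set x : nat -> nat -> X | (forall k l, mcar X (x k l)) /\
       exists c : R, forall n : nat,
         mnorm X (\matrix_(k < n, l < n) x k l : 'M[X]_(n, n)) <= c]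
    (@Minf_norm R X).

Definition finitely_supported (R : realType) (X : mspace R) :
    set (nat -> nat -> X) :=
  [set x : nat -> nat -> X | (forall k l, mcar X (x k l)) /\
     exists n : nat, forall k l, (n <= k)%N || (n <= l)%N -> x k l = 0].

(* K_oo(X): the closure of the finitely supported infinite matrices. *)
Definition Kinf_space (R : realType) (X : mspace R) : mspace R :=
  @MSpace R (nat -> nat -> X)
    (@mclosure R (Minf X) (@finitely_supported R X)) (@Minf_norm R X).

Definition mlim (R : realType) (X : mspace R) (u : nat -> X) : X :=
  xget 0 [set l | mcar X l /\ nrm (u n - l) @[n --> \oo] --> (0 : R)].

(* Products of infinite matrices: the series defining the entries converge in
   norm on [Kinf_space A]. *)
Definition Kinf (R : realType) (A : malgebra R) : malgebra R :=
  @MAlgebra R (Kinf_space A)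
    (fun (x y : nat -> nat -> A) i j =>
       mlim (fun n => \sum_(k < n) mmul A (x i k) (y k j))).

Definition stably_isomorphic (R : realType) (A B : malgebra R) : Prop :=
  exists f : Kinf A -> Kinf B,
    completely_isometric_iso f /\ multiplicative_on f.

Definition TRO (R : realType) (H K : hilbert R) (M : set (H -> K)) : Prop :=
  [/\ M `<=` @bounded_op R H K, linear_subspace M
    & forall f g h, M f -> M g -> M h -> M (f \o adjoint g \o h)].

Definition sigma_TRO (R : realType) (H K : hilbert R) (M : set (H -> K)) : Prop :=
  [/\ TRO M, @mclosure R (BO H K) M = M,
      exists m : nat -> H -> K, [/\ forall i, M (m i),
        forall f, M f ->
          @nrm R (BO H K) ((\sum_(i < n) (m i \o adjoint (m i) \o f)) - f)
            @[n --> \oo] --> (0 : R)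
        & forall n, @nrm R (BO K K) (\sum_(i < n) (m i \o adjoint (m i))) <= 1]
    & exists m : nat -> H -> K, [/\ forall j, M (m j),
        forall f, M f ->
          @nrm R (BO H K) ((\sum_(j < n) (f \o adjoint (m j) \o m j)) - f)
            @[n --> \oo] --> (0 : R)
        & forall n, @nrm R (BO H H) (\sum_(j < n) (adjoint (m j) \o m j)) <= 1]].

Record sigma_delta_presentation (R : realType) (A : malgebra R) (Y : mspace R)
    (r : Y -> A -> Y) (H K : hilbert R) (a : A -> H -> H) (M : set (H -> K)) :
    Prop := SigmaDeltaPresentation {
  sdp_representation : completely_isometric_representation a;
  sdp_sigma_TRO : sigma_TRO M;
  sdp_invariant :
    op_products (op_products (adjoints M) M) (a @` mcar A) `<=` a @` mcar A;
  sdp_iso : exists f : Y -> H -> K,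
    @completely_isometric_iso R Y
      (concrete_space (closed_span (op_products M (a @` mcar A)))) f /\
    forall y x, mcar Y y -> mcar A x -> f (r y x) = f y \o a x }.

(* [M a(A) M* M] *)
Definition rigged_restriction (R : realType) (A : malgebra R) (H K : hilbert R)
    (a : A -> H -> H) (M : set (H -> K)) : set (H -> K) :=
  closed_span (op_products (op_products M (a @` mcar A))
                           (op_products (adjoints M) M)).

(* [M* M a(A) M* M] and, below, [M a(A) M*]. *)
Definition source_algebra (R : realType) (A : malgebra R) (H K : hilbert R)
    (a : A -> H -> H) (M : set (H -> K)) : malgebra R :=
  concrete_algebra (closed_span
    (op_products (op_products (op_products (adjoints M) M) (a @` mcar A))
                 (op_products (adjoints M) M))).

Definition target_algebra (R : realType) (A : malgebra R) (H K : hilbert R)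
    (a : A -> H -> H) (M : set (H -> K)) : malgebra R :=
  concrete_algebra (closed_span
    (op_products (op_products M (a @` mcar A)) (adjoints M))).

(* Main.v *)
Require Import Defs.
From HB Require Import structures.
From mathcomp Require Import all_boot all_order all_algebra sesquilinear complex.
From mathcomp Require Import all_classical all_reals all_analysis.
From mathcomp Require Import ring lra.

(* Z and X = [M^* M a(A) M^*] carry approximate identities made of finite rows
   and columns, the sums of m_i e n_j^* n_j m_i^* on Z and of
   n_j^* m_i e m_i^* n_j on X, where e runs through a contractive approximate
   identity of a(A). They split the multiplication maps from the Haagerup tensor
   products onto B and A_0 up to balancing, so that these maps are complete
   quotient maps whose kernels are exactly the balancing relations.

   For the stable isomorphism, the isometries m^* : y |-> (m_i^* y)_i and
   n : x |-> (n_j x)_j embed the essential parts of K and H into countable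
   multiples of each other. Working in l2 (l2 H) and l2 (l2 K) and playing an
   Eilenberg swindle in both directions gives a contraction
   V = delta' alpha + gamma' beta from l2 (l2 H) to l2 (l2 K) which is unitary on
   everything that is seen by A_0 and B. Identifying K_oo(A_0) and K_oo(B) with
   the closed spans of the e_i x e_j^*, the map y |-> V y V^* is the desired
   isomorphism. *)

Set Implicit Arguments.
Unset Strict Implicit.
Unset Printing Implicit Defensive.

Import Order.TTheory GRing.Theory Num.Theory.
Import numFieldNormedType.Exports.

Local Open Scope classical_set_scope.
Local Open Scope complex_scope.
Local Open Scope ring_scope.

(** * Hilbert spaces *)

(** Two obstacles shape the proof. The algebra a(A) need not be self-adjoint and absorbs M^* M on
    the left only, and the m_i themselves need not lie in Z. So e and the second family n_j have to
    be inserted, and the approximation is an iterated limit whose order is dictated by which factor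
    stands next to which. This is why the approximate identities of the tensor part are filters of
    contractions and not sequences. On the Hilbert space side, m^* and n are only partial
    isometries, and the sums of the m_i m_i^* converge in norm only next to elements of M. A strong
    limit such as V therefore does not obviously map norm closed spans into norm closed spans; each
    such inclusion is proved on generators, with a norm estimate, and extended by closedness. The
    double sum l2 (l2 H) provides room for infinitely many copies of the l2 H in which m^* takes its
    values. Since the Haagerup tensor product is only characterised in the statement, a model is
    built: tensors as functions on bilinear forms, with the Haagerup norm, completed by Cauchy
    sequences. *)

Section RealForm.
Variables (R : realType) (V : lmodType R[i]) (f : V -> V -> R).
Hypotheses (fC : forall x y, f x y = f y x)
  (fD : forall x y z, f (x + y) z = f x z + f y z)
  (fZ : forall (t : R) x z, f (t%:C *: x) z = t * f x z)
  (f_ge0 : forall x, 0 <= f x x).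

Lemma formDr x y z : f x (y + z) = f x y + f x z.
Proof. by rewrite fC fD !(fC x). Qed.

Lemma formZr t x z : f x (t%:C *: z) = t * f x z.
Proof. by rewrite fC fZ (fC x). Qed.

Lemma form_square t x y :
  f (x + t%:C *: y) (x + t%:C *: y) = f x x + 2 * t * f x y + t ^+ 2 * f y y.
Proof. by rewrite fD !formDr !fZ !formZr (fC y x); ring. Qed.

(** Only semidefiniteness is assumed, so a null vector [y] needs its own argument. Otherwise the
    quadratic polynomial in [t] is evaluated at its minimum. *)
Lemma form_CauchySchwarz2 x y : f x y ^+ 2 <= f x x * f y y.
Proof.
have [y0|yn0] := eqVneq (f y y) 0.
  rewrite y0 mulr0 exprn_even_le0 //=; apply/eqP/eqP; apply: contraT => xy0.
  (* With [f y y = 0] the form is affine in [t], and this [t] makes it equal to [-1]. *)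
  have := f_ge0 (x + (- (f x x + 1) / (2 * f x y))%:C *: y).
  rewrite form_square y0 mulr0 addr0.
  have -> : 2 * (- (f x x + 1) / (2 * f x y)) * f x y = - (f x x + 1).
    by field.
  lra.
have y0 : 0 < f y y by rewrite lt_def yn0 f_ge0.
have := f_ge0 (x + (- f x y / f y y)%:C *: y).
rewrite form_square.
have -> : f x x + 2 * (- f x y / f y y) * f x y + (- f x y / f y y) ^+ 2 * f y y
   = (f x x * f y y - f x y ^+ 2) / f y y by field.
by rewrite pmulr_lge0 ?invr_gt0 // subr_ge0.
Qed.

Lemma form_CauchySchwarz x y :
  `|f x y| <= Num.sqrt (f x x) * Num.sqrt (f y y).
Proof. by rewrite -sqrtrM // -sqrtr_sqr ler_wsqrtr // form_CauchySchwarz2. Qed.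

Lemma form_triangle x y :
  Num.sqrt (f (x + y) (x + y)) <= Num.sqrt (f x x) + Num.sqrt (f y y).
Proof.
rewrite -(@ler_pXn2r _ 2) ?nnegrE ?addr_ge0 ?sqrtr_ge0 //.
rewrite sqrrD !sqr_sqrtr // fD !formDr (fC y x).
have := le_trans (ler_norm _) (form_CauchySchwarz x y); lra.
Qed.

End RealForm.

(** * The modulus on the complex scalars *)

Section Cabs.
Variable R : realType.
Implicit Types z w : R[i].

Lemma cabsE z : cabs z = Num.sqrt (complex.Re z ^+ 2 + complex.Im z ^+ 2).
Proof. by rewrite /cabs normc_def. Qed.

Lemma norm_cabs z : `|z| = (cabs z)%:C.
Proof. by rewrite cabsE normc_def. Qed.

Lemma cabs_ge0 z : 0 <= cabs z.
Proof. by rewrite cabsE sqrtr_ge0. Qed.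

Lemma sqr_cabs z : cabs z ^+ 2 = complex.Re z ^+ 2 + complex.Im z ^+ 2.
Proof. by rewrite cabsE sqr_sqrtr // addr_ge0 ?sqr_ge0. Qed.

Lemma cabsM z w : cabs (z * w) = cabs z * cabs w.
Proof. by rewrite /cabs normrM !norm_cabs /= mul0r subr0. Qed.

Lemma cabs_eq0 z : (cabs z == 0) = (z == 0).
Proof. by rewrite -(inj_eq (@complexI R)) -norm_cabs normr_eq0. Qed.

Lemma cabs0 : cabs (0 : R[i]) = 0.
Proof. by apply/eqP; rewrite cabs_eq0. Qed.

Lemma cabs1 : cabs (1 : R[i]) = 1.
Proof. by rewrite /cabs normr1. Qed.

Lemma cabsN z : cabs (- z) = cabs z.
Proof. by rewrite /cabs normrN. Qed.

Lemma cabs_real (t : R) : cabs t%:C = `|t|.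
Proof. by rewrite cabsE /= expr0n addr0 sqrtr_sqr. Qed.

Lemma cabsD z w : cabs (z + w) <= cabs z + cabs w.
Proof.
have := ler_normD z w; rewrite !norm_cabs => h.
by rewrite -lecR rmorphD.
Qed.

Lemma cabsV z : cabs z^-1 = (cabs z)^-1.
Proof.
have [->|z0] := eqVneq z 0; first by rewrite invr0 cabs0 invr0.
have cz : cabs z != 0 by rewrite cabs_eq0.
by apply: (mulfI cz); rewrite -cabsM !mulfV // cabs1.
Qed.

End Cabs.

Section HilbertBasics.
Variables (R : realType) (H : hilbert R).
Implicit Types (x y z : H) (t : R) (c : R[i]).

(** Norms and adjoints are computed through the real inner product: it is symmetric and determines
    [hdot], whose imaginary part is [rdot x ('i *: y)], so that conjugation seldom enters. *)
Definition rdot x y : R := complex.Re (hdot H x y).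

Lemma hdotDl x y z : hdot H (x + y) z = hdot H x z + hdot H y z.
Proof. by rewrite linearDl. Qed.

Lemma hdotZl c x y : hdot H (c *: x) y = c * hdot H x y.
Proof. by rewrite linearZl. Qed.

Lemma hdotC x y : hdot H x y = (hdot H y x)^*.
Proof. by rewrite hermC /= expr0 mul1r. Qed.

Lemma rdotC x y : rdot x y = rdot y x.
Proof. by rewrite /rdot hdotC; case: (hdot H y x). Qed.

Lemma rdotDl x y z : rdot (x + y) z = rdot x z + rdot y z.
Proof. by rewrite /rdot hdotDl raddfD. Qed.

Lemma rdotZl t x y : rdot (t%:C *: x) y = t * rdot x y.
Proof. by rewrite /rdot hdotZl; case: (hdot H x y) => a b /=; rewrite mul0r subr0. Qed.

Lemma rdotDr x y z : rdot x (y + z) = rdot x y + rdot x z.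
Proof. exact: (formDr rdotC rdotDl). Qed.

Lemma rdotZr t x y : rdot x (t%:C *: y) = t * rdot x y.
Proof. exact: (formZr rdotC rdotZl). Qed.

Lemma rdotNl x y : rdot (- x) y = - rdot x y.
Proof. by have := rdotZl (-1) x y; rewrite rmorphN1 scaleN1r mulN1r. Qed.

Lemma rdotNr x y : rdot x (- y) = - rdot x y.
Proof. by rewrite rdotC rdotNl rdotC. Qed.

Lemma rdotBl x y z : rdot (x - y) z = rdot x z - rdot y z.
Proof. by rewrite rdotDl rdotNl. Qed.

Lemma rdotBr x y z : rdot x (y - z) = rdot x y - rdot x z.
Proof. by rewrite rdotDr rdotNr. Qed.

Lemma rdot0l x : rdot 0 x = 0.
Proof. by have := rdotBl x x x; rewrite !subrr. Qed.

Lemma rdot0r x : rdot x 0 = 0.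
Proof. by rewrite rdotC rdot0l. Qed.

Lemma rdot_suml (I : Type) (s : seq I) (P : pred I) (F : I -> H) y :
  rdot (\sum_(i <- s | P i) F i) y = \sum_(i <- s | P i) rdot (F i) y.
Proof. exact: (big_morph (rdot ^~ y) (fun x z => rdotDl x z y) (rdot0l y)). Qed.

Lemma rdot_sumr (I : Type) (s : seq I) (P : pred I) (F : I -> H) y :
  rdot y (\sum_(i <- s | P i) F i) = \sum_(i <- s | P i) rdot y (F i).
Proof. by rewrite rdotC rdot_suml; apply: eq_bigr => i _; rewrite rdotC. Qed.

Lemma rdot_ge0 x : 0 <= rdot x x.
Proof.
have [->|x0] := eqVneq x 0; first by rewrite rdot0l.
by have := neq0_dnorm_gt0 (s := hdot H) x x0; rewrite ltcE /= => /andP[_ /ltW].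
Qed.

Lemma rdot_eq0 x : rdot x x = 0 -> x = 0.
Proof.
move=> h; apply/eqP/negPn/negP => x0.
have := neq0_dnorm_gt0 (s := hdot H) x x0; rewrite ltcE /= => /andP[_].
by rewrite -/(rdot x x) h ltxx.
Qed.

Lemma Im_hdot x y : complex.Im (hdot H x y) = rdot x ('i *: y).
Proof.
by rewrite /rdot (hdotC x (_ *: _)) hdotZl (hdotC x y); case: (hdot H y x) => a b /=; ring.
Qed.

Lemma hdotE x y : hdot H x y = rdot x y +i* rdot x ('i *: y).
Proof. by rewrite -Im_hdot /rdot; case: (hdot H x y). Qed.

Lemma rdotiC x y : rdot ('i *: x) y = - rdot x ('i *: y).
Proof.
by rewrite -Im_hdot /rdot hdotZl; case: (hdot H x y) => a b /=; ring.
Qed.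

Lemma rdotZr_complex c x y :
  rdot x (c *: y) = complex.Re c * rdot x y + complex.Im c * rdot x ('i *: y).
Proof.
rewrite -!rdotZr -rdotDr scalerA -scalerDl; congr (rdot x (_ *: y)).
by rewrite {1}[c]complexE (mulrC 'i).
Qed.

Lemma rdot_inj x y : (forall z, rdot x z = rdot y z) -> x = y.
Proof.
move=> h; apply/eqP; rewrite -subr_eq0; apply/eqP/rdot_eq0.
by rewrite rdotBl h subrr.
Qed.

Lemma hnorm_ge0 x : 0 <= hnorm x.
Proof. by rewrite sqrtr_ge0. Qed.

Lemma sqr_hnorm x : hnorm x ^+ 2 = rdot x x.
Proof. by rewrite sqr_sqrtr // rdot_ge0. Qed.

Lemma rdot_le_norm x y : `|rdot x y| <= hnorm x * hnorm y.
Proof. exact: (form_CauchySchwarz rdotC rdotDl rdotZl rdot_ge0). Qed.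

Lemma rdot_le x y : rdot x y <= hnorm x * hnorm y.
Proof. exact: le_trans (ler_norm _) (rdot_le_norm x y). Qed.

Lemma hnormD_le x y : hnorm (x + y) <= hnorm x + hnorm y.
Proof. exact: (form_triangle rdotC rdotDl rdotZl rdot_ge0). Qed.

Lemma hnorm0 : hnorm (0 : H) = 0.
Proof. by rewrite /hnorm -/(rdot 0 0) rdot0l sqrtr0. Qed.

Lemma hnorm_eq0 x : hnorm x = 0 -> x = 0.
Proof. by move=> h; apply: rdot_eq0; rewrite -sqr_hnorm h expr0n. Qed.

Lemma hnormZ c x : hnorm (c *: x) = cabs c * hnorm x.
Proof.
have h : hnorm (c *: x) ^+ 2 = (cabs c * hnorm x) ^+ 2.
  rewrite exprMn !sqr_hnorm sqr_cabs /rdot hdotZl hdotC hdotZl.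
  have : complex.Im (hdot H x x) = 0.
    by have := hdotC x x; case: (hdot H x x) => a b [] /=; lra.
  by case: (hdot H x x) => a b /= ->; case: c => c d /=; ring.
have : `|hnorm (c *: x)| = `|cabs c * hnorm x| by rewrite -!sqrtr_sqr h.
by rewrite !ger0_norm // ?mulr_ge0 ?hnorm_ge0 ?cabs_ge0.
Qed.

Lemma hnormN_eq x : hnorm (- x) = hnorm x.
Proof. by rewrite -scaleN1r hnormZ cabsN cabs1 mul1r. Qed.

Lemma hnorm_distC x y : hnorm (x - y) = hnorm (y - x).
Proof. by rewrite -hnormN_eq opprB. Qed.

Lemma hnorm_sum (I : Type) (s : seq I) (P : pred I) (F : I -> H) :
  hnorm (\sum_(i <- s | P i) F i) <= \sum_(i <- s | P i) hnorm (F i).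
Proof.
elim/big_rec2: _ => [|i y x _ IH]; first by rewrite hnorm0.
by apply: le_trans (hnormD_le _ _) _; rewrite lerD2l.
Qed.

Lemma hnorm_le_rdot x (c : R) :
  0 <= c -> (forall y, rdot x y <= c * hnorm y) -> hnorm x <= c.
Proof.
move=> c0 h; have [x0|xn0] := eqVneq (hnorm x) 0; first by rewrite x0.
have x0 : 0 < hnorm x by rewrite lt_def xn0 hnorm_ge0.
by have := h x; rewrite -sqr_hnorm expr2 ler_pM2r.
Qed.

Lemma parallelogram x y :
  hnorm (x - y) ^+ 2 = 2 * hnorm x ^+ 2 + 2 * hnorm y ^+ 2 - hnorm (x + y) ^+ 2.
Proof. by rewrite !sqr_hnorm !(rdotBl, rdotBr, rdotDl, rdotDr) (rdotC y x); ring. Qed.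

End HilbertBasics.

(** * Sequences of reals tending to zero *)

Section Tends0.
Variable R : realType.

(** One-sided on purpose: for nonnegative sequences this is convergence to 0, and comparisons need
    no absolute values. *)
Definition tends0 (f : nat -> R) := forall e : R, 0 < e ->
  exists N : nat, forall n, (N <= n)%N -> f n < e.

Lemma tends0P (f : nat -> R) : (forall n, 0 <= f n) ->
  tends0 f <-> f n @[n --> \oo] --> (0 : R).
Proof.
move=> f0; split=> [h|/cvgrPdist_lt h e e0].
  apply/cvgrPdist_lt => e /h [N hN]; exists N => // n /= /hN.
  by rewrite sub0r normrN ger0_norm.
have [N _ hN] := h e e0; exists N => n /hN /=.
by rewrite sub0r normrN ger0_norm.
Qed.

Lemma tends0_harmonic : tends0 (fun n => n.+1%:R^-1).
Proof.
by apply/tends0P => [n|]; [rewrite invr_ge0|exact: cvg_harmonic].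
Qed.

Lemma tends0_le (f g : nat -> R) : (forall n, f n <= g n) -> tends0 g -> tends0 f.
Proof.
move=> fg h e /h [N hN]; exists N => n /hN; exact: le_lt_trans.
Qed.

Lemma tends0D (f g : nat -> R) : tends0 f -> tends0 g -> tends0 (fun n => f n + g n).
Proof.
move=> hf hg e e0; have e2 : 0 < e / 2 by lra.
have [N hN] := hf _ e2; have [M hM] := hg _ e2; exists (maxn N M) => n.
rewrite geq_max => /andP[/hN h1 /hM h2]; lra.
Qed.

Lemma tends0M (c : R) (f : nat -> R) : 0 <= c -> tends0 f -> tends0 (fun n => c * f n).
Proof.
move=> c0 hf e e0.
have c1 : 0 < c + 1 by lra.
have [N hN] := hf (e / (c + 1)) (divr_gt0 e0 c1); exists N => n /hN.
rewrite ltr_pdivlMr // => h.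
have [fn|fn] := leP 0 (f n); first by apply: le_lt_trans h; lra.
by apply: le_lt_trans e0; rewrite mulr_ge0_le0 // ltW.
Qed.

Lemma tends0_0 : tends0 (fun=> 0).
Proof. by move=> e e0; exists 0%N. Qed.

Lemma tends0_sum (I : finType) (f : I -> nat -> R) : (forall i, tends0 (f i)) ->
  tends0 (fun n => \sum_i f i n).
Proof.
move=> h; elim: (index_enum I) => [|i s IH].
  by apply: tends0_le tends0_0 => n; rewrite big_nil.
by apply: tends0_le (tends0D (h i) IH) => n; rewrite big_cons.
Qed.

Lemma tends0_ge (c : R) (f : nat -> R) : (forall n, c <= f n) -> tends0 f -> c <= 0.
Proof.
move=> cf h; rewrite leNgt; apply/negP => /h[N /(_ N (leqnn N))].
by rewrite ltNge cf.
Qed.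

Lemma eps_le (a b : R) : (forall e, 0 < e -> a <= b + e) -> a <= b.
Proof. by move=> h; apply/ler_addgt0Pr. Qed.

Lemma sum_half_pow_le (e : R) (N n : nat) : 0 <= e ->
  \sum_(N <= k < N + n) e / 2 ^+ k.+1 <= e / 2 ^+ N.
Proof.
move=> e0.
have E m : e / 2 ^+ m.+1 = e / 2 ^+ m / 2 by rewrite exprS invfM [_ / 2]mulrC mulrCA mulrA.
have : \sum_(N <= k < N + n) e / 2 ^+ k.+1 = e / 2 ^+ N - e / 2 ^+ (N + n).
  elim: n => [|n IH]; first by rewrite addn0 big_geq // subrr.
  by rewrite addnS big_nat_recr ?leq_addr //= IH !E; lra.
move=> ->; rewrite lerBlDr lerDl divr_ge0 // exprn_ge0 //; lra.
Qed.

End Tends0.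

Section Linear.
Variables (R : realType) (V W : lmodType R[i]) (T : V -> W).
Hypothesis linT : linear T.

Lemma linD x y : T (x + y) = T x + T y.
Proof. by have := linT 1 x y; rewrite !scale1r. Qed.

Lemma lin0 : T 0 = 0.
Proof. by have := linD 0 0; rewrite addr0 => /eqP; rewrite -subr_eq0 opprD addNKr oppr_eq0 => /eqP. Qed.

Lemma linZ c x : T (c *: x) = c *: T x.
Proof. by have := linT c x 0; rewrite lin0 !addr0. Qed.

Lemma linN x : T (- x) = - T x.
Proof. by rewrite -scaleN1r linZ scaleN1r. Qed.

Lemma linB x y : T (x - y) = T x - T y.
Proof. by rewrite linD linN. Qed.

Lemma lin_sum (I : Type) (s : seq I) (P : pred I) (F : I -> V) :
  T (\sum_(i <- s | P i) F i) = \sum_(i <- s | P i) T (F i).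
Proof. exact: (big_morph T linD lin0). Qed.

End Linear.

(** * Riesz representation and adjoints *)

Section Riesz.
Variables (R : realType) (H : hilbert R).

Lemma hilbert_cauchy (u : nat -> H) :
  (forall e, 0 < e -> exists N : nat, forall m n, (N <= m)%N -> (N <= n)%N ->
     hnorm (u m - u n) < e) ->
  exists l, tends0 (fun n => hnorm (u n - l)).
Proof.
move=> h; have [l _ hl] := @hilbert_complete R H u (fun=> I) h.
by exists l; apply/tends0P => // n; exact: hnorm_ge0.
Qed.

Variables (psi : H -> R) (c : R).
Hypotheses (psiD : forall x y, psi (x + y) = psi x + psi y)
  (psiZ : forall (t : R) x, psi (t%:C *: x) = t * psi x)
  (psi_le : forall x, psi x <= c * hnorm x).

(* The representing vector minimises |x|^2 - 2 psi(x). *)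
Let J x := hnorm x ^+ 2 - 2 * psi x.

Let J_lb x : - c ^+ 2 <= J x.
Proof.
have := psi_le x; rewrite /J; set a := hnorm x; move=> h.
have := sqr_ge0 (a - c); nra.
Qed.

Let I := inf (range J).

Let I_le x : I <= J x.
Proof. by apply: ge_inf; [exists (- c ^+ 2) => _ [y _ <-]|exists x]. Qed.

Let I_adh e : 0 < e -> exists x, J x < I + e.
Proof.
move=> e0; have [|_ [x _ <-] h] := @inf_adherent _ (range J) e e0; last by exists x.
by split; [exists (J 0), 0|exists (- c ^+ 2) => _ [y _ <-]].
Qed.

(** Minimising sequences of [J] are Cauchy by the parallelogram law, since the midpoint cannot fall
    below the infimum [I]. At a near minimiser the first variation of [J] is small, and in the limit
    it vanishes, which is the equation [psi x = rdot x z]. *)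
Lemma riesz_real : exists z, forall x, psi x = rdot x z.
Proof.
have /choice[x hx] : forall n : nat, exists y, J y < I + n.+1%:R^-1.
  by move=> n; apply: I_adh; rewrite invr_gt0.
have half2 (y : H) : y = 2%:C *: (2^-1%:C *: y).
  by rewrite scalerA -rmorphM /= mulfV ?pnatr_eq0 // scale1r.
have cau m n : hnorm (x m - x n) ^+ 2 <= 2 * m.+1%:R^-1 + 2 * n.+1%:R^-1.
  have := I_le (2^-1%:C *: (x m + x n)).
  rewrite /J parallelogram hnormZ cabs_real psiZ psiD exprMn.
  have -> : `|2^-1 : R| ^+ 2 = 4^-1 by rewrite ger0_norm //; field.
  have := hx m; have := hx n; rewrite /J => h1 h2 h3.
  move: h1 h2 h3; move: (n.+1%:R^-1) (m.+1%:R^-1) => s s'.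
  move: (hnorm (x m + x n) ^+ 2) => a; lra.
have [z hz] : exists z, tends0 (fun n => hnorm (x n - z)).
  apply: hilbert_cauchy => e e0.
  have e4 : 0 < e ^+ 2 / 4 by rewrite divr_gt0 ?exprn_gt0.
  have [N hN] := @tends0_harmonic R _ e4; exists N => m n /hN h1 /hN h2.
  rewrite -(@ltr_pXn2r _ 2) ?nnegrE ?hnorm_ge0 ?ltW //.
  apply: le_lt_trans (cau m n) _; move: h1 h2.
  by move: (n.+1%:R^-1) (m.+1%:R^-1) (e ^+ 2) => s s' d; lra.
exists z => y; apply/eqP; rewrite eq_sym -subr_eq0 -normr_le0.
set b := fun n => rdot y (x n) - psi y.
have hb n : b n ^+ 2 <= hnorm y ^+ 2 * n.+1%:R^-1.
  have [y0|yn0] := eqVneq (hnorm y) 0.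
    have -> : b n = 0.
      by rewrite /b (hnorm_eq0 y0) rdot0l -(scale0r (0 : H)) (psiZ 0) mul0r subr0.
    by rewrite expr0n mulr_ge0 ?exprn_ge0 ?hnorm_ge0.
  have y0 : 0 < hnorm y ^+ 2 by rewrite exprn_gt0 // lt_def yn0 hnorm_ge0.
  (* Moving [x n] along [y] by the optimal amount lowers [J] by [b n ^+ 2 / hnorm y ^+ 2], but
     [J (x n)] exceeds the infimum by less than [n.+1%:R^-1]. *)
  have := I_le (x n + (- b n / hnorm y ^+ 2)%:C *: y); have := hx n.
  rewrite /J !sqr_hnorm psiD psiZ (form_square (@rdotC _ H) (@rdotDl _ H) (@rdotZl _ H)).
  rewrite -!sqr_hnorm; set a := hnorm y ^+ 2 in y0 *.
  rewrite (rdotC (x n)); have -> : rdot y (x n) = b n + psi y by rewrite /b; ring.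
  set s := n.+1%:R^-1 => h1 h2.
  have h3 : 0 <= s + 2 * (- b n / a) * b n + (- b n / a) ^+ 2 * a by lra.
  have : s + 2 * (- b n / a) * b n + (- b n / a) ^+ 2 * a = s - b n ^+ 2 / a.
    by field; rewrite gt_eqF.
  move=> E; move: h3; rewrite E subr_ge0 ler_pdivrMr // mulrC; lra.
apply: eps_le => e e0; rewrite add0r.
have e2 : 0 < e / 2 by lra.
have [N1 h1] := tends0M (hnorm_ge0 y) hz e2.
have [N2 h2] := tends0M (exprn_ge0 2 (hnorm_ge0 y)) (@tends0_harmonic R) (exprn_gt0 2 e2).
set n := maxn N1 N2.
have {}h1 := h1 n (leq_maxl _ _); have {}h2 := h2 n (leq_maxr _ _).
have -> : rdot y z - psi y = b n - rdot y (x n - z) by rewrite /b rdotBr; ring.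
apply: le_trans (ler_normB _ _) _.
have b1 : `|b n| <= e / 2.
  rewrite -(@ler_pXn2r _ 2) ?nnegrE ?normr_ge0 ?ltW // real_normK ?num_real //.
  exact: le_lt_trans (hb n) h2.
have := rdot_le_norm y (x n - z); lra.
Qed.

End Riesz.

Section Adjoint.
Variables (R : realType) (H K : hilbert R).
Implicit Types T S : H -> K.

Lemma bounded_ge0 T : bounded_op T ->
  exists2 c : R, 0 <= c & forall x, hnorm (T x) <= c * hnorm x.
Proof.
move=> [_ [c hc]]; exists `|c| => // x; apply: le_trans (hc x) _.
by rewrite ler_wpM2r ?hnorm_ge0 // ler_norm.
Qed.

(** The real Riesz theorem handles [rdot]; the imaginary parts agree as well because [T] commutes
    with multiplication by ['i]. *)
Lemma adjoint_exists T : bounded_op T -> exists S : K -> H,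
  forall x y, hdot K (T x) y = hdot H x (S y).
Proof.
move=> bT; have [linT _] := bT; have [c c0 hc] := bounded_ge0 bT.
suff /choice[S hS] : forall y, exists z, forall x, rdot (T x) y = rdot x z.
  exists S => x y; rewrite !hdotE hS; congr (_ +i* _).
  apply: oppr_inj; rewrite -!rdotiC -hS linZ //.
move=> y; apply: (@riesz_real _ _ _ (c * hnorm y)).
- by move=> u v; rewrite linD // rdotDl.
- by move=> t u; rewrite linZ // rdotZl.
- move=> x; apply: le_trans (rdot_le _ _) _.
  by rewrite mulrAC ler_wpM2r ?hnorm_ge0.
Qed.

Lemma adjointP T : bounded_op T -> forall x y, rdot (T x) y = rdot x (adjoint T y).
Proof.
move=> bT x y; have [S hS] := adjoint_exists bT.
by rewrite /rdot (xgetPex (P := [set S | forall x y, hdot K (T x) y = hdot H x (S y)])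
  (0 : K -> H)) //; exists S.
Qed.

Lemma adjoint_unique T (S : K -> H) : bounded_op T ->
  (forall x y, rdot (T x) y = rdot x (S y)) -> adjoint T = S.
Proof.
move=> bT h; apply/funext => y; apply: rdot_inj => z.
by rewrite !(rdotC _ z) -adjointP // h.
Qed.

Lemma rdot_linear (S : K -> H) T : linear T ->
  (forall x y, rdot (T x) y = rdot x (S y)) -> linear S.
Proof.
move=> linT h c x y; apply: rdot_inj => z; rewrite rdotDl !(rdotC _ z) -!h rdotDr.
congr (_ + _); rewrite [LHS]rdotZr_complex [RHS]rdotZr_complex h; congr (_ + _ * _).
by apply: oppr_inj; rewrite -!rdotiC -h linZ.
Qed.

Lemma adjoint_bounded T : bounded_op T -> bounded_op (adjoint T).
Proof.
move=> bT; split; first by apply: rdot_linear (adjointP bT); case: bT.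
have [c c0 hc] := bounded_ge0 bT; exists c => y.
apply: hnorm_le_rdot => [|x]; first by rewrite mulr_ge0 ?hnorm_ge0.
rewrite rdotC -adjointP //; apply: le_trans (rdot_le _ _) _.
by rewrite mulrAC ler_wpM2r ?hnorm_ge0.
Qed.

End Adjoint.

Lemma adjointK (R : realType) (H K : hilbert R) (T : H -> K) :
  bounded_op T -> adjoint (adjoint T) = T.
Proof.
move=> bT; apply: adjoint_unique; first exact: adjoint_bounded.
by move=> x y; rewrite rdotC -adjointP // rdotC.
Qed.

(** * Norms of matrices of operators *)

Section InfSq.
Variables (R : realType) (X : Type) (f g : X -> R).
Hypotheses (f_ge0 : forall x, 0 <= f x) (g_ge0 : forall x, 0 <= g x).

Let S := [set c : R | 0 <= c /\ forall x, f x <= c ^+ 2 * g x].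

Lemma inf_sq_ge0 : 0 <= inf S.
Proof.
(* The infimum of the empty set is 0, so no bound has to exist here. *)
have [->|S0] := eqVneq S set0; first by rewrite inf0.
by apply: lb_le_inf; [exact/set0P|move=> c []].
Qed.

Lemma inf_sq_le c : 0 <= c -> (forall x, f x <= c ^+ 2 * g x) -> inf S <= c.
Proof. by move=> c0 h; apply: ge_inf => //; exists 0 => y []. Qed.

(** The infimum is attained: the square root of [f x / g x] is a lower bound of [S] whenever
    [g x > 0]. The given [c] makes [S] nonempty and settles the case [g x = 0]. *)
Lemma inf_sqP c x : 0 <= c -> (forall x, f x <= c ^+ 2 * g x) ->
  f x <= inf S ^+ 2 * g x.
Proof.
move=> c0 hc; have [g0|gn0] := eqVneq (g x) 0.
  by have := hc x; rewrite g0 !mulr0.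
have gx : 0 < g x by rewrite lt_def gn0 g_ge0.
rewrite -ler_pdivrMr // -[leLHS]sqr_sqrtr ?divr_ge0 //.
rewrite ler_pXn2r ?nnegrE ?sqrtr_ge0 ?inf_sq_ge0 //.
apply: lb_le_inf; first by exists c.
move=> d [d0 hd]; rewrite -(@ler_pXn2r _ 2) ?nnegrE ?sqrtr_ge0 //.
by rewrite sqr_sqrtr ?divr_ge0 // ler_pdivrMr.
Qed.

End InfSq.

(** A crude bound of Hilbert-Schmidt type; it provides the finite constant that [inf_sqP] asks
    for. *)
Lemma sum_sq_bound (R : realType) (I : finType) (N A : I -> R) (s : R) :
  (forall i, 0 <= N i) -> (forall i, N i <= A i * s) ->
  \sum_i N i ^+ 2 <= Num.sqrt (\sum_i A i ^+ 2) ^+ 2 * s ^+ 2.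
Proof.
move=> N0 h; rewrite sqr_sqrtr ?sumr_ge0 // => [|i _]; last exact: sqr_ge0.
rewrite mulr_suml; apply: ler_sum => i _; rewrite -exprMn ler_pXn2r ?nnegrE //.
exact: le_trans (h i).
Qed.

Lemma ler_sqr_norm (R : realType) (a b : R) : 0 <= b -> a ^+ 2 <= b ^+ 2 -> a <= b.
Proof.
move=> b0 h; have [a0|a0] := leP 0 a; last exact: ltW (lt_le_trans a0 b0).
by rewrite -(@ler_pXn2r _ 2).
Qed.

Section VecNorm.
Variables (R : realType) (H : hilbert R).
Implicit Types I : finType.

(** Inner product and norm of a finite Hilbert sum of copies of [H], on plain families, so that this
    sum need not be built as a Hilbert space. *)
Definition vdot I (x y : I -> H) : R := \sum_i rdot (x i) (y i).
Definition vn I (x : I -> H) : R := Num.sqrt (vdot x x).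

Lemma vn_ge0 I (x : I -> H) : 0 <= vn x. Proof. exact: sqrtr_ge0. Qed.

Lemma vdot_ge0 I (x : I -> H) : 0 <= vdot x x.
Proof. by apply: sumr_ge0 => i _; exact: rdot_ge0. Qed.

Lemma sqr_vn I (x : I -> H) : vn x ^+ 2 = \sum_i hnorm (x i) ^+ 2.
Proof.
by rewrite sqr_sqrtr ?vdot_ge0 //; apply: eq_bigr => i _; rewrite sqr_hnorm.
Qed.

Lemma vdotC I (x y : I -> H) : vdot x y = vdot y x.
Proof. by apply: eq_bigr => i _; rewrite rdotC. Qed.

Lemma vdotDl I (x y z : I -> H) : vdot (x + y) z = vdot x z + vdot y z.
Proof. by rewrite -big_split; apply: eq_bigr => i _; rewrite rdotDl. Qed.

Lemma vdotZl I (t : R) (x z : I -> H) : vdot (t%:C *: x) z = t * vdot x z.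
Proof. by rewrite mulr_sumr; apply: eq_bigr => i _; rewrite rdotZl. Qed.

Lemma vdot_le I (x y : I -> H) : vdot x y <= vn x * vn y.
Proof.
apply: le_trans (ler_norm _) _.
exact: (form_CauchySchwarz (@vdotC I) (@vdotDl I) (@vdotZl I) (@vdot_ge0 I)).
Qed.

Lemma vnD I (x y : I -> H) : vn (fun i => x i + y i) <= vn x + vn y.
Proof. exact: (form_triangle (@vdotC I) (@vdotDl I) (@vdotZl I) (@vdot_ge0 I)). Qed.

Lemma eq_vn I (x y : I -> H) : x =1 y -> vn x = vn y.
Proof. by move=> /funext ->. Qed.

Lemma vnZ I (c : R[i]) (x : I -> H) : vn (fun i => c *: x i) = cabs c * vn x.
Proof.
apply/eqP; rewrite -(@eqrXn2 _ 2) ?mulr_ge0 ?vn_ge0 ?cabs_ge0 // exprMn !sqr_vn.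
by rewrite mulr_sumr; apply/eqP/eq_bigr => i _; rewrite hnormZ exprMn.
Qed.

Lemma hnorm_le_vn I (x : I -> H) i : hnorm (x i) <= vn x.
Proof.
apply: ler_sqr_norm; rewrite ?vn_ge0 // sqr_vn (bigD1 i) //= lerDl.
by apply: sumr_ge0 => j _; rewrite exprn_ge0 // hnorm_ge0.
Qed.

Lemma vn0 I : vn (fun _ : I => 0 : H) = 0.
Proof. by rewrite /vn /vdot big1 ?sqrtr0 // => i _; rewrite rdot0l. Qed.

Lemma vn_const1 (x : 'I_1 -> H) : vn x = hnorm (x 0).
Proof. by rewrite /vn /vdot big_ord1. Qed.

Lemma sqr_vn_split p q (x : 'I_(p + q) -> H) :
  vn x ^+ 2 = vn (x \o lshift q) ^+ 2 + vn (x \o @rshift p q) ^+ 2.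
Proof. by rewrite !sqr_vn big_split_ord. Qed.

Lemma vn_le_vdot I (x : I -> H) (c : R) :
  0 <= c -> (forall y, vdot x y <= c * vn y) -> vn x <= c.
Proof.
move=> c0 h; have [x0|xn0] := eqVneq (vn x) 0; first by rewrite x0.
have x0 : 0 < vn x by rewrite lt_def xn0 vn_ge0.
have := h x; have -> : vdot x x = vn x ^+ 2 by rewrite sqr_sqrtr // vdot_ge0.
by rewrite expr2 ler_pM2r.
Qed.

End VecNorm.

Section Bounded.
Variables (R : realType) (H K : hilbert R).
Implicit Types T S : H -> K.

Lemma bounded_lin : linear_subspace (@bounded_op R H K).
Proof.
split.
  split; first by move=> c x y; rewrite /= scaler0 addr0.
  by exists 0 => x; rewrite hnorm0 mul0r.
move=> c T S bT bS; have [lT _] := bT; have [lS _] := bS; split.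
  move=> d x y; rewrite !fctE lT lS !scalerDr !scalerA mulrC.
  by rewrite !addrA; congr (_ + _); rewrite -!addrA; congr (_ + _); rewrite addrC.
have [e e0 he] := bounded_ge0 bT; have [f f0 hf] := bounded_ge0 bS.
exists (cabs c * e + f) => x; apply: le_trans (hnormD_le _ _) _.
by rewrite mulrDl lerD // !fctE hnormZ -mulrA ler_wpM2l ?cabs_ge0.
Qed.

End Bounded.

Section Subspaces.
Variables (R : realType) (V : lmodType R[i]) (S : set V).
Hypothesis linS : linear_subspace S.

Lemma sub0 : S 0. Proof. by case: linS. Qed.

Lemma subD x y : S x -> S y -> S (x + y).
Proof. by move=> Sx Sy; rewrite -[x]scale1r; case: linS => _; apply. Qed.

Lemma subZ c x : S x -> S (c *: x).
Proof. by move=> Sx; rewrite -[_ *: _]addr0; case: linS => S0; apply. Qed.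

Lemma subN x : S x -> S (- x).
Proof. by move=> Sx; rewrite -scaleN1r; exact: subZ. Qed.

Lemma subB x y : S x -> S y -> S (x - y).
Proof. by move=> Sx Sy; apply: subD => //; exact: subN. Qed.

Lemma sub_sum (I : Type) (s : seq I) (P : pred I) (F : I -> V) :
  (forall i, P i -> S (F i)) -> S (\sum_(i <- s | P i) F i).
Proof. by move=> h; elim/big_ind: _ => //; [exact: sub0|exact: subD]. Qed.

End Subspaces.

Lemma bounded_comp (R : realType) (G H K : hilbert R) (T : H -> K) (S : G -> H) :
  bounded_op T -> bounded_op S -> bounded_op (T \o S).
Proof.
move=> bT bS; have [lT _] := bT; have [lS _] := bS; split.
  by move=> c x y; rewrite /= lS lT.
have [e e0 he] := bounded_ge0 bT; have [f f0 hf] := bounded_ge0 bS.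
exists (e * f) => x /=; apply: le_trans (he _) _.
by rewrite -mulrA ler_wpM2l.
Qed.

Lemma bounded_id (R : realType) (H : hilbert R) : bounded_op (@idfun H).
Proof. by split=> //; exists 1 => x; rewrite mul1r. Qed.

Section Opnorm.
Variables (R : realType) (H K : hilbert R).

Definition mxapp p q (T : 'M[H -> K]_(p, q)) (x : 'I_q -> H) : 'I_p -> K :=
  fun i => \sum_(j < q) T i j (x j).

Local Notation bnd := (mx_in (@bounded_op R H K)).

Lemma opnormE p q (T : 'M[H -> K]_(p, q)) : opnorm T =
  inf [set c : R | 0 <= c /\ forall x, vn (mxapp T x) ^+ 2 <= c ^+ 2 * vn x ^+ 2].
Proof.
congr inf; apply/seteqP; split=> c [c0 h]; split=> // x; have := h x;
  by rewrite !sqr_vn.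
Qed.

Lemma opnorm_ge0 p q (T : 'M[H -> K]_(p, q)) : 0 <= opnorm T.
Proof. by rewrite opnormE; apply: inf_sq_ge0 => x; rewrite exprn_ge0 ?vn_ge0. Qed.

Lemma opnorm_le p q (T : 'M[H -> K]_(p, q)) c : 0 <= c ->
  (forall x, vn (mxapp T x) <= c * vn x) -> opnorm T <= c.
Proof.
move=> c0 h; rewrite opnormE; apply: inf_sq_le => // x.
by rewrite -exprMn ler_pXn2r ?nnegrE ?mulr_ge0 ?vn_ge0.
Qed.

Lemma mxapp_bounded p q (T : 'M[H -> K]_(p, q)) : bnd T ->
  exists2 c, 0 <= c & forall x, vn (mxapp T x) ^+ 2 <= c ^+ 2 * vn x ^+ 2.
Proof.
move=> bT.
have /choice[d hd] : forall ij, exists c : R,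
    0 <= c /\ forall x, hnorm (T ij.1 ij.2 x) <= c * hnorm x.
  by move=> [i j] /=; have [c c0 hc] := bounded_ge0 (bT i j); exists c.
exists (Num.sqrt (\sum_i (\sum_j d (i, j)) ^+ 2)) => [|x]; first exact: sqrtr_ge0.
rewrite sqr_vn; apply: sum_sq_bound => i; first exact: hnorm_ge0.
apply: le_trans (hnorm_sum _ _ _) _; rewrite mulr_suml; apply: ler_sum => j _.
have [d0 h] := hd (i, j); apply: le_trans (h _) _.
by rewrite ler_wpM2l // hnorm_le_vn.
Qed.

Lemma opnormP p q (T : 'M[H -> K]_(p, q)) x : bnd T ->
  vn (mxapp T x) <= opnorm T * vn x.
Proof.
move=> bT; have [c c0 hc] := mxapp_bounded bT.
apply: ler_sqr_norm; first by rewrite mulr_ge0 ?vn_ge0 ?opnorm_ge0.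
by rewrite exprMn opnormE; apply: inf_sqP hc => // y; rewrite exprn_ge0 ?vn_ge0.
Qed.

Lemma opnormD p q (T S : 'M[H -> K]_(p, q)) : bnd T -> bnd S ->
  opnorm (T + S) <= opnorm T + opnorm S.
Proof.
move=> bT bS; apply: opnorm_le => [|x]; first by rewrite addr_ge0 ?opnorm_ge0.
rewrite (eq_vn (y := fun i => mxapp T x i + mxapp S x i)).
  by apply: le_trans (vnD _ _) _; rewrite mulrDl lerD ?opnormP.
by move=> i; rewrite -big_split; apply: eq_bigr => j _; rewrite mxE.
Qed.

Lemma opnormZ_le p q (c : R[i]) (T : 'M[H -> K]_(p, q)) : bnd T ->
  opnorm (map_mx ( *:%R c) T) <= cabs c * opnorm T.
Proof.
move=> bT; apply: opnorm_le => [|x]; first by rewrite mulr_ge0 ?opnorm_ge0 ?cabs_ge0.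
rewrite (eq_vn (y := fun i => c *: mxapp T x i)).
  by rewrite vnZ -mulrA ler_wpM2l ?cabs_ge0 ?opnormP.
by move=> i; rewrite scaler_sumr; apply: eq_bigr => j _; rewrite mxE.
Qed.

Lemma mx_in_scale p q (c : R[i]) (T : 'M[H -> K]_(p, q)) : bnd T ->
  bnd (map_mx ( *:%R c) T).
Proof. by move=> bT i j; rewrite mxE; exact: (subZ (bounded_lin H K)). Qed.

Lemma opnormZ p q (c : R[i]) (T : 'M[H -> K]_(p, q)) : bnd T ->
  opnorm (map_mx ( *:%R c) T) = cabs c * opnorm T.
Proof.
move=> bT; apply/eqP; rewrite eq_le opnormZ_le //=.
have [->|c0] := eqVneq c 0; first by rewrite cabs0 mul0r opnorm_ge0.
have := opnormZ_le c^-1 (mx_in_scale c bT).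
have -> : map_mx ( *:%R c^-1) (map_mx ( *:%R c) T) = T.
  by apply/matrixP => i j; rewrite !mxE scalerA mulVf // scale1r.
by rewrite cabsV mulrC ler_pdivlMr ?(mulrC (opnorm _)) // lt_def cabs_eq0 c0 cabs_ge0.
Qed.

(** The norm of one operator as that of a 1 x 1 matrix, so that it unfolds to the same term as [nrm]
    on [BO H K]. *)
Definition onrm (T : H -> K) : R := opnorm (const_mx T : 'M[H -> K]_(1, 1)).

Lemma mx_in_const T : bounded_op T -> bnd (const_mx T : 'M[H -> K]_(1, 1)).
Proof. by move=> bT i j; rewrite mxE. Qed.

Lemma onrm_ge0 T : 0 <= onrm T. Proof. exact: opnorm_ge0. Qed.

Lemma onrmP T x : bounded_op T -> hnorm (T x) <= onrm T * hnorm x.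
Proof.
move=> bT; have := @opnormP 1 1 (const_mx T) (fun=> x) (mx_in_const bT).
by rewrite !vn_const1 /mxapp big_ord1 mxE.
Qed.

Lemma onrm_le T c : 0 <= c -> (forall x, hnorm (T x) <= c * hnorm x) -> onrm T <= c.
Proof.
move=> c0 h; apply: opnorm_le => // x.
by rewrite !vn_const1 /mxapp big_ord1 mxE.
Qed.

Lemma onrmD T S : bounded_op T -> bounded_op S -> onrm (T + S) <= onrm T + onrm S.
Proof.
move=> bT bS; apply: onrm_le => [|x]; first by rewrite addr_ge0 ?onrm_ge0.
by apply: le_trans (hnormD_le _ _) _; rewrite mulrDl lerD ?onrmP.
Qed.

Lemma onrmZ c T : bounded_op T -> onrm (c *: T) = cabs c * onrm T.
Proof.
by move=> bT; rewrite -opnormZ ?/onrm ?map_const_mx //; exact: mx_in_const.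
Qed.

Lemma onrmN T : onrm (- T) = onrm T.
Proof.
rewrite /onrm !opnormE; congr inf; apply: eq_set => c; congr (_ /\ _).
apply/propext; split=> h x; have := h x;
  by rewrite !vn_const1 /mxapp !big_ord1 !mxE /= hnormN_eq.
Qed.

Lemma onrm0 : onrm (0 : H -> K) = 0.
Proof.
apply/eqP; rewrite eq_le onrm_ge0 andbT; apply: onrm_le => // x.
by rewrite hnorm0 mul0r.
Qed.

Lemma onrm_eq0 T : bounded_op T -> onrm T = 0 -> T = 0.
Proof.
move=> bT T0; apply/funext => x; apply: hnorm_eq0; apply/eqP.
by rewrite eq_le hnorm_ge0 andbT; have := onrmP x bT; rewrite T0 mul0r.
Qed.

Lemma onrm_sum (I : Type) (s : seq I) (F : I -> H -> K) :
  (forall i, bounded_op (F i)) ->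
  onrm (\sum_(i <- s) F i) <= \sum_(i <- s) onrm (F i).
Proof.
move=> bF; elim: s => [|i s IH]; first by rewrite !big_nil onrm0.
rewrite !big_cons; apply: le_trans (onrmD _ _) _ => //; last by rewrite lerD2l.
by apply: (sub_sum (bounded_lin H K)) => j _.
Qed.

Lemma onrm_distC T S : onrm (T - S) = onrm (S - T).
Proof. by rewrite -onrmN opprB. Qed.

Lemma opnorm_entry p q (T : 'M[H -> K]_(p, q)) i j : bnd T ->
  onrm (T i j) <= opnorm T.
Proof.
move=> bT; apply: onrm_le => [|x]; first exact: opnorm_ge0.
pose X := fun k : 'I_q => if k == j then x else 0.
have -> : hnorm x = vn X.
  rewrite /vn /vdot (bigD1 j) //= {1 2}/X eqxx big1 ?addr0 // => k /negPf kj.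
  by rewrite /X kj rdot0l.
apply: le_trans (opnormP X bT).
have -> : T i j x = mxapp T X i; last exact: (hnorm_le_vn (mxapp T X)).
rewrite /mxapp (bigD1 j) //= {1}/X eqxx big1 ?addr0 // => k /negPf kj.
by rewrite /X kj lin0 //; case: (bT i k).
Qed.

(** Together with [opnorm_entry]: for matrices of a fixed size, norm convergence is entrywise
    convergence. *)
Lemma opnorm_le_sum p q (T : 'M[H -> K]_(p, q)) : bnd T ->
  opnorm T <= \sum_i \sum_j onrm (T i j).
Proof.
move=> bT; have s0 i : 0 <= \sum_j onrm (T i j).
  by apply: sumr_ge0 => j _; exact: onrm_ge0.
apply: opnorm_le => [|x]; first by apply: sumr_ge0.
have h i : hnorm (mxapp T x i) <= (\sum_j onrm (T i j)) * vn x.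
  apply: le_trans (hnorm_sum _ _ _) _; rewrite mulr_suml; apply: ler_sum => j _.
  by apply: le_trans (onrmP _ (bT i j)) _; rewrite ler_wpM2l ?onrm_ge0 ?hnorm_le_vn.
have := sum_sq_bound (fun i => hnorm_ge0 (mxapp T x i)) h.
rewrite -sqr_vn sqr_sqrtr; last by apply: sumr_ge0 => i _; exact: sqr_ge0.
move=> {}h; apply: ler_sqr_norm; first by rewrite mulr_ge0 ?sumr_ge0 ?vn_ge0.
apply: le_trans h _; rewrite exprMn ler_wpM2r ?exprn_ge0 ?vn_ge0 //.
elim: (index_enum _) => [|i s IH]; first by rewrite !big_nil expr0n.
rewrite !big_cons sqrrD; set a := \sum_(_ <- s) _ in IH *; set b := \sum_j _.
have b0 : 0 <= b by apply: s0.
have a0 : 0 <= a by apply: sumr_ge0 => k _; exact: s0.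
by have := mulr_ge0 b0 a0; lra.
Qed.

End Opnorm.

(** * Scalar matrices acting on finite Hilbert sums *)

Section ScalarMatrix.
Variable R : realType.

Definition sapp p q (a : 'M[R[i]]_(p, q)) (K : lmodType R[i]) (y : 'I_q -> K) : 'I_p -> K :=
  fun i => \sum_(k < q) a i k *: y k.

Lemma scalar_mxnorm_ge0 p q (a : 'M[R[i]]_(p, q)) : 0 <= scalar_mxnorm a.
Proof.
by apply: inf_sq_ge0 => v; apply: sumr_ge0 => i _; rewrite exprn_ge0 ?cabs_ge0.
Qed.

Lemma cabs_sum (I : Type) (s : seq I) (F : I -> R[i]) :
  cabs (\sum_(i <- s) F i) <= \sum_(i <- s) cabs (F i).
Proof.
elim: s => [|i s IH]; first by rewrite !big_nil cabs0.
by rewrite !big_cons; apply: le_trans (cabsD _ _) _; rewrite lerD2l.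
Qed.

Lemma scalar_mxnormP p q (a : 'M[R[i]]_(p, q)) (v : 'I_q -> R[i]) :
  \sum_i cabs (\sum_j a i j * v j) ^+ 2 <=
  scalar_mxnorm a ^+ 2 * \sum_j cabs (v j) ^+ 2.
Proof.
have s0 (w : 'I_q -> R[i]) : 0 <= \sum_j cabs (w j) ^+ 2.
  by apply: sumr_ge0 => j _; rewrite exprn_ge0 ?cabs_ge0.
apply: (@inf_sqP _ _ _ _ _ _ (Num.sqrt (\sum_i (\sum_j cabs (a i j)) ^+ 2))) => //.
  by move=> w; apply: sumr_ge0 => j _; rewrite exprn_ge0 ?cabs_ge0.
move=> w; rewrite -[X in _ * X]sqr_sqrtr //.
apply: sum_sq_bound => i; first exact: cabs_ge0.
apply: le_trans (cabs_sum _ _) _; rewrite mulr_suml; apply: ler_sum => j _.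
rewrite cabsM ler_wpM2l ?cabs_ge0 //.
apply: ler_sqr_norm; rewrite ?sqrtr_ge0 // sqr_sqrtr // (bigD1 j) //= lerDl.
by apply: sumr_ge0 => k _; rewrite exprn_ge0 ?cabs_ge0.
Qed.

Section Direction.
Variables (K : hilbert R) (e : K).
Hypothesis e1 : rdot e e = 1.

Let perp (x : K) := x - hdot K x e *: e.

Let pythagoras x : hnorm x ^+ 2 = cabs (hdot K x e) ^+ 2 + hnorm (perp x) ^+ 2.
Proof.
rewrite !sqr_hnorm /perp rdotBl !rdotBr; set c := hdot K x e.
have xc : rdot x (c *: e) = cabs c ^+ 2.
  by rewrite rdotZr_complex sqr_cabs /c [hdot K x e]hdotE /= !expr2.
have cc : rdot (c *: e) (c *: e) = cabs c ^+ 2.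
  by rewrite -sqr_hnorm hnormZ exprMn sqr_hnorm e1 mulr1.
by rewrite (rdotC _ x) xc cc; ring.
Qed.

Let perp_lin : linear perp.
Proof.
move=> c x y; rewrite /perp hdotDl hdotZl scalerBr scalerDl opprD scalerA.
by rewrite !addrA; congr (_ - _); rewrite addrAC.
Qed.

(** Along [e] the inequality is the scalar one, applied to the coordinates; orthogonal to [e] it is
    the hypothesis. By Pythagoras the two add up. *)
Lemma sapp_direction p q (a : 'M[R[i]]_(p, q)) (y : 'I_q -> K) :
  vn (sapp a (perp \o y)) ^+ 2 <= scalar_mxnorm a ^+ 2 * vn (perp \o y) ^+ 2 ->
  vn (sapp a y) ^+ 2 <= scalar_mxnorm a ^+ 2 * vn y ^+ 2.
Proof.
have := scalar_mxnormP a (fun k => hdot K (y k) e).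
rewrite !sqr_vn; move=> h1 h2.
have -> : \sum_i hnorm (sapp a y i) ^+ 2 =
    \sum_i cabs (\sum_j a i j * hdot K (y j) e) ^+ 2 +
    \sum_i hnorm (sapp a (perp \o y) i) ^+ 2.
  rewrite -big_split; apply: eq_bigr => i _ /=; rewrite pythagoras; congr (_ ^+ 2 + _ ^+ 2).
    congr cabs; rewrite /sapp.
    rewrite (big_morph (hdot K ^~ e) (fun u v => hdotDl u v e) (linear0l (hdot K) e)).
    by apply: eq_bigr => j _; rewrite hdotZl.
  by congr hnorm; rewrite /sapp (lin_sum perp_lin); apply: eq_bigr => j _; rewrite (linZ perp_lin).
have -> : \sum_i hnorm (y i) ^+ 2 =
    \sum_i cabs (hdot K (y i) e) ^+ 2 + \sum_i hnorm ((perp \o y) i) ^+ 2.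
  by rewrite -big_split; apply: eq_bigr => i _ /=; rewrite pythagoras.
by rewrite mulrDr lerD.
Qed.

Lemma perp0 : perp 0 = 0. Proof. exact: lin0 perp_lin. Qed.

End Direction.

(* Induction on the number of nonzero vectors: splitting off the direction of
   one of them leaves orthogonal remainders, with one more zero among them. *)
Lemma sapp_le p q (a : 'M[R[i]]_(p, q)) (K : hilbert R) (y : 'I_q -> K) :
  vn (sapp a y) <= scalar_mxnorm a * vn y.
Proof.
apply: ler_sqr_norm; first by rewrite mulr_ge0 ?vn_ge0 ?scalar_mxnorm_ge0.
rewrite exprMn; have [n] := ubnP #|[pred k | y k != 0]|.
elim: n => // n IH in y *; rewrite ltnS => hn.
have [[k0 yk0]|y0] := pselect (exists k, y k != 0); last first.
  have {}y0 k : y k = 0 by apply/eqP/negPn/negP => h; apply: y0; exists k.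
  rewrite !sqr_vn big1 => [|i _].
    by rewrite mulr_ge0 ?sqr_ge0 // sumr_ge0 // => i _; exact: sqr_ge0.
  by rewrite /sapp big1 ?hnorm0 ?expr0n // => k _; rewrite y0 scaler0.
have n0 : hnorm (y k0) != 0 by apply: contraNneq yk0 => /hnorm_eq0 ->.
pose e := (hnorm (y k0))^-1%:C *: y k0.
have e1 : rdot e e = 1.
  by rewrite rdotZl rdotZr -sqr_hnorm expr2 mulKf // mulVf.
apply: (sapp_direction e1); apply: IH; apply: leq_trans hn.
apply: proper_card; apply/properP; split.
  apply/fintype.subsetP => k; rewrite !inE; apply: contraNneq => /= ->.
  by rewrite perp0.
exists k0; rewrite !inE //= negbK.
have -> : hdot K (y k0) e = (hnorm (y k0))%:C.
  rewrite hdotE rdotZr -sqr_hnorm expr2 mulKf // scalerA mulrC -scalerA rdotZr.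
  by have := rdotiC (y k0) (y k0); rewrite rdotC => h; congr (_ +i* _); nra.
by rewrite /e scalerA -rmorphM /= mulfV // scale1r subrr.
Qed.

End ScalarMatrix.

Lemma mx_in_block (V : nmodType) (S : set V) p q p' q'
    (x : 'M[V]_(p, q)) (y : 'M[V]_(p', q')) : S 0 ->
  mx_in S x -> mx_in S y -> mx_in S (block_mx x 0 0 y).
Proof.
move=> S0 Sx Sy i j; rewrite -(splitK i) -(splitK j).
case: (fintype.split i) => i'; case: (fintype.split j) => j' /=;
  by rewrite ?block_mxEul ?block_mxEur ?block_mxEdl ?block_mxEdr ?mxE.
Qed.

Section OpnormAlgebra.
Variables (R : realType) (H K : hilbert R).
Local Notation bnd := (mx_in (@bounded_op R H K)).

Lemma opnorm_scalar p p' q' q (a : 'M[R[i]]_(p, p')) (T : 'M[H -> K]_(p', q'))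
    (b : 'M[R[i]]_(q', q)) : bnd T ->
  opnorm (mxop (fun v c => c *: v) (mxop (fun c v => c *: v) a T) b) <=
  scalar_mxnorm a * opnorm T * scalar_mxnorm b.
Proof.
move=> bT; apply: opnorm_le => [|x].
  by rewrite !mulr_ge0 ?opnorm_ge0 ?scalar_mxnorm_ge0.
have E : mxapp (mxop (fun v c => c *: v) (mxop (fun c v => c *: v) a T) b) x =1
         sapp a (mxapp T (sapp b x)).
  move=> i; rewrite /mxapp /sapp.
  under eq_bigr do rewrite mxE fct_sumE.
  rewrite exchange_big /=.
  under eq_bigr => k _ do under eq_bigr => j _ do
    rewrite /= mxE !fctE fct_sumE scaler_sumr.
  under eq_bigr => k _ do rewrite exchange_big /=.
  rewrite exchange_big /=; apply: eq_bigr => l _; rewrite scaler_sumr.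
  apply: eq_bigr => k _; have [lT _] := bT l k.
  rewrite (lin_sum lT) scaler_sumr; apply: eq_bigr => j _.
  by rewrite (linZ lT) [RHS]scalerA mulrC -scalerA.
rewrite (eq_vn E); apply: le_trans (sapp_le _ _) _; rewrite -!mulrA.
rewrite ler_wpM2l ?scalar_mxnorm_ge0 //; apply: le_trans (opnormP _ bT) _.
by rewrite ler_wpM2l ?opnorm_ge0 ?sapp_le.
Qed.

Lemma opnorm_direct_sum p q p' q'
    (x : 'M[H -> K]_(p, q)) (y : 'M[H -> K]_(p', q')) : bnd x -> bnd y ->
  opnorm (block_mx x 0 0 y) = Num.max (opnorm x) (opnorm y).
Proof.
move=> bx by_; have b0 := sub0 (bounded_lin H K).
have bxy := mx_in_block b0 bx by_.
have El v i : mxapp (block_mx x 0 0 y) v (lshift p' i) = mxapp x (v \o lshift q') i.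
  rewrite /mxapp big_split_ord /= [X in _ + X]big1 => [|j _].
    by rewrite addr0; apply: eq_bigr => j _; rewrite block_mxEul.
  by rewrite block_mxEur mxE.
have Er v i : mxapp (block_mx x 0 0 y) v (rshift p i) = mxapp y (v \o @rshift q q') i.
  rewrite /mxapp big_split_ord /= big1 => [|j _].
    by rewrite add0r; apply: eq_bigr => j _; rewrite block_mxEdr.
  by rewrite block_mxEdl mxE.
apply/eqP; rewrite eq_le; apply/andP; split.
  apply: opnorm_le => [|v]; first by rewrite le_max opnorm_ge0.
  set M := Num.max _ _; have M0 : 0 <= M by rewrite le_max opnorm_ge0.
  apply: ler_sqr_norm; first by rewrite mulr_ge0 ?vn_ge0.
  rewrite exprMn !sqr_vn_split mulrDr (eq_vn (El v)) (eq_vn (Er v)).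
  rewrite -!exprMn; apply: lerD; rewrite ler_pXn2r ?nnegrE ?mulr_ge0 ?vn_ge0 //.
    by apply: le_trans (opnormP _ bx) _; rewrite ler_wpM2r ?vn_ge0 // le_max lexx.
  by apply: le_trans (opnormP _ by_) _; rewrite ler_wpM2r ?vn_ge0 // le_max lexx orbT.
rewrite ge_max; apply/andP; split.
  apply: opnorm_le => [|v]; first exact: opnorm_ge0.
  pose w := fun k : 'I_(q + q') => if fintype.split k is inl k' then v k' else 0.
  have wl : w \o lshift q' =1 v by move=> k; rewrite /w /= (unsplitK (inl k)).
  have wr : w \o @rshift q q' =1 (fun=> 0) by move=> k; rewrite /w /= (unsplitK (inr k)).
  have -> : vn v = vn w.
    apply/eqP; rewrite -(@eqrXn2 _ 2) ?vn_ge0 //.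
    by rewrite (sqr_vn_split w) (eq_vn wl) (eq_vn wr) vn0 expr0n addr0.
  apply: le_trans (opnormP w bxy); apply: ler_sqr_norm; first exact: vn_ge0.
  rewrite [leRHS]sqr_vn_split (eq_vn (El w)) (funext wl) lerDl; exact: sqr_ge0.
apply: opnorm_le => [|v]; first exact: opnorm_ge0.
pose w := fun k : 'I_(q + q') => if fintype.split k is inr k' then v k' else 0.
have wr : w \o @rshift q q' =1 v by move=> k; rewrite /w /= (unsplitK (inr k)).
have wl : w \o lshift q' =1 (fun=> 0) by move=> k; rewrite /w /= (unsplitK (inl k)).
have -> : vn v = vn w.
  apply/eqP; rewrite -(@eqrXn2 _ 2) ?vn_ge0 //.
  by rewrite (sqr_vn_split w) (eq_vn wl) (eq_vn wr) vn0 expr0n add0r.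
apply: le_trans (opnormP w bxy); apply: ler_sqr_norm; first exact: vn_ge0.
rewrite [leRHS]sqr_vn_split (eq_vn (Er w)) (funext wr) lerDr; exact: sqr_ge0.
Qed.

Lemma opnorm0P p q (T : 'M[H -> K]_(p, q)) : bnd T -> (opnorm T = 0 <-> T = 0).
Proof.
move=> bT; split=> [T0|->].
  apply/matrixP => i j; rewrite mxE; apply: (onrm_eq0 (bT i j)).
  by apply/eqP; rewrite eq_le onrm_ge0 andbT -T0 opnorm_entry.
apply/eqP; rewrite eq_le opnorm_ge0 andbT; apply: opnorm_le => // x.
by rewrite (eq_vn (y := fun=> 0)) ?vn0 ?mul0r // => i; rewrite /mxapp big1 // => j; rewrite mxE.
Qed.

End OpnormAlgebra.

Section OpnormComp.
Variables (R : realType) (G H K : hilbert R).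

Lemma mxapp_comp p r q (T : 'M[H -> K]_(p, r)) (S : 'M[G -> H]_(r, q)) x :
  mx_in (@bounded_op R H K) T ->
  mxapp (mxop (fun (T : H -> K) (S : G -> H) => T \o S) T S) x =1 mxapp T (mxapp S x).
Proof.
move=> bT i; rewrite /mxapp; under eq_bigr do rewrite mxE fct_sumE.
rewrite exchange_big /=; apply: eq_bigr => k _.
by have [lT _] := bT i k; rewrite (lin_sum lT).
Qed.

Lemma opnorm_comp p r q (T : 'M[H -> K]_(p, r)) (S : 'M[G -> H]_(r, q)) :
  mx_in (@bounded_op R H K) T -> mx_in (@bounded_op R G H) S ->
  opnorm (mxop (fun (T : H -> K) (S : G -> H) => T \o S) T S) <= opnorm T * opnorm S.
Proof.
move=> bT bS; apply: opnorm_le => [|x]; first by rewrite mulr_ge0 ?opnorm_ge0.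
rewrite (eq_vn (mxapp_comp S x bT)); apply: le_trans (opnormP _ bT) _.
by rewrite -mulrA ler_wpM2l ?opnorm_ge0 ?opnormP.
Qed.

Lemma onrm_comp (T : H -> K) (S : G -> H) : bounded_op T -> bounded_op S ->
  onrm (T \o S) <= onrm T * onrm S.
Proof.
move=> bT bS; apply: onrm_le => [|x]; first by rewrite mulr_ge0 ?onrm_ge0.
apply: le_trans (onrmP _ bT) _.
by rewrite -mulrA ler_wpM2l ?onrm_ge0 ?onrmP.
Qed.

End OpnormComp.

(** * Adjoints and the operator norm *)

Section OpnormAdjoint.
Variables (R : realType) (H K : hilbert R).
Implicit Types T S : H -> K.

Lemma onrm_adjoint_le T : bounded_op T -> onrm (adjoint T) <= onrm T.
Proof.
move=> bT; apply: onrm_le => [|y]; first exact: onrm_ge0.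
apply: hnorm_le_rdot => [|x]; first by rewrite mulr_ge0 ?onrm_ge0 ?hnorm_ge0.
rewrite rdotC -adjointP //; apply: le_trans (rdot_le _ _) _.
by rewrite mulrAC ler_wpM2r ?hnorm_ge0 ?onrmP.
Qed.

Lemma adjoint_linear_comb c T S : bounded_op T -> bounded_op S ->
  adjoint (c *: T + S) = c^* *: adjoint T + adjoint S.
Proof.
move=> bT bS; apply: adjoint_unique; first by case: (bounded_lin H K) => _; apply.
move=> x y; rewrite !fctE rdotDl rdotDr -(adjointP bS); congr (_ + _).
have h : rdot x ('i *: adjoint T y) = - rdot y ('i *: T x).
  by apply: oppr_inj; rewrite opprK -rdotiC -adjointP // linZ ?(rdotC y) //; case: bT.
rewrite rdotC [LHS]rdotZr_complex [RHS]rdotZr_complex h -(adjointP bT) (rdotC y).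
by case: c => a b /=; ring.
Qed.

End OpnormAdjoint.

Section AdjointComp.
Variables (R : realType) (G H K : hilbert R).

Lemma onrm_adjoint (T : H -> K) : bounded_op T -> onrm (adjoint T) = onrm T.
Proof.
move=> bT; apply/eqP; rewrite eq_le onrm_adjoint_le //=.
by rewrite -{1}(adjointK bT) onrm_adjoint_le //; exact: adjoint_bounded.
Qed.

Lemma adjoint_comp (T : H -> K) (S : G -> H) : bounded_op T -> bounded_op S ->
  adjoint (T \o S) = adjoint S \o adjoint T.
Proof.
move=> bT bS; apply: adjoint_unique; first exact: bounded_comp.
by move=> x y /=; rewrite adjointP // adjointP.
Qed.

Lemma adjointB (T S : H -> K) : bounded_op T -> bounded_op S ->
  adjoint (T - S) = adjoint T - adjoint S.
Proof.
move=> bT bS; apply: adjoint_unique; first exact: (subB (bounded_lin H K)).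
by move=> x y; rewrite !fctE rdotBl rdotBr !adjointP.
Qed.

Lemma adjoint_sum (I : Type) (s : seq I) (F : I -> H -> K) :
  (forall i, bounded_op (F i)) ->
  adjoint (\sum_(i <- s) F i) = \sum_(i <- s) adjoint (F i).
Proof.
move=> bF; apply: adjoint_unique.
  by apply: (sub_sum (bounded_lin H K)) => i _.
move=> x y; rewrite !fct_sumE rdot_suml rdot_sumr.
by apply: eq_bigr => i _; rewrite adjointP.
Qed.

End AdjointComp.

(** * Operator spaces and closed spans *)

(** Ruan's axioms without completeness, for the algebraic tensor product before it is completed. *)
Record pre_operator_space (R : realType) (X : mspace R) : Prop := PreOperatorSpace {
  pos_subspace : linear_subspace (mcar X);
  pos_norm0 : forall p q (x : 'M[X]_(p, q)), mx_in (mcar X) x ->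
    (mnorm X x = 0 <-> x = 0);
  pos_triangle : forall p q (x y : 'M[X]_(p, q)),
    mx_in (mcar X) x -> mx_in (mcar X) y ->
    mnorm X (x + y) <= mnorm X x + mnorm X y;
  pos_norm_ge0 : forall p q (x : 'M[X]_(p, q)), mx_in (mcar X) x ->
    0 <= mnorm X x;
  pos_normZ : forall p q (c : R[i]) (x : 'M[X]_(p, q)), mx_in (mcar X) x ->
    mnorm X (map_mx ( *:%R c) x) = cabs c * mnorm X x;
  pos_scalar_mx : forall p p' q' q
      (a : 'M[R[i]]_(p, p')) (x : 'M[X]_(p', q')) (b : 'M[R[i]]_(q', q)),
    mx_in (mcar X) x ->
    mnorm X (mxop (fun v c => c *: v) (mxop (fun c v => c *: v) a x) b) <=
      scalar_mxnorm a * mnorm X x * scalar_mxnorm b;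
  pos_direct_sum : forall p q p' q' (x : 'M[X]_(p, q)) (y : 'M[X]_(p', q')),
    mx_in (mcar X) x -> mx_in (mcar X) y ->
    mnorm X (block_mx x 0 0 y) = Num.max (mnorm X x) (mnorm X y) }.

Lemma operator_spaceP (R : realType) (X : mspace R) :
  operator_space X <-> pre_operator_space X /\ complete_for (@nrm R X) (mcar X).
Proof.
split=> [h|[[? ? ? ? ? ? ?] ?]]; last by split.
by split; [split; case: h|case: h].
Qed.

Lemma os_pos (R : realType) (X : mspace R) : operator_space X -> pre_operator_space X.
Proof. by move=> /operator_spaceP[]. Qed.

Section Lspan.
Variables (R : realType) (V : lmodType R[i]).
Implicit Types S P : set V.

Lemma lspan_incl S : S `<=` lspan S.
Proof.
move=> x Sx; exists 1%N, (fun=> 1), (fun=> x); split => //.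
by rewrite big_ord1 scale1r.
Qed.

Lemma lspan_min S P : linear_subspace P -> S `<=` P -> lspan S `<=` P.
Proof.
move=> linP SP x [n [c [s [hs ->]]]]; apply: sub_sum => // i _.
by apply: subZ => //; exact: SP.
Qed.

Lemma lspan_subspace S : linear_subspace (lspan S).
Proof.
split; first by exists 0%N, (fun=> 0), (fun=> 0); split=> [[]|] //; rewrite big_ord0.
move=> c x y [n [a [s [hs ->]]]] [m [b [t [ht ->]]]].
exists (n + m)%N,
  (fun i => match fintype.split i with inl j => c * a j | inr j => b j end),
  (fun i => match fintype.split i with inl j => s j | inr j => t j end).
split=> [i|]; first by case: (fintype.split i).
rewrite big_split_ord scaler_sumr /=; congr (_ + _); apply: eq_bigr => i _.
  by rewrite (unsplitK (inl i)) scalerA.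
by rewrite (unsplitK (inr i)).
Qed.

End Lspan.

Lemma scalar_mxnorm_delta (R : realType) p q (i0 : 'I_p) (j0 : 'I_q) :
  scalar_mxnorm (delta_mx i0 j0 : 'M[R[i]]_(p, q)) <= 1.
Proof.
apply: inf_sq_le => // v; rewrite expr1n mul1r.
rewrite (bigD1 i0) //= [X in _ + X]big1 => [|i /negPf ii0]; last first.
  by rewrite big1 ?cabs0 ?expr0n // => j _; rewrite mxE ii0 mul0r.
rewrite addr0 (bigD1 j0) //= [X in _ + X]big1 => [|j /negPf jj0]; last first.
  by rewrite mxE jj0 andbF mul0r.
rewrite addr0 mxE !eqxx mul1r [leRHS](bigD1 j0) //= lerDl.
by apply: sumr_ge0 => j _; exact: sqr_ge0.
Qed.

Section PreOperatorSpace.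
Variables (R : realType) (X : mspace R).
Hypothesis posX : pre_operator_space X.
Let linX := pos_subspace posX.
Local Notation car := (mx_in (mcar X)).

Lemma mx_in_const1 (x : X) : mcar X x -> car (const_mx x : 'M[X]_(1, 1)).
Proof. by move=> Xx i j; rewrite mxE. Qed.

Lemma mx_inD p q (x y : 'M[X]_(p, q)) : car x -> car y -> car (x + y).
Proof. by move=> hx hy i j; rewrite mxE; exact: (subD linX). Qed.

Lemma mx_inN p q (x : 'M[X]_(p, q)) : car x -> car (- x).
Proof. by move=> hx i j; rewrite mxE; exact: (subN linX). Qed.

Lemma mx_inB p q (x y : 'M[X]_(p, q)) : car x -> car y -> car (x - y).
Proof. by move=> hx hy; apply: mx_inD => //; exact: mx_inN. Qed.

Lemma mx_in0 p q : car (0 : 'M[X]_(p, q)).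
Proof. by move=> i j; rewrite mxE; exact: (sub0 linX). Qed.

Lemma mx_in_sum p q (I : Type) (s : seq I) (F : I -> 'M[X]_(p, q)) :
  (forall i, car (F i)) -> car (\sum_(i <- s) F i).
Proof. by move=> h; elim/big_ind: _ => //; [exact: mx_in0|exact: mx_inD]. Qed.

Lemma mnorm0 p q : mnorm X (0 : 'M[X]_(p, q)) = 0.
Proof. by apply/(pos_norm0 posX) => //; exact: mx_in0. Qed.

Lemma mnormN p q (x : 'M[X]_(p, q)) : car x -> mnorm X (- x) = mnorm X x.
Proof.
move=> hx; have := pos_normZ posX (-1) hx; rewrite cabsN cabs1 mul1r => <-.
by congr mnorm; apply/matrixP => i j; rewrite !mxE scaleN1r.
Qed.

Lemma mnorm_sum p q (I : Type) (s : seq I) (F : I -> 'M[X]_(p, q)) :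
  (forall i, car (F i)) -> mnorm X (\sum_(i <- s) F i) <= \sum_(i <- s) mnorm X (F i).
Proof.
move=> hF; elim: s => [|i s IH]; first by rewrite !big_nil mnorm0.
rewrite !big_cons; apply: le_trans (pos_triangle posX _ _) _ => //.
  exact: mx_in_sum.
by rewrite lerD2l.
Qed.

(** Multiplying by matrix units isolates a single entry and moves it anywhere. By Ruan's axiom this
    does not increase norms, so every matrix norm is comparable with the norms of the entries. *)
Lemma sandwich_delta p p' q' q (i0 : 'I_p) (k0 : 'I_p') (l0 : 'I_q') (j0 : 'I_q)
    (x : 'M[X]_(p', q')) :
  mxop (fun v c => c *: v)
    (mxop (fun c v => c *: v) (delta_mx i0 k0 : 'M[R[i]]_(p, p')) x)
    (delta_mx l0 j0 : 'M[R[i]]_(q', q)) =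
  \matrix_(i, j) (if (i == i0) && (j == j0) then x k0 l0 else 0).
Proof.
apply/matrixP => i j; rewrite !mxE (bigD1 l0) //= big1 => [|l /negPf ll0]; last first.
  by rewrite !mxE ll0 scale0r.
rewrite addr0 !mxE eqxx /=; have [_|_] := eqVneq j j0; last by rewrite andbF scale0r.
rewrite andbT scale1r (bigD1 k0) //= big1 => [|k /negPf kk0]; last first.
  by rewrite !mxE kk0 andbF scale0r.
by rewrite addr0 !mxE eqxx andbT; case: eqP => _; rewrite ?scale1r ?scale0r.
Qed.

Lemma mnorm_sandwich p p' q' q (i0 : 'I_p) (k0 : 'I_p') (l0 : 'I_q') (j0 : 'I_q)
    (x : 'M[X]_(p', q')) : car x ->
  mnorm X (\matrix_(i < p, j < q) (if (i == i0) && (j == j0) then x k0 l0 else 0))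
  <= mnorm X x.
Proof.
move=> hx; rewrite -sandwich_delta; apply: le_trans (pos_scalar_mx posX _ _ hx) _.
apply: (@le_trans _ _ (1 * mnorm X x * 1)); last by rewrite mul1r mulr1.
have h := pos_norm_ge0 posX hx.
by rewrite !ler_pM ?mulr_ge0 ?scalar_mxnorm_ge0 ?scalar_mxnorm_delta.
Qed.

Lemma nrm_entry p q (x : 'M[X]_(p, q)) i j : car x -> nrm (x i j) <= mnorm X x.
Proof.
move=> hx; rewrite /nrm; have := @mnorm_sandwich 1 p q 1 0 i j 0 x hx.
by congr (mnorm X _ <= _); apply/matrixP => i' j'; rewrite !mxE !ord1.
Qed.

Lemma mnorm_le_sum p q (x : 'M[X]_(p, q)) : car x ->
  mnorm X x <= \sum_i \sum_j nrm (x i j).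
Proof.
move=> hx.
pose D i j : 'M[X]_(p, q) :=
  \matrix_(i', j') (if (i' == i) && (j' == j) then x i j else 0).
have hD i j : car (D i j).
  by move=> i' j'; rewrite mxE; case: ifP => _; [|exact: (sub0 linX)].
have Ex : \sum_i \sum_j D i j = x.
  apply/matrixP => i' j'; rewrite summxE.
  rewrite (eq_bigr (fun i => if i == i' then x i' j' else 0)) => [|i _].
    by rewrite -big_mkcond big_pred1_eq.
  rewrite summxE (eq_bigr (fun j => if j == j' then
      (if i == i' then x i' j' else 0) else 0)) => [|j _].
    by rewrite -big_mkcond big_pred1_eq.
  rewrite mxE (eq_sym i') (eq_sym j').
  by have [->|_] := eqVneq i i'; have [->|_] := eqVneq j j'.
rewrite -{1}Ex; apply: le_trans (mnorm_sum _ _) _ => [i|]; first exact: mx_in_sum.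
apply: ler_sum => i _; apply: le_trans (mnorm_sum _ _) _ => //.
apply: ler_sum => j _.
have := @mnorm_sandwich p 1 1 q i 0 0 j (const_mx (x i j)) (mx_in_const1 (hx i j)).
by congr (mnorm X _ <= _); apply/matrixP => i' j'; rewrite !mxE.
Qed.

Lemma nrm_ge0 (x : X) : mcar X x -> 0 <= nrm x.
Proof. by move=> Xx; apply: (pos_norm_ge0 posX); exact: mx_in_const1. Qed.

Lemma nrm0 : nrm (0 : X) = 0.
Proof.
rewrite /nrm -(mnorm0 1 1); congr mnorm; exact: const_mx0.
Qed.

Lemma nrm_eq0 (x : X) : mcar X x -> nrm x = 0 -> x = 0.
Proof.
move=> Xx /(pos_norm0 posX (mx_in_const1 Xx)) /matrixP /(_ 0 0).
by rewrite !mxE.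
Qed.

Lemma nrmD (x y : X) : mcar X x -> mcar X y -> nrm (x + y) <= nrm x + nrm y.
Proof.
move=> Xx Xy; have := pos_triangle posX (mx_in_const1 Xx) (mx_in_const1 Xy).
by congr (mnorm X _ <= _); apply/matrixP => i j; rewrite !mxE.
Qed.

Lemma nrmN (x : X) : mcar X x -> nrm (- x) = nrm x.
Proof.
move=> Xx; rewrite /nrm -[RHS]mnormN; last exact: mx_in_const1.
by congr mnorm; apply/matrixP => i j; rewrite !mxE.
Qed.

Lemma nrmZ c (x : X) : mcar X x -> nrm (c *: x) = cabs c * nrm x.
Proof.
move=> Xx; rewrite /nrm -(pos_normZ posX); last exact: mx_in_const1.
by congr mnorm; apply/matrixP => i j; rewrite !mxE.
Qed.

Lemma nrm_distC (x y : X) : mcar X x -> mcar X y -> nrm (x - y) = nrm (y - x).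
Proof. by move=> Xx Xy; rewrite -nrmN ?opprB //; exact: (subB linX). Qed.

Lemma nrm_trans (x y z : X) : mcar X x -> mcar X y -> mcar X z ->
  nrm (x - z) <= nrm (x - y) + nrm (y - z).
Proof.
move=> Xx Xy Xz; have -> : x - z = (x - y) + (y - z) by rewrite addrA addrNK.
by apply: nrmD; exact: (subB linX).
Qed.

Lemma mnorm_lip p q (x y : 'M[X]_(p, q)) : car x -> car y ->
  `|mnorm X x - mnorm X y| <= \sum_i \sum_j nrm (x i j - y i j).
Proof.
move=> hx hy.
have h u v : car u -> car v -> mnorm X u <= mnorm X v + mnorm X (u - v).
  by move=> hu hv; rewrite -{1}(subrK v u) addrC; apply: (pos_triangle posX) => //; exact: mx_inB.
have : mnorm X (x - y) <= \sum_i \sum_j nrm (x i j - y i j).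
  apply: le_trans (mnorm_le_sum (mx_inB hx hy)) _.
  by apply: ler_sum => i _; apply: ler_sum => j _; rewrite !mxE.
apply: le_trans; rewrite ler_norml lerBlDl h // andbT lerNl opprB lerBlDl.
by rewrite -(mnormN (mx_inB hx hy)) opprB h.
Qed.

Lemma mclosure_incl (S : set X) : S `<=` mcar X -> S `<=` mclosure S.
Proof.
move=> SX x Sx; split; first exact: SX.
by move=> e e0; exists x => //; rewrite subrr nrm0.
Qed.

Lemma mclosure_subspace (S : set X) : S `<=` mcar X -> linear_subspace S ->
  linear_subspace (mclosure S).
Proof.
move=> SX linS; split; first by apply: mclosure_incl => //; exact: sub0.
move=> c x y [Xx hx] [Xy hy]; split; first by apply: (subD linX) => //; exact: (subZ linX).
move=> e e0; have c1 : 0 < cabs c + 1 by rewrite ltr_pwDr ?cabs_ge0.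
have [s Ss hs] := hx (e / 2 / (cabs c + 1)) (divr_gt0 (divr_gt0 e0 (ltr0n _ 2)) c1).
have [t St ht] := hy (e / 2) (divr_gt0 e0 (ltr0n _ 2)).
exists (c *: s + t); first by apply: (subD linS) => //; exact: (subZ linS).
have -> : c *: x + y - (c *: s + t) = c *: (x - s) + (y - t).
  by rewrite scalerBr opprD addrACA.
have Xxs : mcar X (x - s) by apply: (subB linX) => //; exact: SX.
have Xyt : mcar X (y - t) by apply: (subB linX) => //; exact: SX.
apply: le_lt_trans (nrmD (subZ linX c Xxs) Xyt) _.
move: hs; rewrite nrmZ // ltr_pdivlMr // => hs; have := nrm_ge0 Xxs; lra.
Qed.

Lemma mclosure_idem (S : set X) : S `<=` mcar X -> mclosure (mclosure S) `<=` mclosure S.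
Proof.
move=> SX x [Xx hx]; split=> // e e0; have e2 : 0 < e / 2 by lra.
have [s [Xs hs] h1] := hx _ e2; have [t St h2] := hs _ e2; exists t => //.
by apply: le_lt_trans (nrm_trans Xx Xs (SX _ St)) _; lra.
Qed.

Lemma lspan_car (S : set X) : S `<=` mcar X -> lspan S `<=` mcar X.
Proof. exact: lspan_min. Qed.

Lemma clspan_incl (S : set X) : S `<=` mcar X -> S `<=` clspan S.
Proof.
move=> SX x Sx; apply: mclosure_incl; first exact: lspan_car.
exact: lspan_incl.
Qed.

Lemma clspan_subspace (S : set X) : S `<=` mcar X -> linear_subspace (clspan S).
Proof.
by move=> SX; apply: mclosure_subspace; [exact: lspan_car|exact: lspan_subspace].
Qed.

Lemma clspan_closed (S : set X) : S `<=` mcar X -> mclosure (clspan S) `<=` clspan S.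
Proof. by move=> SX; apply: mclosure_idem; exact: lspan_car. Qed.

Lemma clspan_min (S P : set X) : linear_subspace P -> mclosure P `<=` P ->
  S `<=` P -> clspan S `<=` P.
Proof.
move=> linP clP SP x [Xx hx]; apply: clP; split=> // e /hx [s Ss hs].
by exists s => //; exact: lspan_min Ss.
Qed.

End PreOperatorSpace.

(** * Norm closed spaces of bounded operators *)

Section Concrete.
Variables (R : realType) (H K : hilbert R).

Lemma concrete_pos (S : set (H -> K)) : linear_subspace S ->
  S `<=` @bounded_op R H K -> pre_operator_space (concrete_space S).
Proof.
move=> linS Sb; have mxb p q (x : 'M[H -> K]_(p, q)) :
    mx_in S x -> mx_in (@bounded_op R H K) x by move=> h i j; exact: Sb.
split=> //=.
- by move=> p q x /mxb; exact: opnorm0P.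
- by move=> p q x y /mxb hx /mxb hy; exact: opnormD.
- by move=> p q x _; exact: opnorm_ge0.
- by move=> p q c x /mxb; exact: opnormZ.
- by move=> p p' q' q a x b /mxb; exact: opnorm_scalar.
- by move=> p q p' q' x y /mxb hx /mxb hy; exact: opnorm_direct_sum.
Qed.

Lemma BO_pos : pre_operator_space (BO H K).
Proof. by apply: concrete_pos => //; exact: bounded_lin. Qed.

(** Limits are tested among bounded operators only: on an unbounded map [onrm] is an infimum over
    the empty set, hence 0. *)
Record closed_subspace (S : set (H -> K)) : Prop := ClosedSubspace {
  cs_lin : linear_subspace S;
  cs_bounded : S `<=` @bounded_op R H K;
  cs_closed : forall T, bounded_op T ->
    (forall e, 0 < e -> exists2 s, S s & onrm (T - s) < e) -> S T }.

Lemma BO_complete (u : nat -> H -> K) : (forall n, bounded_op (u n)) ->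
  (forall e, 0 < e -> exists N : nat, forall m n, (N <= m)%N -> (N <= n)%N ->
     onrm (u m - u n) < e) ->
  exists2 l, bounded_op l & tends0 (fun n => onrm (u n - l)).
Proof.
move=> bu cu; have bB m n := subB (bounded_lin H K) (bu m) (bu n).
have /choice[l hl] : forall x, exists y, tends0 (fun n => hnorm (u n x - y)).
  move=> x; apply: hilbert_cauchy => e e0.
  have x1 : 0 < hnorm x + 1 by rewrite ltr_pwDr ?hnorm_ge0.
  have [N hN] := cu (e / (hnorm x + 1)) (divr_gt0 e0 x1).
  exists N => m n Nm Nn; apply: le_lt_trans (onrmP x (bB m n)) _.
  have := hN m n Nm Nn; rewrite ltr_pdivlMr //.
  have := onrm_ge0 (u m - u n); lra.
(* Here [n] tends to infinity in the Cauchy estimate. Both the boundedness of [l] and the norm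
   convergence rest on this uniformity in [x]. *)
have hunif e : 0 < e -> exists N : nat, forall m x, (N <= m)%N ->
    hnorm (u m x - l x) <= e * hnorm x.
  move=> e0; have [N hN] := cu e e0; exists N => m x Nm.
  apply: eps_le => d d0; have [M hM] := hl x d d0; set n := maxn N M.
  have -> : u m x - l x = (u m - u n) x + (u n x - l x).
    by rewrite !fctE addrA subrK.
  apply: le_trans (hnormD_le _ _) _; apply: lerD; last exact/ltW/hM/leq_maxr.
  apply: le_trans (onrmP x (bB m n)) _.
  by rewrite ler_wpM2r ?hnorm_ge0 // ltW // hN // leq_maxl.
have bl : bounded_op l.
  split.
    move=> c x y; apply/eqP; rewrite -subr_eq0; apply/eqP/hnorm_eq0/eqP.
    rewrite eq_le hnorm_ge0 andbT.
    apply: (tends0_ge (f := fun n => hnorm (u n (c *: x + y) - l (c *: x + y)) +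
        (cabs c * hnorm (u n x - l x) + hnorm (u n y - l y)))).
      move=> n; rewrite -hnormZ (hnorm_distC (u n (c *: x + y))).
      apply: le_trans (lerD (lexx _) (hnormD_le _ _)).
      apply: le_trans _ (hnormD_le _ _); rewrite le_eqVlt; apply/orP; left; apply/eqP.
      congr hnorm; have [lu _] := bu n; rewrite lu scalerBr.
      set a := c *: u n x; set b := c *: l x; set d := u n y; set f := l y.
      by rewrite -addrA; congr (_ + _); rewrite [_ + (d - f)]addrACA addKr opprD.
    by do !apply: tends0D => //; apply: tends0M => //; exact: cabs_ge0.
  have [N hN] := hunif 1 ltr01; have [c c0 hc] := bounded_ge0 (bu N).
  exists (1 + c) => x; have -> : l x = u N x - (u N x - l x).
    by rewrite opprB addrC subrK.
  apply: le_trans (hnormD_le _ _) _; rewrite hnormN_eq addrC mulrDl lerD //.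
  exact: hN.
exists l => // e e0; have e2 : 0 < e / 2 by lra.
have [N hN] := hunif _ e2; exists N => n Nn; apply: (@le_lt_trans _ _ (e / 2)); last lra.
by apply: onrm_le => [|x]; [exact: ltW|exact: hN].
Qed.

Lemma concrete_os (S : set (H -> K)) : closed_subspace S ->
  operator_space (concrete_space S).
Proof.
move=> [linS Sb clS]; apply/operator_spaceP; split; first exact: concrete_pos.
move=> u uS cu; have [l bl hl] := BO_complete (fun n => Sb _ (uS n)) cu.
exists l; last by apply/tends0P => // n; exact: onrm_ge0.
apply: clS => // e /hl[N /(_ N (leqnn N)) hN]; exists (u N); first exact: uS.
by rewrite onrm_distC.
Qed.

Lemma closed_span_cs (S : set (H -> K)) : S `<=` @bounded_op R H K ->
  closed_subspace (closed_span S).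
Proof.
move=> Sb; split; first exact: (clspan_subspace BO_pos).
  by move=> T [].
by move=> T bT h; apply: (clspan_closed BO_pos).
Qed.

Lemma closed_span_incl (S : set (H -> K)) : S `<=` @bounded_op R H K ->
  S `<=` closed_span S.
Proof. exact: (clspan_incl BO_pos). Qed.

Lemma closed_span_min (S P : set (H -> K)) : closed_subspace P ->
  S `<=` P -> closed_span S `<=` P.
Proof. by move=> [linP Pb clP]; apply: (@clspan_min _ (BO H K)) => // T [bT hT]; exact: clP. Qed.

End Concrete.

Section Preimages.
Variables (R : realType) (H K H' K' : hilbert R).

(* [theta] is the identity for T |-> A T B and the conjugation for T |-> T^*. *)
Lemma preimage_cs (f : (H -> K) -> (H' -> K')) (P : set (H' -> K'))
    (theta : R[i] -> R[i]) (c : R) : 0 <= c ->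
  (forall T, bounded_op T -> bounded_op (f T)) ->
  (forall a T S, bounded_op T -> bounded_op S ->
     f (a *: T + S) = theta a *: f T + f S) ->
  (forall T, bounded_op T -> onrm (f T) <= c * onrm T) ->
  closed_subspace P -> closed_subspace [set T | bounded_op T /\ P (f T)].
Proof.
move=> c0 fb flin fc [linP Pb clP]; have linb := bounded_lin H K.
have f0 : f 0 = 0.
  have b0 := sub0 linb; apply: (onrm_eq0 (fb _ b0)); apply/eqP.
  by rewrite eq_le onrm_ge0 andbT; have := fc _ b0; rewrite onrm0 mulr0.
split=> [|T []//|T bT h].
  split; first by split; [exact: sub0|rewrite f0; exact: sub0].
  move=> a T S [bT PT] [bS PS]; split; first by case: linb => _; apply.
  by rewrite flin //; case: linP => _; apply.
split=> //; apply: clP => [|e e0]; first exact: fb.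
have c1 : 0 < c + 1 by lra.
have [s [bs Ps] hs] := h (e / (c + 1)) (divr_gt0 e0 c1).
have bTs := subB linb bT bs.
exists (f s) => //; have -> : f T - f s = f (T - s).
  apply/eqP; rewrite subr_eq -{1}(subrK s T); apply/eqP.
  (* [theta 1] is not known to be 1, so additivity is recovered by comparing with the case where the
     second operator is 0. *)
  have E : f (T - s + s) = theta 1 *: f (T - s) + f s by rewrite -flin ?scale1r.
  have E2 : f (T - s) = theta 1 *: f (T - s).
    by have := flin 1 (T - s) 0 bTs (sub0 linb); rewrite scale1r !addr0 f0 addr0.
  by rewrite E -E2.
apply: le_lt_trans (fc _ bTs) _; move: hs; rewrite ltr_pdivlMr //.
have := onrm_ge0 (T - s); lra.
Qed.

(** Combined with [closed_span_min], this extends an inclusion of products with [A] and [B] into [P]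
    from generators to their closed span. *)
Lemma sandwich_cs (A : K -> K') (B : H' -> H) (P : set (H' -> K')) :
  bounded_op A -> bounded_op B -> closed_subspace P ->
  closed_subspace [set T | bounded_op T /\ P (A \o T \o B)].
Proof.
move=> bA bB; apply: (preimage_cs (theta := id) (c := onrm A * onrm B)).
- by rewrite mulr_ge0 ?onrm_ge0.
- by move=> T bT; apply: (bounded_comp (bounded_comp bA bT) bB).
- move=> a T S bT bS; apply/funext => x /=; have [lA _] := bA.
  by rewrite !fctE lA.
- move=> T bT; apply: le_trans (onrm_comp (bounded_comp bA bT) bB) _.
  by rewrite mulrAC ler_wpM2r ?onrm_ge0 ?onrm_comp.
Qed.

End Preimages.

(** * Completion *)

Section QuotientSpace.
Variables (R : realType) (V : lmodType R[i]) (N : set V).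
Hypothesis linN : linear_subspace N.

(** The proof of linearity is an argument, so that the closure instance declared below can be
    inferred from the term itself. *)
Definition subspace_pred (_ : linear_subspace N) : {pred V} := [pred x | `[< N x >]].

Lemma subspace_pred_zmod : zmod_closed (subspace_pred linN).
Proof.
by split=> [|x y]; rewrite !inE; [exact: sub0 linN|exact: (subB linN)].
Qed.

HB.instance Definition _ := GRing.isZmodClosed.Build V (subspace_pred linN)
  subspace_pred_zmod.

Local Notation Q := (Quotient.quot (subspace_pred linN)).
Local Open Scope quotient_scope.

Definition quot_scale (c : R[i]) (q : Q) : Q := \pi_Q (c *: repr q).

Lemma pi_eq0 (x : V) : \pi_Q x = 0 <-> N x.
Proof.
have <- : \pi_Q 0 = 0 by exact: pi_zeror.
split => [/eqP|Nx].
  by rewrite -Quotient.idealrBE subr0 inE.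
by apply/eqP; rewrite -Quotient.idealrBE subr0 inE.
Qed.

Lemma pi_quot_scale c x : \pi_Q (c *: x) = quot_scale c (\pi_Q x).
Proof.
apply/eqP; rewrite -Quotient.idealrBE -scalerBr inE.
apply: (subZ linN); apply/pi_eq0.
by rewrite pi_addr pi_oppr reprK subrr.
Qed.

Lemma quot_scaleA a b (q : Q) : quot_scale a (quot_scale b q) = quot_scale (a * b) q.
Proof.
have <- := reprK q; move: (repr q) => v.
by rewrite -(pi_quot_scale b v) -(pi_quot_scale a) -(pi_quot_scale _ v) scalerA.
Qed.

Lemma quot_scale1 : left_id 1 quot_scale.
Proof. by move=> q; rewrite -[q]reprK -pi_quot_scale scale1r. Qed.

Lemma quot_scaleDr : right_distributive quot_scale +%R.
Proof.
move=> a q r; have <- := reprK q; have <- := reprK r.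
move: (repr q) (repr r) => v w; rewrite -(pi_addr (s := Q)).
by rewrite -(pi_quot_scale a v) -(pi_quot_scale a w) -(pi_quot_scale a) scalerDr pi_addr.
Qed.

Lemma quot_scaleDl (q : Q) : {morph quot_scale^~ q : a b / a + b}.
Proof.
by move=> a b /=; rewrite -[q]reprK -!pi_quot_scale -pi_addr scalerDl.
Qed.

HB.instance Definition _ := GRing.Zmodule_isLmodule.Build R[i] Q
  quot_scaleA quot_scale1 quot_scaleDr quot_scaleDl.

(** From here on the quotient is seen only through a linear surjection with kernel [N]. *)
Lemma quotient_space : exists (W : lmodType R[i]) (pr : V -> W),
  [/\ linear pr, forall w, exists v, pr v = w & forall v, pr v = 0 <-> N v].
Proof.
exists Q, (\pi_Q); split.
- by move=> c x y; rewrite pi_addr pi_quot_scale.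
- by move=> w; exists (repr w); rewrite reprK.
- exact: pi_eq0.
Qed.

End QuotientSpace.

Lemma real_cauchy (R : realType) (a : nat -> R) :
  (forall e, 0 < e -> exists N : nat, forall m n, (N <= m)%N -> (N <= n)%N ->
     `|a m - a n| < e) -> a n @[n --> \oo] --> limn a.
Proof.
move=> h; apply/cauchy_cvgP/cauchy_exP => e e0.
have [N hN] := h e e0; exists (a N); exists N => // n /= Nn.
by apply: hN.
Qed.

Section Completion.
Variables (R : realType) (X : mspace R).
Hypothesis posX : pre_operator_space X.
Let linX := pos_subspace posX.
Local Notation car := (mx_in (mcar X)).

Definition cauchy_in (u : nat -> X) := (forall n, mcar X (u n)) /\
  forall e : R, 0 < e -> exists N : nat, forall m n : nat,
    (N <= m)%N -> (N <= n)%N -> nrm (u m - u n) < e.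

Let null (u : nat -> X) := (forall n, mcar X (u n)) /\ tends0 (fun n => nrm (u n)).

Let null_lin : linear_subspace null.
Proof.
split.
  split=> [n|]; first exact: (sub0 linX).
  by apply: (tends0_le _ (@tends0_0 R)) => n; rewrite nrm0.
move=> c u v [Xu hu] [Xv hv]; split=> [n|].
  by apply: (subD linX) => //; exact: (subZ linX).
apply: tends0_le (tends0D (tends0M (cabs_ge0 c) hu) hv) => n.
rewrite -nrmZ //; apply: (nrmD posX) => //; exact: (subZ linX).
Qed.

Let cauchy_lin c u v : cauchy_in u -> cauchy_in v -> cauchy_in (c *: u + v).
Proof.
move=> [Xu hu] [Xv hv]; split=> [n|e e0].
  by apply: (subD linX) => //; exact: (subZ linX).
have c1 : 0 < cabs c + 1 by rewrite ltr_pwDr ?cabs_ge0.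
have e2 : 0 < e / 2 by lra.
have [N hN] := hu _ (divr_gt0 e2 c1); have [M hM] := hv _ e2.
exists (maxn N M) => m n; rewrite !geq_max => /andP[Nm Mm] /andP[Nn Mn].
have -> : (c *: u + v) m - (c *: u + v) n = c *: (u m - u n) + (v m - v n).
  by rewrite !fctE scalerBr opprD addrACA.
have Xum := subB linX (Xu m) (Xu n).
apply: le_lt_trans (nrmD posX (subZ linX c Xum) (subB linX (Xv m) (Xv n))) _.
have := hN m n Nm Nn; rewrite ltr_pdivlMr // nrmZ //.
have := hM m n Mm Mn; have := nrm_ge0 posX Xum; lra.
Qed.

Let cauchy0 : cauchy_in 0.
Proof.
split=> [n|e e0]; first exact: (sub0 linX).
by exists 0%N => m n _ _; rewrite subrr nrm0.
Qed.

Let lin_cauchy : linear_subspace [set u | cauchy_in u].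
Proof. by split; [exact: cauchy0|exact: cauchy_lin]. Qed.

Section Model.
Variables (W : lmodType R[i]) (pr : (nat -> X) -> W).
Hypotheses (lin_pr : linear pr) (pr_surj : forall w, exists u, pr u = w)
  (pr_null : forall u, pr u = 0 <-> null u).

Let rep (w : W) : nat -> X := xget 0 [set u | cauchy_in u /\ pr u = w].

Let wcar : set W := [set w | exists2 u, cauchy_in u & pr u = w].

Let repP w : wcar w -> cauchy_in (rep w) /\ pr (rep w) = w.
Proof.
by move=> [u cu hu]; rewrite /rep; apply: (xgetPex (P := [set u | cauchy_in u /\ pr u = w]) 0); exists u.
Qed.

Let rmx p q (w : 'M[W]_(p, q)) n : 'M[X]_(p, q) := \matrix_(i, j) rep (w i j) n.

(** The ambient space is a quotient of all sequences by the null sequences, and the classes of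
    Cauchy sequences form the carrier. The norm is read off the representatives chosen by [rep];
    [prm_cvg] shows that the choice does not matter. *)
Definition completion : mspace R :=
  @MSpace R W wcar (fun p q w => limn (fun n => mnorm X (rmx w n))).

Local Notation prm u := (\matrix_(i, j) pr (fun n => (u n) i j)).

Definition cauchy_mx p q (u : nat -> 'M[X]_(p, q)) :=
  forall i j, cauchy_in (fun n => u n i j).

Let cauchy_mx_car p q (u : nat -> 'M[X]_(p, q)) n : cauchy_mx u -> car (u n).
Proof. by move=> cu i j; have [] := cu i j. Qed.

Let rmx_cauchy p q (w : 'M[W]_(p, q)) : mx_in wcar w -> cauchy_mx (rmx w).
Proof.
move=> hw i j; have [h _] := repP (hw i j); move: h; congr cauchy_in.
by apply/funext => n; rewrite mxE.
Qed.

Let rmxK p q (w : 'M[W]_(p, q)) : mx_in wcar w -> w = prm (rmx w).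
Proof.
move=> hw; apply/matrixP => i j; rewrite mxE.
have [_ {1}<-] := repP (hw i j); congr pr; apply/funext => n; rewrite mxE.
by [].
Qed.

Let mnorm_cvg p q (u : nat -> 'M[X]_(p, q)) : cauchy_mx u ->
  mnorm X (u n) @[n --> \oo] --> limn (fun n => mnorm X (u n)).
Proof.
move=> cu; apply: real_cauchy => e e0.
(* The successor keeps the denominator positive and makes the sum of the [p * q] errors strictly
   smaller than [e]. *)
have [f hf] : exists f : 'I_p -> 'I_q -> nat, forall i j m n, (f i j <= m)%N ->
    (f i j <= n)%N -> nrm (u m i j - u n i j) < e / (p * q).+1%:R.
  have /choice[f hf] : forall ij : 'I_p * 'I_q, exists N : nat, forall m n,
      (N <= m)%N -> (N <= n)%N ->
      nrm (u m ij.1 ij.2 - u n ij.1 ij.2) < e / (p * q).+1%:R.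
    by move=> [i j]; have [_] := cu i j; apply; rewrite divr_gt0.
  by exists (fun i j => f (i, j)) => i j; exact: (hf (i, j)).
exists (\max_i \max_j f i j) => m n hm hn.
have fm i j : (f i j <= \max_i \max_j f i j)%N.
  by apply: leq_trans (leq_bigmax i); apply: (leq_bigmax (F := f i) j).
have hmn := mnorm_lip posX (cauchy_mx_car m cu) (cauchy_mx_car n cu).
apply: le_lt_trans hmn _.
apply: (@le_lt_trans _ _ (\sum_(i < p) \sum_(j < q) e / (p * q).+1%:R)).
  apply: ler_sum => i _; apply: ler_sum => j _; apply/ltW/hf; exact: leq_trans (fm i j) _.
rewrite !sumr_const !card_ord -mulrnA -[X in X < _]mulr_natr mulrAC ltr_pdivrMr //.
by rewrite ltr_pM2l // ltr_nat mulnC.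
Qed.

(** A Cauchy representative differs from the chosen one by a null sequence, so it computes the same
    norm. With this, each of Ruan's axioms passes from [X] to the limit. *)
Let prm_cvg p q (u : nat -> 'M[X]_(p, q)) : cauchy_mx u ->
  mnorm X (u n) @[n --> \oo] --> mnorm completion (prm u).
Proof.
move=> cu; have hw : mx_in wcar (prm u).
  by move=> i j; rewrite mxE; exists (fun n => u n i j) => //; exact: cu.
have crw := rmx_cauchy hw.
have d0 : (mnorm X (u n) - mnorm X (rmx (prm u) n)) @[n --> \oo] --> (0 : R).
  apply: norm_cvg0; apply/tends0P => //.
  apply: (tends0_le (fun n => mnorm_lip posX (cauchy_mx_car n cu) (cauchy_mx_car n crw))).
  apply: tends0_sum => i; apply: tends0_sum => j.
  suff [] : null (fun n => u n i j - rmx (prm u) n i j) by [].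
  apply/pr_null; rewrite -[fun n => _]/((fun n => u n i j) - (fun n => rmx (prm u) n i j)).
  rewrite (linB lin_pr); have := congr1 (fun A : 'M[W]_(p, q) => A i j) (rmxK hw).
  by rewrite /= !mxE => <-; rewrite subrr.
have h := cvgD d0 (mnorm_cvg crw); rewrite add0r in h.
suff -> : (fun n => mnorm X (u n)) =
    (fun n => mnorm X (u n) - mnorm X (rmx (prm u) n) + mnorm X (rmx (prm u) n)) by exact: h.
by apply/funext => n; rewrite subrK.
Qed.

Let prm_wcar p q (u : nat -> 'M[X]_(p, q)) : cauchy_mx u -> mx_in wcar (prm u).
Proof. by move=> cu i j; rewrite mxE; exists (fun n => u n i j) => //; exact: cu. Qed.

Let prmP p q (w : 'M[W]_(p, q)) : mx_in wcar w -> exists2 u, cauchy_mx u & w = prm u.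
Proof. by move=> hw; exists (rmx w); [exact: rmx_cauchy|exact: rmxK]. Qed.

Let wcar_lin : linear_subspace wcar.
Proof.
split; first by exists 0; [exact: cauchy0|exact: lin0].
move=> c _ _ [u cu <-] [v cv <-]; exists (c *: u + v); first exact: cauchy_lin.
by rewrite lin_pr.
Qed.

Let le_lim (a b : nat -> R) la lb : a n @[n --> \oo] --> la ->
  b n @[n --> \oo] --> lb -> (forall n, a n <= b n) -> la <= lb.
Proof.
move=> ha hb ab; rewrite -(cvg_lim _ ha) // -(cvg_lim _ hb) //.
apply: ler_lim; [by apply/cvg_ex; exists la|by apply/cvg_ex; exists lb|].
by near=> n.
Unshelve. all: by end_near. Qed.

Lemma completion_pos : pre_operator_space completion.
Proof.
split.
- exact: wcar_lin.
- move=> p q w hw; split=> [w0|->]; last first.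
    have -> : (0 : 'M[W]_(p, q)) = prm (fun=> 0 : 'M[X]_(p, q)).
      apply/matrixP => i j; rewrite [LHS]mxE [RHS]mxE -[LHS](lin0 lin_pr); congr pr.
      by apply/funext => n; rewrite mxE.
    have c0 : cauchy_mx (fun=> 0 : 'M[X]_(p, q)).
      by move=> i j; move: cauchy0; congr cauchy_in; apply/funext => n; rewrite mxE.
    apply: (cvg_unique _ (prm_cvg c0)) => //.
    by rewrite mnorm0 //; exact: cvg_cst.
  have cw := rmx_cauchy hw.
  have := prm_cvg cw; rewrite -rmxK // w0 => /tends0P h.
  apply/matrixP => i j; rewrite mxE; have [cr <-] := repP (hw i j).
  apply/pr_null; split=> [n|]; first by case: cr.
  apply: tends0_le (h _) => n; last exact: (pos_norm_ge0 posX (cauchy_mx_car n cw)).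
  by have := nrm_entry posX i j (cauchy_mx_car n cw); rewrite mxE.
- move=> p q _ _ /prmP[u cu ->] /prmP[v cv ->].
  have cuv : cauchy_mx (fun n => u n + v n).
    move=> i j; have := subD lin_cauchy (cu i j) (cv i j).
    by congr cauchy_in; apply/funext => n; rewrite mxE.
  have -> : prm u + prm v = prm (fun n => u n + v n).
    apply/matrixP => i j; rewrite !mxE -(linD lin_pr); congr pr.
    by apply/funext => n; rewrite mxE.
  apply: le_lim (prm_cvg cuv) (cvgD (prm_cvg cu) (prm_cvg cv)) _ => n.
  by apply: (pos_triangle posX); exact: cauchy_mx_car.
- move=> p q _ /prmP[u cu ->].
  apply: le_lim (cvg_cst 0) (prm_cvg cu) _ => n.
  by apply: (pos_norm_ge0 posX); exact: cauchy_mx_car.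
- move=> p q c _ /prmP[u cu ->].
  have cc : cauchy_mx (fun n => map_mx ( *:%R c) (u n)).
    move=> i j; have := subZ lin_cauchy c (cu i j).
    by congr cauchy_in; apply/funext => n; rewrite mxE.
  have -> : map_mx ( *:%R c) (prm u) = prm (fun n => map_mx ( *:%R c) (u n)).
    apply/matrixP => i j; rewrite !mxE -(linZ lin_pr); congr pr.
    by apply/funext => n; rewrite mxE.
  apply: (cvg_unique _ (prm_cvg cc)) => //.
  have -> : (fun n => mnorm X (map_mx ( *:%R c) (u n))) = (fun n => cabs c * mnorm X (u n)).
    by apply/funext => n; rewrite (pos_normZ posX) //; exact: cauchy_mx_car.
  by apply: cvgMl_tmp; exact: prm_cvg.
- move=> p p' q' q a _ b /prmP[u cu ->].
  pose sw u := mxop (fun v c => c *: v) (mxop (fun c (v : X) => c *: v) a u) b.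
  have E i j : (fun n => sw (u n) i j) =
      \sum_k b k j *: \sum_l a i l *: (fun n => u n l k).
    apply/funext => n; rewrite !mxE fct_sumE; apply: eq_bigr => k _.
    rewrite mxE !fctE fct_sumE; congr (_ *: _); apply: eq_bigr => l _; by rewrite !fctE.
  have cs : cauchy_mx (fun n => sw (u n)).
    move=> i j; rewrite E; apply: (sub_sum lin_cauchy) => k _.
    apply: (subZ lin_cauchy); apply: (sub_sum lin_cauchy) => l _.
    by apply: (subZ lin_cauchy); exact: cu.
  have -> : mxop (fun v c => c *: v) (mxop (fun c (v : W) => c *: v) a (prm u)) b =
      prm (fun n => sw (u n)).
    apply/matrixP => i j; rewrite [RHS]mxE E (lin_sum lin_pr) mxE.
    apply: eq_bigr => k _; rewrite (linZ lin_pr) (lin_sum lin_pr) mxE.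
    congr (_ *: _); apply: eq_bigr => l _; by rewrite (linZ lin_pr) mxE.
  have h : scalar_mxnorm a * mnorm X (u n) * scalar_mxnorm b @[n --> \oo] -->
      scalar_mxnorm a * mnorm completion (prm u) * scalar_mxnorm b.
    by apply: cvgMr_tmp; apply: cvgMl_tmp; exact: prm_cvg.
 apply: le_lim (prm_cvg cs) h _ => n.
  by apply: (pos_scalar_mx posX); exact: cauchy_mx_car.
- move=> p q p' q' _ _ /prmP[u cu ->] /prmP[v cv ->].
  have c0 : cauchy_in (fun=> 0) by exact: cauchy0.
  have E : block_mx (prm u) 0 0 (prm v) = prm (fun n => block_mx (u n) 0 0 (v n)).
    apply/matrixP => i j; rewrite -(splitK i) -(splitK j) [RHS]mxE.
    case: (fintype.split i) => i'; case: (fintype.split j) => j' /=;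
      rewrite ?block_mxEul ?block_mxEur ?block_mxEdl ?block_mxEdr mxE.
    + by congr pr; apply/funext => n; rewrite block_mxEul.
    + by rewrite -(lin0 lin_pr); congr pr; apply/funext => n; rewrite block_mxEur mxE.
    + by rewrite -(lin0 lin_pr); congr pr; apply/funext => n; rewrite block_mxEdl mxE.
    + by congr pr; apply/funext => n; rewrite block_mxEdr.
  have cb : cauchy_mx (fun n => block_mx (u n) 0 0 (v n)).
    move=> i j; rewrite -(splitK i) -(splitK j).
    case: (fintype.split i) => i'; case: (fintype.split j) => j' /=.
    + by move: (cu i' j'); congr cauchy_in; apply/funext => n; rewrite block_mxEul.
    + by move: c0; congr cauchy_in; apply/funext => n; rewrite block_mxEur mxE.
    + by move: c0; congr cauchy_in; apply/funext => n; rewrite block_mxEdl mxE.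
    + by move: (cv i' j'); congr cauchy_in; apply/funext => n; rewrite block_mxEdr.
  rewrite E; apply: (cvg_unique _ (prm_cvg cb)) => //.
  (* The maximum is written with an absolute value, so that its limit follows from the continuity of
     the arithmetic operations. *)
  have -> : (fun n => mnorm X (block_mx (u n) 0 0 (v n))) =
      (fun n => (mnorm X (u n) + mnorm X (v n) + `|mnorm X (u n) - mnorm X (v n)|) / 2).
    by apply/funext => n; rewrite (pos_direct_sum posX) ?maxr_absE //; exact: cauchy_mx_car.
  rewrite maxr_absE.
  apply: cvgMr_tmp; apply: cvgD; first exact: cvgD (prm_cvg cu) (prm_cvg cv).
  by apply: cvg_norm; exact: cvgB (prm_cvg cu) (prm_cvg cv).
Qed.

Definition completion_map (x : X) : completion := pr (fun=> x).

Let cauchy_cst x : mcar X x -> cauchy_in (fun=> x).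
Proof.
by move=> Xx; split=> // e e0; exists 0%N => m n _ _; rewrite subrr nrm0.
Qed.

Lemma completion_isometric : completely_isometric completion_map.
Proof.
split=> [x Xx|c x y Xx Xy|p q x hx].
- by exists (fun=> x) => //; exact: cauchy_cst.
- by rewrite /completion_map -lin_pr.
- have cx : cauchy_mx (fun=> x) by move=> i j; exact: cauchy_cst.
  have -> : map_mx completion_map x = prm (fun=> x).
    by apply/matrixP => i j; rewrite !mxE.
  by apply: (cvg_unique _ (prm_cvg cx)) => //; exact: cvg_cst.
Qed.

Let nrm_pr_cvg u : cauchy_in u ->
  nrm (u n) @[n --> \oo] --> nrm (pr u : completion).
Proof.
move=> cu; have cc : cauchy_mx (fun n => const_mx (u n) : 'M[X]_(1, 1)).
  by move=> i j; move: cu; congr cauchy_in; apply/funext => n; rewrite mxE.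
have := prm_cvg cc; rewrite /nrm.
congr (_ --> mnorm completion _); apply/matrixP => i j; rewrite !mxE.
by congr pr; apply/funext => n; rewrite mxE.
Qed.

Let completion_car_map x : mcar X x -> wcar (completion_map x).
Proof. by move=> Xx; have [h _ _] := completion_isometric; exact: h. Qed.

Let nrm_pr_le u x e : cauchy_in u -> mcar X x ->
  (exists N : nat, forall n, (N <= n)%N -> nrm (u n - x) <= e) ->
  nrm ((pr u : completion) - completion_map x) <= e.
Proof.
move=> cu Xx [N hN].
have cux : cauchy_in (u - fun=> x) by apply: (subB lin_cauchy) => //; exact: cauchy_cst.
have := nrm_pr_cvg cux; rewrite (linB lin_pr) => h.
apply: (cvgr_to_le h); exists N => // n /= Nn; exact: hN.
Qed.

(** Diagonal argument: [w n] is within [n.+1%:R^-1] of the class of the constant sequence [x n]; the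
    sequence [x] is Cauchy in [X], and its class is the limit of [w]. *)
Lemma completion_complete : complete_for (@nrm R completion) wcar.
Proof.
move=> w hw cw; have posW := completion_pos; have linW := wcar_lin.
have /choice[x hx] : forall n : nat, exists x, mcar X x /\
    nrm ((w n : completion) - completion_map x) <= n.+1%:R^-1.
  move=> n; have [cu {1}<-] := repP (hw n); have [Xu hu] := cu.
  have [N hN] := hu n.+1%:R^-1 (ltac:(by rewrite invr_gt0)).
  exists (rep (w n) N); split=> //; apply: nrm_pr_le => //.
  by exists N => m Nm; apply/ltW/hN.
have Xx n : mcar X (x n) by have [] := hx n.
have Ww n : wcar (completion_map (x n)) by exact: completion_car_map.
have cx : cauchy_in x.
  split=> // e e0; have e3 : 0 < e / 3 by lra.
  have [N hN] := @tends0_harmonic R _ e3; have [M hM] := cw _ e3.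
  exists (maxn N M) => m n; rewrite !geq_max => /andP[Nm Mm] /andP[Nn Mn].
  have [_ _ iso] := completion_isometric.
  have -> : nrm (x m - x n) = nrm (completion_map (x m) - completion_map (x n)).
    rewrite /nrm -(iso 1%N 1%N); last by apply: mx_in_const1; exact: (subB linX).
    congr (mnorm completion _); apply/matrixP => i j; rewrite !mxE.
    by rewrite /completion_map -(linB lin_pr).
  have h1 := nrm_trans posW (Ww m) (hw m) (Ww n).
  have h2 := nrm_trans posW (hw m) (hw n) (Ww n).
  have [_ hm] := hx m; have [_ hn] := hx n; rewrite (nrm_distC posW (Ww m) (hw m)) in h1.
  have := hM m n Mm Mn; have := hN m Nm; have := hN n Nn.
  move: hm hn h1 h2; move: (m.+1%:R^-1) (n.+1%:R^-1) => a b; lra.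
have Wx : wcar (pr x) by exists x.
exists (pr x : completion) => //.
apply/tends0P => [n|]; first by apply: (nrm_ge0 posW); exact: (subB linW).
have h : tends0 (fun n => nrm ((pr x : completion) - completion_map (x n))).
  move=> e e0; have e2 : 0 < e / 2 by lra.
  have [_ /(_ _ e2)[N hN]] := cx; exists N => n Nn.
  apply: (@le_lt_trans _ _ (e / 2)); last lra.
  by apply: nrm_pr_le => //; exists N => m Nm; apply/ltW/hN.
apply: (tends0_le _ (tends0D (@tends0_harmonic R) h)) => n.
apply: le_trans (nrm_trans posW (hw n) (Ww n) Wx) _.
by rewrite lerD ?(nrm_distC posW (Ww n)) //; have [] := hx n.
Qed.

Lemma completion_dense w : wcar w -> forall e, 0 < e ->
  exists2 x, mcar X x & nrm ((w : completion) - completion_map x) < e.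
Proof.
move=> hw e e0; have [cu {1}<-] := repP hw; have [Xu hu] := cu.
have e2 : 0 < e / 2 by lra.
have [N hN] := hu _ e2; exists (rep w N) => //.
apply: (@le_lt_trans _ _ (e / 2)); last lra.
by apply: nrm_pr_le => //; exists N => m Nm; apply/ltW/hN.
Qed.

End Model.

Lemma completion_exists : exists (W : mspace R) (i : X -> W),
  [/\ operator_space W, completely_isometric i
    & forall w, mcar W w -> forall e, 0 < e ->
        exists2 x, mcar X x & nrm (w - i x) < e].
Proof.
have [W [pr [lin_pr _ pr_null]]] := quotient_space null_lin.
exists (completion pr), (completion_map pr); split.
- apply/operator_spaceP; split; first exact: completion_pos.
  exact: (completion_complete lin_pr pr_null).
- exact: completion_isometric.
- exact: completion_dense.
Qed.

End Completion.

(** * The Haagerup tensor product of concrete operator spaces *)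

Section LinearOn.
Variables (R : realType) (V W : lmodType R[i]) (S : set V) (f : V -> W).
Hypotheses (linS : linear_subspace S) (linf : linear_on S f).

Lemma lin_on0 : f 0 = 0.
Proof.
have := linf 0 (sub0 linS) (sub0 linS); rewrite !scale0r !add0r => h.
by have := linf 1 (sub0 linS) (sub0 linS); rewrite !scale1r addr0 => /eqP;
  rewrite -subr_eq0 opprD addNKr oppr_eq0 => /eqP.
Qed.

Lemma lin_onD x y : S x -> S y -> f (x + y) = f x + f y.
Proof. by move=> Sx Sy; have := linf 1 Sx Sy; rewrite !scale1r. Qed.

Lemma lin_onZ c x : S x -> f (c *: x) = c *: f x.
Proof.
by move=> Sx; have := linf c Sx (sub0 linS); rewrite lin_on0 !addr0.
Qed.

Lemma lin_onB x y : S x -> S y -> f (x - y) = f x - f y.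
Proof.
by move=> Sx Sy; rewrite (lin_onD Sx (subN linS Sy)) -[- y]scaleN1r lin_onZ // scaleN1r.
Qed.

Lemma lin_on_sum (I : Type) (s : seq I) (P : pred I) (x : I -> V) :
  (forall i, P i -> S (x i)) -> f (\sum_(i <- s | P i) x i) = \sum_(i <- s | P i) f (x i).
Proof.
move=> Sx; suff [] : S (\sum_(i <- s | P i) x i) /\
    f (\sum_(i <- s | P i) x i) = \sum_(i <- s | P i) f (x i) by [].
elim/big_ind2: _ => [|x1 y1 x2 y2 [S1 E1] [S2 E2]|i Pi].
- by split; [exact: sub0|exact: lin_on0].
- by split; [exact: subD|rewrite lin_onD // E1 E2].
- by split=> //; exact: Sx.
Qed.

End LinearOn.

(** * Extension of complete contractions by density *)

Section Extension.
Variables (R : realType) (X W Y : mspace R).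
Hypotheses (posX : pre_operator_space X) (osW : operator_space W)
  (osY : operator_space Y).
Variables (i : X -> W) (f : X -> Y).
Hypotheses (iso_i : completely_isometric i)
  (dense_i : forall w, mcar W w -> forall e, 0 < e ->
        exists2 x, mcar X x & nrm (w - i x) < e)
  (car_f : forall x, mcar X x -> mcar Y (f x))
  (lin_f : linear_on (mcar X) f)
  (contr_f : forall p q (x : 'M[X]_(p, q)), mx_in (mcar X) x ->
     mnorm Y (map_mx f x) <= mnorm X x).
Let posW := os_pos osW.
Let posY := os_pos osY.
Let linX := pos_subspace posX.
Let linW := pos_subspace posW.
Let linY := pos_subspace posY.

Let car_i x : mcar X x -> mcar W (i x). Proof. by case: iso_i => h _ _; exact: h. Qed.

Let lin_i : linear_on (mcar X) i. Proof. by case: iso_i. Qed.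

Let nrm_i x y : mcar X x -> mcar X y -> nrm (i x - i y) = nrm (x - y).
Proof.
move=> Xx Xy; rewrite -(lin_onB linX lin_i) //; case: iso_i => _ _ iso.
rewrite /nrm -(iso 1%N 1%N); last by apply: mx_in_const1; exact: (subB linX).
by congr (mnorm W _); apply/matrixP => a b; rewrite !mxE.
Qed.

Let nrm_f x y : mcar X x -> mcar X y -> nrm (f x - f y) <= nrm (x - y).
Proof.
move=> Xx Xy; rewrite -(lin_onB linX lin_f) // /nrm.
have := @contr_f 1 1 (const_mx (x - y)) (mx_in_const1 (subB linX Xx Xy)).
by congr (mnorm Y _ <= _); apply/matrixP => a b; rewrite !mxE.
Qed.

(** The closure of the graph of [f], transported along [i]. Contractivity of [f] makes it single
    valued, completeness of [Y] makes it total on the carrier of [W]. *)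
Let G w y := forall e : R, 0 < e ->
  exists x, [/\ mcar X x, nrm (w - i x) < e & nrm (y - f x) < e].

Let G_unique w y y' : mcar W w -> mcar Y y -> mcar Y y' -> G w y -> G w y' -> y = y'.
Proof.
move=> Ww Yy Yy' h h'; apply/eqP; rewrite -subr_eq0; apply/eqP.
have Yyy' := subB linY Yy Yy'; apply: (nrm_eq0 posY) => //.
apply/eqP; rewrite eq_le (nrm_ge0 posY) // andbT; apply: eps_le => e e0; rewrite add0r.
have e4 : 0 < e / 4 by lra.
have [x [Xx h1 h2]] := h _ e4; have [x' [Xx' h1' h2']] := h' _ e4.
have h3 := nrm_trans posY Yy (car_f Xx) Yy'.
have h4 := nrm_trans posY (car_f Xx) (car_f Xx') Yy'.
have h5 := nrm_f Xx Xx'; rewrite -nrm_i // in h5.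
have h6 := nrm_trans posW (car_i Xx) Ww (car_i Xx').
rewrite (nrm_distC posW (car_i Xx) Ww) in h6.
rewrite (nrm_distC posY (car_f Xx')) // in h4; lra.
Qed.

Let G_exists w : mcar W w -> exists2 y, mcar Y y & G w y.
Proof.
move=> Ww.
have /choice[x hx] : forall n : nat, exists x, mcar X x /\ nrm (w - i x) < n.+1%:R^-1.
  move=> n; have [x Xx h] := dense_i Ww (ltac:(by rewrite invr_gt0) : 0 < n.+1%:R^-1 :> R).
  by exists x.
have Xx n : mcar X (x n) by have [] := hx n.
have [|e e0|y Yy hy] := os_complete osY (u := fun n => f (x n)).
- by move=> n; exact: car_f.
- have e2 : 0 < e / 2 by lra.
  have [N hN] := @tends0_harmonic R _ e2; exists N => m n Nm Nn.
  apply: le_lt_trans (nrm_f (Xx m) (Xx n)) _; rewrite -nrm_i //.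
  apply: le_lt_trans (nrm_trans posW (car_i (Xx m)) Ww (car_i (Xx n))) _.
  rewrite (nrm_distC posW (car_i (Xx m))) //.
  have [_ h1] := hx m; have [_ h2] := hx n; have := hN m Nm; have := hN n Nn.
  move: h1 h2; move: (m.+1%:R^-1) (n.+1%:R^-1) => a b; lra.
exists y => // e e0.
have hy0 : tends0 (fun n => nrm (f (x n) - y)).
  by apply/tends0P => // n; apply: (nrm_ge0 posY); apply: (subB linY) => //; exact: car_f.
have [N hN] := hy0 e e0; have [M hM] := @tends0_harmonic R _ e0.
exists (x (maxn N M)); split => //.
  by have [_ h] := hx (maxn N M); apply: lt_trans h _; apply: hM; rewrite leq_maxr.
by rewrite (nrm_distC posY) //; [apply: hN; rewrite leq_maxl|exact: car_f].
Qed.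

Lemma extend_contraction : exists g : W -> Y,
  [/\ forall w, mcar W w -> mcar Y (g w), linear_on (mcar W) g,
      forall p q (w : 'M[W]_(p, q)), mx_in (mcar W) w ->
        mnorm Y (map_mx g w) <= mnorm W w
    & forall x, mcar X x -> g (i x) = f x].
Proof.
have /choice[g hg] : forall w, exists y, mcar W w -> mcar Y y /\ G w y.
  move=> w; have [Ww|nW] := pselect (mcar W w); last by exists 0.
  by have [y Yy Gy] := G_exists Ww; exists y.
have Yg w : mcar W w -> mcar Y (g w) by move=> /hg[].
have Gg w : mcar W w -> G w (g w) by move=> /hg[].
exists g; split => //.
- move=> c v w Wv Ww; have Wcvw : mcar W (c *: v + w) by case: linW => _; apply.
  apply: (G_unique Wcvw (Yg _ Wcvw) _ (Gg _ Wcvw)).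
    by case: linY => _; apply; exact: Yg.
  move=> e e0; have c1 : 0 < cabs c + 1 by rewrite ltr_pwDr ?cabs_ge0.
  have e2 : 0 < e / 2 by lra.
  have [x [Xx h1 h2]] := Gg v Wv _ (divr_gt0 e2 c1).
  have [y [Xy h3 h4]] := Gg w Ww _ e2.
  exists (c *: x + y); split; first by case: linX => _; apply.
    rewrite lin_i // opprD addrACA -scalerBr.
    have Wvx := subB linW Wv (car_i Xx).
    apply: le_lt_trans (nrmD posW (subZ linW c Wvx) (subB linW Ww (car_i Xy))) _.
    rewrite nrmZ //; move: h1; rewrite ltr_pdivlMr // => h1.
    have := nrm_ge0 posW Wvx; lra.
  rewrite lin_f // opprD addrACA -scalerBr.
  have Yvx := subB linY (Yg _ Wv) (car_f Xx).
  apply: le_lt_trans (nrmD posY (subZ linY c Yvx) (subB linY (Yg _ Ww) (car_f Xy))) _.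
  rewrite nrmZ //; move: h2; rewrite ltr_pdivlMr // => h2.
  have := nrm_ge0 posY Yvx; lra.
- move=> p q w hw; apply: eps_le => e e0.
  pose d := e / 2 / (p * q).+1%:R.
  have d0 : 0 < d by rewrite !divr_gt0.
  have /choice[x hx] : forall ij : 'I_p * 'I_q, exists x, [/\ mcar X x,
      nrm (w ij.1 ij.2 - i x) < d & nrm (g (w ij.1 ij.2) - f x) < d].
    by move=> [a b]; exact: Gg (hw a b) _ d0.
  pose xm : 'M[X]_(p, q) := \matrix_(a, b) x (a, b).
  have Xxm : mx_in (mcar X) xm by move=> a b; rewrite mxE; have [] := hx (a, b).
  have Yxm : mx_in (mcar Y) (map_mx f xm) by move=> a b; rewrite mxE; exact: car_f.
  have Wxm : mx_in (mcar W) (map_mx i xm) by move=> a b; rewrite mxE; exact: car_i.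
  have Ygm : mx_in (mcar Y) (map_mx g w) by move=> a b; rewrite mxE; exact: Yg.
  have sd : \sum_(a < p) \sum_(b < q) d <= e / 2.
    rewrite !sumr_const !card_ord -mulrnA -[X in X <= _]mulr_natr /d mulrAC.
    by rewrite ler_pdivrMr // ler_wpM2l ?divr_ge0 ?ltW // ltr_nat mulnC.
  have h1 := mnorm_lip posY Ygm Yxm.
  have {}h1 : mnorm Y (map_mx g w) - mnorm Y (map_mx f xm) <= e / 2.
    apply: le_trans (ler_norm _) _; apply: le_trans h1 _; apply: le_trans sd.
    apply: ler_sum => a _; apply: ler_sum => b _; rewrite !mxE; apply: ltW.
    by have [] := hx (a, b).
  have h2 := mnorm_lip posW Wxm hw.
  have {}h2 : mnorm W (map_mx i xm) - mnorm W w <= e / 2.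
    apply: le_trans (ler_norm _) _; apply: le_trans h2 _; apply: le_trans sd.
    apply: ler_sum => a _; apply: ler_sum => b _; rewrite !mxE.
    have [Xx h _] := hx (a, b); rewrite (nrm_distC posW) ?ltW //; exact: car_i.
  have := contr_f Xxm; case: iso_i => _ _ iso; have := iso _ _ _ Xxm; lra.
- move=> x Xx; apply: (G_unique (car_i Xx) (Yg _ (car_i Xx)) (car_f Xx) (Gg _ (car_i Xx))).
  by move=> e e0; exists x; split=> //; rewrite subrr nrm0.
Qed.

End Extension.

Section VectorFunctionals.
Variables (R : realType) (K : hilbert R).

(** The real inequality, applied to [u] and the multiple of [v] whose phase makes the inner product
    with [u] real. *)
Lemma cabs_hdot_le (u v : K) : cabs (hdot K u v) <= hnorm u * hnorm v.
Proof.
have h := rdot_le u (hdot K u v *: v); move: h; set z := hdot K u v.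
have -> : rdot u (z *: v) = cabs z ^+ 2.
  by rewrite rdotZr_complex sqr_cabs /z [hdot K u v]hdotE /= !expr2.
rewrite hnormZ expr2 mulrCA.
have [z0|zn0] := eqVneq (cabs z) 0; first by rewrite z0 mulr_ge0 ?hnorm_ge0.
by rewrite ler_pM2l // lt_def zn0 cabs_ge0.
Qed.

Lemma hdot_suml (I : Type) (s : seq I) (P : pred I) (F : I -> K) y :
  hdot K (\sum_(i <- s | P i) F i) y = \sum_(i <- s | P i) hdot K (F i) y.
Proof. by rewrite (big_morph (hdot K ^~ y) (fun u v => hdotDl u v y) (linear0l (hdot K) y)). Qed.

Lemma hdotNl (u v : K) : hdot K (- u) v = - hdot K u v.
Proof. by rewrite -scaleN1r hdotZl mulN1r. Qed.

Lemma hdotBl (u v w : K) : hdot K (u - v) w = hdot K u w - hdot K v w.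
Proof. by rewrite hdotDl hdotNl. Qed.

Lemma hdot_inj (u v : K) : (forall w, hdot K u w = hdot K v w) -> u = v.
Proof. by move=> h; apply: rdot_inj => w; rewrite /rdot h. Qed.

End VectorFunctionals.

Section AlgebraicTensor.
Variables (R : realType) (H1 K1 H2 K2 : hilbert R).
Variables (S : set (H1 -> K1)) (T : set (H2 -> K2)).
Hypotheses (linS : linear_subspace S) (bS : S `<=` @bounded_op R H1 K1)
  (linT : linear_subspace T) (bT : T `<=` @bounded_op R H2 K2).
Local Notation X := (concrete_space S).
Local Notation Y := (concrete_space T).
Local Notation bil := (bilinear_on S T).

(* Tensors are represented by their values on all bilinear forms. *)
Definition tensor_value : lmodType R[i] :=
  ((H1 -> K1) -> (H2 -> K2) -> R[i]^o) -> R[i]^o.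

(** On maps that are not bilinear the value is set to 0, so that equality of matrices of such values
    is exactly [same_tensor]. *)
Definition ptensor (x : H1 -> K1) (y : H2 -> K2) : tensor_value :=
  fun phi => if `[< bil phi >] then phi x y else 0.

Definition tmx p r q (x : 'M[H1 -> K1]_(p, r)) (y : 'M[H2 -> K2]_(r, q)) :
  'M[tensor_value]_(p, q) := mxop ptensor x y.

Lemma tmxE p r q (x : 'M[H1 -> K1]_(p, r)) (y : 'M[H2 -> K2]_(r, q)) i j phi :
  bil phi -> tmx x y i j phi = mxop phi x y i j.
Proof.
move=> hphi; rewrite !mxE fct_sumE; apply: eq_bigr => k _.
by rewrite /ptensor; case: asboolP.
Qed.

Lemma tmx_same p r r' q (x : 'M[H1 -> K1]_(p, r)) (y : 'M[H2 -> K2]_(r, q))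
    (x' : 'M[H1 -> K1]_(p, r')) (y' : 'M[H2 -> K2]_(r', q)) :
  @same_tensor R X Y p r r' q x y x' y' <-> tmx x y = tmx x' y'.
Proof.
split=> [h|h phi hphi].
  apply/matrixP => i j; apply/funext => phi.
  have [hphi|nphi] := pselect (bil phi).
    by rewrite !tmxE // h.
  rewrite !mxE !fct_sumE !big1 // => k _; rewrite /ptensor; case: asboolP => //.
by apply/matrixP => i j; have := congr1 (fun A : 'M[tensor_value]_(p, q) => A i j phi) h;
  rewrite /= !tmxE.
Qed.

Lemma ptensor_bilinear : bilinear_on S T ptensor.
Proof.
split=> [y Ty c x x' Sx Sx'|x Sx c y y' Ty Ty']; apply/funext => phi;
  rewrite /ptensor !fctE; case: asboolP => [[hl hr]|_].
- by rewrite hl.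
- by rewrite scaler0 addr0.
- by rewrite hr.
- by rewrite scaler0 addr0.
Qed.

Definition tensor_space : mspace R :=
  @MSpace R tensor_value
    [set w | exists r (x : 'M[H1 -> K1]_(1, r)) (y : 'M[H2 -> K2]_(r, 1)),
       [/\ mx_in S x, mx_in T y & w = tmx x y 0 0]]
    (fun p q w => inf [set c : R | exists r (x : 'M[H1 -> K1]_(p, r))
       (y : 'M[H2 -> K2]_(r, q)),
       [/\ mx_in S x, mx_in T y, tmx x y = w & c = opnorm x * opnorm y]]).

Local Notation Z := tensor_space.

Lemma tnorm_le p r q (x : 'M[H1 -> K1]_(p, r)) (y : 'M[H2 -> K2]_(r, q)) :
  mx_in S x -> mx_in T y -> mnorm Z (tmx x y) <= opnorm x * opnorm y.
Proof.
move=> Sx Ty; apply: ge_inf; last by exists r, x, y.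
by exists 0 => c [r' [x' [y' [_ _ _ ->]]]]; rewrite mulr_ge0 ?opnorm_ge0.
Qed.

Lemma tnorm_ge0 p q (w : 'M[tensor_value]_(p, q)) : 0 <= mnorm Z w.
Proof.
rewrite /= -[leLHS]inf0; set A := [set c | _].
have [->|A0] := eqVneq A set0; first by rewrite lexx.
rewrite inf0; apply: lb_le_inf; first exact/set0P.
by move=> c [r [x [y [_ _ _ ->]]]]; rewrite mulr_ge0 ?opnorm_ge0.
Qed.

Lemma tmx_in p r q (x : 'M[H1 -> K1]_(p, r)) (y : 'M[H2 -> K2]_(r, q)) :
  mx_in S x -> mx_in T y -> mx_in (mcar Z) (tmx x y).
Proof.
move=> Sx Ty i j; exists r, (row i x), (col j y); split=> [a b|a b|].
- by rewrite mxE.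
- by rewrite mxE.
- by rewrite !mxE; apply: eq_bigr => k _; rewrite !mxE.
Qed.

Lemma tmx_block p r r' q (x : 'M[H1 -> K1]_(p, r)) (y : 'M[H2 -> K2]_(r, q))
    (x' : 'M[H1 -> K1]_(p, r')) (y' : 'M[H2 -> K2]_(r', q)) :
  tmx (row_mx x x') (col_mx y y') = tmx x y + tmx x' y'.
Proof.
apply/matrixP => i j; rewrite !mxE big_split_ord /=; congr (_ + _);
  by apply: eq_bigr => k _; rewrite ?row_mxEl ?row_mxEr ?col_mxEu ?col_mxEd.
Qed.

Lemma tmx_scale p r q c d (x : 'M[H1 -> K1]_(p, r)) (y : 'M[H2 -> K2]_(r, q)) :
  mx_in S x -> mx_in T y ->
  tmx (map_mx ( *:%R c) x) (map_mx ( *:%R d) y) = map_mx ( *:%R (c * d)) (tmx x y).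
Proof.
move=> Sx Ty; apply/matrixP => i j; rewrite !mxE scaler_sumr; apply: eq_bigr => k _.
have [hl hr] := ptensor_bilinear; rewrite !mxE.
rewrite (lin_onZ linS (hl _ (subZ linT d (Ty k j)))) //.
by rewrite (lin_onZ linT (hr _ (Sx i k))) // scalerA.
Qed.

Lemma mx_in_row_mx (V : Type) (P : set V) p r r' (x : 'M[V]_(p, r)) (x' : 'M[V]_(p, r')) :
  mx_in P x -> mx_in P x' -> mx_in P (row_mx x x').
Proof.
move=> Px Px' i j; rewrite -(splitK j); case: (fintype.split j) => k /=.
  by rewrite row_mxEl.
by rewrite row_mxEr.
Qed.

Lemma mx_in_col_mx (V : Type) (P : set V) q r r' (y : 'M[V]_(r, q)) (y' : 'M[V]_(r', q)) :
  mx_in P y -> mx_in P y' -> mx_in P (col_mx y y').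
Proof.
move=> Py Py' i j; rewrite -(splitK i); case: (fintype.split i) => k /=.
  by rewrite col_mxEu.
by rewrite col_mxEd.
Qed.

Definition trep p q (w : 'M[tensor_value]_(p, q)) := exists r
  (x : 'M[H1 -> K1]_(p, r)) (y : 'M[H2 -> K2]_(r, q)),
  [/\ mx_in S x, mx_in T y & w = tmx x y].

Lemma trep0 p q : trep (0 : 'M[tensor_value]_(p, q)).
Proof.
exists 0%N, (\matrix_(i, j) 0), (\matrix_(i, j) 0); split=> [i []|[]|] //.
by apply/matrixP => i j; rewrite !mxE big_ord0.
Qed.

Lemma trepD p q (w w' : 'M[tensor_value]_(p, q)) : trep w -> trep w' -> trep (w + w').
Proof.
move=> [r [x [y [Sx Ty ->]]]] [r' [x' [y' [Sx' Ty' ->]]]].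
exists (r + r')%N, (row_mx x x'), (col_mx y y'); rewrite tmx_block; split=> //.
  exact: mx_in_row_mx.
exact: mx_in_col_mx.
Qed.

(** Sums become a single product by concatenating rows and columns, as in [tmx_block]. So it
    suffices to treat a matrix with one nonzero entry, whose row and column are padded with
    zeros. *)
Lemma trepP p q (w : 'M[tensor_value]_(p, q)) : mx_in (mcar Z) w -> trep w.
Proof.
move=> hw; pose D i0 j0 : 'M[tensor_value]_(p, q) :=
  \matrix_(i, j) (if (i == i0) && (j == j0) then w i0 j0 else 0).
have -> : w = \sum_i \sum_j D i j.
  apply/matrixP => i' j'; rewrite summxE.
  rewrite (eq_bigr (fun i => if i == i' then w i' j' else 0)) => [|i _].
    by rewrite -big_mkcond big_pred1_eq.
  rewrite summxE (eq_bigr (fun j => if j == j' then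
      (if i == i' then w i' j' else 0) else 0)) => [|j _].
    by rewrite -big_mkcond big_pred1_eq.
  rewrite mxE (eq_sym i') (eq_sym j').
  by have [->|_] := eqVneq i i'; have [->|_] := eqVneq j j'.
elim/big_ind: _ => [||i _]; [exact: trep0|exact: trepD|].
elim/big_ind: _ => [||j _]; [exact: trep0|exact: trepD|].
have [r [x [y [Sx Ty E]]]] := hw i j.
exists r, (\matrix_(i', k) (if i' == i then x 0 k else 0)),
  (\matrix_(k, j') (if j' == j then y k 0 else 0)); split=> [a b|a b|].
- by rewrite mxE; case: ifP => // _; exact: sub0.
- by rewrite mxE; case: ifP => // _; exact: sub0.
apply/matrixP => i' j'; rewrite !mxE.
have [hl hr] := ptensor_bilinear.
case: (eqVneq i' i) => [->|i'i] /=; last first.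
  rewrite big1 // => k _; rewrite !mxE (negPf i'i) /=.
  apply: (lin_on0 linS (hl _ _)); case: ifP => // _; exact: sub0.
case: (eqVneq j' j) => [->|j'j] /=; last first.
  rewrite big1 // => k _; rewrite !mxE (negPf j'j) /=.
  apply: (lin_on0 linT (hr _ _)); case: ifP => // _; exact: sub0.
rewrite E !mxE; apply: eq_bigr => k _; rewrite !mxE.
by rewrite !eqxx.
Qed.

End AlgebraicTensor.

(** * Norms of rows, columns and submatrices of operators *)

Section RowColumnNorms.
Variables (R : realType) (H K : hilbert R).
Local Notation bnd := (mx_in (@bounded_op R H K)).

(** Cauchy-Schwarz in the plane. This additivity of squares, here and for columns, is the source of
    the triangle inequality of the Haagerup norm. *)
Lemma opnorm_row_mx p r r' (x : 'M[H -> K]_(p, r)) (x' : 'M[H -> K]_(p, r')) :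
  bnd x -> bnd x' ->
  opnorm (row_mx x x') ^+ 2 <= opnorm x ^+ 2 + opnorm x' ^+ 2.
Proof.
move=> bx bx'; set a := opnorm x; set b := opnorm x'.
have ab0 : 0 <= a ^+ 2 + b ^+ 2 by rewrite addr_ge0 ?sqr_ge0.
have a0 : 0 <= a by exact: opnorm_ge0. have b0 : 0 <= b by exact: opnorm_ge0.
rewrite -[leRHS]sqr_sqrtr // ler_pXn2r ?nnegrE ?opnorm_ge0 ?sqrtr_ge0 //.
apply: opnorm_le => [|v]; first exact: sqrtr_ge0.
rewrite (eq_vn (y := fun i => mxapp x (v \o lshift r') i + mxapp x' (v \o @rshift r r') i)).
  2: { move=> i; rewrite /mxapp big_split_ord /=; congr (_ + _); apply: eq_bigr => k _.
         by rewrite row_mxEl.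
       by rewrite row_mxEr. }
apply: le_trans (vnD _ _) _.
apply: le_trans (lerD (opnormP _ bx) (opnormP _ bx')) _; rewrite -/a -/b.
apply: ler_sqr_norm; first by rewrite mulr_ge0 ?sqrtr_ge0 ?vn_ge0.
rewrite exprMn (sqr_sqrtr ab0) sqr_vn_split.
set u := vn (_ \o _); set w := vn (_ \o _).
have := sqr_ge0 (a * w - b * u); nra.
Qed.

Lemma opnorm_col_mx r r' q (y : 'M[H -> K]_(r, q)) (y' : 'M[H -> K]_(r', q)) :
  bnd y -> bnd y' ->
  opnorm (col_mx y y') ^+ 2 <= opnorm y ^+ 2 + opnorm y' ^+ 2.
Proof.
move=> by1 by2; set a := opnorm y; set b := opnorm y'.
have ab0 : 0 <= a ^+ 2 + b ^+ 2 by rewrite addr_ge0 ?sqr_ge0.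
rewrite -[leRHS]sqr_sqrtr // ler_pXn2r ?nnegrE ?opnorm_ge0 ?sqrtr_ge0 //.
apply: opnorm_le => [|v]; first exact: sqrtr_ge0.
apply: ler_sqr_norm; first by rewrite mulr_ge0 ?sqrtr_ge0 ?vn_ge0.
rewrite exprMn (sqr_sqrtr ab0) sqr_vn_split.
have -> : mxapp (col_mx y y') v \o lshift r' = mxapp y v.
  by apply/funext => i; apply: eq_bigr => k _ /=; rewrite col_mxEu.
have -> : mxapp (col_mx y y') v \o @rshift r r' = mxapp y' v.
  by apply/funext => i; apply: eq_bigr => k _ /=; rewrite col_mxEd.
rewrite mulrDl -!exprMn; apply: lerD;
  by rewrite ler_pXn2r ?nnegrE ?mulr_ge0 ?opnorm_ge0 ?vn_ge0 ?opnormP.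
Qed.

Lemma opnorm_smul p p' q (a : 'M[R[i]]_(p, p')) (x : 'M[H -> K]_(p', q)) : bnd x ->
  opnorm (mxop (fun c v => c *: v) a x) <= scalar_mxnorm a * opnorm x.
Proof.
move=> bx; apply: opnorm_le => [|v]; first by rewrite mulr_ge0 ?opnorm_ge0 ?scalar_mxnorm_ge0.
have E : mxapp (mxop (fun c v => c *: v) a x) v =1 sapp a (mxapp x v).
  move=> i; rewrite /mxapp /sapp; under eq_bigr do rewrite mxE fct_sumE.
  by rewrite exchange_big; apply: eq_bigr => k _; rewrite scaler_sumr.
rewrite (eq_vn E); apply: le_trans (sapp_le _ _) _; rewrite -mulrA.
by rewrite ler_wpM2l ?scalar_mxnorm_ge0 ?opnormP.
Qed.

Lemma opnorm_muls p q' q (y : 'M[H -> K]_(p, q')) (b : 'M[R[i]]_(q', q)) : bnd y ->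
  opnorm (mxop (fun v c => c *: v) y b) <= opnorm y * scalar_mxnorm b.
Proof.
move=> hy; apply: opnorm_le => [|v]; first by rewrite mulr_ge0 ?opnorm_ge0 ?scalar_mxnorm_ge0.
have E : mxapp (mxop (fun v c => c *: v) y b) v =1 mxapp y (sapp b v).
  move=> i; rewrite /mxapp /sapp; under eq_bigr do rewrite mxE fct_sumE.
  rewrite exchange_big; apply: eq_bigr => k _ /=.
  have [ly _] := hy i k; rewrite (lin_sum ly); apply: eq_bigr => j _.
  by rewrite (linZ ly).
rewrite (eq_vn E); apply: le_trans (opnormP _ hy) _; rewrite -mulrA.
by rewrite ler_wpM2l ?opnorm_ge0 ?sapp_le.
Qed.

Lemma opnorm_usubmx p p' q (x : 'M[H -> K]_(p + p', q)) : bnd x ->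
  opnorm (usubmx x) <= opnorm x /\ opnorm (dsubmx x) <= opnorm x.
Proof.
move=> bx; split; (apply: opnorm_le => [|v]; first exact: opnorm_ge0);
  apply: le_trans (opnormP v bx); apply: ler_sqr_norm; rewrite ?vn_ge0 //;
  rewrite [leRHS]sqr_vn_split.
  have -> : mxapp x v \o lshift p' = mxapp (usubmx x) v.
    by apply/funext => i; apply: eq_bigr => k _; rewrite mxE.
  by rewrite lerDl sqr_ge0.
have -> : mxapp x v \o @rshift p p' = mxapp (dsubmx x) v.
  by apply/funext => i; apply: eq_bigr => k _; rewrite mxE.
by rewrite lerDr sqr_ge0.
Qed.

Lemma opnorm_lsubmx p q q' (x : 'M[H -> K]_(p, q + q')) : bnd x ->
  opnorm (lsubmx x) <= opnorm x /\ opnorm (rsubmx x) <= opnorm x.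
Proof.
move=> bx; split; (apply: opnorm_le => [|v]; first exact: opnorm_ge0).
  pose w := fun k : 'I_(q + q') => if fintype.split k is inl k' then v k' else 0.
  have wl : w \o lshift q' =1 v by move=> k; rewrite /w /= (unsplitK (inl k)).
  have wr : w \o @rshift q q' =1 (fun=> 0) by move=> k; rewrite /w /= (unsplitK (inr k)).
  have -> : vn v = vn w.
    apply/eqP; rewrite -(@eqrXn2 _ 2) ?vn_ge0 //.
    by rewrite (sqr_vn_split w) (eq_vn wl) (eq_vn wr) vn0 expr0n addr0.
  rewrite (eq_vn (y := mxapp x w)) ?opnormP // => i.
  rewrite [RHS]big_split_ord /= [X in _ + X]big1 ?addr0 => [|k _].
    apply: eq_bigr => k _; rewrite mxE; congr (x _ _ _); exact: esym (wl k).
  by have := wr k; rewrite /= => ->; rewrite lin0 //; case: (bx i (rshift q k)).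
pose w := fun k : 'I_(q + q') => if fintype.split k is inr k' then v k' else 0.
have wl : w \o lshift q' =1 (fun=> 0) by move=> k; rewrite /w /= (unsplitK (inl k)).
have wr : w \o @rshift q q' =1 v by move=> k; rewrite /w /= (unsplitK (inr k)).
have -> : vn v = vn w.
  apply/eqP; rewrite -(@eqrXn2 _ 2) ?vn_ge0 //.
  by rewrite (sqr_vn_split w) (eq_vn wl) (eq_vn wr) vn0 expr0n add0r.
rewrite (eq_vn (y := mxapp x w)) ?opnormP // => i.
rewrite [RHS]big_split_ord /= big1 ?add0r => [|k _].
  apply: eq_bigr => k _; rewrite mxE; congr (x _ _ _); exact: esym (wr k).
by have := wl k; rewrite /= => ->; rewrite lin0 //; case: (bx i (lshift q' k)).
Qed.

End RowColumnNorms.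

(** * The Haagerup norm on the algebraic tensor product *)

Section TensorNondegenerate.
Variables (R : realType) (H1 K1 H2 K2 : hilbert R).
Variables (S : set (H1 -> K1)) (T : set (H2 -> K2)).
Hypotheses (linS : linear_subspace S) (bS : S `<=` @bounded_op R H1 K1)
  (linT : linear_subspace T) (bT : T `<=` @bounded_op R H2 K2).

(* Induction on the number of terms: a vector functional that does not vanish
   on y_0 lets us express x_0 by the other x_k. *)
Lemma tensor_separated r (x : 'I_r -> H1 -> K1) (y : 'I_r -> H2 -> K2) :
  (forall k, S (x k)) -> (forall k, T (y k)) ->
  (forall s t s' t',
     \sum_k hdot K1 (x k s) t * hdot K2 (y k s') t' = 0) ->
  forall phi : (H1 -> K1) -> (H2 -> K2) -> R[i]^o, bilinear_on S T phi ->
  \sum_k phi (x k) (y k) = 0.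
Proof.
elim: r x y => [|r IH] x y Sx Ty h phi [hl hr]; first by rewrite big_ord0.
rewrite big_ord_recl.
have [[s' [t' g0]]|ng] := pselect (exists s' t', hdot K2 (y ord0 s') t' != 0); last first.
  have y0 : y ord0 = 0.
    apply/funext => s'; apply: hdot_inj => t'; rewrite linear0l.
    by apply/eqP/negPn/negP => g; apply: ng; exists s', t'.
  rewrite y0 (lin_on0 linT (hr _ (Sx ord0))) add0r.
  apply: (IH (fun k => x (lift ord0 k)) (fun k => y (lift ord0 k))) => // s t s' t'.
  by have := h s t s' t'; rewrite big_ord_recl y0 /= linear0l mulr0 add0r.
set g := hdot K2 (y ord0 s') t' in g0.
pose c (k : 'I_r) := hdot K2 (y (lift ord0 k) s') t' / g.
have Ef s t : hdot K1 (x ord0 s) t = - \sum_k c k * hdot K1 (x (lift ord0 k) s) t.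
  apply: (mulIf g0); have := h s t s' t'; rewrite big_ord_recl -/g => /eqP.
  rewrite addr_eq0 => /eqP ->; rewrite mulNr mulr_suml; congr (- _).
  by apply: eq_bigr => k _; rewrite /c mulrAC divfK // mulrC.
have Ex0 : x ord0 = - \sum_k c k *: x (lift ord0 k).
  apply/funext => s; apply: hdot_inj => t; rewrite Ef.
  have -> : (- \sum_k c k *: x (lift ord0 k)) s = - \sum_k c k *: x (lift ord0 k) s.
    by rewrite !fctE fct_sumE.
  by rewrite hdotNl hdot_suml; congr (- _); apply: eq_bigr => k _; rewrite hdotZl.
(* Since [x ord0] is minus the sum of the [c k *: x (lift ord0 k)], the first term of the tensor is
   absorbed into the others by this change of the [y k]. *)
pose y' (k : 'I_r) := y (lift ord0 k) - c k *: y ord0.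
have Ty' k : T (y' k) by apply: (subB linT) => //; exact: (subZ linT).
have -> : phi (x ord0) (y ord0) + \sum_(k < r) phi (x (lift ord0 k)) (y (lift ord0 k)) =
    \sum_(k < r) phi (x (lift ord0 k)) (y' k).
  have -> : phi (x ord0) (y ord0) = - \sum_k c k *: phi (x (lift ord0 k)) (y ord0).
    have lf := hl _ (Ty ord0).
    have Sc k : S (c k *: x (lift ord0 k)) by exact: (subZ linS).
    rewrite Ex0 -scaleN1r (lin_onZ linS lf); last by apply: (sub_sum linS) => k _.
    rewrite (lin_on_sum linS lf) // scaleN1r; congr (- _).
    by apply: eq_bigr => k _; rewrite (lin_onZ linS lf).
  rewrite -sumrN -big_split; apply: eq_bigr => k _ /=.
  have lf := hr _ (Sx (lift ord0 k)).
  rewrite (lin_onB linT lf) ?(lin_onZ linT lf) //; last exact: (subZ linT).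
  by rewrite addrC.
apply: (IH (fun k => x (lift ord0 k)) y') => // s t s1 t1.
have := h s t s1 t1; rewrite big_ord_recl Ef => E.
rewrite -[RHS]E mulNr mulr_suml addrC -sumrB.
apply: eq_bigr => k _; rewrite /y' !fctE hdotBl !hdotZl /= mulrBr; congr (_ - _).
by rewrite mulrCA mulrA.
Qed.

Lemma tensor_functional_bilinear s t s' t' : bilinear_on S T
  (fun (x : H1 -> K1) (y : H2 -> K2) => (hdot K1 (x s) t * hdot K2 (y s') t' : R[i]^o)).
Proof.
split=> [y _ c x x' _ _|x _ c y y' _ _]; rewrite !fctE hdotDl hdotZl.
  by rewrite mulrDl -mulrA.
by rewrite mulrDr mulrCA.
Qed.

(** The sum equals [hdot K1 (mxapp x v i) t] for the vectors [v k := hdot K2 (y k j s') t' *: s],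
    and [vn v] is controlled by the column [j] of [y]. *)
Lemma tensor_functional_le p r q (x : 'M[H1 -> K1]_(p, r)) (y : 'M[H2 -> K2]_(r, q))
    i j s t s' t' : mx_in S x -> mx_in T y ->
  cabs (\sum_k hdot K1 (x i k s) t * hdot K2 (y k j s') t') <=
  opnorm x * opnorm y * (hnorm s * hnorm t * (hnorm s' * hnorm t')).
Proof.
move=> Sx Ty.
have bx : mx_in (@bounded_op R H1 K1) x by move=> a b; exact: bS.
have by1 : mx_in (@bounded_op R H2 K2) y by move=> a b; exact: bT.
pose v k := hdot K2 (y k j s') t' *: s.
have -> : \sum_k hdot K1 (x i k s) t * hdot K2 (y k j s') t' = hdot K1 (mxapp x v i) t.
  rewrite hdot_suml; apply: eq_bigr => k _; have [lx _] := bx i k.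
  by rewrite (linZ lx) hdotZl mulrC.
apply: le_trans (cabs_hdot_le _ _) _.
have h1 : hnorm (mxapp x v i) <= opnorm x * vn v.
  exact: le_trans (hnorm_le_vn (mxapp x v) i) (opnormP v bx).
pose e : 'I_q -> H2 := fun k => if k == j then s' else 0.
have ve : vn e = hnorm s'.
  rewrite /vn /vdot (bigD1 j) //= {1 2}/e eqxx big1 ?addr0 // => k /negPf kj.
  by rewrite /e kj rdot0l.
have ye k : mxapp y e k = y k j s'.
  rewrite /mxapp (bigD1 j) //= /e eqxx big1 ?addr0 // => l /negPf lj.
  by rewrite lj lin0 //; case: (by1 k l).
have h2 : vn v <= opnorm y * hnorm s' * hnorm t' * hnorm s.
  apply: ler_sqr_norm; first by rewrite !mulr_ge0 ?hnorm_ge0 ?opnorm_ge0.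
  rewrite sqr_vn !exprMn -ve.
  have h3 : \sum_k hnorm (v k) ^+ 2 <= vn (mxapp y e) ^+ 2 * hnorm t' ^+ 2 * hnorm s ^+ 2.
    rewrite sqr_vn !mulr_suml; apply: ler_sum => k _; rewrite ye hnormZ exprMn.
    rewrite ler_wpM2r ?sqr_ge0 // -exprMn.
    by rewrite ler_pXn2r ?nnegrE ?mulr_ge0 ?hnorm_ge0 ?cabs_ge0 ?cabs_hdot_le.
  apply: le_trans h3 _; rewrite !ler_wpM2r ?sqr_ge0 // -exprMn.
  by rewrite ler_pXn2r ?nnegrE ?mulr_ge0 ?vn_ge0 ?opnorm_ge0 ?opnormP.
apply: le_trans (ler_wpM2r (hnorm_ge0 t) h1) _.
apply: le_trans (ler_wpM2r (hnorm_ge0 t) (ler_wpM2l (opnorm_ge0 x) h2)) _.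
by rewrite le_eqVlt; apply/orP; left; apply/eqP; ring.
Qed.

Local Notation Z := (tensor_space S T).

(** The left-hand side depends on the tensor only, so the bound for single factorisations passes to
    the infimum. With [tensor_separated] it follows that only the zero tensor has norm 0. *)
Lemma tnorm_functional p r q (x : 'M[H1 -> K1]_(p, r)) (y : 'M[H2 -> K2]_(r, q))
    i j s t s' t' : mx_in S x -> mx_in T y ->
  cabs (\sum_k hdot K1 (x i k s) t * hdot K2 (y k j s') t') <=
  mnorm Z (tmx S T x y) * (hnorm s * hnorm t * (hnorm s' * hnorm t')).
Proof.
move=> Sx Ty; set C := hnorm s * _ * _.
have C0 : 0 <= C by rewrite !mulr_ge0 ?hnorm_ge0.
have [C0'|Cn0] := eqVneq C 0.
  by have := tensor_functional_le i j s t s' t' Sx Ty; rewrite -/C C0' !mulr0.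
have Cgt : 0 < C by rewrite lt_def Cn0.
rewrite -ler_pdivrMr //; apply: lb_le_inf.
  by exists (opnorm x * opnorm y), r, x, y.
move=> _ [r' [x' [y' [Sx' Ty' E ->]]]]; rewrite ler_pdivrMr //.
have := tensor_functional_le i j s t s' t' Sx' Ty'; rewrite -/C; congr (cabs _ <= _).
have hb := tensor_functional_bilinear s t s' t'.
have := congr1 (fun A : 'M[tensor_value H1 K1 H2 K2]_(p, q) => A i j
  (fun x y => hdot K1 (x s) t * hdot K2 (y s') t')) E.
by rewrite /= !tmxE // !mxE.
Qed.

Lemma tnorm_eq0 p q (w : 'M[tensor_value H1 K1 H2 K2]_(p, q)) : mx_in (mcar Z) w ->
  mnorm Z w = 0 -> w = 0.
Proof.
move=> /(trepP linS linT)[r [x [y [Sx Ty ->]]]] w0.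
apply/matrixP => i j; apply/funext => phi.
have [hphi|nphi] := pselect (bilinear_on S T phi); last first.
  rewrite !mxE fct_sumE big1 // => k _; rewrite /ptensor; case: asboolP => //.
rewrite tmxE // !mxE; apply: (tensor_separated (x := x i) (y := y ^~ j)) => // s t s' t'.
apply/eqP; rewrite -cabs_eq0 eq_le cabs_ge0 andbT.
by have := tnorm_functional i j s t s' t' Sx Ty; rewrite w0 mul0r.
Qed.

(** The factors get balanced: rescaling [x] by [u] and [y] by [u^-1] keeps the tensor, and
    [u := Num.sqrt c / opnorm x] makes both squares at most [c]. Such bounds on squares add up under
    concatenation. *)
Lemma tnorm_lt p q (w : 'M[tensor_value H1 K1 H2 K2]_(p, q)) c : mx_in (mcar Z) w ->
  mnorm Z w < c -> exists r (x : 'M[H1 -> K1]_(p, r)) (y : 'M[H2 -> K2]_(r, q)),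
  [/\ mx_in S x, mx_in T y, tmx S T x y = w, opnorm x ^+ 2 <= c & opnorm y ^+ 2 <= c].
Proof.
move=> hw wc; have c0 : 0 < c by apply: le_lt_trans wc; exact: tnorm_ge0.
have [r0 [x0 [y0 [Sx0 Ty0 Ew]]]] := trepP linS linT hw.
have [|_ [r [x [y [Sx Ty E ->]]]] h] := inf_lt _ wc.
  by exists (opnorm x0 * opnorm y0), r0, x0, y0.
have bx : mx_in (@bounded_op R H1 K1) x by move=> a b; exact: bS.
have by1 : mx_in (@bounded_op R H2 K2) y by move=> a b; exact: bT.
have [u [u0 h1 h2]] : exists u : R, [/\ 0 < u, (u * opnorm x) ^+ 2 <= c &
    (u^-1 * opnorm y) ^+ 2 <= c].
  have sc : 0 < Num.sqrt c by rewrite sqrtr_gt0.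
  have csq : c = Num.sqrt c ^+ 2 by rewrite sqr_sqrtr // ltW.
  have x0' := opnorm_ge0 x; have y0' := opnorm_ge0 y.
  have [x00|xn0] := eqVneq (opnorm x) 0.
    (* For [x] of norm 0 any [u] that shrinks [y] far enough will do; the [1] keeps [u] positive. *)
    have u0 : 0 < (opnorm y + 1) / Num.sqrt c by rewrite divr_gt0 // ltr_pwDr.
    exists ((opnorm y + 1) / Num.sqrt c); split=> //.
      by rewrite x00 mulr0 expr0n ltW.
    have v0 : 0 <= ((opnorm y + 1) / Num.sqrt c)^-1 * opnorm y.
      by rewrite mulr_ge0 // invr_ge0 ltW.
    rewrite [leRHS]csq ler_pXn2r ?nnegrE ?sqrtr_ge0 //.
    rewrite invf_div mulrAC ler_pdivrMr ?ltr_pwDr // ler_pM2l //; lra.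
  have xgt : 0 < opnorm x by rewrite lt_def xn0.
  exists (Num.sqrt c / opnorm x); split; first by rewrite divr_gt0.
    by rewrite divfK // -csq.
  have v0 : 0 <= (Num.sqrt c / opnorm x)^-1 * opnorm y.
    by rewrite mulr_ge0 // invr_ge0 divr_ge0 // sqrtr_ge0.
  rewrite [leRHS]csq ler_pXn2r ?nnegrE ?sqrtr_ge0 //.
  by rewrite invf_div mulrAC ler_pdivrMr // -expr2 -csq ltW.
have uE : `|u| = u by rewrite ger0_norm // ltW.
exists r, (map_mx ( *:%R u%:C) x), (map_mx ( *:%R (u^-1)%:C) y); split.
- by move=> a b; rewrite mxE; exact: (subZ linS).
- by move=> a b; rewrite mxE; exact: (subZ linT).
- rewrite tmx_scale // -rmorphM /= mulfV ?gt_eqF // E.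
  by apply/matrixP => a b; rewrite mxE scale1r.
- by rewrite opnormZ // cabs_real uE.
- by rewrite opnormZ // cabs_real normfV uE.
Qed.

Lemma tnorm_approx p q (w : 'M[tensor_value H1 K1 H2 K2]_(p, q)) e :
  mx_in (mcar Z) w -> 0 < e ->
  exists r (x : 'M[H1 -> K1]_(p, r)) (y : 'M[H2 -> K2]_(r, q)),
  [/\ mx_in S x, mx_in T y, tmx S T x y = w,
      opnorm x ^+ 2 <= mnorm Z w + e & opnorm y ^+ 2 <= mnorm Z w + e].
Proof. by move=> hw e0; apply: tnorm_lt; rewrite ?ltrDl. Qed.

Let le_prod (a b c : R) : 0 <= a -> 0 <= b -> a ^+ 2 <= c -> b ^+ 2 <= c -> a * b <= c.
Proof. by move=> a0 b0 ha hb; have := sqr_ge0 (a - b); nra. Qed.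

Let bndS p q (x : 'M[H1 -> K1]_(p, q)) : mx_in S x -> mx_in (@bounded_op R H1 K1) x.
Proof. by move=> h a b; exact: bS. Qed.

Let bndT p q (x : 'M[H2 -> K2]_(p, q)) : mx_in T x -> mx_in (@bounded_op R H2 K2) x.
Proof. by move=> h a b; exact: bT. Qed.

Let tnormZ_le p q c (w : 'M[tensor_value H1 K1 H2 K2]_(p, q)) : mx_in (mcar Z) w ->
  mnorm Z (map_mx ( *:%R c) w) <= cabs c * mnorm Z w.
Proof.
move=> hw; apply: eps_le => e e0.
have c1 : 0 < cabs c + 1 by rewrite ltr_pwDr ?cabs_ge0.
have [r [x [y [Sx Ty E hx hy]]]] := tnorm_approx hw (divr_gt0 e0 c1).
have E2 : map_mx ( *:%R c) w = tmx S T (map_mx ( *:%R c) x) (map_mx ( *:%R 1) y).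
  by rewrite tmx_scale // mulr1 E.
have Sx' : mx_in S (map_mx ( *:%R c) x).
  by move=> a b; rewrite mxE; apply: (subZ linS); exact: Sx.
have Ty' : mx_in T (map_mx ( *:%R 1) y).
  by move=> a b; rewrite mxE; apply: (subZ linT); exact: Ty.
rewrite E2; apply: le_trans (tnorm_le Sx' Ty') _.
rewrite !opnormZ; [|exact: bndT|exact: bndS].
rewrite cabs1 mul1r -mulrA; have h := le_prod (opnorm_ge0 x) (opnorm_ge0 y) hx hy.
apply: le_trans (ler_wpM2l (cabs_ge0 c) h) _.
rewrite mulrDr lerD2l mulrCA ler_piMr ?ltW // ltr_pdivrMr // mul1r; lra.
Qed.

Let Zlin : linear_subspace (mcar Z).
Proof.
have toZ (w : 'M[tensor_value H1 K1 H2 K2]_(1, 1)) : trep S T w -> mcar Z (w 0 0).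
  by move=> [r [x [y [Sx Ty ->]]]]; exists r, x, y.
split.
  by have := toZ _ (trep0 S T 1 1); rewrite mxE.
move=> c v w [r [x [y [Sx Ty ->]]]] [r' [x' [y' [Sx' Ty' ->]]]].
have := toZ (tmx S T (map_mx ( *:%R c) x) (map_mx ( *:%R 1) y) + tmx S T x' y').
rewrite tmx_scale // mulr1 !mxE; apply; apply: trepD; last by exists r', x', y'.
exists r, (map_mx ( *:%R c) x), (map_mx ( *:%R 1) y); split.
- by move=> a b; rewrite mxE; exact: (subZ linS).
- by move=> a b; rewrite mxE; exact: (subZ linT).
- by rewrite tmx_scale // mulr1.
Qed.

Let Zbil := ptensor_bilinear S T.

Let tnorm_triangle p q (v w : 'M[tensor_value H1 K1 H2 K2]_(p, q)) :
  mx_in (mcar Z) v -> mx_in (mcar Z) w -> mnorm Z (v + w) <= mnorm Z v + mnorm Z w.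
Proof.
move=> hv hw; apply: eps_le => e e0; have e2 : 0 < e / 2 by lra.
have [r [x [y [Sx Ty E hx hy]]]] := tnorm_approx hv e2.
have [r' [x' [y' [Sx' Ty' E' hx' hy']]]] := tnorm_approx hw e2.
rewrite -{1}E -{1}E' -tmx_block.
apply: le_trans (tnorm_le (mx_in_row_mx Sx Sx') (mx_in_col_mx Ty Ty')) _.
apply: le_prod; rewrite ?opnorm_ge0 //.
  have := opnorm_row_mx (bndS Sx) (bndS Sx'); move: hx hx'; lra.
have := opnorm_col_mx (bndT Ty) (bndT Ty'); move: hy hy'; lra.
Qed.

Let tnorm_scalar p p' q' q (a : 'M[R[i]]_(p, p'))
    (w : 'M[tensor_value H1 K1 H2 K2]_(p', q')) (b : 'M[R[i]]_(q', q)) :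
  mx_in (mcar Z) w ->
  mnorm Z (mxop (fun v c => c *: v) (mxop (fun c (v : Z) => c *: v) a w) b) <=
  scalar_mxnorm a * mnorm Z w * scalar_mxnorm b.
Proof.
move=> hw; have a0 := scalar_mxnorm_ge0 a; have b0 := scalar_mxnorm_ge0 b.
apply: eps_le => e e0; set m := scalar_mxnorm a * scalar_mxnorm b.
have m1 : 0 < m + 1 by rewrite ltr_pwDr // mulr_ge0.
have [r [x [y [Sx Ty E hx hy]]]] := tnorm_approx hw (divr_gt0 e0 m1).
have [hl hr] := Zbil.
have Sx' : mx_in S (mxop (fun c (v : H1 -> K1) => c *: v) a x).
  by move=> i j; rewrite mxE; apply: (sub_sum linS) => k _; exact: (subZ linS).
have Ty' : mx_in T (mxop (fun (v : H2 -> K2) c => c *: v) y b).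
  by move=> i j; rewrite mxE; apply: (sub_sum linT) => k _; exact: (subZ linT).
have -> : mxop (fun v c => c *: v) (mxop (fun c (v : Z) => c *: v) a w) b =
    tmx S T (mxop (fun c (v : H1 -> K1) => c *: v) a x)
      (mxop (fun (v : H2 -> K2) c => c *: v) y b).
  apply/matrixP => i j; rewrite !mxE -E.
  under eq_bigr => l _ do rewrite mxE scaler_sumr.
  under eq_bigr => l _ do under eq_bigr => k _ do rewrite mxE !scaler_sumr.
  under eq_bigr => l _ do rewrite exchange_big /=.
  rewrite exchange_big /=; apply: eq_bigr => m' _; rewrite !mxE.
  have Tyb : T (\sum_(k < q') b k j *: y m' k).
    by apply: (sub_sum linT) => k _; exact: (subZ linT).
  have Sax k : S (a i k *: x k m') by exact: (subZ linS).
  rewrite (lin_on_sum linS (hl _ Tyb)) // exchange_big; apply: eq_bigr => k _ /=.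
  rewrite (lin_onZ linS (hl _ Tyb)) //.
  rewrite (lin_on_sum linT (hr _ (Sx k m'))) => [|l _]; last exact: (subZ linT).
  rewrite scaler_sumr; apply: eq_bigr => l _.
  by rewrite (lin_onZ linT (hr _ (Sx k m'))) // !scalerA mulrC.
apply: le_trans (tnorm_le Sx' Ty') _.
have h1 := opnorm_smul a (bndS Sx); have h2 := opnorm_muls b (bndT Ty).
apply: le_trans (ler_pM (opnorm_ge0 _) (opnorm_ge0 _) h1 h2) _.
have h := le_prod (opnorm_ge0 x) (opnorm_ge0 y) hx hy.
have -> : scalar_mxnorm a * opnorm x * (opnorm y * scalar_mxnorm b) = m * (opnorm x * opnorm y).
  by rewrite /m; ring.
have m0 : 0 <= m by rewrite mulr_ge0.
apply: le_trans (ler_wpM2l m0 h) _.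
have -> : scalar_mxnorm a * mnorm Z w * scalar_mxnorm b = m * mnorm Z w.
  by rewrite /m; ring.
rewrite mulrDr lerD2l mulrCA ler_piMr ?ltW // ltr_pdivrMr // mul1r; lra.
Qed.

Let mx_in_diag (H K : hilbert R) (P : set (H -> K)) p r p' r'
    (x : 'M[H -> K]_(p, r)) (x' : 'M[H -> K]_(p', r')) : linear_subspace P ->
  mx_in P x -> mx_in P x' -> mx_in P (block_mx x 0 0 x').
Proof. by move=> linP; apply: mx_in_block; exact: (sub0 linP). Qed.

(** Block diagonal matrices of balanced factors give the upper bound. For the lower bound, the upper
    rows of [x] and the left columns of [y], or the lower and the right ones, factor a diagonal
    block without increase of norms. *)
Let tnorm_direct_sum p q p' q' (v : 'M[tensor_value H1 K1 H2 K2]_(p, q))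
    (w : 'M[tensor_value H1 K1 H2 K2]_(p', q')) :
  mx_in (mcar Z) v -> mx_in (mcar Z) w ->
  mnorm Z (block_mx v 0 0 w) = Num.max (mnorm Z v) (mnorm Z w).
Proof.
move=> hv hw; have [hl hr] := Zbil.
have hvw : mx_in (mcar Z) (block_mx v 0 0 w).
  by apply: mx_in_block => //; exact: (sub0 Zlin).
apply/eqP; rewrite eq_le; apply/andP; split.
  apply: eps_le => e e0.
  have [r [x [y [Sx Ty E hx hy]]]] := tnorm_approx hv e0.
  have [r' [x' [y' [Sx' Ty' E' hx' hy']]]] := tnorm_approx hw e0.
  have -> : block_mx v 0 0 w = tmx S T (block_mx x 0 0 x') (block_mx y 0 0 y').
    rewrite -E -E'; apply/matrixP => i j; rewrite [RHS]mxE big_split_ord /=.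
    rewrite -(splitK i) -(splitK j).
    case: (fintype.split i) => i'; case: (fintype.split j) => j' /=.
    - rewrite block_mxEul [LHS]mxE [X in _ + X]big1 => [|k _]; last first.
        rewrite block_mxEur block_mxEdl !mxE; apply: (lin_on0 linS (hl _ (sub0 linT))).
      by rewrite addr0; apply: eq_bigr => k _; rewrite !block_mxEul.
    - rewrite block_mxEur [LHS]mxE !big1 ?addr0 // => k _.
        rewrite block_mxEur block_mxEdr mxE; apply: (lin_on0 linS (hl _ _)) => //.
      rewrite block_mxEul block_mxEur [X in ptensor _ _ _ X]mxE.
      exact: (lin_on0 linT (hr _ (Sx _ _))).
    - rewrite block_mxEdl [LHS]mxE !big1 ?addr0 // => k _.
        rewrite block_mxEdr block_mxEdl [X in ptensor _ _ _ X]mxE.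
        exact: (lin_on0 linT (hr _ (Sx' _ _))).
      rewrite block_mxEdl block_mxEul mxE; apply: (lin_on0 linS (hl _ _)) => //.
    - rewrite block_mxEdr [LHS]mxE [X in _ = X + _]big1 => [|k _]; last first.
        rewrite block_mxEdl block_mxEur !mxE; apply: (lin_on0 linS (hl _ (sub0 linT))).
      by rewrite add0r; apply: eq_bigr => k _; rewrite !block_mxEdr.
  apply: le_trans (tnorm_le (mx_in_diag linS Sx Sx') (mx_in_diag linT Ty Ty')) _.
  rewrite opnorm_direct_sum ?opnorm_direct_sum; try exact: bndS; try exact: bndT.
  set M := Num.max (mnorm Z v) _.
  have hM : mnorm Z v <= M /\ mnorm Z w <= M by rewrite !le_max !lexx orbT.
  apply: le_prod; rewrite ?le_max ?opnorm_ge0 //.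
    by case: (leP (opnorm x) (opnorm x')) => _; move: hM hx hx' => []; lra.
  by case: (leP (opnorm y) (opnorm y')) => _; move: hM hy hy' => []; lra.
rewrite ge_max; apply/andP; split; apply: eps_le => e e0.
  have [r [x [y [Sx Ty E hx hy]]]] := tnorm_approx hvw e0.
  have Sx' : mx_in S (usubmx x) by move=> i j; rewrite mxE.
  have Ty' : mx_in T (lsubmx y) by move=> i j; rewrite mxE.
  have Ev : v = tmx S T (usubmx x) (lsubmx y).
    apply/matrixP => i j; have := congr1 (fun A : 'M[Z]_(p + p', q + q') => A (lshift _ i) (lshift _ j)) E.
    by rewrite /= block_mxEul !mxE => <-; apply: eq_bigr => k _; rewrite !mxE.
  rewrite [in leLHS]Ev; apply: le_trans (tnorm_le Sx' Ty') _.
  have [h1 _] := opnorm_usubmx (bndS Sx); have [h2 _] := opnorm_lsubmx (bndT Ty).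
  apply: le_trans (ler_pM (opnorm_ge0 _) (opnorm_ge0 _) h1 h2) _.
  by apply: le_prod; rewrite ?opnorm_ge0.
have [r [x [y [Sx Ty E hx hy]]]] := tnorm_approx hvw e0.
have Sx' : mx_in S (dsubmx x) by move=> i j; rewrite mxE.
have Ty' : mx_in T (rsubmx y) by move=> i j; rewrite mxE.
have Ew : w = tmx S T (dsubmx x) (rsubmx y).
  apply/matrixP => i j; have := congr1 (fun A : 'M[Z]_(p + p', q + q') => A (rshift _ i) (rshift _ j)) E.
  by rewrite /= block_mxEdr !mxE => <-; apply: eq_bigr => k _; rewrite !mxE.
rewrite [in leLHS]Ew; apply: le_trans (tnorm_le Sx' Ty') _.
have [_ h1] := opnorm_usubmx (bndS Sx); have [_ h2] := opnorm_lsubmx (bndT Ty).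
apply: le_trans (ler_pM (opnorm_ge0 _) (opnorm_ge0 _) h1 h2) _.
by apply: le_prod; rewrite ?opnorm_ge0.
Qed.

Lemma tensor_space_pos : pre_operator_space Z.
Proof.
split.
- exact: Zlin.
- move=> p q w hw; split=> [|->]; first exact: tnorm_eq0.
  (* The empty factorisation, with inner size 0, has factors of norm 0. *)
  have -> : (0 : 'M[Z]_(p, q)) =
      tmx S T (\matrix_(i < p, k < 0) 0) (\matrix_(k < 0, j < q) 0).
    by apply/matrixP => i j; rewrite !mxE big_ord0.
  apply/eqP; rewrite eq_le tnorm_ge0 andbT.
  apply: le_trans (tnorm_le _ _) _; [by move=> i []|by move=> []|].
  rewrite mulr_le0_ge0 ?opnorm_ge0 //; apply: opnorm_le => // v.
  by rewrite (eq_vn (y := fun=> 0)) ?vn0 ?mul0r // => i; rewrite /mxapp big_ord0.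
- by move=> p q v w; exact: tnorm_triangle.
- by move=> p q w _; exact: tnorm_ge0.
- move=> p q c w hw; apply/eqP; rewrite eq_le tnormZ_le //=.
  have [->|c0] := eqVneq c 0; first by rewrite cabs0 mul0r tnorm_ge0.
  have hcw : mx_in (mcar Z) (map_mx ( *:%R c) w).
    by move=> i j; rewrite mxE; exact: (subZ Zlin).
  have := tnormZ_le c^-1 hcw.
  have -> : map_mx ( *:%R c^-1) (map_mx ( *:%R c) w) = w.
    by apply/matrixP => i j; rewrite !mxE scalerA mulVf // scale1r.
  by rewrite cabsV mulrC ler_pdivlMr ?(mulrC (mnorm Z w)) // lt_def cabs_eq0 c0 cabs_ge0.
- by move=> p p' q' q a w b; exact: tnorm_scalar.
- by move=> p q p' q' v w; exact: tnorm_direct_sum.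
Qed.

End TensorNondegenerate.

(** * Balanced tensor products given by multiplication *)

Section ExactLift.
Variables (R : realType) (W Y : mspace R).
Hypotheses (osW : operator_space W) (posY : pre_operator_space Y).
Variable q : W -> Y.
Hypotheses (car_q : forall w, mcar W w -> mcar Y (q w))
  (lin_q : linear_on (mcar W) q)
  (contr_q : forall m n (w : 'M[W]_(m, n)), mx_in (mcar W) w ->
     mnorm Y (map_mx q w) <= mnorm W w)
  (approx_q : forall m n (v : 'M[Y]_(m, n)) d, mx_in (mcar Y) v -> 0 < d ->
     exists w : 'M[W]_(m, n), [/\ mx_in (mcar W) w, mnorm W w <= mnorm Y v &
       mnorm Y (v - map_mx q w) <= d]).
Let posW := os_pos osW.
Let linW := pos_subspace posW.
Let linY := pos_subspace posY.

Lemma map_mx_onB m n (w w' : 'M[W]_(m, n)) : mx_in (mcar W) w -> mx_in (mcar W) w' ->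
  map_mx q (w - w') = map_mx q w - map_mx q w'.
Proof.
by move=> hw hw'; apply/matrixP => i j; rewrite !mxE (lin_onB linW lin_q).
Qed.

Lemma map_mx_onD m n (w w' : 'M[W]_(m, n)) : mx_in (mcar W) w -> mx_in (mcar W) w' ->
  map_mx q (w + w') = map_mx q w + map_mx q w'.
Proof.
by move=> hw hw'; apply/matrixP => i j; rewrite !mxE (lin_onD lin_q).
Qed.

Lemma map_mx_car m n (w : 'M[W]_(m, n)) : mx_in (mcar W) w ->
  mx_in (mcar Y) (map_mx q w).
Proof. by move=> hw i j; rewrite mxE; exact: car_q. Qed.

(* The lift is the limit of a series of approximate lifts of the residues. *)
Lemma exact_lift m n (v : 'M[Y]_(m, n)) e : mx_in (mcar Y) v -> 0 < e ->
  exists w : 'M[W]_(m, n), [/\ mx_in (mcar W) w, map_mx q w = v &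
    mnorm W w <= mnorm Y v + e].
Proof.
move=> hv e0.
have /choice[F hF] : forall vd : 'M[Y]_(m, n) * R, exists w : 'M[W]_(m, n),
    mx_in (mcar Y) vd.1 -> 0 < vd.2 -> [/\ mx_in (mcar W) w,
      mnorm W w <= mnorm Y vd.1 & mnorm Y (vd.1 - map_mx q w) <= vd.2].
  move=> [u d] /=; have [[hu d0]|h] := pselect (mx_in (mcar Y) u /\ 0 < d).
    by have [w hw] := approx_q hu d0; exists w.
  by exists 0 => hu d0; case: h.
(* Halving the tolerance at each stage makes all corrections together cost at most [e]. *)
pose eps k := e / 2 ^+ k.+1.
have eps0 k : 0 < eps k by rewrite divr_gt0 // exprn_gt0.
pose s := fix s k := match k with
  | 0 => F (v, eps 0)
  | k'.+1 => s k' + F (v - map_mx q (s k'), eps k'.+1) end.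
have hs k : mx_in (mcar W) (s k) /\ mnorm Y (v - map_mx q (s k)) <= eps k.
  elim: k => [|k [IH1 IH2]] /=; first by have [] := hF (v, eps 0) hv (eps0 0).
  have hr := mx_inB posY hv (map_mx_car IH1).
  have [h1 h2 h3] := hF (v - map_mx q (s k), eps k.+1) hr (eps0 k.+1).
  split; first exact: (mx_inD posW).
  by rewrite map_mx_onD // opprD addrA.
have hW k : mx_in (mcar W) (s k) by have [] := hs k.
have step k : mnorm W (s k.+1 - s k) <= eps k.
  rewrite /= addrC addKr; have [IH1 IH2] := hs k.
  have hr := mx_inB posY hv (map_mx_car IH1).
  have [_ h2 _] := hF (v - map_mx q (s k), eps k.+1) hr (eps0 k.+1).
  exact: le_trans h2 IH2.
have steps k l : mnorm W (s (k + l)%N - s k) <= e / 2 ^+ k.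
  apply: le_trans (sum_half_pow_le k l (ltW e0)).
  elim: l => [|l IH]; first by rewrite addn0 subrr mnorm0 // big_geq.
  rewrite addnS big_nat_recr ?leq_addr //=.
  have -> : s (k + l).+1 - s k = (s (k + l)%N - s k) + (s (k + l).+1 - s (k + l)%N).
    by rewrite [RHS]addrC addrA subrK.
  apply: le_trans (pos_triangle posW _ _) _; [exact: (mx_inB posW)|exact: (mx_inB posW)|].
  exact: lerD IH (step _).
(* The first lift has norm at most that of [v]; the corrections account for [e]. *)
have bound k : mnorm W (s k) <= mnorm Y v + e.
  have -> : s k = s 0%N + (s (0 + k)%N - s 0%N) by rewrite addrC subrK.
  apply: le_trans (pos_triangle posW _ _) _; [exact: hW|exact: (mx_inB posW)|].
  apply: lerD; first by have [] := hF (v, eps 0) hv (eps0 0).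
  by have := steps 0%N k; rewrite expr0 divr1.
have pow_small : tends0 (fun k => e / 2 ^+ k).
  apply/tends0P => [k|]; first by rewrite divr_ge0 ?ltW // exprn_ge0.
  rewrite -(mulr0 e); apply: cvgMl_tmp; under eq_fun do rewrite -exprVn.
  by apply: cvg_expr; rewrite ger0_norm // invf_lt1 ?ltr1n.
have /choice[l hl] : forall ij : 'I_m * 'I_n, exists l, mcar W l /\
    tends0 (fun k => nrm (s k ij.1 ij.2 - l)).
  move=> [i j] /=.
  have [|d d0|l Wl /tends0P hl] := os_complete osW (u := fun k => s k i j).
  - by move=> k; exact: hW.
  - have [N hN] := pow_small (d / 2) (ltac:(lra)); exists N => a b Na Nb.
    have hd c : (N <= c)%N -> nrm (s c i j - s N i j) < d / 2.
      move=> Nc; apply: le_lt_trans (hN N (leqnn N)).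
      apply: le_trans (steps N (c - N)%N); rewrite subnKC //.
      by have := nrm_entry posW i j (mx_inB posW (hW c) (hW N)); rewrite !mxE.
    apply: le_lt_trans (nrm_trans posW (hW a i j) (hW N i j) (hW b i j)) _.
    rewrite (nrm_distC posW (hW N i j) (hW b i j)).
    by have := hd a Na; have := hd b Nb; lra.
  by exists l; split=> //; apply: hl => k; apply: (nrm_ge0 posW); apply: (subB linW) => //; exact: hW.
pose L : 'M[W]_(m, n) := \matrix_(i, j) l (i, j).
have WL : mx_in (mcar W) L by move=> i j; rewrite mxE; have [] := hl (i, j).
have small : tends0 (fun k => \sum_i \sum_j nrm (s k i j - L i j)).
  apply: tends0_sum => i; apply: tends0_sum => j; rewrite mxE.
  by have [] := hl (i, j).
have sL k : mnorm W (s k - L) <= \sum_i \sum_j nrm (s k i j - L i j).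
  apply: le_trans (mnorm_le_sum posW (mx_inB posW (hW k) WL)) _.
  by apply: ler_sum => i _; apply: ler_sum => j _; rewrite !mxE.
exists L; split=> //.
  apply/eqP; rewrite eq_sym -subr_eq0; apply/eqP.
  have YvL := mx_inB posY hv (map_mx_car WL).
  apply/(pos_norm0 posY) => //; apply/eqP; rewrite eq_le (pos_norm_ge0 posY) // andbT.
  apply: (tends0_ge _ (tends0D pow_small small)) => k.
  have -> : v - map_mx q L = (v - map_mx q (s k)) + map_mx q (s k - L).
    by rewrite map_mx_onB // addrA subrK.
  apply: le_trans (pos_triangle posY _ _) _.
  - by apply: (mx_inB posY) => //; exact: map_mx_car.
  - by apply: map_mx_car; exact: (mx_inB posW).
  apply: lerD; last by apply: le_trans (contr_q _) (sL k); exact: (mx_inB posW).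
  have [_ h] := hs k; apply: le_trans h _; rewrite /eps; apply: ler_wpM2l; first exact: ltW.
  by rewrite lef_pV2 ?posrE ?exprn_gt0 // exprS ler_peMl ?exprn_ge0 // ler1n.
rewrite -subr_le0; apply: (tends0_ge _ small) => k; rewrite lerBlDl.
have -> : L = s k - (s k - L) by rewrite opprB addrC subrK.
apply: le_trans (pos_triangle posW _ _) _.
- exact: hW.
- by apply: (mx_inN posW); exact: (mx_inB posW).
rewrite (mnormN posW); last exact: (mx_inB posW).
by apply: lerD; [exact: bound|apply: le_trans (sL k) _; rewrite opprB addrC subrK].
Qed.

End ExactLift.

(** * Multiplication as a complete contraction on the Haagerup tensor product *)

Section HaagerupMultiplication.
Variables (R : realType) (G E K : hilbert R).
Variables (S : set (E -> K)) (T : set (G -> E)) (O : set (G -> K)).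
Hypotheses (csS : closed_subspace S) (csT : closed_subspace T)
  (csO : closed_subspace O)
  (hST : forall x y, S x -> T y -> O (x \o y)).
Let linS := cs_lin csS.
Let linT := cs_lin csT.
Let linO := cs_lin csO.
Let bS := cs_bounded csS.
Let bT := cs_bounded csT.
Let bO := cs_bounded csO.
Local Notation X := (concrete_space S).
Local Notation Y := (concrete_space T).
Local Notation Z := (tensor_space S T).
Local Notation comp := (fun (x : E -> K) (y : G -> E) => x \o y).

Lemma comp_bilinear : bilinear_on S T comp.
Proof.
split=> [y Ty c x x' Sx Sx'|x Sx c y y' Ty Ty'] //.
by apply/funext => s; have [lx _] := bS Sx; rewrite !fctE lx.
Qed.

Let value_bilinear s t : bilinear_on S T
  (fun (x : E -> K) (y : G -> E) => (hdot K (x (y s)) t : R[i]^o)).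
Proof.
split=> [y _ c x x' _ _|x Sx c y y' _ _]; first by rewrite !fctE hdotDl hdotZl.
by have [lx _] := bS Sx; rewrite !fctE lx hdotDl hdotZl.
Qed.

Let mu (w : tensor_value E K G E) : G -> K :=
  xget 0 [set z | exists r (x : 'M[E -> K]_(1, r)) (y : 'M[G -> E]_(r, 1)),
    [/\ mx_in S x, mx_in T y, w = tmx S T x y 0 0 & z = mxop comp x y 0 0]].

(** The forms [hdot K (x (y s)) t] are bilinear in [x] and [y] and separate operators, so the
    product does not depend on the factorisation that [xget] picks. *)
Let mu_tmx p r q (x : 'M[E -> K]_(p, r)) (y : 'M[G -> E]_(r, q)) :
  mx_in S x -> mx_in T y -> map_mx mu (tmx S T x y) = mxop comp x y.
Proof.
move=> Sx Ty; apply/matrixP => i j; rewrite [LHS]mxE.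
have Sx' : mx_in S (row i x) by move=> a b; rewrite mxE.
have Ty' : mx_in T (col j y) by move=> a b; rewrite mxE.
have E1 : tmx S T x y i j = tmx S T (row i x) (col j y) 0 0.
  by rewrite !mxE; apply: eq_bigr => k _; rewrite !mxE.
have E2 : mxop comp x y i j = mxop comp (row i x) (col j y) 0 0.
  by rewrite !mxE; apply: eq_bigr => k _; rewrite !mxE.
rewrite E1 E2 /mu.
set P := [set z | _].
have [r' [x' [y' [Sx1 Ty1 Ew ->]]]] : P (xget 0 P).
  by apply: (xgetPex (P := P) 0); exists (mxop comp (row i x) (col j y) 0 0), r, (row i x), (col j y).
apply/funext => s; apply: hdot_inj => t.
have := congr1 (fun w : tensor_value E K G E => w (fun x y => hdot K (x (y s)) t)) Ew.
rewrite /= !tmxE; [|exact: value_bilinear..].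
rewrite !mxE !fct_sumE !hdot_suml => ->.
by [].
Qed.

(** The model is the completion of [tensor_space]. Multiplication is contractive for the Haagerup
    norm because [opnorm_comp] holds for every factorisation, and it extends to the completion by
    density. *)
Lemma haagerup_mult : exists (W : mspace R) (t : X -> Y -> W) (q : W -> G -> K),
  [/\ is_haagerup t,
      forall w, mcar W w -> O (q w),
      @linear_on R W (G -> K) (mcar W) q,
      forall m n (w : 'M[W]_(m, n)), mx_in (mcar W) w -> opnorm (map_mx q w) <= mnorm W w
    & forall x y, S x -> T y -> q (t x y) = x \o y].
Proof.
have posZ := tensor_space_pos linS bS linT bT.
have [W [i [osW iso_i dense_i]]] := completion_exists posZ.
have [car_i lin_i norm_i] := iso_i.
have [hl hr] := ptensor_bilinear S T.
have linZ := pos_subspace posZ.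
pose t (x : X) (y : Y) : W := i (ptensor S T x y).
have Zt x y : S x -> T y -> mcar Z (ptensor S T x y).
  move=> Sx Ty; exists 1%N, (const_mx x), (const_mx y); split=> [a b|a b|].
  - by rewrite mxE.
  - by rewrite mxE.
  - by rewrite mxE big_ord1 !mxE.
have Et p r q (x : 'M[E -> K]_(p, r)) (y : 'M[G -> E]_(r, q)) :
    mx_in S x -> mx_in T y -> mxop t x y = map_mx i (tmx S T x y).
  move=> Sx Ty; apply/matrixP => a b; rewrite !mxE.
  by rewrite (lin_on_sum linZ lin_i) // => k _; exact: Zt.
have ht : is_haagerup t.
  split.
  - exact: osW.
  - by move=> x y Sx Ty; apply: car_i; exact: Zt.
  - split=> [y Ty c x x' Sx Sx'|x Sx c y y' Ty Ty']; rewrite /t.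
      by rewrite hl // lin_i //; exact: Zt.
    by rewrite hr // lin_i //; exact: Zt.
  - move=> p r q x y Sx Ty; rewrite Et // norm_i; last exact: tmx_in.
    rewrite /haagerup_norm /=; congr inf; apply/seteqP; split=> c.
      move=> [r' [x' [y' [Sx' Ty' E' ->]]]]; exists r', x', y'; split=> //.
      by apply/tmx_same; rewrite E'.
    move=> [r' [x' [y' [Sx' Ty' /tmx_same E' ->]]]]; exists r', x', y'; split=> //.
  - apply/seteqP; split=> [w []//|w Ww]; split=> // e e0.
    have [z [r [x [y [Sx Ty ->]]]] h] := dense_i w Ww e e0.
    exists (i (tmx S T x y 0 0)) => //.
    have -> : i (tmx S T x y 0 0) = \sum_k t (x 0 k) (y k 0).
      by rewrite mxE (lin_on_sum linZ lin_i) // => k _; exact: Zt.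
    apply: (sub_sum (lspan_subspace _)) => k _; apply: lspan_incl.
    by exists (x 0 k), (y k 0); split; [exact: Sx|exact: Ty|].
have mu1 w : mcar Z w -> exists r (x : 'M[E -> K]_(1, r)) (y : 'M[G -> E]_(r, 1)),
    [/\ mx_in S x, mx_in T y, w = tmx S T x y 0 0 & mu w = mxop comp x y 0 0].
  move=> [r [x [y [Sx Ty Ew]]]]; exists r, x, y; split=> //.
  by rewrite -mu_tmx // mxE Ew.
have car_mu w : mcar Z w -> O (mu w).
  move=> /mu1[r [x [y [Sx Ty _ ->]]]]; rewrite mxE.
  by apply: (sub_sum linO) => k _; exact: hST.
have lin_mu : linear_on (mcar Z) mu.
  have [bl br] := comp_bilinear.
  move=> c _ _ [r [x [y [Sx Ty ->]]]] [r' [x' [y' [Sx' Ty' ->]]]].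
  have Sc : mx_in S (map_mx ( *:%R c) x) by move=> a b; rewrite mxE; apply: (subZ linS); exact: Sx.
  have T1 : mx_in T (map_mx ( *:%R 1) y) by move=> a b; rewrite mxE; apply: (subZ linT); exact: Ty.
  have h := mu_tmx (mx_in_row_mx Sc Sx') (mx_in_col_mx T1 Ty').
  rewrite tmx_block tmx_scale // mulr1 in h.
  have := congr1 (fun A : 'M[G -> K]_(1, 1) => A 0 0) h; rewrite /= !mxE => ->.
  have h1 := congr1 (fun A : 'M[G -> K]_(1, 1) => A 0 0) (mu_tmx Sx Ty).
  have h2 := congr1 (fun A : 'M[G -> K]_(1, 1) => A 0 0) (mu_tmx Sx' Ty').
  move: h1 h2; rewrite /= !mxE => -> ->.
  rewrite big_split_ord /=; congr (_ + _).
    rewrite scaler_sumr; apply: eq_bigr => k _.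
    by rewrite row_mxEl col_mxEu !mxE scale1r.
  by apply: eq_bigr => k _; rewrite row_mxEr col_mxEd.
have contr_mu p q (w : 'M[Z]_(p, q)) : mx_in (mcar Z) w ->
    mnorm (concrete_space O) (map_mx mu w) <= mnorm Z w.
  move=> hw; apply: lb_le_inf.
    have [r [x [y [Sx Ty ->]]]] := trepP linS linT hw.
    by exists (opnorm x * opnorm y), r, x, y.
  move=> _ [r [x [y [Sx Ty <- ->]]]]; rewrite mu_tmx //=; apply: opnorm_comp => a b.
    exact: bS.
  exact: bT.
have [q [car_q lin_q contr_q qi]] :=
  extend_contraction posZ osW (concrete_os csO) iso_i dense_i car_mu lin_mu contr_mu.
exists W, t, q; split=> // x y Sx Ty; rewrite /t qi; last exact: Zt.
have := @mu_tmx 1 1 1 (const_mx x) (const_mx y) (fun a b => ltac:(by rewrite mxE)) (fun a b => ltac:(by rewrite mxE)).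
move=> /matrixP /(_ 0 0); rewrite !mxE !big_ord1 !mxE.
by [].
Qed.

End HaagerupMultiplication.

Section PairIndex.
Variables m k : nat.

(** The bijection underlying [mxvec]; it lets the inner index of a factorisation be a pair. *)
Definition pair_dec (l : 'I_(m * k)) : 'I_m * 'I_k :=
  enum_val (cast_ord (esym (mxvec_cast m k)) l).

Lemma sum_pair_dec (V : nmodType) (F : 'I_m * 'I_k -> V) :
  \sum_l F (pair_dec l) = \sum_i \sum_j F (i, j).
Proof.
rewrite pair_big /= (reindex pair_dec).
  by apply: eq_bigr => l _; case: (pair_dec l).
exists (fun ij => cast_ord (mxvec_cast m k) (enum_rank ij)) => [l _|ij _].
  by rewrite /pair_dec enum_valK cast_ordKV.
by rewrite /pair_dec cast_ordK enum_rankK.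
Qed.

End PairIndex.

(** * The multiplication map as the quotient by the balancing relations *)

Section Balanced.
Variables (R : realType) (G E K : hilbert R).
Variables (S : set (E -> K)) (T : set (G -> E)) (O : set (G -> K)) (C : set (E -> E)).
Hypotheses (csS : closed_subspace S) (csT : closed_subspace T)
  (csO : closed_subspace O) (bC : C `<=` @bounded_op R E E)
  (hST : forall x y, S x -> T y -> O (x \o y))
  (hSC : forall x c, S x -> C c -> S (x \o c))
  (hCT : forall c y, C c -> T y -> T (c \o y)).
Let linS := cs_lin csS.
Let linT := cs_lin csT.
Let linO := cs_lin csO.
Let bS := cs_bounded csS.
Let bT := cs_bounded csT.
Let bO := cs_bounded csO.

(* An approximate identity sum_i u_i v_i made of a row u over S and a column v:
   modulo balancing, z (x) o is close to sum_i u_i v_i z (x) o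
   = sum_i u_i (x) v_i z o, which depends on the product z o only. *)
Definition left_approximable := forall (I J : finType) (z : I -> E -> K)
    (o : J -> G -> K) (e : R), (forall i, S (z i)) -> (forall j, O (o j)) -> 0 < e ->
  exists (n : nat) (u : 'I_n -> E -> K) (v : 'I_n -> K -> E),
  [/\ (forall i, S (u i)) /\ (forall i, bounded_op (v i)),
      (forall xi : 'I_n -> E, hnorm (\sum_i u i (xi i)) <= vn xi) /\
      (forall eta, vn (v ^~ eta) <= hnorm eta),
      (forall i x, S x -> C (v i \o x)) /\ (forall i y, O y -> T (v i \o y)),
      (forall i, onrm (z i - \sum_l (u l \o v l \o z i)) < e)
    & (forall j, onrm (o j - \sum_l (u l \o v l \o o j)) < e)].

Hypothesis approx : left_approximable.

Local Notation X := (concrete_space S).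
Local Notation Y := (concrete_space T).
Local Notation BO1 := (concrete_space O).

Section Quotient.
Variables (W : mspace R) (t : X -> Y -> W) (q : W -> G -> K).
Hypotheses (ht : is_haagerup t)
  (car_q : forall w, mcar W w -> O (q w))
  (lin_q : @linear_on R W (G -> K) (mcar W) q)
  (contr_q : forall m n (w : 'M[W]_(m, n)), mx_in (mcar W) w ->
     opnorm (map_mx q w) <= mnorm W w)
  (qt : forall x y, S x -> T y -> q (t x y) = x \o y).
Let osW := ht_space ht.
Let posW := os_pos osW.
Let linW := pos_subspace posW.
Let tl y (Ty : T y) := (ht_bilinear ht).1 y Ty.
Let tr x (Sx : S x) := (ht_bilinear ht).2 x Sx.

Let tnorm p r p' (x : 'M[E -> K]_(p, r)) (y : 'M[G -> E]_(r, p')) :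
  mx_in S x -> mx_in T y -> mnorm W (mxop t x y) <= opnorm x * opnorm y.
Proof.
move=> Sx Ty; rewrite (ht_norm ht) //; apply: ge_inf; last by exists r, x, y.
by exists 0 => c [r' [x' [y' [_ _ _ ->]]]]; rewrite mulr_ge0 ?opnorm_ge0.
Qed.

Let tcar p r p' (x : 'M[E -> K]_(p, r)) (y : 'M[G -> E]_(r, p')) :
  mx_in S x -> mx_in T y -> mx_in (mcar W) (mxop t x y).
Proof.
move=> Sx Ty i j; rewrite mxE; apply: (sub_sum linW) => k _.
by apply: (ht_closed ht); [exact: Sx|exact: Ty].
Qed.

Let q_mxop p r p' (x : 'M[E -> K]_(p, r)) (y : 'M[G -> E]_(r, p')) :
  mx_in S x -> mx_in T y ->
  map_mx q (mxop t x y) = mxop (fun (x : E -> K) (y : G -> E) => x \o y) x y.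
Proof.
move=> Sx Ty; apply/matrixP => i j; rewrite !mxE.
rewrite (lin_on_sum linW lin_q) => [|k _].
  by apply: eq_bigr => k _; rewrite (qt (Sx i k) (Ty k j)).
by apply: (ht_closed ht); [exact: Sx|exact: Ty].
Qed.

(** Copies of the row [u] along the diagonal form a contraction [x], the operators [v l \o o i j]
    form a matrix [y] of norm at most that of [o], and the product of the two is close to [o]. So
    the tensor of [x] and [y] lifts [o] approximately, without increase of norm. *)
Let approx_lift m n (o : 'M[G -> K]_(m, n)) d : mx_in O o -> 0 < d ->
  exists w : 'M[W]_(m, n), [/\ mx_in (mcar W) w, mnorm W w <= opnorm o &
    opnorm (o - map_mx q w) <= d].
Proof.
move=> Oo d0; pose e := d / (m * n).+1%:R; have e0 : 0 < e by rewrite divr_gt0.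
(* Only elements of [O] have to be approximated here, hence the empty family on the side of [S]. *)
have [k [u [v [[Su bv] [hu hv] [_ vT] _ ho]]]] :=
  approx (z := fun i : 'I_0 => 0 : E -> K) (o := fun ij : 'I_m * 'I_n => o ij.1 ij.2)
    (fun i => sub0 linS) (fun ij => Oo ij.1 ij.2) e0.
have bo : mx_in (@bounded_op R G K) o by move=> a b; apply: bO; exact: Oo.
pose x : 'M[E -> K]_(m, m * k) :=
  \matrix_(i, l) (if (pair_dec l).1 == i then u (pair_dec l).2 else 0).
pose y : 'M[G -> E]_(m * k, n) :=
  \matrix_(l, j) (v (pair_dec l).2 \o o (pair_dec l).1 j).
have Sx : mx_in S x by move=> i l; rewrite mxE; case: ifP => // _; exact: (sub0 linS).
have Ty : mx_in T y by move=> l j; rewrite mxE; apply: vT; exact: Oo.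
have Exy : mxop (fun (x : E -> K) (y : G -> E) => x \o y) x y =
    \matrix_(i, j) \sum_l (u l \o v l \o o i j).
  apply/matrixP => i j; rewrite !mxE.
  under eq_bigr => l _ do rewrite !mxE.
  rewrite (sum_pair_dec (fun ab => (if ab.1 == i then u ab.2 else 0) \o (v ab.2 \o o ab.1 j))).
  rewrite (bigD1 i) //= [X in _ + X]big1 ?addr0 => [|i' /negPf i'i].
    by apply: eq_bigr => b _; rewrite eqxx.
  by rewrite big1 // => b _; rewrite i'i.
exists (mxop t x y); split; first exact: tcar.
  apply: le_trans (tnorm Sx Ty) _.
  have x1 : opnorm x <= 1.
    apply: opnorm_le => // xi; rewrite mul1r; apply: ler_sqr_norm; first exact: vn_ge0.
    rewrite !sqr_vn.
    rewrite (eq_bigr (fun l => hnorm ((fun ab => xi (cast_ord (mxvec_cast m k) (enum_rank ab))) (pair_dec l)) ^+ 2)); last first.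
      by move=> l _; rewrite /pair_dec enum_valK cast_ordKV.
    rewrite (sum_pair_dec (fun ab => hnorm (xi (cast_ord (mxvec_cast m k) (enum_rank ab))) ^+ 2)).
    apply: ler_sum => i _.
    pose xi' b := xi (cast_ord (mxvec_cast m k) (enum_rank (i, b))).
    have -> : mxapp x xi i = \sum_b u b (xi' b).
      rewrite /mxapp (eq_bigr (fun l => (fun ab => (if ab.1 == i then u ab.2 else 0)
        (xi (cast_ord (mxvec_cast m k) (enum_rank ab)))) (pair_dec l))); last first.
        by move=> l _; rewrite mxE /pair_dec enum_valK cast_ordKV.
      rewrite (sum_pair_dec (fun ab => (if ab.1 == i then u ab.2 else 0)
        (xi (cast_ord (mxvec_cast m k) (enum_rank ab))))).
      rewrite (bigD1 i) //= [X in _ + X]big1 ?addr0 => [|i' /negPf i'i].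
        by apply: eq_bigr => b _; rewrite eqxx.
      by rewrite big1 // => b _; rewrite i'i.
    rewrite -(sqr_vn xi') ler_pXn2r ?nnegrE ?hnorm_ge0 ?vn_ge0 //; exact: hu.
  have y1 : opnorm y <= opnorm o.
    apply: opnorm_le => [|z]; first exact: opnorm_ge0.
    apply: le_trans (opnormP z bo); apply: ler_sqr_norm; first exact: vn_ge0.
    rewrite !sqr_vn (eq_bigr (fun l => (fun ab => hnorm (v ab.2 (mxapp o z ab.1)) ^+ 2) (pair_dec l))).
      rewrite (sum_pair_dec (fun ab => hnorm (v ab.2 (mxapp o z ab.1)) ^+ 2)).
      apply: ler_sum => i _; rewrite -(sqr_vn (fun b => v b (mxapp o z i))).
      by rewrite ler_pXn2r ?nnegrE ?hnorm_ge0 ?vn_ge0.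
    move=> l _ /=; congr (hnorm _ ^+ 2); have [lv _] := bv (pair_dec l).2.
    by rewrite /mxapp (lin_sum lv); apply: eq_bigr => j _; rewrite mxE.
  by rewrite -[leRHS]mul1r ler_pM ?opnorm_ge0.
rewrite q_mxop // Exy; apply: le_trans (opnorm_le_sum _) _.
  move=> i j; rewrite !mxE; apply: (subB (bounded_lin G K)); first exact: bo.
  apply: (sub_sum (bounded_lin G K)) => l _.
  by apply: bounded_comp => //; apply: bounded_comp => //; exact: bS.
apply: (@le_trans _ _ (\sum_(i < m) \sum_(j < n) e)).
  by apply: ler_sum => i _; apply: ler_sum => j _; rewrite !mxE; exact/ltW/(ho (i, j)).
rewrite !sumr_const !card_ord -mulrnA -[X in X <= _]mulr_natr /e mulrAC.
by rewrite ler_pdivrMr // ler_wpM2l ?ltW // ltr_nat mulnC.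
Qed.

Let N0 : set W := [set w | exists z c x, [/\ S z, C c, T x
                         & w = t (z \o c) x - t z (c \o x)]].

Let N0_car : N0 `<=` mcar W.
Proof.
move=> _ [z [c [x [Sz Cc Tx ->]]]]; apply: (subB linW); apply: (ht_closed ht) => //.
  exact: hSC.
exact: hCT.
Qed.

Let nrm_q w : mcar W w -> onrm (q w) <= nrm w.
Proof.
move=> Ww; have := @contr_q 1 1 (const_mx w) (mx_in_const1 Ww).
by congr (opnorm _ <= _); apply/matrixP => i j; rewrite !mxE.
Qed.

Let nrm_t x y : S x -> T y -> nrm (t x y) <= onrm x * onrm y.
Proof.
move=> Sx Ty; have := @tnorm 1 1 1 (const_mx x) (const_mx y).
have -> : mxop t (const_mx x : 'M[E -> K]_(1, 1)) (const_mx y : 'M[G -> E]_(1, 1)) =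
    const_mx (t x y).
  by apply/matrixP => i j; rewrite !mxE big_ord1 !mxE.
by apply=> i j; rewrite mxE.
Qed.

(** For the inclusion of the kernel, [w] is replaced by a finite sum [w1] of elementary tensors and
    [w1] by [w2], where the approximate identity is inserted. Moving each [v l \o z i] across the
    tensor sign turns [w2] into [w3], so that [w2 - w3] is a sum of balancing relations, and [w3]
    depends on the small product [p] only. *)
Let q_kernel w : mcar W w -> (q w = 0 <-> clspan N0 w).
Proof.
move=> Ww; split=> [qw0|]; last first.
  suff h : clspan N0 `<=` [set w | mcar W w /\ q w = 0] by move=> /h[].
  apply: (@clspan_min _ W).
  - split; first by split; [exact: (sub0 linW)|exact: (lin_on0 linW lin_q)].
    move=> c x y [Wx qx] [Wy qy]; split; first by case: linW => _; apply.
    by rewrite lin_q // qx qy scaler0 addr0.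
  - move=> x [Wx hx]; split=> //.
    apply: (onrm_eq0 (bO (car_q Wx))); apply/eqP; rewrite eq_le onrm_ge0 andbT.
    apply: eps_le => e e0; rewrite add0r; have [s [Ws qs] h] := hx e e0.
    have -> : q x = q (x - s) by rewrite (lin_onB linW lin_q) // qs subr0.
    by apply: le_trans (ltW h); apply: nrm_q; exact: (subB linW).
  - move=> w' hw'; split; first exact: N0_car.
    have [z [c [x [Sz Cc Tx ->]]]] := hw'.
    have Szc : S (z \o c) by exact: hSC. have Tcx : T (c \o x) by exact: hCT.
    rewrite (lin_onB linW lin_q); [|exact: (ht_closed ht)..].
    by rewrite !qt // subrr.
split=> // e e0; have e3 : 0 < e / 3 by lra.
have := Ww; rewrite -(ht_dense ht) => -[_ /(_ _ e3)[_ [n [c [s [hs ->]]]] hw]].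
have /choice[zx hzx] : forall i, exists zx : (E -> K) * (G -> E),
    [/\ S zx.1, T zx.2 & s i = t zx.1 zx.2].
  by move=> i; have [x [y [? ? ?]]] := hs i; exists (x, y).
pose z i := c i *: (zx i).1; pose x i := (zx i).2.
have Sz i : S (z i) by apply: (subZ linS); have [] := hzx i.
have Tx i : T (x i) by have [] := hzx i.
have Es : \sum_(i < n) c i *: s i = \sum_i t (z i) (x i).
  apply: eq_bigr => i _; have [Sx1 Tx2 ->] := hzx i.
  by rewrite /z (lin_onZ linS (tl (Tx i))).
rewrite Es in hw; set w1 := \sum_i t (z i) (x i) in hw.
have Ww1 : mcar W w1 by apply: (sub_sum linW) => i _; exact: (ht_closed ht).
(* The errors of the [z i] get multiplied by the [onrm (x i)]; the [1] keeps [D] positive. *)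
pose D := 1 + \sum_i onrm (x i).
have s0 : 0 <= \sum_i onrm (x i) by apply: sumr_ge0 => i _; exact: onrm_ge0.
have D0 : 0 < D by rewrite ltr_pwDl.
have [k [u [v [[Su bv] [hu hv] [vC vT] hz _]]]] :=
  approx (o := fun i : 'I_0 => 0 : G -> K) Sz (fun i => sub0 linO) (divr_gt0 e3 D0).
have Cvz l i : C (v l \o z i) by apply: vC.
have Suvz l i : S (u l \o v l \o z i) by apply: (hSC (Su l) (Cvz l i)).
pose p : G -> K := \sum_i (z i \o x i).
have Op : O p by apply: (sub_sum linO) => i _; exact: hST.
have Tvp l : T (v l \o p) by exact: vT.
have Tvzx l i : T (v l \o z i \o x i) by apply: (hCT (Cvz l i) (Tx i)).
pose w2 := \sum_i t (\sum_l (u l \o v l \o z i)) (x i).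
pose w3 := \sum_l t (u l) (v l \o p).
have Ww2 : mcar W w2.
  apply: (sub_sum linW) => i _; apply: (ht_closed ht) => //.
  by apply: (sub_sum linS) => l _.
have Ww3 : mcar W w3 by apply: (sub_sum linW) => i _; exact: (ht_closed ht).
exists (w2 - w3).
  have E2 : w2 = \sum_l \sum_i t (u l \o (v l \o z i)) (x i).
    rewrite exchange_big; apply: eq_bigr => i _.
    by rewrite (lin_on_sum linS (tl (Tx i))).
  have E3 : w3 = \sum_l \sum_i t (u l) ((v l \o z i) \o x i).
    apply: eq_bigr => l _.
    have -> : v l \o p = \sum_i (v l \o z i \o x i).
      apply/funext => g; rewrite /p /= !fct_sumE; have [lv _] := bv l.
      by rewrite (lin_sum lv).
    by rewrite (lin_on_sum linT (tr (Su l))).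
  rewrite E2 E3 -sumrB; apply: (sub_sum (lspan_subspace _)) => l _.
  rewrite -sumrB; apply: (sub_sum (lspan_subspace _)) => i _.
  by apply: lspan_incl; exists (u l), (v l \o z i), (x i).
have h12 : nrm (w1 - w2) < e / 3.
  have -> : w1 - w2 = \sum_i t (z i - \sum_l (u l \o v l \o z i)) (x i).
    rewrite -sumrB; apply: eq_bigr => i _; rewrite (lin_onB linS (tl (Tx i))) //.
    by apply: (sub_sum linS) => l _.
  have Sd i : S (z i - \sum_l (u l \o v l \o z i)).
    by apply: (subB linS) => //; apply: (sub_sum linS) => l _.
  apply: (@le_lt_trans _ _ (\sum_i e / 3 / D * onrm (x i))).
    have hsum (r : seq 'I_n) : nrm (\sum_(i <- r) t (z i - \sum_l (u l \o v l \o z i)) (x i)) <=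
       \sum_(i <- r) e / 3 / D * onrm (x i).
      elim: r => [|i r IH]; first by rewrite !big_nil nrm0.
      rewrite !big_cons; apply: le_trans (nrmD posW _ _) _.
      - exact: (ht_closed ht).
      - by apply: (sub_sum linW) => j _; exact: (ht_closed ht).
      apply: lerD => //; apply: le_trans (nrm_t (Sd i) (Tx i)) _.
      by rewrite ler_wpM2r ?onrm_ge0 // ltW.
    exact: hsum.
  rewrite -mulr_sumr mulrAC ltr_pdivrMr // ltr_pM2l // /D; lra.
(* The row [u] and the column [v] are contractions, so [w3] is bounded by [onrm p], and
   [p = q (w1 - w)] because [q w = 0]. *)
have h3 : nrm w3 <= e / 3.
  have -> : nrm w3 = mnorm W (mxop t (\row_l u l) (\col_l (v l \o p))).
    rewrite /nrm; congr mnorm; apply/matrixP => i j; rewrite !mxE.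
    by apply: eq_bigr => l _; rewrite !mxE.
  apply: le_trans (tnorm _ _) _; [by move=> i j; rewrite mxE..|].
  have r1 : opnorm (\row_l u l) <= 1.
    apply: opnorm_le => // xi; rewrite mul1r vn_const1 /mxapp.
    by under eq_bigr do rewrite mxE; exact: hu.
  have c1 : opnorm (\col_l (v l \o p)) <= onrm p.
    apply: opnorm_le => [|xi]; first exact: onrm_ge0.
    rewrite vn_const1; apply: le_trans (onrmP _ (bO Op)); apply: le_trans (hv _).
    by rewrite le_eqVlt; apply/orP; left; apply/eqP/eq_vn => l; rewrite /mxapp big_ord1 mxE.
  apply: (@le_trans _ _ (onrm p)).
    by rewrite -[leRHS]mul1r ler_pM ?opnorm_ge0.
  have -> : p = q (w1 - w).
    rewrite (lin_onB linW lin_q) // qw0 subr0 (lin_on_sum linW lin_q); last first.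
      by move=> i _; exact: (ht_closed ht).
    by apply: eq_bigr => i _; rewrite qt.
  apply: le_trans (nrm_q (subB linW Ww1 Ww)) _; rewrite (nrm_distC posW) //; exact: ltW.
have -> : w - (w2 - w3) = (w - w1) + ((w1 - w2) + w3).
  by rewrite opprB addrA [RHS]addrA addrA subrK addrAC.
have W12 := subB linW Ww1 Ww2.
apply: le_lt_trans (nrmD posW (subB linW Ww Ww1) (subD linW W12 Ww3)) _.
have := nrmD posW W12 Ww3; lra.
Qed.

(** Exact lifts of norm at most [opnorm v + e] yield both surjectivity and the formula for the
    quotient norm. *)
Lemma quotient_is_multiplication : @is_quotient R W (clspan N0) BO1 q.
Proof.
have exact_q m n (v : 'M[G -> K]_(m, n)) e : mx_in O v -> 0 < e ->
    exists w : 'M[W]_(m, n), [/\ mx_in (mcar W) w, map_mx q w = v &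
    mnorm W w <= opnorm v + e].
  by apply: (exact_lift osW (os_pos (concrete_os csO)) car_q lin_q contr_q approx_lift).
split.
- exact: concrete_os.
- exact: lin_q.
- apply/seteqP; split=> [_ [w Ww <-]|v Ov]; first exact: car_q.
  have [w [Ww Ew _]] := @exact_q 1 1 (const_mx v) 1 (mx_in_const1 (X := BO1) Ov) ltr01.
  exists (w 0 0); first exact: Ww.
  by have /matrixP/(_ 0 0) := Ew; rewrite !mxE.
- exact: q_kernel.
- move=> m n v Ov /=; apply/eqP; rewrite eq_le; apply/andP; split.
    have [w0 [Ww0 Ew0 _]] := exact_q m n v 1 Ov ltr01.
    apply: lb_le_inf; first by exists (mnorm W w0), w0.
    by move=> _ [w [Ww <- ->]]; exact: contr_q.
  apply: eps_le => e e0; have [w [Ww Ew h]] := exact_q m n v e Ov e0.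
  apply: le_trans h; apply: ge_inf; last by exists w.
  by exists 0 => _ [w' [Ww' _ ->]]; exact: (pos_norm_ge0 posW).
Qed.

End Quotient.

(** The quotient is realised by [O] itself, so the isomorphism is the identity. *)
Lemma iso_balanced_multiplication :
  @iso_balanced_haagerup R BO1 (concrete_algebra C) X Y
    (fun (z : E -> K) (c : E -> E) => z \o c)
    (fun (c : E -> E) (x : G -> E) => c \o x).
Proof.
exists BO1.
  have [W [t [q [ht car_q lin_q contr_q qt]]]] := haagerup_mult csS csT csO hST.
  exists W, t, q; split=> //; exact: quotient_is_multiplication.
exists id; split.
  by split=> // p q x Ox; rewrite map_mx_id.
by rewrite image_id.
Qed.

End Balanced.

(** * Approximate identities coming from a sigma-TRO *)

Section SmallAlong.
Variables (R : realType) (D : Type).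
Context (F : set_system D) {filterF : Filter F}.

(** The analogue of [tends0] along a filter, for the nested limits over [k], [e] and [l] below. *)
Definition small_along (f : D -> R) := forall e, 0 < e -> F [set t | f t < e].

Lemma small_le (f g : D -> R) : F [set t | f t <= g t] -> small_along g -> small_along f.
Proof.
move=> fg hg e e0; apply: filterS2 fg (hg e e0) => t /=; exact: le_lt_trans.
Qed.

Lemma smallD (f g : D -> R) : small_along f -> small_along g ->
  small_along (fun t => f t + g t).
Proof.
move=> hf hg e e0; have e2 : 0 < e / 2 by lra.
by apply: filterS2 (hf _ e2) (hg _ e2) => t /=; lra.
Qed.

Lemma smallM (c : R) (f : D -> R) : 0 <= c -> (forall t, 0 <= f t) -> small_along f ->
  small_along (fun t => c * f t).
Proof.
move=> c0 f0 hf e e0; have c1 : 0 < c + 1 by lra.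
apply: filterS (hf _ (divr_gt0 e0 c1)) => t /=; rewrite ltr_pdivlMr // => h.
by have := f0 t; lra.
Qed.

Lemma small0 : small_along (fun=> 0).
Proof. by move=> e e0; apply: filterS filterT. Qed.

Lemma small_sum (I : Type) (s : seq I) (f : I -> D -> R) :
  (forall i, small_along (f i)) -> small_along (fun t => \sum_(i <- s) f i t).
Proof.
move=> h; elim: s => [|i s IH].
  by apply: small_le (small0); apply: filterS filterT => t _ /=; rewrite big_nil.
apply: small_le (smallD (h i) IH).
by apply: filterS filterT => t _ /=; rewrite big_cons.
Qed.

End SmallAlong.

Lemma cvg_small (R : realType) (f : nat -> R) : (forall n, 0 <= f n) ->
  f n @[n --> \oo] --> (0 : R) -> small_along \oo f.
Proof.
by move=> f0 /(tends0P f0) h e /h [N hN]; exists N => // n /= /hN.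
Qed.

Lemma eventually_all (P : nat -> Prop) : (forall k, P k) -> \oo [set k | P k].
Proof. by move=> h; exists 0%N => // k _; exact: h. Qed.

Section ContractionFilter.
Variables (R : realType) (L : hilbert R).
Context (ev : set_system (L -> L)) {filter_ev : Filter ev}.
Hypothesis ev_contr : ev [set T | bounded_op T /\ onrm T <= 1].

Definition approximated (G : hilbert R) : set (G -> L) :=
  [set z | bounded_op z /\ small_along ev (fun T => onrm (T \o z - z))].

(** Closedness holds because the filter eventually consists of contractions: then
    [onrm (T \o z - z)] is at most [onrm (T \o s - s)] plus twice [onrm (z - s)]. *)
Lemma approximated_cs G : closed_subspace (@approximated G).
Proof.
have linb := bounded_lin G L.
split=> [|z []//|z bz hz].
  split.
    split; first exact: sub0.
    apply: (small_le _ (@small0 R _ ev _)); apply: filterS ev_contr => T [[lT _] _] /=.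
    have -> : T \o 0 - 0 = 0 :> (G -> L).
      by apply/funext => x; rewrite subr0; exact: (lin0 lT).
    by rewrite onrm0.
  move=> c x y [bx hx] [by0 hy]; split; first by case: linb => _; apply.
  apply: small_le (smallD (smallM (cabs_ge0 c) (fun T => onrm_ge0 _) hx) hy).
  apply: filterS ev_contr => T [bT _] /=; have [lT _] := bT.
  have -> : T \o (c *: x + y) - (c *: x + y) = c *: (T \o x - x) + (T \o y - y).
    apply/funext => g; rewrite !fctE /= lT scalerBr opprD.
    by rewrite addrACA.
  have bTx := subB linb (bounded_comp bT bx) bx.
  have bTy := subB linb (bounded_comp bT by0) by0.
  by rewrite -onrmZ //; apply: onrmD => //; exact: (subZ linb).
split=> // e e0; have e4 : 0 < e / 4 by lra.
have [s [bs hs] hzs] := hz _ e4; have bzs := subB linb bz bs.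
apply: filterS2 ev_contr (hs _ e4) => T [bT T1] /= h.
have -> : T \o z - z = (T \o (z - s)) + ((T \o s - s) - (z - s)).
  apply/funext => g; rewrite !fctE /=; have [lT _] := bT; rewrite (linB lT).
  by rewrite opprB !addrA !subrK.
have bTs := subB linb (bounded_comp bT bs) bs.
apply: le_lt_trans (onrmD (bounded_comp bT bzs) (subB linb bTs bzs)) _.
have h1 := onrmD bTs (subN linb bzs); rewrite onrmN in h1.
have h2 := onrm_comp bT bzs; have h3 := onrm_ge0 (z - s).
have h4 : onrm T * onrm (z - s) <= 1 * onrm (z - s) by rewrite ler_wpM2r.
lra.
Qed.

Lemma approximated_finite (G : hilbert R) (I : finType) (z : I -> G -> L) (e : R) :
  (forall i, approximated (z i)) -> 0 < e ->
  ev [set T : L -> L | forall i, onrm (T \o z i - z i) < e].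
Proof.
move=> hz e0.
suff h (s : seq I) : ev [set T : L -> L | forall i, i \in s -> onrm (T \o z i - z i) < e].
  by apply: filterS (h (enum I)) => T hT i; apply: hT; rewrite mem_enum.
elim: s => [|i s IH]; first by apply: filterS filterT.
have [_ hi] := hz i; apply: filterS2 (hi e e0) IH => T h1 h2 j.
by rewrite inE => /orP[/eqP->|]; [exact: h1|exact: h2].
Qed.

End ContractionFilter.

Section FactoredContractions.
Variables (R : realType) (G E K : hilbert R).
Variables (S : set (E -> K)) (T : set (G -> E)) (O : set (G -> K)) (C : set (E -> E)).

(** Contractions that split through a contractive row over [S] and a contractive column whose
    entries take [S] into [C] and [O] into [T]. If they are eventual along a filter that
    approximates [S] and [O], then left approximability is a matter of picking one of them. *)
Definition factored : set (K -> K) := [set V | exists n (u : 'I_n -> E -> K)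
    (v : 'I_n -> K -> E),
  [/\ (forall i, S (u i)) /\ (forall i, bounded_op (v i)),
      (forall xi : 'I_n -> E, hnorm (\sum_i u i (xi i)) <= vn xi) /\
      (forall eta, vn (v ^~ eta) <= hnorm eta),
      (forall i x, S x -> C (v i \o x)) /\ (forall i y, O y -> T (v i \o y))
    & V = \sum_l (u l \o v l)]].

Lemma factored_contraction V : S `<=` @bounded_op R E K -> factored V ->
  bounded_op V /\ onrm V <= 1.
Proof.
move=> bS [n [u [v [[Su bv] [hu hv] _ ->]]]]; split.
  apply: (sub_sum (bounded_lin K K)) => l _.
  by apply: bounded_comp => //; exact/bS/Su.
apply: onrm_le => // x; rewrite mul1r fct_sumE.
exact: le_trans (hu (fun l => v l x)) (hv x).
Qed.

Lemma left_approximableP (ev : set_system (K -> K)) : ProperFilter ev ->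
  S `<=` @bounded_op R E K -> ev factored ->
  S `<=` @approximated R K ev E -> O `<=` @approximated R K ev G ->
  left_approximable S T O C.
Proof.
move=> pev bS evf Sev Oev I J z o e Sz Oo e0.
have fev : Filter ev by case: pev.
have evc : ev [set V | bounded_op V /\ onrm V <= 1].
  by apply: filterS evf => V; exact: factored_contraction.
have h := filterI evf (filterI
  (approximated_finite (fun i => Sev _ (Sz i)) e0)
  (approximated_finite (fun j => Oev _ (Oo j)) e0)).
have {}h := h fev fev fev fev.
have [_ [[n [u [v [h1 h2 h3 ->]]]] [hz ho]]] := @filter_ex _ _ pev _ h.
have E1 (G' : hilbert R) (y : G' -> K) :
    \sum_l (u l \o v l \o y) = (\sum_l (u l \o v l)) \o y.
  by apply/funext => x; rewrite /= !fct_sumE.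
exists n, u, v; split=> // i; rewrite E1 onrm_distC; [exact: hz|exact: ho].
Qed.

End FactoredContractions.

Section ClosedSpanProducts.
Variables (R : realType) (G E K : hilbert R).

(** Two passes: the right factor is a fixed generator while the left one ranges over its closed
    span, then the left factor is fixed and the right one varies. *)
Lemma closed_span_comp (S1 : set (E -> K)) (S2 : set (G -> E)) (P : set (G -> K)) :
  S1 `<=` @bounded_op R E K -> S2 `<=` @bounded_op R G E -> closed_subspace P ->
  (forall s t, S1 s -> S2 t -> P (s \o t)) ->
  forall s t, closed_span S1 s -> closed_span S2 t -> P (s \o t).
Proof.
move=> b1 b2 csP h s t hs ht.
have h1 t' : S2 t' -> P (s \o t').
  move=> St'; have bt' := b2 _ St'.
  have := sandwich_cs (bounded_id K) bt' csP.
  move=> /(closed_span_min (S := S1)) /(_ _ s hs) [] // x S1x; split; first exact: b1.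
  exact: h.
have bs : bounded_op s by have [] := hs.
have := sandwich_cs bs (bounded_id G) csP.
move=> /(closed_span_min (S := S2)) /(_ _ t ht) [] // x S2x; split; first exact: b2.
exact: h1.
Qed.

End ClosedSpanProducts.

(** * The bimodules and algebras spanned by products over [M] and [A] *)

Section Rigged.
Variables (R : realType) (H K : hilbert R) (M : set (H -> K)) (A : set (H -> H)).
Variables (m n : nat -> H -> K) (F : set_system (H -> H)).
Context {properF : ProperFilter F}.
Hypotheses (hM : TRO M) (bA : A `<=` @bounded_op R H H)
  (mulA : forall x y, A x -> A y -> A (x \o y))
  (invA : forall f g x, M f -> M g -> A x -> A (adjoint f \o g \o x))
  (unitA : F [set e | A e /\ onrm e <= 1])
  (approxA : forall x, A x -> small_along F (fun e => onrm (e \o x - x)))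
  (Mm : forall i, M (m i))
  (approx_m : forall f, M f ->
     small_along \oo (fun k => onrm (\sum_(i < k) (m i \o adjoint (m i) \o f) - f)))
  (contr_m : forall k, onrm (\sum_(i < k) (m i \o adjoint (m i))) <= 1)
  (Mn : forall i, M (n i))
  (approx_n : forall f, M f ->
     small_along \oo (fun k => onrm (\sum_(i < k) (f \o adjoint (n i) \o n i) - f)))
  (contr_n : forall k, onrm (\sum_(i < k) (adjoint (n i) \o n i)) <= 1).

Let bM f : M f -> bounded_op f. Proof. by case: hM => h _ _; exact: h. Qed.
Let bM' f : M f -> bounded_op (adjoint f).
Proof. by move=> /bM; exact: adjoint_bounded. Qed.
Let MMM f g h : M f -> M g -> M h -> M (f \o adjoint g \o h).
Proof. by case: hM => _ _; apply. Qed.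

Definition genZ := op_products (op_products M A) (op_products (adjoints M) M).
Definition genA0 :=
  op_products (op_products (op_products (adjoints M) M) A) (op_products (adjoints M) M).
Definition genB := op_products (op_products M A) (adjoints M).
Definition genX := op_products (op_products (op_products (adjoints M) M) A) (adjoints M).

Lemma genZ_intro f x g h : M f -> A x -> M g -> M h -> genZ (f \o x \o (adjoint g \o h)).
Proof.
move=> Mf Ax Mg Mh; exists (f \o x), (adjoint g \o h); split=> //.
  by exists f, x.
by exists (adjoint g), h; split=> //; exists g.
Qed.

Lemma genA0_intro f f' x g h : M f -> M f' -> A x -> M g -> M h ->
  genA0 (adjoint f \o f' \o x \o (adjoint g \o h)).
Proof.
move=> Mf Mf' Ax Mg Mh; exists (adjoint f \o f' \o x), (adjoint g \o h); split=> //.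
  exists (adjoint f \o f'), x; split=> //.
  by exists (adjoint f), f'; split=> //; exists f.
by exists (adjoint g), h; split=> //; exists g.
Qed.

Lemma genB_intro f x g : M f -> A x -> M g -> genB (f \o x \o adjoint g).
Proof.
move=> Mf Ax Mg; exists (f \o x), (adjoint g); split=> //; last by exists g.
by exists f, x.
Qed.

Lemma genX_intro f f' x g : M f -> M f' -> A x -> M g ->
  genX (adjoint f \o f' \o x \o adjoint g).
Proof.
move=> Mf Mf' Ax Mg; exists (adjoint f \o f' \o x), (adjoint g); split=> //; last by exists g.
exists (adjoint f \o f'), x; split=> //.
by exists (adjoint f), f'; split=> //; exists f.
Qed.

Lemma genZP z : genZ z -> exists f x g h,
  [/\ M f, A x, M g, M h & z = f \o x \o (adjoint g \o h)].
Proof.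
move=> [_ [_ [[f [x [Mf Ax ->]]] [_ [h [[g Mg <-] Mh ->]]] ->]]].
by exists f, x, g, h.
Qed.

Lemma genA0P z : genA0 z -> exists f f' x g h,
  [/\ M f, M f', A x, M g & M h /\ z = adjoint f \o f' \o x \o (adjoint g \o h)].
Proof.
move=> [_ [_ [[_ [x [[_ [f' [[f Mf <-] Mf' ->]]] Ax ->]]] [_ [h [[g Mg <-] Mh ->]]] ->]]].
by exists f, f', x, g, h.
Qed.

Lemma genBP z : genB z -> exists f x g,
  [/\ M f, A x, M g & z = f \o x \o adjoint g].
Proof.
move=> [_ [_ [[f [x [Mf Ax ->]]] [g Mg <-] ->]]].
by exists f, x, g.
Qed.

Lemma genXP z : genX z -> exists f f' x g,
  [/\ M f, M f', A x, M g & z = adjoint f \o f' \o x \o adjoint g].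
Proof.
move=> [_ [_ [[_ [x [[_ [f' [[f Mf <-] Mf' ->]]] Ax ->]]] [g Mg <-] ->]]].
by exists f, f', x, g.
Qed.

Lemma genZ_bounded : genZ `<=` @bounded_op R H K.
Proof.
move=> _ /genZP[f [x [g [h [Mf Ax Mg Mh ->]]]]].
by do 2?apply: bounded_comp; [exact: bM|exact: bA|exact: bM'|exact: bM].
Qed.

Lemma genA0_bounded : genA0 `<=` @bounded_op R H H.
Proof.
move=> _ /genA0P[f [f' [x [g [h [Mf Mf' Ax Mg [Mh ->]]]]]]].
apply: bounded_comp; apply: bounded_comp; [apply: bounded_comp|..];
  by [exact: bM|exact: bA|exact: bM'].
Qed.

Lemma genB_bounded : genB `<=` @bounded_op R K K.
Proof.
move=> _ /genBP[f [x [g [Mf Ax Mg ->]]]].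
apply: bounded_comp; [apply: bounded_comp|]; by [exact: bM|exact: bA|exact: bM'].
Qed.

Lemma genX_bounded : genX `<=` @bounded_op R K H.
Proof.
move=> _ /genXP[f [f' [x [g [Mf Mf' Ax Mg ->]]]]].
apply: bounded_comp; [apply: bounded_comp; [apply: bounded_comp|]|];
  by [exact: bM|exact: bA|exact: bM'].
Qed.

Local Notation Z := (closed_span genZ).
Local Notation A0 := (closed_span genA0).
Local Notation B := (closed_span genB).
Local Notation X := (closed_span genX).

(** In a product of two generators the part between the outer factors collapses into [A], because
    [M^* M A] lies in [A]. When the middle contains five factors, [inner1] first shortens [M M^* M]
    to an element of [M]. *)
Let inner0 x g h y : A x -> M g -> M h -> A y -> A (x \o (adjoint g \o h \o y)).
Proof. by move=> Ax Mg Mh Ay; apply: mulA => //; exact: invA. Qed.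

Let inner1 x g h f f' y : A x -> M g -> M h -> M f -> M f' -> A y ->
  A (x \o (adjoint g \o (h \o adjoint f \o f') \o y)).
Proof. by move=> Ax Mg Mh Mf Mf' Ay; apply: inner0 => //; exact: MMM. Qed.

Lemma csZ : closed_subspace Z. Proof. exact/closed_span_cs/genZ_bounded. Qed.
Lemma csA0 : closed_subspace A0. Proof. exact/closed_span_cs/genA0_bounded. Qed.
Lemma csB : closed_subspace B. Proof. exact/closed_span_cs/genB_bounded. Qed.
Lemma csX : closed_subspace X. Proof. exact/closed_span_cs/genX_bounded. Qed.

Let inZ z : genZ z -> Z z. Proof. exact/closed_span_incl/genZ_bounded. Qed.
Let inA0 z : genA0 z -> A0 z. Proof. exact/closed_span_incl/genA0_bounded. Qed.
Let inB z : genB z -> B z. Proof. exact/closed_span_incl/genB_bounded. Qed.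
Let inX z : genX z -> X z. Proof. exact/closed_span_incl/genX_bounded. Qed.

Lemma mulZA0 z c : Z z -> A0 c -> Z (z \o c).
Proof.
apply: (closed_span_comp genZ_bounded genA0_bounded csZ).
move=> s t /genZP[f [x [g [h [Mf Ax Mg Mh ->]]]]].
move=> /genA0P[f1 [f2 [y [g1 [h1 [Mf1 Mf2 Ay Mg1 [Mh1 ->]]]]]]]; apply: inZ.
exact: (genZ_intro Mf (inner1 Ax Mg Mh Mf1 Mf2 Ay) Mg1 Mh1).
Qed.

Lemma mulA0A0 z c : A0 z -> A0 c -> A0 (z \o c).
Proof.
apply: (closed_span_comp genA0_bounded genA0_bounded csA0).
move=> s t /genA0P[f [f' [x [g [h [Mf Mf' Ax Mg [Mh ->]]]]]]].
move=> /genA0P[f1 [f2 [y [g1 [h1 [Mf1 Mf2 Ay Mg1 [Mh1 ->]]]]]]]; apply: inA0.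
exact: (genA0_intro Mf Mf' (inner1 Ax Mg Mh Mf1 Mf2 Ay) Mg1 Mh1).
Qed.

Lemma mulA0X z c : A0 z -> X c -> X (z \o c).
Proof.
apply: (closed_span_comp genA0_bounded genX_bounded csX).
move=> s t /genA0P[f [f' [x [g [h [Mf Mf' Ax Mg [Mh ->]]]]]]].
move=> /genXP[f1 [f2 [y [g1 [Mf1 Mf2 Ay Mg1 ->]]]]]; apply: inX.
exact: (genX_intro Mf Mf' (inner1 Ax Mg Mh Mf1 Mf2 Ay) Mg1).
Qed.

Lemma mulZX z c : Z z -> X c -> B (z \o c).
Proof.
apply: (closed_span_comp genZ_bounded genX_bounded csB).
move=> s t /genZP[f [x [g [h [Mf Ax Mg Mh ->]]]]].
move=> /genXP[f1 [f2 [y [g1 [Mf1 Mf2 Ay Mg1 ->]]]]]; apply: inB.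
exact: (genB_intro Mf (inner1 Ax Mg Mh Mf1 Mf2 Ay) Mg1).
Qed.

Lemma mulBZ z c : B z -> Z c -> Z (z \o c).
Proof.
apply: (closed_span_comp genB_bounded genZ_bounded csZ).
move=> s t /genBP[f [x [g [Mf Ax Mg ->]]]].
move=> /genZP[f1 [y [g1 [h1 [Mf1 Ay Mg1 Mh1 ->]]]]]; apply: inZ.
exact: (genZ_intro Mf (inner0 Ax Mg Mf1 Ay) Mg1 Mh1).
Qed.

Lemma mulBB z c : B z -> B c -> B (z \o c).
Proof.
apply: (closed_span_comp genB_bounded genB_bounded csB).
move=> s t /genBP[f [x [g [Mf Ax Mg ->]]]].
move=> /genBP[f1 [y [g1 [Mf1 Ay Mg1 ->]]]]; apply: inB.
exact: (genB_intro Mf (inner0 Ax Mg Mf1 Ay) Mg1).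
Qed.

Lemma mulXB z c : X z -> B c -> X (z \o c).
Proof.
apply: (closed_span_comp genX_bounded genB_bounded csX).
move=> s t /genXP[f [f' [x [g [Mf Mf' Ax Mg ->]]]]].
move=> /genBP[f1 [y [g1 [Mf1 Ay Mg1 ->]]]]; apply: inX.
exact: (genX_intro Mf Mf' (inner0 Ax Mg Mf1 Ay) Mg1).
Qed.

Lemma mulXZ z c : X z -> Z c -> A0 (z \o c).
Proof.
apply: (closed_span_comp genX_bounded genZ_bounded csA0).
move=> s t /genXP[f [f' [x [g [Mf Mf' Ax Mg ->]]]]].
move=> /genZP[f1 [y [g1 [h1 [Mf1 Ay Mg1 Mh1 ->]]]]]; apply: inA0.
exact: (genA0_intro Mf Mf' (inner0 Ax Mg Mf1 Ay) Mg1 Mh1).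
Qed.

Lemma adjM_Z f z : M f -> Z z -> A0 (adjoint f \o z).
Proof.
move=> Mf; have := sandwich_cs (bM' Mf) (bounded_id H) csA0.
move=> /(closed_span_min (S := genZ)) h /h[] // _ /genZP[f1 [x [g [h1 [Mf1 Ax Mg Mh ->]]]]].
by split; [apply/genZ_bounded/genZ_intro|apply/inA0/(genA0_intro Mf Mf1 Ax Mg Mh)].
Qed.

Lemma adjM_B f z : M f -> B z -> X (adjoint f \o z).
Proof.
move=> Mf; have := sandwich_cs (bM' Mf) (bounded_id K) csX.
move=> /(closed_span_min (S := genB)) h /h[] // _ /genBP[f1 [x [g [Mf1 Ax Mg ->]]]].
by split; [apply/genB_bounded/genB_intro|apply/inX/(genX_intro Mf Mf1 Ax Mg)].
Qed.

Lemma M_X f z : M f -> X z -> B (f \o z).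
Proof.
move=> Mf; have := sandwich_cs (bM Mf) (bounded_id K) csB.
move=> /(closed_span_min (S := genX)) h /h[] // _ /genXP[f1 [f2 [x [g [Mf1 Mf2 Ax Mg ->]]]]].
by split; [apply/genX_bounded/genX_intro|apply/inB/(genB_intro (MMM Mf Mf1 Mf2) Ax Mg)].
Qed.

Lemma M_A0 f z : M f -> A0 z -> Z (f \o z).
Proof.
move=> Mf; have := sandwich_cs (bM Mf) (bounded_id H) csZ.
move=> /(closed_span_min (S := genA0)) h /h[] // _ /genA0P[f1 [f2 [x [g [h1 [Mf1 Mf2 Ax Mg [Mh ->]]]]]]].
by split; [apply/genA0_bounded/genA0_intro|apply/inZ/(genZ_intro (MMM Mf Mf1 Mf2) Ax Mg Mh)].
Qed.

(** Tested against [y], this is a bound on the column of the [adjoint (m i) y]. Its squared norm is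
    the inner product of [\sum_i m_i m_i^* y] with [y], which [contr_m] controls. *)
Lemma row_contraction k (xi : 'I_k -> H) : hnorm (\sum_(i < k) m i (xi i)) <= vn xi.
Proof.
apply: hnorm_le_rdot => [|y]; first exact: vn_ge0.
rewrite rdot_suml.
have -> : \sum_(i < k) rdot (m i (xi i)) y = vdot xi (fun i => adjoint (m i) y).
  by apply: eq_bigr => i _; rewrite adjointP //; exact: bM.
apply: le_trans (vdot_le _ _) _; rewrite ler_wpM2l ?vn_ge0 //.
apply: ler_sqr_norm; first exact: hnorm_ge0.
rewrite sqr_vn.
have -> : \sum_(i < k) hnorm (adjoint (m i) y) ^+ 2 =
    rdot ((\sum_(i < k) (m i \o adjoint (m i))) y) y.
  rewrite fct_sumE rdot_suml; apply: eq_bigr => i _.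
  by rewrite sqr_hnorm /= [RHS]adjointP //; exact: bM.
apply: le_trans (rdot_le _ _) _; rewrite expr2 ler_wpM2r ?hnorm_ge0 //.
have bs : bounded_op (\sum_(i < k) (m i \o adjoint (m i))).
  apply: (sub_sum (bounded_lin K K)) => i _; apply: bounded_comp; first exact: bM.
  exact: bM'.
by apply: le_trans (onrmP _ bs) _; rewrite -[leRHS]mul1r ler_wpM2r ?hnorm_ge0.
Qed.

Lemma column_contraction k (y : K) : vn (fun i : 'I_k => adjoint (m i) y) <= hnorm y.
Proof.
apply: vn_le_vdot => [|xi]; first exact: hnorm_ge0.
have -> : vdot (fun i : 'I_k => adjoint (m i) y) xi = rdot y (\sum_(i < k) m i (xi i)).
  rewrite rdot_sumr; apply: eq_bigr => i _.
  by rewrite rdotC -adjointP ?(rdotC y) //; exact: bM.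
by apply: le_trans (rdot_le _ _) _; rewrite ler_wpM2l ?hnorm_ge0 ?row_contraction.
Qed.

Lemma column_contraction_n k (x : H) : vn (fun j : 'I_k => n j x) <= hnorm x.
Proof.
apply: ler_sqr_norm; first exact: hnorm_ge0.
rewrite sqr_vn.
have -> : \sum_(j < k) hnorm (n j x) ^+ 2 =
    rdot ((\sum_(j < k) (adjoint (n j) \o n j)) x) x.
  rewrite fct_sumE rdot_suml; apply: eq_bigr => i _.
  by rewrite sqr_hnorm [LHS]adjointP ?(rdotC x) //; exact: bM.
apply: le_trans (rdot_le _ _) _; rewrite expr2 ler_wpM2r ?hnorm_ge0 //.
have bs : bounded_op (\sum_(j < k) (adjoint (n j) \o n j)).
  apply: (sub_sum (bounded_lin H H)) => i _; apply: bounded_comp; last exact: bM.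
  exact: bM'.
by apply: le_trans (onrmP _ bs) _; rewrite -[leRHS]mul1r ler_wpM2r ?hnorm_ge0.
Qed.

Lemma row_contraction_n k (eta : 'I_k -> K) :
  hnorm (\sum_(j < k) adjoint (n j) (eta j)) <= vn eta.
Proof.
apply: hnorm_le_rdot => [|y]; first exact: vn_ge0.
rewrite rdot_suml.
have -> : \sum_(j < k) rdot (adjoint (n j) (eta j)) y = vdot eta (fun j => n j y).
  by apply: eq_bigr => i _; rewrite rdotC -adjointP ?(rdotC (n i y)) //; exact: bM.
by apply: le_trans (vdot_le _ _) _; rewrite ler_wpM2l ?vn_ge0 ?column_contraction_n.
Qed.

Let N k := \sum_(j < k) (adjoint (n j) \o n j).
Let P e k := \sum_(i < k) (m i \o e \o adjoint (m i)).

Let bN k : bounded_op (N k).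
Proof.
apply: (sub_sum (bounded_lin H H)) => j _; apply: bounded_comp; last exact: bM.
exact: bM'.
Qed.

Let bP e k : bounded_op e -> bounded_op (P e k).
Proof.
move=> be; apply: (sub_sum (bounded_lin K K)) => j _.
by apply: (bounded_comp (bounded_comp _ be)); [exact: bM|exact: bM'].
Qed.

Let vn_op (L L' : hilbert R) k (T : L -> L') (x : 'I_k -> L) : bounded_op T ->
  onrm T <= 1 -> vn (fun i => T (x i)) <= vn x.
Proof.
move=> bT T1; apply: ler_sqr_norm; first exact: vn_ge0.
rewrite !sqr_vn; apply: ler_sum => i _; rewrite ler_pXn2r ?nnegrE ?hnorm_ge0 //.
by apply: le_trans (onrmP _ bT) _; rewrite -[leRHS]mul1r ler_wpM2r ?hnorm_ge0.
Qed.

Let contr_P e k : bounded_op e -> onrm e <= 1 -> onrm (P e k) <= 1.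
Proof.
move=> be e1; apply: onrm_le => // y; rewrite mul1r /P fct_sumE.
apply: le_trans (row_contraction (fun i => e (adjoint (m i) y))) _.
by apply: le_trans (vn_op _ be e1) _; exact: column_contraction.
Qed.

(** The factor [N l] in [U] and the outer [n j] in [V] make the left pieces land in the right space:
    [m i \o e \o N l] lies in [Z] and [adjoint (n j) \o P e l] lies in [X]. *)
Let U k e l : K -> K := \sum_(i < k) ((m i \o e \o N l) \o adjoint (m i)).
Let V k l e : H -> H := \sum_(j < k) ((adjoint (n j) \o P e l) \o n j).

(* First l, then e, then k tends to infinity: sum_j n_j^* n_j acts as the
   identity next to M^*, then e next to A, then sum_i m_i m_i^* next to M. *)
Let evU : set_system (K -> K) :=
  [set Q | \oo [set k | F [set e | \oo [set l | Q (U k e l)]]]].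
(** Here the innermost limit is that of [e], then come [l] and [k]: [e] acts as the identity next to
    [A], then [\sum_i m_i m_i^*] next to [M], then [N k] next to [M^*]. *)
Let evV : set_system (H -> H) :=
  [set Q | \oo [set k | \oo [set l | F [set e | Q (V k l e)]]]].

Instance evU_filter : ProperFilter evU.
Proof.
split.
  move=> h; have [k hk] := @filter_ex _ \oo _ _ h; have [e he] := @filter_ex _ F _ _ hk.
  by have [l []] := @filter_ex _ \oo _ _ he.
split.
- by apply: eventually_all => k; apply: filterS filterT => e _; exact: eventually_all.
- move=> Q Q' hQ hQ'; apply: (@filterS2 _ \oo _ _ _ _ _ hQ hQ') => k /= h h'.
  by apply: filterS2 h h' => e /= h1 h1'; apply: filterS2 h1 h1' => l.
- move=> Q Q' QQ' hQ; apply: (@filterS _ \oo _ _ _ _ hQ) => k /= h; apply: filterS h => e /= h.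
  by apply: filterS h => l; exact: QQ'.
Qed.

Instance evV_filter : ProperFilter evV.
Proof.
split.
  move=> h; have [k hk] := @filter_ex _ \oo _ _ h; have [l hl] := @filter_ex _ \oo _ _ hk.
  by have [e []] := @filter_ex _ F _ _ hl.
split.
- by apply: eventually_all => k; apply: eventually_all => l; apply: filterS filterT.
- move=> Q Q' hQ hQ'; apply: (@filterS2 _ \oo _ _ _ _ _ hQ hQ') => k /= h h'.
  by apply: filterS2 h h' => e /= h1 h1'; apply: filterS2 h1 h1' => l.
- move=> Q Q' QQ' hQ; apply: (@filterS _ \oo _ _ _ _ hQ) => k /= h; apply: filterS h => e /= h.
  by apply: filterS h => l; exact: QQ'.
Qed.

Let ZU k e l i : A e -> (i < k)%N -> Z (m i \o e \o N l).
Proof.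
move=> Ae _; have -> : m i \o e \o N l = \sum_(j < l) (m i \o e \o (adjoint (n j) \o n j)).
  apply/funext => x; rewrite /N /= !fct_sumE.
  have [lme _] := bounded_comp (bM (Mm i)) (bA Ae).
  by rewrite -[m i (e _)]/((m i \o e) _) (lin_sum lme).
by apply: (sub_sum (cs_lin csZ)) => j _; apply: inZ; exact: genZ_intro.
Qed.

Let XV l e j : A e -> X (adjoint (n j) \o P e l).
Proof.
move=> Ae; have -> : adjoint (n j) \o P e l =
    \sum_(i < l) (adjoint (n j) \o m i \o e \o adjoint (m i)).
  apply/funext => x; rewrite /P /= !fct_sumE.
  by have [ln _] := bM' (Mn j); rewrite (lin_sum ln).
by apply: (sub_sum (cs_lin csX)) => i _; apply: inX; exact: genX_intro.
Qed.

(** [e] and [N l] go with the row, which then lies over [Z]; the bare column of the [adjoint (m i)]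
    maps [Z] into [A0] and [B] into [X]. *)
Let factU : evU (factored Z X B A0).
Proof.
apply: eventually_all => k; apply: filterS unitA => e [Ae e1]; apply: eventually_all => l.
have be := bA Ae.
exists k, (fun i => m i \o e \o N l), (fun i => adjoint (m i)); split.
- by split=> i; [exact: ZU|exact: bM'].
- split=> [xi|eta]; last exact: column_contraction.
  apply: le_trans (row_contraction (fun i => e (N l (xi i)))) _.
  apply: le_trans (vn_op _ be e1) _; apply: vn_op => //; exact: contr_n.
- by split=> i x; [exact: adjM_Z|exact: adjM_B].
- by [].
Qed.

(** [P e l] goes with the row of the [adjoint (n j)], which then lies over [X]; the bare column of
    the [n j] maps [X] into [B] and [A0] into [Z]. *)
Let factV : evV (factored X Z A0 B).
Proof.
apply: eventually_all => k; apply: eventually_all => l; apply: filterS unitA => e [Ae e1].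
have be := bA Ae.
exists k, (fun j => adjoint (n j) \o P e l), (fun j => n j : H -> K); split.
- by split=> i; [exact: XV|exact: bM].
- split=> [xi|eta]; last exact: column_contraction_n.
  apply: le_trans (row_contraction_n (fun i => P e l (xi i))) _.
  by apply: vn_op; [exact: bP|exact: contr_P].
- by split=> i x; [exact: M_X|exact: M_A0].
- by [].
Qed.

Let onrm_comp3 (L1 L2 L3 L4 : hilbert R) (x : L3 -> L4) (y : L2 -> L3) (z : L1 -> L2) :
  bounded_op x -> bounded_op y -> bounded_op z ->
  onrm (x \o y \o z) <= onrm x * onrm y * onrm z.
Proof.
move=> bx by1 bz; apply: le_trans (onrm_comp (bounded_comp bx by1) bz) _.
by rewrite ler_wpM2r ?onrm_ge0 ?onrm_comp.
Qed.

(** The hypothesis [approx_n], read through adjoints. *)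
Let approx_n' f : M f ->
  small_along \oo (fun k => onrm (N k \o adjoint f - adjoint f)).
Proof.
move=> Mf; apply: small_le (approx_n Mf); apply: eventually_all => k /=.
have bs : bounded_op (\sum_(i < k) (f \o adjoint (n i) \o n i)).
  apply: (sub_sum (bounded_lin H K)) => i _; apply: bounded_comp; last exact: bM.
  by apply: bounded_comp; [exact: bM|exact: bM'].
rewrite -[leRHS]onrm_adjoint; last by apply: (subB (bounded_lin H K)) => //; exact: bM.
rewrite adjointB //; last exact: bM.
rewrite adjoint_sum => [|i]; last first.
  by apply: bounded_comp; [apply: bounded_comp; [exact: bM|exact: bM']|exact: bM].
rewrite (_ : \sum_(i < k) adjoint (f \o adjoint (n i) \o n i) = N k \o adjoint f) //.
apply/funext => x; rewrite /N /= !fct_sumE; apply: eq_bigr => i _.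
have bfn : bounded_op (f \o adjoint (n i)) by apply: bounded_comp; [exact: bM|exact: bM'].
rewrite (adjoint_comp bfn (bM (Mn i))) (adjoint_comp (bM Mf) (bM' (Mn i))).
by rewrite adjointK //; exact: bM.
Qed.

Let approx_m' f : M f -> small_along \oo (fun k => onrm
  ((\sum_(i < k) (m i \o adjoint (m i))) \o f - f)).
Proof.
move=> Mf; apply: small_le (approx_m Mf); apply: eventually_all => k /=.
rewrite (_ : _ \o f = \sum_(i < k) (m i \o adjoint (m i) \o f)) //.
by apply/funext => x; rewrite /= !fct_sumE.
Qed.

Let onrm_sum_le (L L' : hilbert R) k (T : 'I_k -> L -> L') (c : 'I_k -> R) :
  (forall i, bounded_op (T i)) -> (forall i, onrm (T i) <= c i) ->
  onrm (\sum_(i < k) T i) <= \sum_(i < k) c i.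
Proof.
by move=> bT h; apply: le_trans (onrm_sum _ bT) _; apply: ler_sum => i _.
Qed.

(** The error telescopes into [D1], [D2] and [D3]: [N l] is dropped next to [adjoint (m i)], then
    [e] next to [w i], which lies in [A] by [invA], and finally the sum of the [m_i m_i^*] next to
    [p]. For fixed [k] there are finitely many [w i], so one [e] serves them all, and finitely many
    [adjoint (m i)], so one [l] does. *)
Lemma approximatedU (G : hilbert R) (p : H -> K) x (y : G -> H) : M p -> A x ->
  bounded_op y -> @approximated R K evU G (p \o x \o y).
Proof.
move=> Mp Ax by0; have bp := bM Mp; have bx := bA Ax.
have bz := bounded_comp (bounded_comp bp bx) by0.
split=> // eps eps0; have e3 : 0 < eps / 3 by lra.
have c0 : 0 <= onrm x * onrm y by rewrite mulr_ge0 ?onrm_ge0.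
apply: filterS (smallM c0 (fun k => onrm_ge0 _) (approx_m' Mp) e3) => k /= h1.
pose w i := adjoint (m i) \o p \o x.
have Aw i : A (w i) by exact: invA.
have s2 : small_along F (fun e => \sum_(i < k)
    onrm (m i) * onrm y * onrm (e \o w i - w i)).
  apply: small_sum => i; apply: smallM; first by rewrite mulr_ge0 ?onrm_ge0.
    by move=> e; exact: onrm_ge0.
  exact: approxA.
apply: filterS2 unitA (s2 _ e3) => e [Ae e1] /= h2; have be := bA Ae.
have s3 : small_along \oo (fun l => \sum_(i < k)
    onrm (m i) * onrm (p \o x \o y) * onrm (N l \o adjoint (m i) - adjoint (m i))).
  apply: small_sum => i; apply: smallM; first by rewrite mulr_ge0 ?onrm_ge0.
    by move=> l; exact: onrm_ge0.
  exact: approx_n'.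
apply: filterS (s3 _ e3) => l /= h3.
pose D1 := \sum_(i < k) (m i \o e \o (N l \o adjoint (m i) - adjoint (m i)) \o (p \o x \o y)).
pose D2 := \sum_(i < k) (m i \o (e \o w i - w i) \o y).
pose D3 := (((\sum_(i < k) (m i \o adjoint (m i))) \o p - p) \o (x \o y)).
have lm i : linear (m i) by have [] := bM (Mm i).
have le : linear e by have [] := be.
have -> : U k e l \o (p \o x \o y) - (p \o x \o y) = D1 + (D2 + D3).
  apply/funext => g; rewrite /D1 /D2 /D3 /U !fctE /= !fct_sumE /=.
  rewrite [in RHS]addrA [in RHS]addrA; congr (_ - _).
  rewrite -!big_split /=; apply: eq_bigr => i _.
  rewrite !fctE /= (linB le) !(linB (lm i)).
  by rewrite [X in X + _]addrA subrK subrK.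
have bd1 i : bounded_op (N l \o adjoint (m i) - adjoint (m i)).
  apply: (subB (bounded_lin K H)); last exact: bM'.
  by apply: bounded_comp => //; exact: bM'.
have bd2 i : bounded_op (e \o w i - w i).
  apply: (subB (bounded_lin H H)); last exact: bA.
  by apply: bounded_comp => //; exact: bA.
have bd3 : bounded_op ((\sum_(i < k) (m i \o adjoint (m i))) \o p - p).
  apply: (subB (bounded_lin H K)) => //; apply: bounded_comp => //.
  apply: (sub_sum (bounded_lin K K)) => i _.
  by apply: bounded_comp; [exact: bM|exact: bM'].
have bt1 (i : 'I_k) : bounded_op (m i \o e \o (N l \o adjoint (m i) - adjoint (m i)) \o (p \o x \o y)).
  by apply: bounded_comp bz; apply: bounded_comp (bd1 i); apply: bounded_comp => //; exact: bM.
have bt2 (i : 'I_k) : bounded_op (m i \o (e \o w i - w i) \o y).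
  by apply: bounded_comp by0; apply: bounded_comp (bd2 i); exact: bM.
have bD1 : bounded_op D1 by apply: (sub_sum (bounded_lin G K)) => i _.
have bD2 : bounded_op D2 by apply: (sub_sum (bounded_lin G K)) => i _.
have bD3 : bounded_op D3 by apply: bounded_comp => //; exact: bounded_comp.
have n1 : onrm D1 < eps / 3.
  apply: le_lt_trans h3; apply: onrm_sum_le => // i.
  apply: le_trans (onrm_comp3 (bounded_comp (bM (Mm i)) be) (bd1 i) bz) _.
  rewrite mulrAC ler_wpM2r ?onrm_ge0 // ler_wpM2r ?onrm_ge0 //.
  apply: le_trans (onrm_comp (bM (Mm i)) be) _.
  by rewrite -[leRHS]mulr1 ler_wpM2l ?onrm_ge0.
have n2 : onrm D2 < eps / 3.
  apply: le_lt_trans h2; apply: onrm_sum_le => // i.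
  apply: le_trans (onrm_comp3 (bM (Mm i)) (bd2 i) by0) _.
  by rewrite mulrAC.
have n3 : onrm D3 < eps / 3.
  apply: le_lt_trans h1; apply: le_trans (onrm_comp bd3 (bounded_comp bx by0)) _.
  by rewrite mulrC ler_wpM2r ?onrm_ge0 ?onrm_comp.
have := onrmD bD1 (subD (bounded_lin G K) bD2 bD3).
have := onrmD bD2 bD3; lra.
Qed.

(** The same telescoping with two families. Each [f j] lies in [M], hence each [w j i] lies in [A];
    [k] leaves finitely many [f j], then [l] leaves finitely many [w j i], and [e] is chosen
    last. *)
Lemma approximatedV (G : hilbert R) (p q : H -> K) x (y : G -> H) : M p -> M q -> A x ->
  bounded_op y -> @approximated R H evV G (adjoint p \o q \o x \o y).
Proof.
move=> Mp Mq Ax by0; have bp := bM' Mp; have bq := bM Mq; have bx := bA Ax.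
have bz := bounded_comp (bounded_comp (bounded_comp bp bq) bx) by0.
have bqxy := bounded_comp (bounded_comp bq bx) by0.
split=> // eps eps0; have e3 : 0 < eps / 3 by lra.
have c0 : 0 <= onrm q * onrm x * onrm y by rewrite !mulr_ge0 ?onrm_ge0.
apply: filterS (smallM c0 (fun k => onrm_ge0 _) (approx_n' Mp) e3) => k /= h1.
pose f j := n j \o adjoint p \o q.
have Mf j : M (f j) by exact: MMM.
have s2 : small_along \oo (fun l => \sum_(j < k) onrm (adjoint (n j)) * (onrm x * onrm y) *
    onrm ((\sum_(i < l) (m i \o adjoint (m i))) \o f j - f j)).
  apply: small_sum => j; apply: smallM; first by rewrite !mulr_ge0 ?onrm_ge0.
    by move=> l; exact: onrm_ge0.
  exact: approx_m'.
apply: filterS (s2 _ e3) => l /= h2.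
pose w j i := adjoint (m i) \o f j \o x.
have Aw j i : A (w j i) by exact: invA.
have s3 : small_along F (fun e => \sum_(j < k) \sum_(i < l)
    onrm (adjoint (n j)) * (onrm (m i) * onrm y) * onrm (e \o w j i - w j i)).
  apply: small_sum => j; apply: small_sum => i; apply: smallM.
  - by rewrite !mulr_ge0 ?onrm_ge0.
  - by move=> e; exact: onrm_ge0.
  - exact: approxA.
apply: filterS2 unitA (s3 _ e3) => e [Ae e1] /= h3; have be := bA Ae.
pose D1 := \sum_(j < k) \sum_(i < l) (adjoint (n j) \o m i \o (e \o w j i - w j i) \o y).
pose D2 := \sum_(j < k) (adjoint (n j) \o
  ((\sum_(i < l) (m i \o adjoint (m i))) \o f j - f j) \o (x \o y)).
pose D3 := (N k \o adjoint p - adjoint p) \o (q \o x \o y).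
have lm i : linear (m i) by have [] := bM (Mm i).
have ln j : linear (adjoint (n j)) by have [] := bM' (Mn j).
have E : V k l e \o (adjoint p \o q \o x \o y) - (adjoint p \o q \o x \o y) = D1 + (D2 + D3).
  apply/funext => g; rewrite /D1 /D2 /D3 /V /N /P !fctE /= !fct_sumE /=.
  rewrite [in RHS]addrA [in RHS]addrA; congr (_ - _).
  rewrite -!big_split /=; apply: eq_bigr => j _.
  rewrite !fctE /= !fct_sumE /= !(linB (ln j)) [X in _ = X + _]addrA subrK !(lin_sum (ln j)).
  rewrite -big_split /=; apply: eq_bigr => i _.
  by rewrite !fctE /= (linB (lm i)) (linB (ln j)) subrK.
have bd1 j i : bounded_op (e \o w j i - w j i).
  apply: (subB (bounded_lin H H)); last exact: bA.
  by apply: bounded_comp => //; exact: bA.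
have bd2 j : bounded_op ((\sum_(i < l) (m i \o adjoint (m i))) \o f j - f j).
  apply: (subB (bounded_lin H K)); last exact: bM.
  apply: bounded_comp; last exact: bM.
  apply: (sub_sum (bounded_lin K K)) => i _.
  by apply: bounded_comp; [exact: bM|exact: bM'].
have bd3 : bounded_op (N k \o adjoint p - adjoint p).
  by apply: (subB (bounded_lin K H)) => //; apply: bounded_comp.
have bnm j i : bounded_op (adjoint (n j) \o m i).
  by apply: bounded_comp; [exact: bM'|exact: bM].
have bt1 j i : bounded_op (adjoint (n j) \o m i \o (e \o w j i - w j i) \o y).
  by apply: bounded_comp by0; apply: bounded_comp (bd1 j i).
have bt2 (j : 'I_k) : bounded_op (adjoint (n j) \o
    ((\sum_(i < l) (m i \o adjoint (m i))) \o f j - f j) \o (x \o y)).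
  by apply: bounded_comp (bounded_comp bx by0); apply: bounded_comp (bd2 j); exact: bM'.
have bD1' (j : 'I_k) : bounded_op (\sum_(i < l) (adjoint (n j) \o m i \o (e \o w j i - w j i) \o y)).
  by apply: (sub_sum (bounded_lin G H)) => i _.
have bD1 : bounded_op D1 by apply: (sub_sum (bounded_lin G H)) => j _.
have bD2 : bounded_op D2 by apply: (sub_sum (bounded_lin G H)) => i _.
have bD3 : bounded_op D3 by exact: bounded_comp.
have n1 : onrm D1 < eps / 3.
  apply: le_lt_trans h3; apply: onrm_sum_le => // j; apply: onrm_sum_le => // i.
  apply: le_trans (onrm_comp3 (bnm j i) (bd1 j i) by0) _.
  rewrite mulrAC mulrA ler_wpM2r ?onrm_ge0 // ler_wpM2r ?onrm_ge0 //.
  by apply: onrm_comp; [exact: bM'|exact: bM].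
have n2 : onrm D2 < eps / 3.
  apply: le_lt_trans h2; apply: onrm_sum_le => // j.
  apply: le_trans (onrm_comp3 (bM' (Mn j)) (bd2 j) (bounded_comp bx by0)) _.
  rewrite mulrAC ler_wpM2r ?onrm_ge0 // ler_wpM2l ?onrm_ge0 //; exact: onrm_comp.
have n3 : onrm D3 < eps / 3.
  apply: le_lt_trans h1; apply: le_trans (onrm_comp bd3 bqxy) _.
  by rewrite mulrC ler_wpM2r ?onrm_ge0 ?onrm_comp3.
rewrite E; have := onrmD bD1 (subD (bounded_lin G H) bD2 bD3).
have := onrmD bD2 bD3; lra.
Qed.

Let contrU : evU [set T | bounded_op T /\ onrm T <= 1].
Proof.
by apply: filterS factU => T; apply: factored_contraction; exact: cs_bounded csZ.
Qed.

Let contrV : evV [set T | bounded_op T /\ onrm T <= 1].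
Proof.
by apply: filterS factV => T; apply: factored_contraction; exact: cs_bounded csX.
Qed.

Lemma left_approximableZ : left_approximable Z X B A0.
Proof.
apply: (left_approximableP (ev := evU)).
- exact: cs_bounded csZ.
- exact: factU.
- apply: closed_span_min; first exact: approximated_cs.
  move=> _ /genZP[f [x [g [h [Mf Ax Mg Mh ->]]]]].
  by apply: approximatedU => //; apply: bounded_comp; [exact: bM'|exact: bM].
- apply: closed_span_min; first exact: approximated_cs.
  move=> _ /genBP[f [x [g [Mf Ax Mg ->]]]].
  by apply: approximatedU => //; exact: bM'.
Qed.

Lemma left_approximableX : left_approximable X Z A0 B.
Proof.
apply: (left_approximableP (ev := evV)).
- exact: cs_bounded csX.
- exact: factV.
- apply: closed_span_min; first exact: approximated_cs.
  move=> _ /genXP[f [f' [x [g [Mf Mf' Ax Mg ->]]]]].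
  by apply: approximatedV => //; exact: bM'.
- apply: closed_span_min; first exact: approximated_cs.
  move=> _ /genA0P[f [f' [x [g [h [Mf Mf' Ax Mg [Mh ->]]]]]]].
  by apply: approximatedV => //; apply: bounded_comp; [exact: bM'|exact: bM].
Qed.

End Rigged.

(** * Countable Hilbert sums *)

Section L2.
Variables (R : realType) (H : hilbert R).

Definition square_summable (x : nat -> H) :=
  exists c : R, forall n : nat, \sum_(i < n) hnorm (x i) ^+ 2 <= c.

Lemma square_summable_lin : linear_subspace square_summable.
Proof.
split; first by exists 0 => n; rewrite big1 // => i _; rewrite hnorm0 expr0n.
move=> a x y [c hc] [d hd]; exists (2 * cabs a ^+ 2 * c + 2 * d) => n.
apply: (@le_trans _ _ (\sum_(i < n) (2 * cabs a ^+ 2 * hnorm (x i) ^+ 2 + 2 * hnorm (y i) ^+ 2))).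
  apply: ler_sum => i _; rewrite !fctE.
  have h := hnormD_le (a *: x i) (y i); rewrite hnormZ in h.
  have h0 := hnorm_ge0 (a *: x i + y i).
  have h1 : hnorm (a *: x i + y i) ^+ 2 <= (cabs a * hnorm (x i) + hnorm (y i)) ^+ 2.
    by rewrite ler_pXn2r ?nnegrE // addr_ge0 ?mulr_ge0 ?hnorm_ge0 ?cabs_ge0.
  apply: le_trans h1 _; have := sqr_ge0 (cabs a * hnorm (x i) - hnorm (y i)).
  nra.
rewrite big_split -!mulr_sumr; apply: lerD; apply: ler_wpM2l => //.
by rewrite mulr_ge0 ?sqr_ge0.
Qed.

Definition l2_pred : {pred nat -> H} := [pred x | `[< square_summable x >]].

Lemma l2_pred_closed : GRing.subsemimod_closed l2_pred.
Proof.
have lin := square_summable_lin.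
split; first split=> [|x y]; rewrite ?inE.
- exact: (sub0 lin).
- by move=> hx hy; exact: (subD lin).
- by move=> a x; rewrite !inE => hx; exact: (subZ lin).
Qed.

HB.instance Definition _ := GRing.isSubmodClosed.Build R[i] (nat -> H) l2_pred
  l2_pred_closed.

Record l2_type := L2Type { l2_val :> nat -> H; l2_valP : l2_val \in l2_pred }.

HB.instance Definition _ := [isSub for l2_val].
HB.instance Definition _ := [Choice of l2_type by <:].
HB.instance Definition _ := [SubChoice_isSubLmodule of l2_type by <:].

Implicit Types x y z : l2_type.

Lemma l2_valD x y i : (x + y) i = x i + y i.
Proof. by rewrite -[(x + y) i]/(\val (x + y) i) raddfD. Qed.

Lemma l2_valZ c x i : (c *: x) i = c *: x i.
Proof. by rewrite -[(c *: x) i]/(\val (c *: x) i) linearZ. Qed.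

Lemma l2_valN x i : (- x) i = - x i.
Proof. by rewrite -[(- x) i]/(\val (- x) i) raddfN. Qed.

Lemma l2_val0 i : (0 : l2_type) i = 0.
Proof. by rewrite -[LHS]/(\val (0 : l2_type) i) raddf0. Qed.

Lemma l2_ext x y : (forall i, x i = y i) -> x = y.
Proof. by move=> h; apply: val_inj; apply/funext. Qed.

Lemma l2_summable x : square_summable x.
Proof. by have := l2_valP x; rewrite inE. Qed.

Definition l2_mk (u : nat -> H) (hu : square_summable u) : l2_type.
Proof. by exists u; rewrite inE. Defined.

Let psum x y n : R := \sum_(i < n) rdot (x i) (y i).

Let psum_sq x n : psum x x n = \sum_(i < n) hnorm (x i) ^+ 2.
Proof. by apply: eq_bigr => i _; rewrite sqr_hnorm. Qed.

Let psum_nd x : nondecreasing_seq (psum x x).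
Proof.
apply/nondecreasing_seqP => n; rewrite /psum big_ord_recr /= lerDl; exact: rdot_ge0.
Qed.

Let psum_sq_cvg x : cvgn (psum x x).
Proof.
apply: nondecreasing_is_cvgn; first exact: psum_nd.
by have [c hc] := l2_summable x; exists c => _ [n _ <-]; rewrite psum_sq.
Qed.

Definition l2_rdot x y : R := limn (psum x y).

Let psum_cvg x y : psum x y n @[n --> \oo] --> l2_rdot x y.
Proof.
suff : cvgn (psum x y) by [].
(* Polarisation: the sums of squares converge by monotonicity, and the mixed sums are expressed by
   them. *)
have h : (fun n => 2^-1 * (psum (x + y) (x + y) n - psum x x n - psum y y n)) n @[n --> \oo] -->
    2^-1 * (limn (psum (x + y) (x + y)) - limn (psum x x) - limn (psum y y)).
  by apply: cvgMl_tmp; apply: cvgB; [apply: cvgB|]; exact: psum_sq_cvg.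
have -> : psum x y = (fun n => 2^-1 * (psum (x + y) (x + y) n - psum x x n - psum y y n)).
  apply/funext => n; rewrite /psum -!sumrB mulr_sumr; apply: eq_bigr => i _.
  by rewrite l2_valD rdotDl !rdotDr (rdotC (y i)); field.
exact: cvgP h.
Qed.

Let lim_eq x y (f : nat -> R) (l : R) : psum x y =1 f -> f n @[n --> \oo] --> l ->
  l2_rdot x y = l.
Proof. by move=> /funext E h; apply: cvg_lim => //; rewrite E. Qed.

Lemma l2_rdotC x y : l2_rdot x y = l2_rdot y x.
Proof.
apply: (lim_eq (f := psum y x)); last exact: psum_cvg.
by move=> n; apply: eq_bigr => i _; rewrite rdotC.
Qed.

Lemma l2_rdotD x y z : l2_rdot (x + y) z = l2_rdot x z + l2_rdot y z.
Proof.
apply: (lim_eq (f := fun n => psum x z n + psum y z n)); last first.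
  by apply: cvgD; exact: psum_cvg.
by move=> n; rewrite -big_split; apply: eq_bigr => i _; rewrite l2_valD rdotDl.
Qed.

Lemma l2_rdotZ (t : R) x z : l2_rdot (t%:C *: x) z = t * l2_rdot x z.
Proof.
apply: (lim_eq (f := fun n => t * psum x z n)) => [n|].
  by rewrite mulr_sumr; apply: eq_bigr => i _; rewrite l2_valZ rdotZl.
by apply: cvgMl_tmp; exact: psum_cvg.
Qed.

Lemma l2_rdotiC x y : l2_rdot ('i *: x) y = - l2_rdot x ('i *: y).
Proof.
apply: (lim_eq (f := fun n => - psum x ('i *: y) n)) => [n|].
  by rewrite -sumrN; apply: eq_bigr => i _; rewrite !l2_valZ rdotiC.
by apply: cvgN; exact: psum_cvg.
Qed.

Lemma l2_psum_le x n : \sum_(i < n) hnorm (x i) ^+ 2 <= l2_rdot x x.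
Proof.
rewrite -psum_sq; apply: (nondecreasing_cvgn_le (psum_nd x)).
exact: psum_sq_cvg.
Qed.

Lemma l2_le x c : (forall n, \sum_(i < n) hnorm (x i) ^+ 2 <= c) -> l2_rdot x x <= c.
Proof.
move=> h; apply: limr_le; first exact: psum_sq_cvg.
by apply: nearW => n; rewrite psum_sq.
Qed.

Lemma l2_rdot_ge0 x : 0 <= l2_rdot x x.
Proof. by have := l2_psum_le x 0; rewrite big_ord0. Qed.

Lemma l2_coord_le x i : hnorm (x i) ^+ 2 <= l2_rdot x x.
Proof.
apply: le_trans (l2_psum_le x i.+1); rewrite big_ord_recr /= lerDr.
by apply: sumr_ge0 => j _; exact: sqr_ge0.
Qed.

Lemma l2_rdot_eq0 x : l2_rdot x x = 0 -> x = 0.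
Proof.
move=> x0; apply: l2_ext => i; rewrite l2_val0; apply: hnorm_eq0.
have := l2_coord_le x i; rewrite x0 => h; apply/eqP.
by rewrite -sqrf_eq0 eq_le h sqr_ge0.
Qed.

(** The imaginary part is forced by the rule [Im_hdot], valid in every Hilbert space. *)
Definition l2_dot x y : R[i] := l2_rdot x y +i* l2_rdot x ('i *: y).

Lemma l2_dotC x y : l2_dot x y = (l2_dot y x)^*.
Proof.
by rewrite /l2_dot /= l2_rdotC; congr (_ +i* _); rewrite -l2_rdotiC l2_rdotC.
Qed.

Lemma l2_dot_linl z : linear_for *%R (l2_dot ^~ z).
Proof.
move=> c x y; rewrite /l2_dot !l2_rdotD.
have E u : l2_rdot (c *: x) u = complex.Re c * l2_rdot x u - complex.Im c * l2_rdot x ('i *: u).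
  rewrite {1}[c]complexE scalerDl l2_rdotD (mulrC 'i) -scalerA !l2_rdotZ l2_rdotiC.
  by rewrite mulrN.
rewrite !E scalerA -expr2 sqr_i scaleN1r.
have N u : l2_rdot x (- u) = - l2_rdot x u.
  by rewrite l2_rdotC -scaleN1r -(rmorphN1 (real_complex R)) l2_rdotZ mulN1r l2_rdotC.
rewrite N; move: (l2_rdot x z) (l2_rdot x _) (l2_rdot y _) (l2_rdot y _) => a b d e.
by case: c {E} => c c' /=; apply/eqP; rewrite eq_complex /=; apply/andP; split; apply/eqP; ring.
Qed.

Lemma l2_dot_bilinear : bilinear_for ( *%R : R[i] -> R[i] -> R[i])
  (Num.conj \; *%R : R[i] -> R[i] -> R[i]) (l2_dot : l2_type -> l2_type -> R[i]).
Proof.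
split=> [z|z] c x y; first exact: l2_dot_linl.
rewrite l2_dotC l2_dot_linl rmorphD rmorphM /= -!l2_dotC.
by [].
Qed.

HB.instance Definition _ := bilinear_isBilinear.Build R[i] l2_type l2_type R[i]
  ( *%R ) (Num.conj \; *%R) l2_dot l2_dot_bilinear.

Lemma l2_dot_herm x y : l2_dot x y = (-1) ^+ false * Num.conj (l2_dot y x).
Proof. by rewrite expr0 mul1r l2_dotC. Qed.

HB.instance Definition _ := isHermitianSesquilinear.Build R[i] l2_type false
  Num.conj l2_dot l2_dot_herm.

Lemma l2_dot_gt0 x : x != 0 -> 0 < l2_dot x x.
Proof.
move=> x0; rewrite ltcE /= lt_def l2_rdot_ge0 andbT; apply/andP; split.
  by have := l2_rdotiC x x; rewrite l2_rdotC => h; apply/eqP; lra.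
by apply: contraNneq x0 => /l2_rdot_eq0 ->.
Qed.

HB.instance Definition _ := isDotProduct.Build R[i] l2_type l2_dot l2_dot_gt0.

Definition l2_form : {dot l2_type for Num.conj} := l2_dot.

(** The limit [l] is taken coordinatewise. [tail] bounds all finite sums of
    [hnorm (u m i - l i) ^+ 2] uniformly, which shows both that [l] is square summable and that [u]
    converges to it. *)
Lemma l2_complete : complete_for
  (fun x : l2_type => Num.sqrt (complex.Re (l2_form x x))) setT.
Proof.
move=> u _ cu.
have nE x : Num.sqrt (complex.Re (l2_form x x)) = Num.sqrt (l2_rdot x x) by [].
have cle x i : hnorm (x i) <= Num.sqrt (l2_rdot x x).
  apply: ler_sqr_norm; first exact: sqrtr_ge0.
  by rewrite [leRHS]sqr_sqrtr ?l2_rdot_ge0 // l2_coord_le.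
have /choice[l hl] : forall i, exists l, tends0 (fun n => hnorm (u n i - l)).
  move=> i; apply: hilbert_cauchy => e /cu[N hN]; exists N => m n Nm Nn.
  apply: le_lt_trans (hN m n Nm Nn); rewrite nE.
  by apply: le_trans (cle (u m - u n) i); rewrite l2_valD l2_valN.
have tail e : 0 < e -> exists N : nat, forall m k, (N <= m)%N ->
    \sum_(i < k) hnorm (u m i - l i) ^+ 2 <= e ^+ 2.
  move=> e0; have [N hN] := cu e e0; exists N => m k Nm.
  apply: eps_le => d d0.
  (* If [a <= e] is the distance from [u m i] to [u n i] and [b] the one from [u n i] to [l i], then
     the square of [a + b] exceeds that of [a] by at most [b * (2 * e + b)], which tends to 0 in
     [n]. *)
  have small i : tends0 (fun n => hnorm (u n i - l i) * (2 * e + hnorm (u n i - l i))).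
    move=> d' d'0; have e1 : 0 < 2 * e + 1 by lra.
    have [N1 h1] := hl i _ (divr_gt0 d'0 e1); have [N2 h2] := hl i 1 ltr01.
    exists (maxn N1 N2) => n; rewrite geq_max => /andP[/h1 g1 /h2 g2].
    move: g1; rewrite ltr_pdivlMr // => g1; have := hnorm_ge0 (u n i - l i).
    move: g1 g2; set a := hnorm _ => g1 g2 g3.
    by apply: le_lt_trans g1; rewrite ler_wpM2l // lerD2l ltW.
  have [N' hN'] := tends0_sum (fun i : 'I_k => small i) d0.
  pose J n := \sum_(i < k) hnorm (u n i - l i) * (2 * e + hnorm (u n i - l i)).
  pose n := maxn N N'; have Nn : (N <= n)%N by rewrite leq_maxl.
  have hJ := hN' n (leq_maxr _ _).
  have hmn := ltW (hN m n Nm Nn).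
  have hmn2 : \sum_(i < k) hnorm (u m i - u n i) ^+ 2 <= e ^+ 2.
    apply: (@le_trans _ _ (l2_rdot (u m - u n) (u m - u n))).
      apply: le_trans (l2_psum_le _ k); apply: ler_sum => i _.
      by rewrite l2_valD l2_valN.
    rewrite -[leLHS]sqr_sqrtr ?l2_rdot_ge0 //.
    by rewrite ler_pXn2r ?nnegrE ?sqrtr_ge0 ?(ltW e0).
  apply: (@le_trans _ _ (\sum_(i < k) hnorm (u m i - u n i) ^+ 2 + J n)); last first.
    by apply: lerD => //; exact: ltW.
  rewrite -big_split; apply: ler_sum => i _ /=.
  have hi : hnorm (u m i - u n i) <= e.
    by have := le_trans (cle (u m - u n) i) hmn; rewrite l2_valD l2_valN.
  have : hnorm (u m i - l i) <= hnorm (u m i - u n i) + hnorm (u n i - l i).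
    by apply: le_trans (hnormD_le _ _); rewrite addrA subrK.
  have := hnorm_ge0 (u m i - l i); have := hnorm_ge0 (u m i - u n i).
  have := hnorm_ge0 (u n i - l i); move: hi.
  move: (hnorm _) (hnorm _) (hnorm _) => b c a *; nra.
have sl : square_summable l.
  have [N hN] := tail 1 ltr01.
  have -> : l = l2_val (u N) - (l2_val (u N) - l) by rewrite opprB addrC subrK.
  apply: (subB square_summable_lin); first exact: l2_summable.
  by exists 1 => k; have := hN N k (leqnn N); rewrite expr1n.
exists (l2_mk sl) => //; apply/tends0P => [n|]; first exact: sqrtr_ge0.
move=> e e0; have e2 : 0 < e / 2 by lra.
have [N hN] := tail _ e2; exists N => n Nn; rewrite nE.
apply: (@le_lt_trans _ _ (e / 2)); last lra.
rewrite -[leRHS](ger0_norm (ltW e2)) -sqrtr_sqr ler_wsqrtr //.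
apply: l2_le => k; apply: le_trans (hN n k Nn); apply: ler_sum => i _.
by rewrite l2_valD l2_valN.
Qed.

Definition l2 : hilbert R := Hilbert l2_complete.

End L2.

Section L2Theory.
Variables (R : realType) (H : hilbert R).
Local Notation L := (l2 H).

Definition l2_coord (i : nat) (x : L) : H := l2_val x i.

Lemma l2_eqP (x y : L) : (forall i, l2_coord i x = l2_coord i y) -> x = y.
Proof. exact: l2_ext. Qed.

Lemma l2_sqr_hnorm (x : L) : hnorm x ^+ 2 = l2_rdot x x.
Proof. by rewrite sqr_hnorm. Qed.

Lemma l2_coord_lin i : linear (l2_coord i).
Proof. by move=> c x y; rewrite /l2_coord l2_valD l2_valZ. Qed.

Lemma l2_hnorm_le (x : L) c : 0 <= c ->
  (forall n, \sum_(i < n) hnorm (l2_coord i x) ^+ 2 <= c ^+ 2) -> hnorm x <= c.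
Proof.
by move=> c0 h; apply: ler_sqr_norm => //; rewrite l2_sqr_hnorm; exact: l2_le.
Qed.

Lemma l2_sum_le (x : L) n : \sum_(i < n) hnorm (l2_coord i x) ^+ 2 <= hnorm x ^+ 2.
Proof. by rewrite l2_sqr_hnorm l2_psum_le. Qed.

Lemma single_summable i (h : H) : square_summable (fun j => if j == i then h else 0).
Proof.
exists (hnorm h ^+ 2) => n; case: (ltnP i n) => [ltin|lein].
  rewrite (bigD1 (Ordinal ltin)) //= eqxx big1 ?addr0 // => j.
  by rewrite -val_eqE /= => /negPf ->; rewrite hnorm0 expr0n.
rewrite big1 ?sqr_ge0 // => j _; rewrite (ltn_eqF (leq_trans (ltn_ord j) lein)).
by rewrite hnorm0 expr0n.
Qed.

Definition l2_single (i : nat) (h : H) : L := l2_mk (single_summable i h).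

Lemma l2_coord_single i j h : l2_coord j (l2_single i h) = if j == i then h else 0.
Proof. by []. Qed.

Lemma l2_single_lin i : linear (l2_single i).
Proof.
move=> c x y; apply: l2_eqP => j; rewrite l2_coord_lin !l2_coord_single.
by case: eqP => _ //; rewrite scaler0 addr0.
Qed.

Lemma rdot_single i (h : H) (x : L) : rdot (l2_single i h) x = rdot h (l2_coord i x).
Proof.
rewrite -[LHS]/(l2_rdot (l2_single i h) x); apply: cvg_lim => //.
apply: cvg_near_cst; exists i.+1 => // n /= ltin.
rewrite (bigD1 (Ordinal ltin)) //= -[X in rdot X]/(l2_coord i (l2_single i h)).
rewrite l2_coord_single eqxx big1 ?addr0 // => j; rewrite -val_eqE /= => /negPf ji.
by rewrite -[X in rdot X]/(l2_coord j (l2_single i h)) l2_coord_single ji rdot0l.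
Qed.

Lemma l2_single_norm i (h : H) : hnorm (l2_single i h) = hnorm h.
Proof.
apply/eqP; rewrite -(@eqrXn2 _ 2) ?hnorm_ge0 // !sqr_hnorm rdot_single.
by rewrite l2_coord_single eqxx.
Qed.

Lemma l2_single_bounded i : bounded_op (l2_single i).
Proof.
by split; [exact: l2_single_lin|exists 1 => x; rewrite mul1r l2_single_norm].
Qed.

Lemma l2_build (x : nat -> H) (c : R) : 0 <= c ->
  (forall n, \sum_(i < n) hnorm (x i) ^+ 2 <= c ^+ 2) ->
  exists2 xi : L, forall i, l2_coord i xi = x i & hnorm xi <= c.
Proof.
move=> c0 h; have hx : square_summable x by exists (c ^+ 2).
by exists (l2_mk hx) => //; exact: l2_hnorm_le.
Qed.

Lemma l2_build_op (G : hilbert R) (T : nat -> G -> H) (c : R) : 0 <= c ->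
  (forall i, linear (T i)) ->
  (forall x n, \sum_(i < n) hnorm (T i x) ^+ 2 <= (c * hnorm x) ^+ 2) ->
  exists2 S : G -> L, bounded_op S /\ (forall x, hnorm (S x) <= c * hnorm x)
    & forall i x, l2_coord i (S x) = T i x.
Proof.
move=> c0 lT h.
have /choice[S hS] : forall x, exists xi : L,
    (forall i, l2_coord i xi = T i x) /\ hnorm xi <= c * hnorm x.
  move=> x; have c1 : 0 <= c * hnorm x by rewrite mulr_ge0 ?hnorm_ge0.
  by have [xi h1 h2] := @l2_build (fun i => T i x) _ c1 (h x); exists xi.
exists S; last by move=> i x; have [] := hS x.
split=> [|x]; last by have [] := hS x.
split; last by exists c => x; have [] := hS x.
move=> a x y; apply: l2_eqP => i; rewrite l2_coord_lin.
by have [-> _] := hS (a *: x + y); have [-> _] := hS x; have [-> _] := hS y; rewrite lT.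
Qed.

End L2Theory.

(** An orthogonal decomposition of [L] into copies of [H], like an orthonormal basis with
    coefficients in [H]. It treats [l2 H] and [l2 (l2 H)] alike. *)
Record hbasis (R : realType) (H L : hilbert R) (E : nat -> H -> L) : Prop := HBasis {
  hb_bounded : forall j, bounded_op (E j);
  hb_ortho : forall j k x y, rdot (E j x) (E k y) = if j == k then rdot x y else 0;
  hb_total : forall xi, (forall j x, rdot (E j x) xi = 0) -> xi = 0 }.

Section HBasisTheory.
Variables (R : realType) (H L : hilbert R) (E : nat -> H -> L).
Hypothesis hE : hbasis E.
Let bE j := hb_bounded hE j.
Let D j := adjoint (E j).
Let bD j : bounded_op (D j). Proof. exact: adjoint_bounded. Qed.

Lemma hb_coordE j k x : D j (E k x) = if j == k then x else 0.
Proof.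
apply: rdot_inj => y; rewrite rdotC -adjointP // (hb_ortho hE).
by case: eqP => _; [rewrite rdotC|rewrite rdot0l].
Qed.

Lemma hb_norm j x : hnorm (E j x) = hnorm x.
Proof.
by apply/eqP; rewrite -(@eqrXn2 _ 2) ?hnorm_ge0 // !sqr_hnorm (hb_ortho hE) eqxx.
Qed.

Lemma hb_adj_norm j : onrm (D j) <= 1.
Proof.
rewrite onrm_adjoint //; apply: onrm_le => // x; by rewrite hb_norm mul1r.
Qed.

Lemma hb_ext (xi eta : L) : (forall j, D j xi = D j eta) -> xi = eta.
Proof.
move=> h; apply/eqP; rewrite -subr_eq0; apply/eqP/(hb_total hE) => j x.
by have [lD _] := bD j; rewrite adjointP // -/(D j) (linB lD) h subrr rdot0r.
Qed.

Definition hb_proj n (xi : L) : L := \sum_(j < n) E j (D j xi).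

Lemma hb_sum_sqr n (x : 'I_n -> H) :
  hnorm (\sum_(l < n) E l (x l)) ^+ 2 = \sum_l hnorm (x l) ^+ 2.
Proof.
rewrite sqr_hnorm rdot_suml; apply: eq_bigr => j _.
rewrite rdot_sumr (bigD1 j) //= big1 ?addr0 => [|k kj].
  by rewrite (hb_ortho hE) eqxx sqr_hnorm.
by rewrite (hb_ortho hE) eq_sym; case: ifP kj => //; rewrite -val_eqE /= => ->.
Qed.

Lemma hb_proj_sqr n xi : hnorm (hb_proj n xi) ^+ 2 = \sum_(j < n) hnorm (D j xi) ^+ 2.
Proof. exact: hb_sum_sqr. Qed.

Lemma hb_proj_rdot n xi : rdot (hb_proj n xi) xi = \sum_(j < n) hnorm (D j xi) ^+ 2.
Proof. by rewrite rdot_suml; apply: eq_bigr => j _; rewrite adjointP // sqr_hnorm. Qed.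

Lemma hb_proj_le n xi : hnorm (hb_proj n xi) <= hnorm xi.
Proof.
have := rdot_le (hb_proj n xi) xi; rewrite hb_proj_rdot -hb_proj_sqr expr2.
have [p0|pn0] := eqVneq (hnorm (hb_proj n xi)) 0; first by rewrite p0 hnorm_ge0.
by rewrite ler_pM2l // lt_def pn0 hnorm_ge0.
Qed.

Lemma hb_bessel n xi : \sum_(j < n) hnorm (D j xi) ^+ 2 <= hnorm xi ^+ 2.
Proof.
by rewrite -hb_proj_sqr ler_pXn2r ?nnegrE ?hnorm_ge0 // hb_proj_le.
Qed.

Lemma hb_proj_bounded n : bounded_op (hb_proj n).
Proof.
split; last by exists 1 => x; rewrite mul1r hb_proj_le.
move=> c x y; rewrite /hb_proj scaler_sumr -big_split; apply: eq_bigr => j _.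
by have [lE _] := bE j; have [lD _] := bD j; rewrite lD lE.
Qed.

Lemma hb_coord_proj n j xi : D j (hb_proj n xi) = if (j < n)%N then D j xi else 0.
Proof.
have [lD _] := bD j; rewrite /hb_proj (lin_sum lD); case: ltnP => [ltjn|lenj].
  rewrite (bigD1 (Ordinal ltjn)) //= hb_coordE eqxx big1 ?addr0 // => k.
  by rewrite -val_eqE /= hb_coordE eq_sym => /negPf ->.
by rewrite big1 // => k _; rewrite hb_coordE gtn_eqF // (leq_trans (ltn_ord k)).
Qed.

(** Bessel's inequality makes the partial sums Cauchy; their limit has the coordinates of [xi] and
    hence equals it. *)
Lemma hb_proj_cvg xi : tends0 (fun n => hnorm (hb_proj n xi - xi)).
Proof.
pose s n := \sum_(j < n) hnorm (D j xi) ^+ 2.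
have snd : nondecreasing_seq s.
  by apply/nondecreasing_seqP => n; rewrite /s big_ord_recr /= lerDl sqr_ge0.
have scvg : cvgn s.
  apply: nondecreasing_is_cvgn => //.
  by exists (hnorm xi ^+ 2) => _ [n _ <-]; exact: hb_bessel.
have dist m n : (n <= m)%N -> hnorm (hb_proj m xi - hb_proj n xi) ^+ 2 = s m - s n.
  move=> nm; rewrite sqr_hnorm rdotBl !rdotBr.
  have pp a b : (a <= b)%N -> rdot (hb_proj a xi) (hb_proj b xi) = s a.
    move=> ab; rewrite /hb_proj rdot_suml; apply: eq_bigr => j _.
    rewrite adjointP // -/(hb_proj b xi) -/(D j) hb_coord_proj (leq_trans (ltn_ord j) ab).
    by rewrite sqr_hnorm.
  by rewrite (rdotC (hb_proj m xi) (hb_proj n xi)) !pp //; ring.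
have [|eta heta] := @hilbert_cauchy _ L (hb_proj ^~ xi).
  move=> e e0; have e2 : 0 < e ^+ 2 by rewrite exprn_gt0.
  have /cvgrPdist_lt /(_ _ e2)[N _ hN] := scvg.
  have hs n : (N <= n)%N -> limn s - s n < e ^+ 2.
    by move=> /hN /=; apply: le_lt_trans; exact: ler_norm.
  have wl m n : (n <= m)%N -> (N <= n)%N -> hnorm (hb_proj m xi - hb_proj n xi) < e.
    move=> nm Nn; rewrite -(@ltr_pXn2r _ 2) ?nnegrE ?hnorm_ge0 ?(ltW e0) // dist //.
    by apply: le_lt_trans (hs n Nn); rewrite lerD2r; apply: nondecreasing_cvgn_le.
  exists N => m n Nm Nn; case: (leqP n m) => nm; first exact: wl.
  by rewrite hnorm_distC; apply: wl => //; exact: ltnW.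
suff E0 : xi = eta by move: heta; rewrite -E0.
apply: hb_ext => j; apply/eqP; rewrite -subr_eq0; apply/eqP/hnorm_eq0/eqP.
rewrite eq_le hnorm_ge0 andbT; apply: (@eps_le R) => e e0; rewrite add0r.
have [N hN] := heta e e0; set n := maxn N j.+1.
have [lD _] := bD j.
have -> : D j xi - D j eta = D j (hb_proj n xi - eta).
  by rewrite (linB lD) hb_coord_proj leq_max ltnSn orbT.
apply: le_trans (onrmP _ (bD j)) _; apply: (@le_trans _ _ (1 * hnorm (hb_proj n xi - eta))).
  by rewrite ler_wpM2r ?hnorm_ge0 ?hb_adj_norm.
by rewrite mul1r ltW // hN // leq_maxl.
Qed.

End HBasisTheory.

Section HBasisExamples.
Variables (R : realType) (H : hilbert R).

Lemma l2_hbasis : hbasis (@l2_single R H).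
Proof.
split=> [|j k x y|xi h]; first exact: l2_single_bounded.
  by rewrite rdot_single l2_coord_single; case: eqP => // _; rewrite rdot0r.
by apply: l2_eqP => i; apply: rdot_inj => y; rewrite rdotC -rdot_single h /l2_coord l2_val0 rdot0l.
Qed.

End HBasisExamples.

Lemma nat_pairing : exists (f : nat -> nat * nat) (g : nat * nat -> nat),
  cancel f g /\ cancel g f.
Proof.
have /card_set_bijP[g] := card_nat2.
by rewrite setTT_bijective => -[f gK fK]; exists f, g.
Qed.

(** Pairs of indices are renumbered by a single one, so that matrices indexed by [nat] act on the
    double sum. *)
Lemma l2_l2_hbasis (R : realType) (H : hilbert R) : exists e : nat -> H -> l2 (l2 H),
  hbasis e /\ (forall n i, exists j, e j = l2_single n \o l2_single i) /\
  forall j, exists n i, e j = l2_single n \o l2_single i.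
Proof.
have [f [g [fK gK]]] := nat_pairing.
exists (fun j => l2_single (f j).1 \o l2_single (f j).2); split; last first.
  split=> [n i|j]; first by exists (g (n, i)); rewrite gK.
  by exists (f j).1, (f j).2.
split=> [j|j k x y|xi h].
- apply: bounded_comp; exact: l2_single_bounded.
- rewrite /= rdot_single l2_coord_single -[j == k](can_eq fK).
  rewrite -[f j == f k]/(((f j).1 == (f k).1) && ((f j).2 == (f k).2)).
  case: ifP => _; last by rewrite rdot0r.
  by rewrite rdot_single l2_coord_single /=; case: eqP => // _; rewrite rdot0r.
- apply: (hb_total (l2_hbasis (l2 H))) => n x; rewrite rdot_single.
  suff -> : l2_coord n xi = 0 by rewrite rdot0r.
  apply: (hb_total (l2_hbasis H)) => i y.
  by rewrite -rdot_single; have := h (g (n, i)) y; rewrite gK.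
Qed.

(** * The swindle *)

Section Slots.
Variables (R : realType) (A B : hilbert R).

(** [s n = Some k] stands for filling slot [n] from slot [k], and [None] for leaving it empty; the
    inverse [s'] ensures that no slot is read twice. *)
Definition partial_inverse (s s' : nat -> option nat) :=
  forall n k, s n = Some k <-> s' k = Some n.

(** Each [f k] occurs at most once on the left, and [M] exceeds every index that occurs. *)
Lemma partial_inverse_sum_le (s s' : nat -> option nat) (f : nat -> R) (N : nat) :
  partial_inverse s s' -> (forall k, 0 <= f k) ->
  exists M : nat, \sum_(n < N) (if s n is Some k then f k else 0) <= \sum_(k < M) f k.
Proof.
move=> ss' f0; pose M := (\max_(n < N) (if s n is Some k then k.+1 else 0%N))%N.
exists M.
have E (n : 'I_N) : (if s n is Some k then f k else 0) =
    \sum_(k < M) (if s n == Some (k : nat) then f k else 0).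
  case E: (s n) => [k|]; last by rewrite big1.
  have ltkM : (k < M)%N by rewrite /M; apply: leq_trans (leq_bigmax n); rewrite E.
  rewrite (bigD1 (Ordinal ltkM)) //= eqxx big1 ?addr0 // => i.
  by rewrite -val_eqE /= => ik; case: eqP => // -[ki]; rewrite ki eqxx in ik.
rewrite (eq_bigr _ (fun n _ => E n)) exchange_big; apply: ler_sum => k _ /=.
case E': (s' k) => [n|]; last first.
  by rewrite big1 // => n _; case: eqP => // /ss'; rewrite E'.
case: (ltnP n N) => [ltnN|leNn].
  rewrite (bigD1 (Ordinal ltnN)) //= big1 ?addr0; first by case: ifP.
  move=> i; rewrite -val_eqE /= => ni; case: eqP => // /ss'; rewrite E' => -[nn].
  by rewrite nn eqxx in ni.
rewrite big1 // => i _; case: eqP => // /ss'; rewrite E' => -[En].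
by have := ltn_ord i; rewrite -En ltnNge leNn.
Qed.

Lemma slot_exists (T : A -> B) (s s' : nat -> option nat) :
  bounded_op T -> partial_inverse s s' ->
  exists2 S : l2 A -> l2 B, bounded_op S &
    forall n g, l2_coord n (S g) = if s n is Some k then T (l2_coord k g) else 0.
Proof.
move=> bT ss'; have [lT _] := bT; pose F n (g : l2 A) := if s n is Some k then T (l2_coord k g) else 0.
have [||g n|S [bS _] hS] := @l2_build_op _ _ _ F (onrm T).
- exact: onrm_ge0.
- move=> n c x y; rewrite /F; case: (s n) => [k|]; last by rewrite scaler0 addr0.
  by rewrite l2_coord_lin lT.
- pose f k := (onrm T * hnorm (l2_coord k g)) ^+ 2.
  have [M hM] := @partial_inverse_sum_le s s' f n ss' (fun k => sqr_ge0 _).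
  apply: (@le_trans _ _ (\sum_(i < n) (if s i is Some k then f k else 0))).
    apply: ler_sum => i _; rewrite /F /f; case: (s i) => [k|]; last by rewrite hnorm0 expr0n.
    by rewrite ler_pXn2r ?nnegrE ?mulr_ge0 ?onrm_ge0 ?hnorm_ge0 ?onrmP.
  apply: le_trans hM _; rewrite /f; under eq_bigr do rewrite exprMn.
  by rewrite -mulr_sumr exprMn ler_wpM2l ?sqr_ge0 ?l2_sum_le.
- by exists S.
Qed.

Lemma slot_single (T : A -> B) (s s' : nat -> option nat) (S : l2 A -> l2 B) :
  linear T -> partial_inverse s s' ->
  (forall n g, l2_coord n (S g) = if s n is Some k then T (l2_coord k g) else 0) ->
  forall k x, S (l2_single k x) = if s' k is Some n then l2_single n (T x) else 0.
Proof.
move=> lT ss' hS k x; apply: l2_eqP => n; rewrite hS.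
case E': (s' k) => [n'|].
  have En' : s n' = Some k by apply/ss'.
  rewrite l2_coord_single; case: eqP => [->|nn']; first by rewrite En' l2_coord_single eqxx.
  case E: (s n) => [k'|//]; rewrite l2_coord_single; case: eqP => [k'k|]; last by rewrite (lin0 lT).
  by case: nn'; move/ss': E; rewrite k'k E' => -[].
rewrite [RHS]l2_val0; case E: (s n) => [k'|//]; rewrite l2_coord_single.
case: eqP => [k'k|]; last by rewrite (lin0 lT).
by move/ss': E; rewrite k'k E'.
Qed.

End Slots.

(** Adjoints reverse the direction in which slots are filled. It suffices to test against the
    vectors [l2_single k x], on which [slot_single] computes [S]. *)
Lemma slot_adjoint (R : realType) (A B : hilbert R) (T : A -> B) (s s' : nat -> option nat)
    (S : l2 A -> l2 B) (S' : l2 B -> l2 A) :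
  bounded_op T -> partial_inverse s s' -> bounded_op S ->
  (forall n g, l2_coord n (S g) = if s n is Some k then T (l2_coord k g) else 0) ->
  (forall n g, l2_coord n (S' g) = if s' n is Some k then adjoint T (l2_coord k g) else 0) ->
  adjoint S = S'.
Proof.
move=> bT ss' bS hS hS'; apply/funext => g; apply: l2_eqP => k; apply: rdot_inj => x.
rewrite rdotC -rdot_single -adjointP // (slot_single _ ss' hS) ?hS'; last by case: bT.
by case: (s' k) => [n|]; rewrite ?rdot0l // rdot_single adjointP // rdotC.
Qed.

Section Swindle.
Variables (R : realType).

Definition moves (G H K : hilbert R) (T : H -> K) (C : set (G -> H)) (D : set (G -> K)) :=
  forall c, C c -> D (T \o c).

(** For an [hbasis] this is the column space over [S], the norm closure of the finitely supported
    columns, realised by operators from [G] to [L]. *)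
Definition amplify (G H L : hilbert R) (e : nat -> H -> L) (S : set (G -> H)) :=
  closed_span (op_products (range e) S).

Variables (H K : hilbert R) (m : nat -> H -> K) (m' : nat -> K -> H).

(** The conditions under which the swindle carries columns over [S] to columns over [T] and back;
    [cp_lim] is the norm convergence that a strong limit alone does not give. *)
Record compatible (G : hilbert R) (S : set (G -> H)) (T : set (G -> K)) : Prop := Compatible {
  cp_src : closed_subspace S;
  cp_tgt : closed_subspace T;
  cp_m : forall i, moves (m i) S T;
  cp_m' : forall i, moves (m' i) T S;
  cp_lim : forall b, T b ->
    tends0 (fun n => onrm ((\sum_(i < n) (m i \o m' i \o b)) - b)) }.

Hypothesis bm : forall i, bounded_op (m i).
Hypothesis mm' : forall i, adjoint (m i) = m' i.
Hypothesis contr : forall n y, \sum_(i < n) hnorm (m' i y) ^+ 2 <= hnorm y ^+ 2.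
Hypothesis lim_m : forall s, tends0 (fun n => onrm ((\sum_(i < n) (m i \o m' i \o m s)) - m s)).

Let bm' i : bounded_op (m' i).
Proof. by rewrite -mm'; exact: adjoint_bounded. Qed.

(** [J] is the column of the [m' i], and a partial isometry: [adjoint J \o J] is the strong limit of
    the sums of the [m i \o m' i], which is the identity on the ranges of the [m s]. On compatible
    spaces the limit holds in norm, and this puts [J \o b] into the norm closed span. *)
Lemma row_operator : exists J : K -> l2 H, [/\ bounded_op J,
  forall i x, adjoint J (l2_single i x) = m i x,
  forall y, tends0 (fun n => hnorm (\sum_(i < n) m i (m' i y) - y)) -> adjoint J (J y) = y,
  forall y, J (adjoint J (J y)) = J y
  & forall (G : hilbert R) S T (b : G -> K), @compatible G S T -> T b -> amplify (@l2_single R H) S (J \o b)].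
Proof.
have [|i|y n|J [bJ _] hJ] := @l2_build_op _ _ _ m' 1 => //.
- by case: (bm' i).
- by rewrite mul1r.
pose P := adjoint J; have bP : bounded_op P by exact: adjoint_bounded.
have [lP _] := bP; have [lJ _] := bJ.
have hP i x : P (l2_single i x) = m i x.
  apply: rdot_inj => y; rewrite rdotC -(adjointP bJ) rdotC rdot_single hJ -mm'.
  by rewrite -(adjointP (bm i)).
have hb := l2_hbasis H.
have coordE i z : adjoint (@l2_single R H i) z = l2_coord i z.
  apply: rdot_inj => x; rewrite rdotC -adjointP ?rdot_single; last exact: l2_single_bounded.
  by rewrite rdotC.
have projE n y : P (hb_proj (@l2_single R H) n (J y)) = \sum_(i < n) m i (m' i y).
  by rewrite (lin_sum lP); apply: eq_bigr => i _; rewrite coordE hJ hP.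
have PJ y : tends0 (fun n => hnorm (\sum_(i < n) m i (m' i y) - y)) -> P (J y) = y.
  move=> hy; apply/eqP; rewrite -subr_eq0; apply/eqP/hnorm_eq0/eqP.
  rewrite eq_le hnorm_ge0 andbT.
  apply: (tends0_ge (f := fun n => onrm P * hnorm (hb_proj (@l2_single R H) n (J y) - J y)
     + hnorm (\sum_(i < n) m i (m' i y) - y))); last first.
    by apply: tends0D => //; apply: tends0M; [exact: onrm_ge0|exact: hb_proj_cvg].
  move=> n; apply: le_trans (lerD (onrmP _ bP) (lexx _)).
  rewrite (linB lP) projE (hnorm_distC (\sum_(i < n) _) (P _)).
  by apply: le_trans (hnormD_le _ _); rewrite addrA subrK.
have PJm s x : P (J (m s x)) = m s x.
  apply: PJ; apply: (tends0_le (g := fun n => hnorm x * onrm ((\sum_(i < n) (m i \o m' i \o m s)) - m s))).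
    move=> n; rewrite mulrC.
    have bd : bounded_op ((\sum_(i < n) (m i \o m' i \o m s)) - m s).
      apply: (subB (bounded_lin H K)) => //; apply: (sub_sum (bounded_lin H K)) => i _.
      exact: bounded_comp (bounded_comp (bm i) (bm' i)) (bm s).
    by apply: le_trans (onrmP x bd); rewrite !fctE fct_sumE.
  by apply: tends0M => //; exact: hnorm_ge0.
have JPJ y : J (P (J y)) = J y.
  apply: l2_eqP => i; rewrite !hJ -mm'; apply: rdot_inj => x.
  rewrite rdotC -(adjointP (bm i)) [RHS]rdotC -(adjointP (bm i)).
  by rewrite -(adjointP bJ) rdotC (adjointP bJ) -/P PJm rdotC.
exists J; split => // G S T b cST Tb.
have [csS csT mST mTS lim] := cST.
have bb := cs_bounded csT Tb; have [lb _] := bb.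
have bd n : bounded_op ((\sum_(i < n) (m i \o m' i \o b)) - b).
  apply: (subB (bounded_lin G K)) => //; apply: (sub_sum (bounded_lin G K)) => i _.
  exact: bounded_comp (bounded_comp (bm i) (bm' i)) bb.
have inS : op_products (range (@l2_single R H)) S `<=` @bounded_op R G (l2 H).
  move=> _ [_ [s [[i _ <-] Ss ->]]]; apply: bounded_comp; first exact: l2_single_bounded.
  exact: (cs_bounded csS).
have csA := closed_span_cs inS.
apply: (cs_closed csA) => [|e e0]; first exact: bounded_comp.
have e2 : 0 < e / 2 by lra.
have b1 : 0 < onrm b + 1 by rewrite ltr_pwDr ?onrm_ge0.
have [N /(_ N (leqnn N)) hN] := lim _ Tb _ (divr_gt0 (exprn_gt0 2 e2) b1).
exists (\sum_(i < N) (@l2_single R H i \o (m' i \o b))).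
  apply: (sub_sum (cs_lin csA)) => i _; apply: closed_span_incl => //.
  by exists (@l2_single R H i), (m' i \o b); split=> //; apply: mTS.
apply: (@le_lt_trans _ _ (e / 2)); last lra.
apply: onrm_le => [|x]; first exact: ltW.
set y := b x; set z := J y; set Pz := hb_proj (@l2_single R H) N z.
have -> : (J \o b - \sum_(i < N) (@l2_single R H i \o (m' i \o b))) x = z - Pz.
  rewrite !fctE fct_sumE; congr (_ - _); rewrite /Pz /hb_proj; apply: eq_bigr => i _.
  by rewrite coordE hJ.
(* The squared tail of the column is [rdot (z - Pz) z], which moves through [J] to the inner product
   of [y - \sum_i m_i (m'_i y)] with [y]. So the convergence of these sums controls the square of
   the tail, which is why [N] was chosen with the square of [e / 2]. *)
apply: ler_sqr_norm; first by rewrite mulr_ge0 ?hnorm_ge0 ?(ltW e2).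
rewrite sqr_hnorm rdotBl !rdotBr (rdotC z Pz) -(sqr_hnorm Pz).
rewrite hb_proj_rdot // -hb_proj_sqr // subrr subr0.
rewrite hb_proj_sqr // -hb_proj_rdot // -/Pz -rdotBl.
have PJy : P z = y.
  apply: PJ; apply: (tends0_le (g := fun n => hnorm x * onrm ((\sum_(i < n) (m i \o m' i \o b)) - b))).
    move=> n; rewrite mulrC.
    by apply: le_trans (onrmP x (bd n)); rewrite !fctE fct_sumE.
  by apply: tends0M; [exact: hnorm_ge0|exact: lim].
have -> : rdot (z - Pz) z = rdot (y - \sum_(i < N) m i (m' i y)) y.
  by rewrite rdotC (adjointP bJ) rdotC -/P (linB lP) PJy projE.
apply: le_trans (rdot_le _ _) _; rewrite hnorm_distC.
have h1 : hnorm (\sum_(i < N) m i (m' i y) - y) <=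
    onrm ((\sum_(i < N) (m i \o m' i \o b)) - b) * hnorm x.
  by apply: le_trans (onrmP x (bd N)); rewrite !fctE fct_sumE.
have h2 := onrmP x bb; rewrite -/y in h2.
move: hN; rewrite ltr_pdivlMr // => hN.
apply: (@le_trans _ _ ((onrm ((\sum_(i < N) (m i \o m' i \o b)) - b) * hnorm x) * (onrm b * hnorm x))).
  by rewrite ler_pM ?hnorm_ge0.
rewrite mulrACA -expr2 exprMn ler_wpM2r ?sqr_ge0 //.
have := onrm_ge0 ((\sum_(i < N) (m i \o m' i \o b)) - b); have := onrm_ge0 b.
move: hN; set u := onrm _; set v := onrm _; nra.
Qed.

End Swindle.

(** * Operators acting on closed spans of columns *)

Section SpanMoves.
Variables (R : realType).

Lemma moves_span (G H K : hilbert R) (T : H -> K) (X : set (G -> H)) (D : set (G -> K)) :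
  bounded_op T -> X `<=` @bounded_op R G H -> closed_subspace D -> moves T X D ->
  moves T (closed_span X) D.
Proof.
move=> bT Xb csD h.
have cs := sandwich_cs bT (bounded_id G) csD.
have := @closed_span_min _ _ _ X _ cs; rewrite /moves => hm c Xc.
by have [|_] := hm _ c Xc; first by move=> x Xx; split; [exact: Xb|exact: h].
Qed.

Lemma zero_cs (H K : hilbert R) : closed_subspace [set (0 : H -> K)].
Proof.
split=> [|_ ->|T bT h].
- by split=> // c x y -> ->; rewrite scaler0 addr0.
- exact: (sub0 (bounded_lin H K)).
- apply: onrm_eq0 => //; apply/eqP; rewrite eq_le onrm_ge0 andbT.
  by apply: eps_le => e /h[_ -> ]; rewrite subr0 add0r => /ltW.
Qed.

(** [moves_span] for [T - id] and the zero subspace. *)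
Lemma fixes_span (G H : hilbert R) (T : H -> H) (X : set (G -> H)) :
  bounded_op T -> X `<=` @bounded_op R G H -> (forall c, X c -> T \o c = c) ->
  forall c, closed_span X c -> T \o c = c.
Proof.
move=> bT Xb h c Xc.
have bD : bounded_op (T - id) by apply: (subB (bounded_lin H H)) => //; exact: bounded_id.
have := @moves_span G H H (T - id) X [set 0] bD Xb (zero_cs G H) _ c Xc.
rewrite /= => E; apply/funext => x; apply/eqP; rewrite -subr_eq0; apply/eqP.
have : ((T - id) \o c) x = 0.
  by rewrite E // => y /h hy; apply/funext => z; rewrite !fctE /= -[in X in _ - X]hy /= subrr.
by rewrite !fctE.
Qed.

Lemma basis_unitary (H L : hilbert R) (e : nat -> H -> L) : hbasis e ->
  exists W : L -> l2 H, [/\ bounded_op W, forall x, adjoint W (W x) = x,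
    forall g, W (adjoint W g) = g, forall j h, W (e j h) = l2_single j h
    & forall j h, adjoint W (l2_single j h) = e j h].
Proof.
move=> he; have be := hb_bounded he.
have [|i|y n|W [bW _] hW] := @l2_build_op _ _ L (fun j => adjoint (e j)) 1 => //.
- by have [] := adjoint_bounded (be i).
- by rewrite mul1r; exact: hb_bessel.
have We j h : W (e j h) = l2_single j h.
  by apply: l2_eqP => i; rewrite hW l2_coord_single hb_coordE.
have We' j h : adjoint W (l2_single j h) = e j h.
  apply: rdot_inj => x; rewrite rdotC -(adjointP bW) rdotC rdot_single hW.
  by rewrite -(adjointP (be j)).
exists W; split => // [x|g].
  apply: (hb_ext he) => j; apply: rdot_inj => y.
  rewrite rdotC -(adjointP (be j)) -(adjointP bW) We rdot_single hW.
  by rewrite rdotC.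
apply: l2_eqP => j; rewrite hW; apply: rdot_inj => y.
by rewrite rdotC -(adjointP (be j)) -(adjointP bW) We rdot_single rdotC.
Qed.

Definition pair_basis (H : hilbert R) (e : nat -> H -> l2 (l2 H)) :=
  [/\ hbasis e, forall n i, exists j, e j = l2_single n \o l2_single i
    & forall j, exists n i, e j = l2_single n \o l2_single i].

Lemma amplify_incl (G H L : hilbert R) (e : nat -> H -> L) (S : set (G -> H)) :
  hbasis e -> closed_subspace S ->
  op_products (range e) S `<=` @bounded_op R G L.
Proof.
move=> he csS _ [_ [s [[j _ <-] Ss ->]]].
by apply: bounded_comp; [exact: hb_bounded he j|exact: (cs_bounded csS)].
Qed.

Lemma amplify_mem (G H L : hilbert R) (e : nat -> H -> L) (S : set (G -> H)) j s :
  hbasis e -> closed_subspace S -> S s -> amplify e S (e j \o s).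
Proof.
move=> he csS Ss; apply: closed_span_incl; first exact: amplify_incl.
by exists (e j), s.
Qed.

Lemma amplify_cs (G H L : hilbert R) (e : nat -> H -> L) (S : set (G -> H)) :
  hbasis e -> closed_subspace S -> closed_subspace (amplify e S).
Proof. by move=> he csS; apply: closed_span_cs; exact: amplify_incl. Qed.

Lemma amplify_moves (G H L K : hilbert R) (e : nat -> H -> L) (S : set (G -> H))
    (T : L -> K) (D : set (G -> K)) :
  hbasis e -> closed_subspace S -> bounded_op T -> closed_subspace D ->
  (forall j s, S s -> D (T \o (e j \o s))) -> moves T (amplify e S) D.
Proof.
move=> he csS bT csD h.
apply: (@moves_span _ _ _ T _ D bT (amplify_incl he csS) csD).
by move=> _ [_ [s [[j _ <-] Ss ->]]]; exact: h.
Qed.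

Lemma amplify_fixes (G H L : hilbert R) (e : nat -> H -> L) (S : set (G -> H)) (T : L -> L) :
  hbasis e -> closed_subspace S -> bounded_op T ->
  (forall j s, S s -> T \o (e j \o s) = e j \o s) ->
  forall c, amplify e S c -> T \o c = c.
Proof.
move=> he csS bT h; apply: (@fixes_span _ _ T _ bT (amplify_incl he csS)).
by move=> _ [_ [s [[j _ <-] Ss ->]]]; exact: h.
Qed.

End SpanMoves.

(* With J y = (m_i^* y)_i and Q = J J^*, we take
     alpha g = (J^* g_(2n))_n  and  beta g = (Q g_(2n+1) + (1 - Q) g_n)_n,
   so that alpha' alpha + beta' beta = 1 and beta is onto: alpha and beta cut
   l2 (l2 H) into a copy of J^* (l2 (l2 H)) and a copy of l2 (l2 H) itself. *)
Lemma swindle (R : realType) (H K : hilbert R) (m : nat -> H -> K) (m' : nat -> K -> H)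
    (e : nat -> H -> l2 (l2 H)) (f : nat -> K -> l2 (l2 K)) :
  pair_basis e -> pair_basis f ->
  (forall i, bounded_op (m i)) -> (forall i, adjoint (m i) = m' i) ->
  (forall n y, \sum_(i < n) hnorm (m' i y) ^+ 2 <= hnorm y ^+ 2) ->
  (forall s, tends0 (fun n => onrm ((\sum_(i < n) (m i \o m' i \o m s)) - m s))) ->
  exists (al : l2 (l2 H) -> l2 (l2 K)) (al' : l2 (l2 K) -> l2 (l2 H))
    (be be' : l2 (l2 H) -> l2 (l2 H)),
  [/\ [/\ bounded_op al, bounded_op be, adjoint al = al' & adjoint be = be'],
      [/\ forall x, al' (al x) + be' (be x) = x, forall x, al (be' x) = 0,
          forall x, be (al' x) = 0 & forall x, be (be' x) = x]
    & forall (G : hilbert R) (S : set (G -> H)) T, compatible m m' S T ->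
      [/\ moves al (amplify e S) (amplify f T), moves al' (amplify f T) (amplify e S),
          moves be (amplify e S) (amplify e S), moves be' (amplify e S) (amplify e S)
        & forall c, amplify f T c -> al \o al' \o c = c]].
Proof.
move=> [he en ne] [hf fn nf] bm mm' contr lim_m.
have [J [bJ PJs PJ JPJ JT]] := row_operator bm mm' contr lim_m.
pose P := adjoint J; have bP : bounded_op P := adjoint_bounded bJ.
have aP : adjoint P = J by exact: adjointK.
have [lP _] := bP; have [lJ _] := bJ.
have PJP y : P (J (P y)) = P y.
  have Px z x : rdot (P z) x = rdot z (J x) by rewrite rdotC -(adjointP bJ) rdotC.
  by apply: rdot_inj => x; rewrite Px (adjointP bJ) Px JPJ -Px.
have [W [bW W'W WW' Wf W'f]] := basis_unitary hf.
pose Q := J \o P; have bQ : bounded_op Q by exact: bounded_comp.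
have aQ : adjoint Q = Q by rewrite adjoint_comp // aP.
pose Q1 := id - Q.
have bQ1 : bounded_op Q1 by apply: (subB (bounded_lin _ _)) => //; exact: bounded_id.
have aQ1 : adjoint Q1 = Q1.
  rewrite adjointB // ?aQ; last exact: bounded_id.
  by congr (_ - _); apply: adjoint_unique => //; exact: bounded_id.
have QQ x : Q (Q x) = Q x by rewrite /Q /= JPJ.
have [lQ _] := bQ.
have Q1E x : Q1 x = x - Q x by rewrite /Q1 !fctE.
have QQ1 x : Q (Q1 x) = 0 by rewrite Q1E (linB lQ) QQ subrr.
have Q1Q x : Q1 (Q x) = 0 by rewrite Q1E QQ subrr.
have Q1Q1 x : Q1 (Q1 x) = Q1 x by rewrite [LHS]Q1E QQ1 subr0.
(* Even slots feed [al] and odd ones the [Q] part of [be]. The primed maps are the partial inverses,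
   empty on the wrong parity. *)
pose s0 n := Some n.*2; pose s0' k := if odd k then None else Some k./2.
pose s1 n := Some n.*2.+1; pose s1' k := if odd k then Some k./2 else None.
have i0 : partial_inverse s0 s0'.
  move=> n k; rewrite /s0 /s0'; split=> [[<-]|]; first by rewrite odd_double doubleK.
  case: ifP => // ok [<-]; congr Some.
  by rewrite -[RHS]odd_double_half ok.
have i1 : partial_inverse s1 s1'.
  move=> n k; rewrite /s1 /s1'; split=> [[<-]|] /=; first by rewrite odd_double /= uphalf_double.
  case: ifP => // ok [<-]; congr Some.
  by rewrite -[RHS]odd_double_half ok.
have sym s s' : partial_inverse s s' -> partial_inverse s' s.
  by move=> h n k; have := h k n => -[h1 h2]; split.
have iS : partial_inverse Some Some by move=> n k; split=> -[->].
have [A bA hA] := slot_exists bP i0.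
have [A' bA' hA'] := slot_exists bJ (sym _ _ i0).
have [B1 bB1 hB1] := slot_exists bQ i1.
have [B1' bB1' hB1'] := slot_exists bQ (sym _ _ i1).
have [B2 bB2 hB2] := slot_exists bQ1 iS.
have aA : adjoint A = A' by apply: (slot_adjoint bP i0) => // n g; rewrite hA' aP.
have aB1 : adjoint B1 = B1' by apply: (slot_adjoint bQ i1) => // n g; rewrite hB1' aQ.
have aB2 : adjoint B2 = B2 by apply: (slot_adjoint bQ1 iS) => // n g; rewrite hB2 aQ1.
have bW' := adjoint_bounded bW.
have [lQ1 _] := bQ1.
(* The [Q1] part of a slot is invisible to [al], so [be] keeps it in place. The [Q] part of the even
   slots is left to [al], and that of the odd slots is spread over all slots. *)
pose be := B1 + B2; pose be' := B1' + B2.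
exists (adjoint W \o A), (A' \o W), be, be'.
have bal : bounded_op (adjoint W \o A) by exact: bounded_comp.
have bal' : bounded_op (A' \o W) by exact: bounded_comp.
have bbe : bounded_op be by apply: (subD (bounded_lin _ _)).
have bbe' : bounded_op be' by apply: (subD (bounded_lin _ _)).
split.
- split=> //; first by rewrite adjoint_comp // adjointK // aA.
  apply: adjoint_unique => // x y; rewrite /be /be' !fctE rdotDl rdotDr.
  by rewrite (adjointP bB1) (adjointP bB2) aB1 aB2.
- have bec n x : l2_coord n (be x) = Q (l2_coord n.*2.+1 x) + Q1 (l2_coord n x).
    by rewrite /be fctE /l2_coord l2_valD -![l2_val _ n]/(l2_coord n _) hB1 hB2.
  have bec' n x : l2_coord n (be' x) =
      (if odd n then Q (l2_coord n./2 x) else 0) + Q1 (l2_coord n x).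
    rewrite /be' fctE /l2_coord l2_valD -![l2_val _ n]/(l2_coord n _) hB1' hB2 /s1'.
    by case: (odd n).
  have Ac n x : l2_coord n (A x) = P (l2_coord n.*2 x) by rewrite hA.
  have A'c n x : l2_coord n (A' x) = if odd n then 0 else J (l2_coord n./2 x).
    by rewrite hA' /s0'; case: (odd n).
  split=> x.
  + apply: l2_eqP => n; rewrite /l2_coord l2_valD -![l2_val _ n]/(l2_coord n _).
    rewrite bec' !compE WW' A'c !bec Ac.
    case: ifP => on.
      rewrite add0r (linD lQ) (linD lQ1) QQ QQ1 Q1Q Q1Q1 addr0 add0r.
      have -> : n./2.*2.+1 = n by rewrite -[RHS]odd_double_half on.
      by rewrite Q1E subrKC.
    rewrite add0r (linD lQ1) Q1Q Q1Q1 add0r.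
    have -> : n./2.*2 = n by rewrite -[RHS]odd_double_half on.
    by rewrite Q1E -[J (P _)]/(Q _) subrKC.
  + rewrite compE -[RHS](lin0 (proj1 bW')); congr (adjoint W _).
    apply: l2_eqP => n; rewrite Ac bec' odd_double add0r Q1E (linB lP).
    by rewrite /Q compE PJP subrr /l2_coord l2_val0.
  + apply: l2_eqP => n; rewrite bec compE !A'c oddS odd_double (lin0 lQ) add0r.
    rewrite [RHS]l2_val0; case: ifP => _; first exact: (lin0 lQ1).
    by rewrite Q1E /Q !compE JPJ subrr.
  + apply: l2_eqP => n; rewrite bec !bec' oddS odd_double -[_.+1./2]/(uphalf _) uphalf_double.
    rewrite (linD lQ) (linD lQ1) QQ QQ1 Q1Q1 addr0.
    by case: ifP => _; rewrite ?Q1Q ?(lin0 lQ1) add0r Q1E subrKC.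
- move=> G S T cST; have [csS csT mST mTS lim] := cST.
  have csA := amplify_cs he csS; have csF := amplify_cs hf csT.
  have A0 : amplify e S 0 := sub0 (cs_lin csA).
  have F0 : amplify f T 0 := sub0 (cs_lin csF).
  have hs := l2_hbasis H.
  have single_moves n : moves (l2_single n) (amplify (@l2_single R H) S) (amplify e S).
    apply: (amplify_moves hs csS (l2_single_bounded _ n) csA) => i s Ss.
    have [j hj] := en n i.
    by rewrite compA -hj; exact: amplify_mem.
  (* [Q \o l2_single i \o s] is [J] applied to [m i \o s], an element of [T], so that [JT]
     applies. *)
  have Qmem i s : S s -> amplify (@l2_single R H) S (Q \o l2_single i \o s).
    move=> Ss; rewrite -[_ \o _]/(J \o (P \o l2_single i \o s)).
    apply: (JT _ _ T) => //.
    have -> : P \o l2_single i \o s = m i \o s by apply/funext => x /=; rewrite /P PJs.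
    exact: mST.
  have Q1mem i s : S s -> amplify (@l2_single R H) S (Q1 \o l2_single i \o s).
    move=> Ss; have -> : Q1 \o l2_single i \o s = (l2_single i \o s) - (Q \o l2_single i \o s).
      by apply/funext => x; rewrite /= Q1E !fctE.
    apply: (subB (cs_lin (amplify_cs hs csS))); last exact: Qmem.
    exact: amplify_mem.
  split.
  + apply: (amplify_moves he csS bal csF) => j s Ss; have [n [i ->]] := ne j.
    case E : (s0' n) => [k|].
      have -> : (adjoint W \o A) \o (l2_single n \o l2_single i \o s) = f k \o (m i \o s).
        by apply/funext => x /=; rewrite (slot_single lP i0 hA) E W'f /P PJs.
      by apply: amplify_mem => //; exact: mST.
    have -> // : (adjoint W \o A) \o (l2_single n \o l2_single i \o s) = 0.
    by apply/funext => x /=; rewrite (slot_single lP i0 hA) E (lin0 (proj1 bW')).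
  + apply: (amplify_moves hf csT bal' csA) => j b Tb.
    have -> : (A' \o W) \o (f j \o b) = l2_single j.*2 \o (J \o b).
      by apply/funext => x /=; rewrite Wf (slot_single lJ (sym _ _ i0) hA').
    by apply: single_moves; exact: JT Tb.
  + apply: (amplify_moves he csS bbe csA) => j s Ss; have [n [i ->]] := ne j.
    have -> : be \o (l2_single n \o l2_single i \o s) =
       (if s1' n is Some k then l2_single k \o (Q \o l2_single i \o s) else 0) +
       (l2_single n \o (Q1 \o l2_single i \o s)).
      apply/funext => x; rewrite /be /be' /= !fctE (slot_single lQ i1 hB1) (slot_single lQ1 iS hB2).
      by case: (s1' n).
    apply: (subD (cs_lin csA)); last exact: (single_moves _ _ (Q1mem _ _ Ss)).
    case: (s1' n) => [k|]; last exact: A0.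
    exact: (single_moves _ _ (Qmem _ _ Ss)).
  + apply: (amplify_moves he csS bbe' csA) => j s Ss; have [n [i ->]] := ne j.
    have -> : be' \o (l2_single n \o l2_single i \o s) =
       (l2_single n.*2.+1 \o (Q \o l2_single i \o s)) +
       (l2_single n \o (Q1 \o l2_single i \o s)).
      apply/funext => x; rewrite /be /be' /= !fctE (slot_single lQ (sym _ _ i1) hB1').
      by rewrite (slot_single lQ1 iS hB2).
    apply: (subD (cs_lin csA)); first exact: (single_moves _ _ (Qmem _ _ Ss)).
    exact: (single_moves _ _ (Q1mem _ _ Ss)).
  + apply: (amplify_fixes hf csT (bounded_comp bal bal')) => j b Tb; apply/funext => x /=.
    rewrite Wf (slot_single lJ (sym _ _ i0) hA') /= (slot_single lP i0 hA) /s0' odd_double.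
    rewrite doubleK W'f /P PJ //.
    have bb := cs_bounded csT Tb.
    apply: (tends0_le (g := fun n => hnorm x * onrm ((\sum_(i < n) (m i \o m' i \o b)) - b))).
      move=> n; rewrite mulrC.
      have bd : bounded_op ((\sum_(i < n) (m i \o m' i \o b)) - b).
        apply: (subB (bounded_lin G K)) => //; apply: (sub_sum (bounded_lin G K)) => i _.
        by rewrite -mm'; exact: bounded_comp (bounded_comp (bm i) (adjoint_bounded (bm i))) bb.
      by apply: le_trans (onrmP x bd); rewrite !fctE fct_sumE.
    by apply: tends0M; [exact: hnorm_ge0|exact: lim].
Qed.

(** The mixed terms in the products of [V] and [V'] vanish, so [V' V = al' al + be' (ga ga') be] and
    [V V' = de' (al al') de + ga' ga]. The projections [ga ga'] and [al al'] are the identity on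
    columns over [S] and over [T], and what remains are the relations of the two swindles. As [ga']
    is a contraction, so is [V]. One [V] serves all compatible pairs, which is needed to multiply by
    it on both sides. *)
Lemma stable_intertwiner (R : realType) (H K : hilbert R) (m n : nat -> H -> K)
    (e : nat -> H -> l2 (l2 H)) (f : nat -> K -> l2 (l2 K)) :
  pair_basis e -> pair_basis f ->
  (forall i, bounded_op (m i)) -> (forall i, bounded_op (n i)) ->
  (forall k y, \sum_(i < k) hnorm (adjoint (m i) y) ^+ 2 <= hnorm y ^+ 2) ->
  (forall k x, \sum_(i < k) hnorm (n i x) ^+ 2 <= hnorm x ^+ 2) ->
  (forall s, tends0 (fun k => onrm ((\sum_(i < k) (m i \o adjoint (m i) \o m s)) - m s))) ->
  (forall s, tends0 (fun k =>
     onrm ((\sum_(i < k) (adjoint (n i) \o n i \o adjoint (n s))) - adjoint (n s)))) ->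
  exists V : l2 (l2 H) -> l2 (l2 K), [/\ bounded_op V, onrm V <= 1
    & forall (G : hilbert R) (S : set (G -> H)) (T : set (G -> K)),
      compatible m (fun i => adjoint (m i)) S T ->
      compatible (fun i => adjoint (n i)) n T S ->
      [/\ moves V (amplify e S) (amplify f T), moves (adjoint V) (amplify f T) (amplify e S),
          forall c, amplify e S c -> adjoint V \o V \o c = c
        & forall c, amplify f T c -> V \o adjoint V \o c = c]].
Proof.
move=> pe pf bm bn cm cn lm ln.
have bn' i := adjoint_bounded (bn i).
have [al [al' [be [be' [[bal bbe aal abe] [ab1 ab2 ab3 ab4] abm]]]]] :=
  swindle pe pf bm (fun i => erefl) cm lm.
have [ga [ga' [de [de' [[bga bde aga ade] [gd1 gd2 gd3 gd4] gdm]]]]] :=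
  swindle pf pe bn' (fun i => adjointK (bn i)) cn ln.
have bal' : bounded_op al' by rewrite -aal; exact: adjoint_bounded.
have bbe' : bounded_op be' by rewrite -abe; exact: adjoint_bounded.
have bga' : bounded_op ga' by rewrite -aga; exact: adjoint_bounded.
have bde' : bounded_op de' by rewrite -ade; exact: adjoint_bounded.
have [lga' _] := bga'; have [lde' _] := bde'; have [lal' _] := bal'; have [lbe' _] := bbe'.
have [lga _] := bga; have [lde _] := bde; have [lal _] := bal; have [lbe _] := bbe.
have b1 : bounded_op (de' \o al) by exact: bounded_comp.
have b2 : bounded_op (ga' \o be) by exact: bounded_comp.
have b3 : bounded_op (al' \o de) by exact: bounded_comp.
have b4 : bounded_op (be' \o ga) by exact: bounded_comp.
pose V := (de' \o al) + (ga' \o be); pose V' := (al' \o de) + (be' \o ga).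
have VE x : V x = de' (al x) + ga' (be x) by [].
have V'E x : V' x = al' (de x) + be' (ga x) by [].
have bV : bounded_op V by apply: (subD (bounded_lin _ _)).
have aV : adjoint V = V'.
  apply: adjoint_unique => // x y; rewrite VE V'E rdotDl rdotDr -aal -abe.
  rewrite -(adjointP bal) -(adjointP bbe) -ade -aga.
  rewrite ![rdot (adjoint _ _) _]rdotC -(adjointP bde) -(adjointP bga).
  by rewrite ![rdot _ (al _)]rdotC ![rdot _ (be _)]rdotC.
have V'V x : V' (V x) = al' (al x) + be' (ga (ga' (be x))).
  by rewrite V'E VE (linD lde) (linD lga) gd4 gd3 gd2 addr0 add0r.
have VV' x : V (V' x) = de' (al (al' (de x))) + ga' (ga x).
  by rewrite VE V'E (linD lal) (linD lbe) ab2 ab3 ab4 addr0 add0r.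
have pyth x : hnorm x ^+ 2 = hnorm (ga x) ^+ 2 + hnorm (de x) ^+ 2.
  rewrite !sqr_hnorm -[X in rdot _ X = _](gd1 x) rdotDr -aga -ade.
  by rewrite -(adjointP bga) -(adjointP bde).
have pyth' x : hnorm x ^+ 2 = hnorm (al x) ^+ 2 + hnorm (be x) ^+ 2.
  rewrite !sqr_hnorm -[X in rdot _ X = _](ab1 x) rdotDr -aal -abe.
  by rewrite -(adjointP bal) -(adjointP bbe).
have nga y : hnorm (ga' y) <= hnorm y.
  have h : onrm ga <= 1.
    apply: onrm_le => // x; rewrite mul1r; apply: ler_sqr_norm; first exact: hnorm_ge0.
    by rewrite pyth lerDl sqr_ge0.
  apply: le_trans (onrmP _ bga') _; rewrite -aga onrm_adjoint //.
  by rewrite ler_piMl ?hnorm_ge0.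
have nV : onrm V <= 1.
  apply: onrm_le => // x; rewrite mul1r; apply: ler_sqr_norm; first exact: hnorm_ge0.
  rewrite sqr_hnorm (adjointP bV) aV V'V rdotDr pyth' -aal -abe.
  rewrite -(adjointP bal) -(adjointP bbe) -sqr_hnorm lerD2l.
  rewrite rdotC (adjointP bga) aga -sqr_hnorm.
  by rewrite ler_pXn2r ?nnegrE ?hnorm_ge0.
exists V; rewrite aV; split=> // G S T cST cTS.
have [csS csT _ _ _] := cST.
have [he _ _] := pe; have [hf _ _] := pf.
have csA := amplify_cs he csS; have csF := amplify_cs hf csT.
have [al1 al2 be1 be2 alc] := abm G S T cST.
have [ga1 ga2 de1 de2 gac] := gdm G T S cTS.
split=> c hc.
- apply: (subD (cs_lin csF)); first exact: (de2 _ (al1 _ hc)).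
  exact: (ga2 _ (be1 _ hc)).
- apply: (subD (cs_lin csA)); first exact: (al2 _ (de1 _ hc)).
  exact: (be2 _ (ga1 _ hc)).
- apply/funext => x /=; rewrite -/(V (c x)) -/(V' (V (c x))) V'V.
  have /(congr1 (@^~ x)) /= -> := gac _ (be1 _ hc).
  exact: ab1.
- apply/funext => x /=; rewrite -/(V' (c x)) -/(V (V' (c x))) VV'.
  have /(congr1 (@^~ x)) /= -> := alc _ (de1 _ hc).
  by rewrite addrC; exact: gd1.
Qed.

(** * Infinite matrices realised as operators *)

Section Corners.
Variables (R : realType).

Definition star (G H : hilbert R) (S : set (G -> H)) : set (H -> G) :=
  [set T | bounded_op T /\ S (adjoint T)].

Lemma star_cs (G H : hilbert R) (S : set (G -> H)) :
  closed_subspace S -> closed_subspace (star S).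
Proof.
move=> csS; apply: (preimage_cs (theta := Num.conj) (c := 1)) => //.
- exact: adjoint_bounded.
- exact: adjoint_linear_comb.
- by move=> T bT; rewrite mul1r onrm_adjoint.
Qed.

Lemma starK (G H : hilbert R) (S : set (G -> H)) :
  S `<=` @bounded_op R G H -> star (star S) = S.
Proof.
move=> bS; apply/seteqP; split=> T; first by move=> [bT [_]]; rewrite adjointK.
move=> ST; have bT := bS _ ST; split=> //; split; first exact: adjoint_bounded.
by rewrite adjointK.
Qed.

(** The norm closure of the finitely supported infinite matrices over [S]:
    [f i \o s \o adjoint (e j)] is the matrix with the single entry [s] in row [i] and column
    [j]. *)
Definition corner (G H L L' : hilbert R) (f : nat -> H -> L') (S : set (G -> H))
    (e : nat -> G -> L) : set (L -> L') :=
  closed_span (op_products (op_products (range f) S) (adjoints (range e))).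

Variables (G H L L' : hilbert R) (f : nat -> H -> L') (S : set (G -> H)) (e : nat -> G -> L).
Hypotheses (hf : hbasis f) (he : hbasis e) (csS : closed_subspace S).

Lemma corner_gen_bounded :
  op_products (op_products (range f) S) (adjoints (range e)) `<=` @bounded_op R L L'.
Proof.
move=> _ [_ [_ [[_ [s [[i _ <-] Ss ->]]] [_ [j _ <-] <-] ->]]].
apply: bounded_comp; last exact: adjoint_bounded (hb_bounded he j).
by apply: bounded_comp; [exact: hb_bounded hf i|exact: (cs_bounded csS)].
Qed.

Lemma corner_cs : closed_subspace (corner f S e).
Proof. exact/closed_span_cs/corner_gen_bounded. Qed.

Lemma corner_mem i s j : S s -> corner f S e (f i \o s \o adjoint (e j)).
Proof.
move=> Ss; apply: closed_span_incl; first exact: corner_gen_bounded.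
exists (f i \o s), (adjoint (e j)); split=> //; first by exists (f i), s.
by exists (e j).
Qed.

Lemma corner_min (P : set (L -> L')) : closed_subspace P ->
  (forall i s j, S s -> P (f i \o s \o adjoint (e j))) -> corner f S e `<=` P.
Proof.
move=> csP h; apply: closed_span_min => //.
by move=> _ [_ [_ [[_ [s [[i _ <-] Ss ->]]] [_ [j _ <-] <-] ->]]]; exact: h.
Qed.

Lemma corner_amplify c j : amplify f S c -> corner f S e (c \o adjoint (e j)).
Proof.
move=> hc; have bj := adjoint_bounded (hb_bounded he j).
have cs := sandwich_cs (bounded_id L') bj corner_cs.
have := @closed_span_min _ _ _ (op_products (range f) S) _ cs.
move=> /(_ _ c hc)[|_]; last by [].
move=> _ [_ [s [[i _ <-] Ss ->]]]; split; last exact: corner_mem.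
by apply: bounded_comp; [exact: hb_bounded hf i|exact: (cs_bounded csS)].
Qed.

End Corners.

Section CornerMaps.
Variables (R : realType).

Lemma corner_moves (G H H' L L1 L2 : hilbert R) (f : nat -> H -> L1) (S : set (G -> H))
    (f' : nat -> H' -> L2) (S' : set (G -> H')) (e : nat -> G -> L) (T : L1 -> L2) :
  hbasis f -> hbasis f' -> hbasis e -> closed_subspace S -> closed_subspace S' ->
  bounded_op T -> moves T (amplify f S) (amplify f' S') ->
  forall y, corner f S e y -> corner f' S' e (T \o y).
Proof.
move=> hf hf' he csS csS' bT mT y hy.
have cs := sandwich_cs bT (bounded_id L) (corner_cs hf' he csS').
have [|_] := corner_min cs _ hy; last by [].
move=> i s j Ss; split; first exact: (cs_bounded (corner_cs hf he csS) (corner_mem _ _ _ _ _ Ss)).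
have := corner_amplify hf' he csS' j (mT _ (amplify_mem i hf csS Ss)).
by [].
Qed.

Lemma corner_fixes (G H L L' : hilbert R) (f : nat -> H -> L') (S : set (G -> H))
    (e : nat -> G -> L) (T : L' -> L') : hbasis f -> hbasis e -> closed_subspace S ->
  bounded_op T -> (forall c, amplify f S c -> T \o c = c) ->
  forall y, corner f S e y -> T \o y = y.
Proof.
move=> hf he csS bT fT; apply: (fixes_span bT (corner_gen_bounded hf he csS)).
move=> _ [_ [_ [[_ [s [[i _ <-] Ss ->]]] [_ [j _ <-] <-] ->]]].
by rewrite [LHS]compA (fT (f i \o s)) //; exact: amplify_mem.
Qed.

(** Adjoints turn multiplication on the right into multiplication on the left, so [moves] and
    [amplify] need no right-handed counterpart. *)
Lemma corner_adjoint (G H L L' : hilbert R) (f : nat -> H -> L') (S : set (G -> H))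
    (e : nat -> G -> L) : hbasis f -> hbasis e -> closed_subspace S ->
  forall y, corner f S e y -> corner e (star S) f (adjoint y).
Proof.
move=> hf he csS y hy; have csS' := star_cs csS.
have cs := star_cs (corner_cs he hf csS').
have [|_] := corner_min cs _ hy; last by [].
move=> i s j Ss; have bs := cs_bounded csS Ss.
have bi := hb_bounded hf i; have bj := hb_bounded he j.
split; first exact: (cs_bounded (corner_cs hf he csS) (corner_mem _ _ _ _ _ Ss)).
rewrite adjoint_comp ?adjointK //; [|exact: bounded_comp|exact: adjoint_bounded].
rewrite adjoint_comp // compA; apply: corner_mem => //.
by split; [exact: adjoint_bounded|rewrite adjointK].
Qed.

Lemma corner_fixes_right (G H L L' : hilbert R) (f : nat -> H -> L') (S : set (G -> H))
    (e : nat -> G -> L) (T : L -> L) : hbasis f -> hbasis e -> closed_subspace S ->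
  bounded_op T -> adjoint T = T -> (forall c, amplify e (star S) c -> T \o c = c) ->
  forall y, corner f S e y -> y \o T = y.
Proof.
move=> hf he csS bT aT fT y hy; have by0 := cs_bounded (corner_cs hf he csS) hy.
rewrite -[RHS](adjointK by0) -(corner_fixes he hf (star_cs csS) bT fT
  (corner_adjoint hf he csS hy)).
rewrite adjoint_comp ?adjointK ?aT //; exact: adjoint_bounded.
Qed.

Lemma corner_moves_right (G G' H L L1 L2 : hilbert R) (f : nat -> H -> L) (S : set (G -> H))
    (e' : nat -> G' -> L2) (S' : set (G' -> H)) (e : nat -> G -> L1) (T : L1 -> L2) :
  hbasis f -> hbasis e -> hbasis e' -> closed_subspace S -> closed_subspace S' ->
  bounded_op T -> moves T (amplify e (star S)) (amplify e' (star S')) ->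
  forall y, corner f S e y -> corner f S' e' (y \o adjoint T).
Proof.
move=> hf he he' csS csS' bT mT y hy.
have by0 := cs_bounded (corner_cs hf he csS) hy.
have cs1 := star_cs csS; have cs2 := star_cs csS'.
have := corner_adjoint he' hf cs2
  (corner_moves he he' hf cs1 cs2 bT mT (corner_adjoint hf he csS hy)).
rewrite starK; last exact: cs_bounded.
by rewrite adjoint_comp ?adjointK //; exact: adjoint_bounded.
Qed.

Variables (H K : hilbert R) (m n : nat -> H -> K).
Variables (A : set (H -> H)) (Z : set (H -> K)) (X : set (K -> H)) (B : set (K -> K)).

Let m' i := adjoint (m i).
Let n' i := adjoint (n i).

(** Conjugation by [V] passes from [A] to [B] through [Z], and conjugation back passes through [X].
    Multiplication on the left uses the pairs [A], [Z] and [X], [B]; on the right it is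
    multiplication on the left of the adjoints, hence the starred pairs. *)
Record linked : Prop := Linked {
  lk_AZ : compatible m m' A Z; lk_ZA : compatible n' n Z A;
  lk_XB : compatible m m' X B; lk_BX : compatible n' n B X;
  lk_AX : compatible m m' (star A) (star X); lk_XA : compatible n' n (star X) (star A);
  lk_ZB : compatible m m' (star Z) (star B); lk_BZ : compatible n' n (star B) (star Z) }.

Lemma corner_equivalence (e : nat -> H -> l2 (l2 H)) (f : nat -> K -> l2 (l2 K)) :
  pair_basis e -> pair_basis f -> linked ->
  (forall i, bounded_op (m i)) -> (forall i, bounded_op (n i)) ->
  (forall k y, \sum_(i < k) hnorm (adjoint (m i) y) ^+ 2 <= hnorm y ^+ 2) ->
  (forall k x, \sum_(i < k) hnorm (n i x) ^+ 2 <= hnorm x ^+ 2) ->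
  (forall s, tends0 (fun k => onrm ((\sum_(i < k) (m i \o adjoint (m i) \o m s)) - m s))) ->
  (forall s, tends0 (fun k =>
     onrm ((\sum_(i < k) (adjoint (n i) \o n i \o adjoint (n s))) - adjoint (n s)))) ->
  exists V : l2 (l2 H) -> l2 (l2 K), [/\ bounded_op V, onrm V <= 1,
      forall y, corner e A e y -> corner f B f (V \o y \o adjoint V),
      forall y, corner f B f y -> corner e A e (adjoint V \o y \o V)
    & (forall y, corner e A e y ->
         adjoint V \o V \o y = y /\ y \o (adjoint V \o V) = y) /\
      (forall y, corner f B f y ->
         V \o adjoint V \o y = y /\ y \o (V \o adjoint V) = y)].
Proof.
move=> pe pf [AZ ZA XB BX AX XA ZB BZ] bm bn cm cn lm ln.
have [V [bV nV hV]] := stable_intertwiner pe pf bm bn cm cn lm ln.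
have bV' := adjoint_bounded bV.
have [he _ _] := pe; have [hf _ _] := pf.
have [AZ1 AZ2 AZ3 AZ4] := hV _ _ _ AZ ZA.
have [XB1 XB2 XB3 XB4] := hV _ _ _ XB BX.
have [AX1 AX2 AX3 AX4] := hV _ _ _ AX XA.
have [ZB1 ZB2 ZB3 ZB4] := hV _ _ _ ZB BZ.
have [csA csZ _ _ _] := AZ; have [csX csB _ _ _] := XB.
have bVV := bounded_comp bV bV'; have bV'V := bounded_comp bV' bV.
have aVV : adjoint (V \o adjoint V) = V \o adjoint V by rewrite adjoint_comp // adjointK.
have aV'V : adjoint (adjoint V \o V) = adjoint V \o V by rewrite adjoint_comp // adjointK.
exists V; split; [exact: bV|exact: nV|..].
- move=> y hy; apply: (corner_moves_right hf he hf csZ csB bV ZB1).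
  exact: (corner_moves he hf he csA csZ bV AZ1).
- move=> y hy; rewrite -{2}(adjointK bV).
  apply: (corner_moves_right he hf he csX csA bV' AX2).
  exact: (corner_moves hf he hf csB csX bV' XB2).
- split=> y hy; split.
  + exact: (corner_fixes he he csA bV'V AZ3).
  + exact: (corner_fixes_right he he csA bV'V aV'V AX3).
  + exact: (corner_fixes hf hf csB bVV XB4).
  + exact: (corner_fixes_right hf hf csB bVV aVV ZB4).
Qed.

End CornerMaps.

(** * Approximate identities on closed spans and on their adjoints *)

Section Limits.
Variables (R : realType) (H K : hilbert R) (p : nat -> H -> K) (q : nat -> K -> H).
Variable P : set (H -> K).
Hypotheses (bp : forall i, bounded_op (p i)) (bq : forall i, bounded_op (q i))
  (bP : P `<=` @bounded_op R H K)
  (contr : forall k, onrm (\sum_(i < k) (p i \o q i)) <= 1)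
  (lim : forall f, P f ->
     tends0 (fun k => onrm (\sum_(i < k) (p i \o q i \o f) - f))).

Let N k := \sum_(i < k) (p i \o q i).
Let ev : set_system (K -> K) := N @ \oo.

Let fev : Filter ev. Proof. exact: fmap_filter. Qed.

Let NE (G : hilbert R) k (z : G -> K) : N k \o z = \sum_(i < k) (p i \o q i \o z).
Proof. by apply/funext => x; rewrite /N /= !fct_sumE. Qed.

Let bN k : bounded_op (N k).
Proof. by apply: (sub_sum (bounded_lin K K)) => i _; exact: bounded_comp. Qed.

Let approxE (G : hilbert R) (z : G -> K) : @approximated R K ev G z <->
  bounded_op z /\ tends0 (fun k => onrm (\sum_(i < k) (p i \o q i \o z) - z)).
Proof.
split=> -[bz h]; split=> // e e0.
  by have [k _ hk] := h e e0; exists k => j /hk; rewrite /= NE.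
by have [k hk] := h e e0; exists k => // j /= /hk; rewrite NE.
Qed.

Let evc : ev [set T | bounded_op T /\ onrm T <= 1].
Proof. by exists 0%N => // k _; split; [exact: bN|exact: contr]. Qed.

(** The leftmost factor lies in [P], next to which the sums of the [p i \o q i] tend to the identity
    in norm. *)
Definition starting (G : hilbert R) (z : G -> K) :=
  exists f, exists2 y : G -> H, P f /\ bounded_op y & z = f \o y.

Let approx_starting (G : hilbert R) (z : G -> K) : starting z -> @approximated R K ev G z.
Proof.
move=> [f [y [Pf by0] ->]]; apply/approxE; split; first exact: bounded_comp (bP Pf) by0.
apply: (tends0_le (g := fun k => onrm y * onrm (\sum_(i < k) (p i \o q i \o f) - f))).
  move=> k; rewrite mulrC.
  have bd : bounded_op (\sum_(i < k) (p i \o q i \o f) - f).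
    apply: (subB (bounded_lin H K)); last exact: bP.
    apply: (sub_sum (bounded_lin H K)) => i _.
    exact: bounded_comp (bounded_comp (bp i) (bq i)) (bP Pf).
  rewrite (_ : _ - _ = (\sum_(i < k) (p i \o q i \o f) - f) \o y); first exact: onrm_comp.
  by apply/funext => x; rewrite !fctE !fct_sumE.
by apply: tends0M; [exact: onrm_ge0|exact: lim].
Qed.

Lemma limit_span (G : hilbert R) (g : set (G -> K)) : g `<=` @starting G ->
  forall z, closed_span g z ->
  tends0 (fun k => onrm (\sum_(i < k) (p i \o q i \o z) - z)).
Proof.
move=> hg z hz.
have := closed_span_min (@approximated_cs R K ev fev evc G) (S := g).
by move=> /(_ (fun z gz => approx_starting (hg z gz)) z hz) /approxE[].
Qed.

Lemma limit_star (G : hilbert R) (g : set (K -> G)) :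
  (forall z, g z -> bounded_op z) -> (forall z, g z -> starting (adjoint z)) ->
  forall z, star (closed_span g) z ->
  tends0 (fun k => onrm (\sum_(i < k) (p i \o q i \o z) - z)).
Proof.
move=> bg hg z [bz hz].
have := closed_span_min (star_cs (@approximated_cs R K ev fev evc G)) (S := g).
move=> /(_ _ _ hz) []; last by move=> _; rewrite adjointK // => /approxE[].
by move=> y gy; split; [exact: bg|exact: approx_starting (hg _ gy)].
Qed.

Lemma compatible_span (G : hilbert R) (S : set (G -> H)) (g : set (G -> K)) :
  closed_subspace S -> closed_subspace (closed_span g) -> g `<=` @starting G ->
  (forall i s, S s -> closed_span g (p i \o s)) ->
  (forall i t, closed_span g t -> S (q i \o t)) ->
  compatible p q S (closed_span g).
Proof. by move=> csS csT hg hp hq; split=> //; exact: limit_span. Qed.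

Lemma compatible_star (G : hilbert R) (S : set (H -> G)) (g : set (K -> G)) :
  (forall i, adjoint (p i) = q i) ->
  closed_subspace S -> closed_subspace (closed_span g) ->
  (forall z, g z -> bounded_op z) -> (forall z, g z -> starting (adjoint z)) ->
  (forall i s, S s -> closed_span g (s \o q i)) ->
  (forall i t, closed_span g t -> S (t \o p i)) ->
  compatible p q (star S) (star (closed_span g)).
Proof.
move=> pq csS csT bg hg hp hq; split; try exact: star_cs.
- move=> i s [bs Ss]; split; first exact: bounded_comp.
  by rewrite adjoint_comp // pq; exact: hp.
- move=> i s [bs Ss]; split; first exact: bounded_comp.
  by rewrite adjoint_comp // -pq adjointK //; exact: hq.
- exact: limit_star.
Qed.

End Limits.

Section RiggedLinked.
Variables (R : realType) (H K : hilbert R) (M : set (H -> K)) (A : set (H -> H)).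
Variables (m n : nat -> H -> K).
Hypotheses (hM : TRO M) (bA : A `<=` @bounded_op R H H)
  (Mm : forall i, M (m i))
  (approx_m : forall f, M f ->
     tends0 (fun k => onrm (\sum_(i < k) (m i \o adjoint (m i) \o f) - f)))
  (contr_m : forall k, onrm (\sum_(i < k) (m i \o adjoint (m i))) <= 1)
  (Mn : forall i, M (n i))
  (approx_n : forall f, M f ->
     tends0 (fun k => onrm (\sum_(i < k) (f \o adjoint (n i) \o n i) - f)))
  (contr_n : forall k, onrm (\sum_(i < k) (adjoint (n i) \o n i)) <= 1).

Let bM f : M f -> bounded_op f. Proof. by case: hM => h _ _; exact: h. Qed.
Let bM' f : M f -> bounded_op (adjoint f).
Proof. by move=> /bM; exact: adjoint_bounded. Qed.
Let MMM' f g h : M f -> M g -> M h -> exists2 k, M k & adjoint f \o g \o adjoint h = adjoint k.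
Proof.
move=> Mf Mg Mh; have bf := bM Mf; have bg := bM Mg; have bh := bM Mh.
exists (h \o adjoint g \o f); first by case: hM => _ _; apply.
have bg' := bM' Mg.
by rewrite (adjoint_comp (bounded_comp bh bg') bf) (adjoint_comp bh bg') (adjointK bg) compA.
Qed.

Local Notation Z := (closed_span (genZ M A)).
Local Notation A0 := (closed_span (genA0 M A)).
Local Notation B := (closed_span (genB M A)).
Local Notation X := (closed_span (genX M A)).

Let bZ := genZ_bounded hM bA.
Let bA0 := genA0_bounded hM bA.
Let bB := genB_bounded hM bA.
Let bX := genX_bounded hM bA.

Lemma Z_adjM f z : M f -> Z z -> B (z \o adjoint f).
Proof.
move=> Mf; have := sandwich_cs (bounded_id K) (bM' Mf) (csB hM bA).
move=> /(closed_span_min (S := genZ M A)) h /h[] // z0 gz0; split; first exact: bZ.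
have [f1 [x [g [h1 [Mf1 Ax Mg Mh ->]]]]] := genZP gz0.
have [k Mk E] := MMM' Mg Mh Mf.
apply: closed_span_incl => //; have := genB_intro Mf1 Ax Mk; rewrite -E; exact.
Qed.

Lemma A0_adjM f z : M f -> A0 z -> X (z \o adjoint f).
Proof.
move=> Mf; have := sandwich_cs (bounded_id H) (bM' Mf) (csX hM bA).
move=> /(closed_span_min (S := genA0 M A)) h /h[] // z0 gz0; split; first exact: bA0.
have [f1 [f2 [x [g [h1 [Mf1 Mf2 Ax Mg [Mh ->]]]]]]] := genA0P gz0.
have [k Mk E] := MMM' Mg Mh Mf.
apply: closed_span_incl => //; have := genX_intro Mf1 Mf2 Ax Mk; rewrite -E; exact.
Qed.

Lemma B_M f z : M f -> B z -> Z (z \o f).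
Proof.
move=> Mf; have := sandwich_cs (bounded_id K) (bM Mf) (csZ hM bA).
move=> /(closed_span_min (S := genB M A)) h /h[] // z0 gz0; split; first exact: bB.
have [f1 [x [g [Mf1 Ax Mg ->]]]] := genBP gz0.
by apply: closed_span_incl => //; exact: (genZ_intro Mf1 Ax Mg Mf).
Qed.

Lemma X_M f z : M f -> X z -> A0 (z \o f).
Proof.
move=> Mf; have := sandwich_cs (bounded_id H) (bM Mf) (csA0 hM bA).
move=> /(closed_span_min (S := genX M A)) h /h[] // z0 gz0; split; first exact: bX.
have [f1 [f2 [x [g [Mf1 Mf2 Ax Mg ->]]]]] := genXP gz0.
by apply: closed_span_incl => //; exact: (genA0_intro Mf1 Mf2 Ax Mg Mf).
Qed.

Lemma approx_adj_n f : adjoints M f ->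
  tends0 (fun k => onrm (\sum_(i < k) (adjoint (n i) \o n i \o f) - f)).
Proof.
move=> [g Mg <-]; apply: tends0_le (approx_n Mg) => k; have bg := bM Mg.
have bs : forall i : 'I_k, bounded_op (g \o adjoint (n i) \o n i).
  by move=> i; apply: bounded_comp; [apply: bounded_comp => //; exact: bM'|exact: bM].
have bs' : bounded_op (\sum_(i < k) (g \o adjoint (n i) \o n i)).
  by apply: (sub_sum (bounded_lin H K)) => i _.
rewrite -(onrm_adjoint (T := _ - g)); last exact: (subB (bounded_lin H K)).
rewrite adjointB // adjoint_sum //.
rewrite [X in _ <= onrm (X - _)](eq_bigr (fun i : 'I_k => adjoint (n i) \o n i \o adjoint g)) // => i _.
have bi := bM (Mn i); have bi' := bM' (Mn i).
by rewrite (adjoint_comp (bounded_comp bg bi') bi) (adjoint_comp bg bi') (adjointK bi).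
Qed.

Let bP' : adjoints M `<=` @bounded_op R K H.
Proof. by move=> _ [f Mf <-]; exact: bM'. Qed.

(** Which approximate identity applies is decided by leftmost factors. Generators of [Z] and [B]
    begin in [M], those of [A0] and [X] in [M^*]; adjoints of generators of [X] and [B] begin in
    [M], those of [A0] and [Z] in [M^*]. *)
Lemma rigged_linked : linked m n A0 Z X B.
Proof.
have bm i := bM (Mm i); have bn i := bM (Mn i).
have bm' i := bM' (Mm i); have bn' i := bM' (Mn i).
have cA := csA0 hM bA; have cZ := csZ hM bA; have cX := csX hM bA; have cB := csB hM bA.
have sM := compatible_span bm bm' bM contr_m approx_m.
have sN := compatible_span bn' bn bP' contr_n approx_adj_n.
have tM := compatible_star bm bm' bM contr_m approx_m.
have tN := compatible_star bn' bn bP' contr_n approx_adj_n.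
split.
- apply: sM => //.
  + move=> _ /genZP[f [x [g [h [Mf Ax Mg Mh ->]]]]]; exists f, (x \o (adjoint g \o h)) => //.
    split=> //; apply: bounded_comp; first exact: bA.
    by apply: bounded_comp; [exact: bM'|exact: bM].
  + by move=> i s; exact: M_A0.
  + by move=> i s; exact: adjM_Z.
- apply: sN => //.
  + move=> _ /genA0P[f [f' [x [g [h [Mf Mf' Ax Mg [Mh ->]]]]]]].
    exists (adjoint f), (f' \o x \o (adjoint g \o h)) => //.
    split; first by exists f.
    apply: bounded_comp; first by apply: bounded_comp; [exact: bM|exact: bA].
    by apply: bounded_comp; [exact: bM'|exact: bM].
  + by move=> i s; exact: adjM_Z.
  + by move=> i s; exact: M_A0.
- apply: sM => //.
  + move=> _ /genBP[f [x [g [Mf Ax Mg ->]]]]; exists f, (x \o adjoint g) => //.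
    by split=> //; apply: bounded_comp; [exact: bA|exact: bM'].
  + by move=> i s; exact: M_X.
  + by move=> i s; exact: adjM_B.
- apply: sN => //.
  + move=> _ /genXP[f [f' [x [g [Mf Mf' Ax Mg ->]]]]].
    exists (adjoint f), (f' \o x \o adjoint g) => //; split; first by exists f.
    by apply: bounded_comp; [apply: bounded_comp; [exact: bM|exact: bA]|exact: bM'].
  + by move=> i s; exact: adjM_B.
  + by move=> i s; exact: M_X.
- apply: tM => //.
  + move=> _ /genXP[f [f' [x [g [Mf Mf' Ax Mg ->]]]]].
    have b1 : bounded_op (adjoint f \o f' \o x).
      apply: bounded_comp; last exact: bA.
      by apply: bounded_comp; [exact: bM'|exact: bM].
    exists g, (adjoint (adjoint f \o f' \o x)); last first.
      by rewrite adjoint_comp ?adjointK //; [exact: bM|exact: bM'].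
    by split=> //; exact: adjoint_bounded.
  + by move=> i s; exact: A0_adjM.
  + by move=> i s; exact: X_M.
- apply: tN => //.
  + by move=> i; exact: adjointK.
  + move=> _ /genA0P[f [f' [x [g [h [Mf Mf' Ax Mg [Mh ->]]]]]]].
    have b1 : bounded_op (adjoint f \o f' \o x \o adjoint g).
      apply: bounded_comp; last exact: bM'.
      apply: bounded_comp; last exact: bA.
      by apply: bounded_comp; [exact: bM'|exact: bM].
    exists (adjoint h), (adjoint (adjoint f \o f' \o x \o adjoint g)).
      by split; [exists h|exact: adjoint_bounded].
    by rewrite -adjoint_comp //; exact: bM.
  + by move=> i s; exact: X_M.
  + by move=> i s; exact: A0_adjM.
- apply: tM => //.
  + move=> _ /genBP[f [x [g [Mf Ax Mg ->]]]].
    have b1 : bounded_op (f \o x) by apply: bounded_comp; [exact: bM|exact: bA].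
    exists g, (adjoint (f \o x)); last first.
      by rewrite adjoint_comp ?adjointK //; [exact: bM|exact: bM'].
    by split=> //; exact: adjoint_bounded.
  + by move=> i s; exact: Z_adjM.
  + by move=> i s; exact: B_M.
- apply: tN => //.
  + by move=> i; exact: adjointK.
  + move=> _ /genZP[f [x [g [h [Mf Ax Mg Mh ->]]]]].
    have b1 : bounded_op (f \o x \o adjoint g).
      apply: bounded_comp; last exact: bM'.
      by apply: bounded_comp; [exact: bM|exact: bA].
    exists (adjoint h), (adjoint (f \o x \o adjoint g)).
      by split; [exists h|exact: adjoint_bounded].
    by rewrite -adjoint_comp //; exact: bM.
  + by move=> i s; exact: B_M.
  + by move=> i s; exact: Z_adjM.
Qed.

End RiggedLinked.

(** * Infinite matrices *)

Section BlockIndices.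
Variables (V : nmodType) (p n : nat).

Lemma sum_block (F : 'I_p -> 'I_n -> V) :
  \sum_(s < (\sum_(i < p) n)%N) F (tagnat.sig1 s) (tagnat.sig2 s) = \sum_i \sum_k F i k.
Proof.
rewrite sig_big_dep /= (reindex _ (@tagnat.sig_bij_on p (fun=> n))) /=.
exact: eq_bigr.
Qed.

Lemma sum_rank (F : 'I_(\sum_(i < p) n) -> V) :
  \sum_s F s = \sum_i \sum_k F (@tagnat.Rank p (fun=> n) i k).
Proof. by rewrite -sum_block; apply: eq_bigr => s _; rewrite tagnat.sig2K. Qed.

End BlockIndices.

Section Truncations.
Variables (R : realType) (H K : hilbert R) (p q n : nat).
Implicit Type T : 'M[nat -> nat -> H -> K]_(p, q).

Lemma truncationE T s t : truncation n T s t =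
  T (tagnat.sig1 s) (tagnat.sig1 t) (tagnat.sig2 s) (tagnat.sig2 t).
Proof. by rewrite !mxE. Qed.

(** The block index of [\mxblock] is traded for a pair of indices, so that later estimates are about
    double sums. *)
Lemma truncation_le T c : 0 <= c ->
  (forall x : 'I_q -> 'I_n -> H,
    \sum_i \sum_(k < n) hnorm (\sum_j \sum_(l < n) T i j k l (x j l)) ^+ 2 <=
    c ^+ 2 * \sum_j \sum_l hnorm (x j l) ^+ 2) -> opnorm (truncation n T) <= c.
Proof.
move=> c0 h; apply: opnorm_le => // x.
rewrite -(@ler_pXn2r _ 2) ?nnegrE ?mulr_ge0 ?vn_ge0 // exprMn !sqr_vn.
pose y j l := x (@tagnat.Rank q (fun=> n) j l).
rewrite (sum_rank (fun s => hnorm (x s) ^+ 2)); apply: le_trans (h y).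
rewrite -(sum_block (fun i (k : 'I_n) => hnorm (\sum_j \sum_(l < n) T i j k l (y j l)) ^+ 2)).
apply: ler_sum => s _; rewrite /mxapp sum_rank le_eqVlt; apply/orP; left; apply/eqP.
congr (hnorm _ ^+ 2); apply: eq_bigr => j _; apply: eq_bigr => l _.
by rewrite truncationE tagnat.Rank1K tagnat.Rank2K.
Qed.

Lemma truncationP T (x : 'I_q -> 'I_n -> H) : (forall i j k l, bounded_op (T i j k l)) ->
  \sum_i \sum_(k < n) hnorm (\sum_j \sum_(l < n) T i j k l (x j l)) ^+ 2 <=
  opnorm (truncation n T) ^+ 2 * \sum_j \sum_l hnorm (x j l) ^+ 2.
Proof.
move=> bT; have bt : mx_in (@bounded_op R H K) (truncation n T).
  by move=> s t; rewrite truncationE.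
have := opnormP (fun s => x (tagnat.sig1 s) (tagnat.sig2 s)) bt.
rewrite -(@ler_pXn2r _ 2) ?nnegrE ?mulr_ge0 ?vn_ge0 ?opnorm_ge0 // exprMn !sqr_vn.
rewrite (sum_block (fun j l => hnorm (x j l) ^+ 2)).
rewrite -(sum_block (fun i (k : 'I_n) => hnorm (\sum_j \sum_(l < n) T i j k l (x j l)) ^+ 2)).
apply: le_trans; apply: ler_sum => s _; rewrite le_eqVlt; apply/orP; left; apply/eqP.
congr (hnorm _ ^+ 2); rewrite /mxapp.
rewrite -(sum_block (fun j l => T (tagnat.sig1 s) j (tagnat.sig2 s) l (x j l))).
by apply: eq_bigr => t _; rewrite truncationE.
Qed.

End Truncations.

Lemma vn_le_sum (R : realType) (H : hilbert R) (I : finType) (x : I -> H) :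
  vn x <= \sum_i hnorm (x i).
Proof.
have s0 (P : pred I) : 0 <= \sum_(i | P i) hnorm (x i).
  by apply: sumr_ge0 => i _; exact: hnorm_ge0.
rewrite -(@ler_pXn2r _ 2) ?nnegrE ?vn_ge0 // sqr_vn expr2 mulr_suml.
apply: ler_sum => i _; rewrite expr2 ler_wpM2l ?hnorm_ge0 //.
by rewrite (bigD1 i) //= lerDl.
Qed.

Section MatrixUnits.
Variables (R : realType) (H L : hilbert R) (e : nat -> H -> L).
Hypothesis he : hbasis e.
Let be j := hb_bounded he j.
Let bd j := adjoint_bounded (be j).

Definition coefficients (y : L -> L) : nat -> nat -> H -> H :=
  fun k l => adjoint (e k) \o y \o e l.

Lemma coefficients_bounded y k l : bounded_op y -> bounded_op (coefficients y k l).
Proof. by move=> by0; apply: bounded_comp => //; apply: bounded_comp. Qed.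

Section Norms.
Variables (p q : nat) (y : 'M[L -> L]_(p, q)).
Hypothesis by_ : mx_in (@bounded_op R L L) y.

Let coefE n i (k : 'I_n) (x : 'I_q -> 'I_n -> H) :
  \sum_j \sum_(l < n) (map_mx coefficients y) i j k l (x j l) =
  adjoint (e k) (mxapp y (fun j => \sum_(l < n) e l (x j l)) i).
Proof.
have [lk _] := bd k; rewrite /mxapp (lin_sum lk); apply: eq_bigr => j _.
have [ly _] := by_ i j; rewrite (lin_sum ly) (lin_sum lk).
by apply: eq_bigr => l _; rewrite mxE.
Qed.

Lemma truncation_coefficients n : opnorm (truncation n (map_mx coefficients y)) <= opnorm y.
Proof.
apply: truncation_le => [|x]; first exact: opnorm_ge0.
pose xi j := \sum_(l < n) e l (x j l).
apply: (@le_trans _ _ (vn (mxapp y xi) ^+ 2)).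
  rewrite sqr_vn; apply: ler_sum => i _; apply: le_trans (hb_bessel he n _).
  by apply: ler_sum => k _; rewrite coefE.
have -> : \sum_j \sum_l hnorm (x j l) ^+ 2 = vn xi ^+ 2.
  by rewrite sqr_vn; apply: eq_bigr => j _; rewrite (hb_sum_sqr he).
rewrite -exprMn ler_pXn2r ?nnegrE ?mulr_ge0 ?vn_ge0 ?opnorm_ge0 //.
exact: opnormP.
Qed.

(** The truncations are the compressions of [y] by the projections [hb_proj e n], which converge
    strongly to the identity. The sum of the [f i n] bounds the remaining error at [xi]. *)
Lemma opnorm_le_truncation c : 0 <= c ->
  (forall n, opnorm (truncation n (map_mx coefficients y)) <= c) -> opnorm y <= c.
Proof.
move=> c0 h; apply: opnorm_le => // xi; pose P n := hb_proj e n.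
pose eta n := mxapp y (fun j => P n (xi j)); pose z := mxapp y xi.
have h1 n : vn (fun i => P n (eta n i)) <= c * vn xi.
  rewrite -(@ler_pXn2r _ 2) ?nnegrE ?mulr_ge0 ?vn_ge0 // exprMn !sqr_vn.
  under eq_bigr do rewrite hb_proj_sqr //.
  have bc i j k l : bounded_op ((map_mx coefficients y) i j k l).
    by rewrite mxE; exact: coefficients_bounded.
  have := truncationP (n := n) (fun j l => adjoint (e l) (xi j)) bc.
  rewrite (eq_bigr (fun i => \sum_(k < n) hnorm (adjoint (e k) (eta n i)) ^+ 2)); last first.
    by move=> i _; apply: eq_bigr => k _; rewrite coefE.
  move=> /le_trans; apply; apply: ler_pM.
  - exact: sqr_ge0.
  - by apply: sumr_ge0 => j _; apply: sumr_ge0 => l _; exact: sqr_ge0.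
  - by rewrite ler_pXn2r ?nnegrE ?opnorm_ge0.
  - by apply: ler_sum => j _; exact: hb_bessel.
pose f i n := \sum_j onrm (y i j) * hnorm (P n (xi j) - xi j) + hnorm (P n (z i) - z i).
have hf : tends0 (fun n => \sum_i f i n).
  apply: tends0_sum => i; apply: tends0D; last exact: hb_proj_cvg.
  by apply: tends0_sum => j; apply: tends0M; [exact: onrm_ge0|exact: hb_proj_cvg].
rewrite -subr_le0; apply: tends0_ge hf => n; rewrite lerBlDr.
have zE i : z i = P n (eta n i) + (z i - P n (eta n i)) by rewrite addrC subrK.
rewrite -/z (eq_vn zE); apply: le_trans (vnD _ _) _; rewrite addrC; apply: lerD => //.
apply: le_trans (_ : \sum_i hnorm (z i - P n (eta n i)) <= _).
  exact: vn_le_sum.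
apply: ler_sum => i _; rewrite /f.
have -> : z i - P n (eta n i) = - (P n (eta n i - z i) + (P n (z i) - z i)).
  have [lP _] := hb_proj_bounded he n.
  by rewrite /P (linB lP) addrA subrK opprB.
rewrite hnormN_eq; apply: le_trans (hnormD_le _ _) _; rewrite lerD2r.
apply: le_trans (hb_proj_le he n _) _.
rewrite /eta /z /mxapp -sumrB; apply: le_trans (hnorm_sum _ _ _) _.
apply: ler_sum => j _; have [ly _] := by_ i j; rewrite -(linB ly).
exact: onrmP.
Qed.

Lemma Minf_norm_coefficients (S : set (H -> H)) :
  @Minf_norm R (concrete_space S) p q (map_mx coefficients y) = opnorm y.
Proof.
rewrite /Minf_norm; set E := (X in sup X).
have ubE : ubound E (opnorm y) by move=> _ [n ->]; exact: truncation_coefficients.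
have neE : E !=set0 by exists (@opnorm R H H _ _ (truncation 0 (map_mx coefficients y))), 0%N.
apply/eqP; rewrite eq_le; apply/andP; split; first exact: ge_sup.
apply: opnorm_le_truncation => [|n].
  apply: le_trans (_ : @opnorm R H H _ _ (truncation 0 (map_mx coefficients y)) <= _).
    exact: opnorm_ge0.
  by apply: ub_le_sup; [exists (opnorm y)|exists 0%N].
by apply: ub_le_sup; [exists (opnorm y)|exists n].
Qed.

End Norms.
End MatrixUnits.

Section TruncationNorm.
Variables (R : realType) (H : hilbert R).
Implicit Types x : nat -> nat -> H -> H.

Definition tnorm n x : R := opnorm (truncation n (const_mx x : 'M[nat -> nat -> H -> H]_(1, 1))).

(** The carrier of [Minf] is defined with the plain n x n matrix, its norm with the truncation of a
    1 x 1 matrix, whose index type is a sum over one block. The two norms have to be matched. *)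
Lemma tnorm_matrix n x : (forall k l, bounded_op (x k l)) ->
  opnorm (\matrix_(k < n, l < n) x k l) = tnorm n x.
Proof.
move=> bx; apply/eqP; rewrite eq_le; apply/andP; split.
  apply: opnorm_le => [|v]; first exact: opnorm_ge0.
  rewrite -(@ler_pXn2r _ 2) ?nnegrE ?mulr_ge0 ?vn_ge0 ?opnorm_ge0 // exprMn !sqr_vn.
  have bc : forall i j k l, bounded_op ((const_mx x : 'M[nat -> nat -> H -> H]_(1, 1)) i j k l).
    by move=> i j k l; rewrite mxE.
  have h0 := truncationP (n := n) (fun _ => v) bc.
  rewrite big_ord1 [X in _ <= _ * X]big_ord1 in h0; move: h0; apply: le_trans; rewrite le_eqVlt; apply/orP; left; apply/eqP.
  apply: eq_bigr => k _; rewrite big_ord1.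
  by congr (hnorm _ ^+ 2); apply: eq_bigr => l _; rewrite !mxE.
apply: truncation_le => [|v]; first exact: opnorm_ge0.
have bm : mx_in (@bounded_op R H H) (\matrix_(k < n, l < n) x k l).
  by move=> k l; rewrite mxE.
have := opnormP (v 0) bm.
rewrite -(@ler_pXn2r _ 2) ?nnegrE ?mulr_ge0 ?vn_ge0 ?opnorm_ge0 // exprMn !sqr_vn.
move=> h0; rewrite big_ord1 [X in _ <= _ * X]big_ord1; move: h0; apply: le_trans; rewrite le_eqVlt; apply/orP; left; apply/eqP.
  apply: eq_bigr => k _; rewrite big_ord1.
by congr (hnorm _ ^+ 2); apply: eq_bigr => l _; rewrite !mxE.
Qed.

Definition tbounded x := (forall k l, bounded_op (x k l)) /\
  exists c : R, forall n, tnorm n x <= c.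

Let mx_trunc n x : (forall k l, bounded_op (x k l)) ->
  mx_in (@bounded_op R H H) (truncation n (const_mx x : 'M[nat -> nat -> H -> H]_(1, 1))).
Proof. by move=> bx s t; rewrite !mxE. Qed.

Lemma tnorm_triangle n (x y z : nat -> nat -> H -> H) : (forall k l, bounded_op (x k l)) ->
  (forall k l, bounded_op (y k l)) -> (forall k l, bounded_op (z k l)) ->
  tnorm n (x - z) <= tnorm n (x - y) + tnorm n (y - z).
Proof.
move=> bx by0 bz; have bB (u v : nat -> nat -> H -> H) : (forall k l, bounded_op (u k l)) ->
    (forall k l, bounded_op (v k l)) -> forall k l, bounded_op ((u - v) k l).
  by move=> bu bv k l; exact: (subB (bounded_lin H H) (bu k l) (bv k l)).
have := opnormD (mx_trunc (n := n) (bB _ _ bx by0)) (mx_trunc (n := n) (bB _ _ by0 bz)).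
apply: le_trans; rewrite le_eqVlt; apply/orP; left; apply/eqP.
by congr opnorm; apply/matrixP => s t; rewrite !mxE -[LHS]/(x _ _ - z _ _) -[RHS]/(x _ _ - y _ _ + (y _ _ - z _ _)) addrA subrK.
Qed.

Lemma tnormN n x : (forall k l, bounded_op (x k l)) -> tnorm n (- x) = tnorm n x.
Proof.
move=> bx; rewrite /tnorm -[RHS](mnormN (BO_pos H H) (mx_trunc (n := n) bx)).
by congr opnorm; apply/matrixP => s t; rewrite !mxE.
Qed.

Lemma tboundedB x x' : tbounded x -> tbounded x' -> tbounded (x - x').
Proof.
move=> [bx [c hc]] [by0 [d hd]].
split; first by move=> k l; exact: (subB (bounded_lin H H) (bx k l) (by0 k l)).
exists (c + d) => n; have b0 : forall k l, bounded_op ((0 : nat -> nat -> H -> H) k l).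
  by move=> k l; exact: (sub0 (bounded_lin H H)).
apply: le_trans (tnorm_triangle n bx b0 by0) _.
by rewrite subr0 sub0r tnormN // lerD.
Qed.

Variable A : set (H -> H).
Hypothesis csA : closed_subspace A.
Local Notation CA := (concrete_algebra A).

Lemma Minf_nrmE x : @nrm R (Minf CA) x = sup [set c : R | exists n, c = tnorm n x].
Proof. by []. Qed.

Lemma tnorm_le_nrm n x : tbounded x -> tnorm n x <= @nrm R (Minf CA) x.
Proof.
move=> [bx [c hc]]; rewrite Minf_nrmE; apply: ub_le_sup; last by exists n.
by exists c => _ [k ->].
Qed.

Lemma nrm_le_tnorm x c : (forall n, tnorm n x <= c) -> @nrm R (Minf CA) x <= c.
Proof.
move=> h; rewrite Minf_nrmE; apply: ge_sup; first by exists (tnorm 0 x), 0%N.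
by move=> _ [n ->].
Qed.

Lemma entry_le_nrm x k l : tbounded x -> onrm (x k l) <= @nrm R (Minf CA) x.
Proof.
move=> hx; have [bx _] := hx; pose n := (maxn k l).+1.
apply: le_trans (tnorm_le_nrm n hx); rewrite -tnorm_matrix //.
have kn : (k < n)%N by rewrite ltnS leq_maxl.
have ln : (l < n)%N by rewrite ltnS leq_maxr.
have bm : mx_in (@bounded_op R H H) (\matrix_(k < n, l < n) x k l).
  by move=> i j; rewrite mxE.
by have := opnorm_entry (Ordinal kn) (Ordinal ln) bm; rewrite mxE.
Qed.

Lemma Minf_tbounded x : mcar (Minf CA) x -> tbounded x.
Proof.
move=> [Ax [c hc]]; have bx k l := cs_bounded csA (Ax k l).
by split=> //; exists c => n; rewrite -tnorm_matrix //; exact: hc.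
Qed.

Lemma Minf_mem x : (forall k l, A (x k l)) -> tbounded x -> mcar (Minf CA) x.
Proof. by move=> Ax [bx [c hc]]; split=> //; exists c => n; have := hc n; rewrite -tnorm_matrix. Qed.

Variables (L : hilbert R) (e : nat -> H -> L).
Hypothesis he : hbasis e.
Let be j := hb_bounded he j.
Let bd j := adjoint_bounded (be j).
Local Notation coef := (coefficients e).

Lemma coefficients_linear c y y' : bounded_op y -> bounded_op y' ->
  coef (c *: y + y') = c *: coef y + coef y'.
Proof.
move=> by0 by1; apply/funext => k; apply/funext => l; apply/funext => x.
by have [lk _] := bd k; rewrite /coefficients /= !fctE lk.
Qed.

Lemma coefficientsB y y' : bounded_op y -> bounded_op y' -> coef (y - y') = coef y - coef y'.
Proof.
move=> by0 by1; apply/funext => k; apply/funext => l; apply/funext => x.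
by have [lk _] := bd k; rewrite /coefficients /= !fctE (linB lk).
Qed.

Lemma nrm_coefficients y : bounded_op y -> @nrm R (Minf CA) (coef y) = onrm y.
Proof.
move=> by0; rewrite /onrm -(Minf_norm_coefficients he (mx_in_const by0) A).
by rewrite map_const_mx.
Qed.

Lemma coefficients_corner y k l : corner e A e y -> A (coef y k l).
Proof.
move=> hy; have cs := sandwich_cs (bd k) (be l) csA.
have [|_] := corner_min cs _ hy; last by [].
move=> i s j As; split; first exact: (cs_bounded (corner_cs he he csA) (corner_mem he he csA _ _ As)).
have -> : adjoint (e k) \o (e i \o s \o adjoint (e j)) \o e l =
    if (k == i) && (j == l) then s else 0.
  apply/funext => x /=; rewrite !(hb_coordE he); have [ls _] := cs_bounded csA As.
  by case: (k == i); case: (j == l) => //=; rewrite (lin0 ls).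
by case: ifP => // _; exact: (sub0 (cs_lin csA)).
Qed.

Lemma coefficients_tbounded y : bounded_op y -> tbounded (coef y).
Proof.
move=> by0; split=> [k l|]; first exact: coefficients_bounded.
exists (onrm y) => n; have := truncation_coefficients he (mx_in_const by0) n.
by rewrite map_const_mx.
Qed.

Definition from_coefficients n (x : nat -> nat -> H -> H) : L -> L :=
  \sum_(k < n) \sum_(l < n) (e k \o x k l \o adjoint (e l)).

Lemma from_coefficients_corner n x : (forall k l, A (x k l)) ->
  corner e A e (from_coefficients n x).
Proof.
move=> Ax; have lin := cs_lin (corner_cs he he csA).
by apply: (sub_sum lin) => k _; apply: (sub_sum lin) => l _; exact: corner_mem.
Qed.

Lemma from_coefficientsK n x : (forall k l, A (x k l)) ->
  (forall k l, (n <= k)%N || (n <= l)%N -> x k l = 0) ->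
  coef (from_coefficients n x) = x.
Proof.
move=> Ax x0; apply/funext => k; apply/funext => l; apply/funext => h.
have [lk _] := bd k; rewrite /coefficients /from_coefficients !compE fct_sumE (lin_sum lk).
have E (i : 'I_n) : adjoint (e k) ((\sum_(j < n) (e i \o x i j \o adjoint (e j))) (e l h)) =
    if k == i then (if (l < n)%N then x i l h else 0) else 0.
  rewrite fct_sumE (lin_sum lk); case: eqP => [ki|ki]; last first.
    by rewrite big1 // => j _ /=; rewrite hb_coordE //; case: eqP.
  case: ltnP => [ln|nl].
    rewrite (bigD1 (Ordinal ln)) //= !(hb_coordE he) ki !eqxx big1 ?addr0 // => j.
    rewrite -val_eqE /= => /negPf jl; rewrite !(hb_coordE he) eqxx jl.
    by rewrite (lin0 (proj1 (cs_bounded csA (Ax _ _)))).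
  rewrite big1 // => j _ /=; rewrite !(hb_coordE he) ki eqxx.
  by rewrite ltn_eqF ?(leq_trans (ltn_ord j)) // (lin0 (proj1 (cs_bounded csA (Ax _ _)))).
rewrite (eq_bigr _ (fun i _ => E i)); case: (ltnP k n) => [kn|nk].
  rewrite (bigD1 (Ordinal kn)) //= eqxx big1 ?addr0 => [|i]; last first.
    by rewrite -val_eqE /= eq_sym => /negPf ->.
  by case: ltnP => // nl; rewrite x0 ?nl ?orbT.
rewrite x0 ?nk // big1 // => i _; case: eqP => // ki.
by have := ltn_ord i; rewrite -ki ltnNge nk.
Qed.

Lemma lspan_coefficients y :
  lspan (op_products (op_products (range e) A) (adjoints (range e))) y ->
  exists n, forall k l, (n <= k)%N || (n <= l)%N -> coef y k l = 0.
Proof.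
pose P := [set y : L -> L | bounded_op y /\
  exists n, forall k l, (n <= k)%N || (n <= l)%N -> coef y k l = 0].
suff linP : linear_subspace P.
  move=> /(lspan_min linP) [] // z hz; split; first exact: (corner_gen_bounded he he csA).
  move: hz => [_ [_ [[_ [s [[i _ <-] As ->]]] [_ [j _ <-] <-] ->]]].
  exists (maxn i j).+1 => k l; rewrite !gtn_max => hkl; apply/funext => x.
  rewrite /coefficients /= !(hb_coordE he); have [ls _] := cs_bounded csA As.
  case: eqP => [ki|//]; case: eqP => [jl|_]; last exact: lin0.
  by move: hkl; rewrite ki jl !ltnn andbF.
split.
  split; first exact: (sub0 (bounded_lin L L)).
  exists 0%N => k l _; apply/funext => x; rewrite /coefficients /=.
  by rewrite (lin0 (proj1 (bd k))).
move=> c y1 y2 [b1 [n1 h1]] [b2 [n2 h2]]; split; first by case: (bounded_lin L L) => _; apply.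
exists (maxn n1 n2) => k l; rewrite !geq_max => hkl.
rewrite coefficients_linear // -[LHS]/(c *: coef y1 k l + coef y2 k l).
by rewrite h1 ?h2 ?scaler0 ?addr0 //; case/orP: hkl => /andP[h3 h4]; rewrite ?h3 ?h4 ?orbT.
Qed.

(** Coefficients are isometric for the norm of [Minf] and finitely supported on the span of the
    generators. *)
Lemma coefficients_Kinf y : corner e A e y -> mcar (Kinf CA) (coef y).
Proof.
move=> hy; have by0 := cs_bounded (corner_cs he he csA) hy.
split; first by apply: Minf_mem; [move=> k l; exact: coefficients_corner|exact: coefficients_tbounded].
move=> d d0; have [_ hd] := hy; have [s hs sd] := hd d d0.
have cs : corner e A e s.
  apply: (mclosure_incl (BO_pos L L)) => //; apply: (lspan_min (bounded_lin L L)).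
  exact: (corner_gen_bounded he he csA).
have bs := cs_bounded (corner_cs he he csA) cs.
exists (coef s).
  by split; [move=> k l; exact: coefficients_corner|exact: lspan_coefficients].
by rewrite -coefficientsB // nrm_coefficients //; exact: (subB (bounded_lin L L)).
Qed.

(** Finitely supported matrices lift to operators. Because coefficients are isometric, the lifts of
    approximants of [x] form a Cauchy sequence, whose limit lies in the closed corner; it has the
    entries of [x] since an entry is bounded by the norm of the matrix. *)
Lemma coefficients_onto x : mcar (Kinf CA) x -> exists2 y, corner e A e y & coef y = x.
Proof.
move=> [mx hx]; have tx := Minf_tbounded mx; have [bx _] := tx.
have csC := corner_cs he he csA.
have /choice[y hy] : forall n : nat, exists y,
    corner e A e y /\ @nrm R (Minf CA) (x - coef y) < n.+1%:R^-1.
  move=> n; have i0 : (0 : R) < n.+1%:R^-1 by rewrite invr_gt0.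
  have [s [As [k sk]] hs] := hx _ i0; exists (from_coefficients k s).
  by rewrite from_coefficientsK //; split=> //; exact: from_coefficients_corner.
have cy n : corner e A e (y n) by have [] := hy n.
have by0 n := cs_bounded csC (cy n).
have tB n : tbounded (x - coef (y n)) by apply: tboundedB => //; exact: coefficients_tbounded.
have small : tends0 (fun n => @nrm R (Minf CA) (x - coef (y n))).
  by apply: tends0_le (@tends0_harmonic R) => n; apply: ltW; have [] := hy n.
have [|l bl hl] := BO_complete by0.
  move=> d d0; have d2 : 0 < d / 2 by lra.
  have [N hN] := small _ d2; exists N => i j Ni Nj.
  have bB := subB (bounded_lin L L) (by0 i) (by0 j).
  apply: (@le_lt_trans _ _ (@nrm R (Minf CA) (x - coef (y i)) + @nrm R (Minf CA) (x - coef (y j)))).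
    rewrite -nrm_coefficients // coefficientsB //; apply: nrm_le_tnorm => n.
    have bi k := fun l => coefficients_bounded he k l (by0 i).
    have bj k := fun l => coefficients_bounded he k l (by0 j).
    apply: le_trans (tnorm_triangle n bi bx bj) _.
    apply: lerD; last exact: tnorm_le_nrm.
    rewrite -opprB tnormN; first exact: tnorm_le_nrm.
    by have [] := tB i.
  by apply: lt_le_trans (ltrD (hN i Ni) (hN j Nj)) _; rewrite -splitr.
have cl : corner e A e l.
  apply: (cs_closed csC) => // d /hl[N /(_ N (leqnn N)) hN]; exists (y N) => //.
  by rewrite onrm_distC.
exists l => //; apply/funext => i; apply/funext => j.
have bij := coefficients_bounded he i j bl.
apply/eqP; rewrite -subr_eq0; apply/eqP.
have bd0 := subB (bounded_lin H H) bij (bx i j).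
apply: onrm_eq0 => //; apply/eqP; rewrite eq_le onrm_ge0 andbT.
apply: (tends0_ge (f := fun n => onrm (y n - l) + @nrm R (Minf CA) (x - coef (y n)))); last first.
  by apply: tends0D.
move=> n; have bB := subB (bounded_lin L L) (by0 n) bl.
have h1 := entry_le_nrm i j (coefficients_tbounded bB).
rewrite nrm_coefficients // coefficientsB // in h1.
have h2 := entry_le_nrm i j (tB n).
apply: le_trans (lerD h1 h2).
have -> : coef l i j - x i j = - ((coef (y n) i j - coef l i j) + (x i j - coef (y n) i j)).
  by rewrite -[LHS]opprB; congr (- _); rewrite [RHS]addrC addrA subrK.
rewrite onrmN; apply: onrmD.
  by apply: (subB (bounded_lin H H)) => //; exact: coefficients_bounded.
by apply: (subB (bounded_lin H H)) => //; exact: coefficients_bounded.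
Qed.

(** [mlim] picks some limit, and limits in norm are unique. *)
Lemma mlimE (u : nat -> H -> H) (l : H -> H) : (forall n, A (u n)) -> A l ->
  tends0 (fun n => onrm (u n - l)) -> @mlim R CA u = l.
Proof.
move=> Au Al hu; have bA T : A T -> bounded_op T by exact: cs_bounded.
have Q l' : [set l' | mcar CA l' /\ @nrm R CA (u n - l') @[n --> \oo] --> (0 : R)] l' -> l' = l.
  move=> [Al' /tends0P hl']; have {}hl' := hl' (fun n => onrm_ge0 _).
  apply/eqP; rewrite -subr_eq0; apply/eqP.
  have bll := subB (bounded_lin H H) (bA _ Al') (bA _ Al).
  apply: onrm_eq0 => //; apply/eqP; rewrite eq_le onrm_ge0 andbT.
  apply: (tends0_ge (f := fun n => onrm (u n - l') + onrm (u n - l))); last exact: tends0D.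
  move=> n; rewrite -(onrm_distC l' (u n)).
  have -> : l' - l = (l' - u n) + (u n - l) by rewrite addrA subrK.
  by apply: onrmD; apply: (subB (bounded_lin H H)); exact: bA.
apply: Q; apply: (@xgetPex _ 0 [set l' | mcar CA l' /\ @nrm R CA (u n - l') @[n --> \oo] --> (0 : R)]).
by exists l; split=> //; apply/tends0P => // n; exact: onrm_ge0.
Qed.

(** With [P_n := hb_proj e n], the partial sums for an entry of the product are
    [e_i^* y P_n y' e_j]. They converge in norm because [P_n y'] does: this holds for generators of
    the corner and, the [P_n] being contractions, on its closure. *)
Lemma coefficients_mul y y' : (forall a b, A a -> A b -> A (a \o b)) ->
  corner e A e y -> corner e A e y' -> corner e A e (y \o y') ->
  coef (y \o y') = mmul (Kinf CA) (coef y) (coef y').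
Proof.
move=> mulA hy hy' hyy'; apply/funext => i; apply/funext => j; apply/esym.
have csC := corner_cs he he csA.
have by0 := cs_bounded csC hy; have by1 := cs_bounded csC hy'.
apply: mlimE.
- move=> n; apply: (sub_sum (cs_lin csA)) => k _.
  by apply: mulA; exact: coefficients_corner.
- exact: coefficients_corner.
pose ev : set_system (L -> L) := hb_proj e @ \oo.
have fev : Filter ev by exact: fmap_filter.
have evc : ev [set T | bounded_op T /\ onrm T <= 1].
  exists 0%N => // n _; split; first exact: hb_proj_bounded.
  by apply: onrm_le => // x; rewrite mul1r hb_proj_le.
have [|_ hP] := corner_min (@approximated_cs R L ev fev evc L) _ hy'.
  move=> k s l As; split; first exact: (cs_bounded csC (corner_mem he he csA _ _ As)).
  (* From [n = k.+1] on, [hb_proj e n] fixes the range of [e k]. *)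
  move=> d d0; exists k.+1 => // n /= kn.
  have -> : hb_proj e n \o (e k \o s \o adjoint (e l)) - (e k \o s \o adjoint (e l)) = 0.
    apply/funext => x; rewrite !fctE /=; set h := s _.
    apply/eqP; rewrite subr_eq0; apply/eqP/(hb_ext he) => m.
    rewrite hb_coord_proj // hb_coordE //; case: ltnP => // nm.
    by rewrite gtn_eqF // (leq_trans kn).
  by rewrite onrm0.
have {}hP : tends0 (fun n => onrm (hb_proj e n \o y' - y')).
  by move=> d d0; have [N _ hN] := hP d d0; exists N => n; exact: hN.
apply: (tends0_le (g := fun n => onrm (adjoint (e i) \o y) * (onrm (e j) * onrm (hb_proj e n \o y' - y')))).
  move=> n; have biy := bounded_comp (bd i) by0.
  have bpy : bounded_op (hb_proj e n \o y' - y').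
    apply: (subB (bounded_lin L L)) => //; apply: bounded_comp => //; exact: hb_proj_bounded.
  have -> : \sum_(k < n) mmul CA (coef y i k) (coef y' k j) - coef (y \o y') i j =
      (adjoint (e i) \o y) \o ((hb_proj e n \o y' - y') \o e j).
    apply/funext => x; have [liy _] := biy; rewrite /coefficients /= !fctE fct_sumE /=.
    rewrite -[adjoint (e i) (y (_ - _))]/((adjoint (e i) \o y) _) (linB liy); congr (_ - _).
    by rewrite /hb_proj (lin_sum liy).
  apply: le_trans (onrm_comp biy (bounded_comp bpy (be j))) _.
  rewrite ler_wpM2l ?onrm_ge0 // mulrC; exact: onrm_comp.
by apply: tends0M; [exact: onrm_ge0|apply: tends0M => //; exact: onrm_ge0].
Qed.

End TruncationNorm.

(** * Conjugation by a contraction that is unitary on the corners *)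

Section Conjugation.
Variables (R : realType).

Lemma opnorm_conj (L L' : hilbert R) (T : L -> L') (S : L' -> L) p q (y : 'M[L -> L]_(p, q)) :
  bounded_op T -> bounded_op S -> onrm T <= 1 -> onrm S <= 1 ->
  mx_in (@bounded_op R L L) y ->
  opnorm (map_mx (fun z : L -> L => T \o z \o S) y) <= opnorm y.
Proof.
move=> bT bS T1 S1 by0; apply: opnorm_le => [|x]; first exact: opnorm_ge0.
have contr (G G' : hilbert R) (U : G -> G') h : bounded_op U -> onrm U <= 1 -> hnorm (U h) <= hnorm h.
  by move=> bU U1; apply: le_trans (onrmP h bU) _; rewrite ler_piMl ?hnorm_ge0.
have vcontr (G G' : hilbert R) (U : G -> G') k (h : 'I_k -> G) : bounded_op U -> onrm U <= 1 ->
    vn (fun i => U (h i)) <= vn h.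
  move=> bU U1; apply: ler_sqr_norm; first exact: vn_ge0.
  rewrite !sqr_vn; apply: ler_sum => i _; rewrite ler_pXn2r ?nnegrE ?hnorm_ge0 //.
  exact: contr.
rewrite (eq_vn (y := fun i => T (mxapp y (fun j => S (x j)) i))); last first.
  move=> i; have [lT _] := bT; rewrite /mxapp (lin_sum lT); apply: eq_bigr => j _.
  by rewrite mxE.
apply: le_trans (vcontr _ _ T _ _ bT T1) _; apply: le_trans (opnormP _ by0) _.
by rewrite ler_wpM2l ?opnorm_ge0 // vcontr.
Qed.

Variables (H K L L' : hilbert R) (e : nat -> H -> L) (f : nat -> K -> L').
Variables (A : set (H -> H)) (B : set (K -> K)) (V : L -> L').
Hypotheses (he : hbasis e) (hf : hbasis f) (csA : closed_subspace A) (csB : closed_subspace B)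
  (mulA : forall a b, A a -> A b -> A (a \o b)) (mulB : forall a b, B a -> B b -> B (a \o b))
  (bV : bounded_op V) (nV : onrm V <= 1)
  (AB : forall y, corner e A e y -> corner f B f (V \o y \o adjoint V))
  (BA : forall y, corner f B f y -> corner e A e (adjoint V \o y \o V))
  (fixA : forall y, corner e A e y ->
     adjoint V \o V \o y = y /\ y \o (adjoint V \o V) = y)
  (fixB : forall y, corner f B f y ->
     V \o adjoint V \o y = y /\ y \o (V \o adjoint V) = y).

Lemma corner_mul (G M : hilbert R) (g : nat -> G -> M) (S : set (G -> G)) :
  hbasis g -> closed_subspace S -> (forall a b, S a -> S b -> S (a \o b)) ->
  forall y z, corner g S g y -> corner g S g z -> corner g S g (y \o z).
Proof.
move=> hg csS mulS; have cs := corner_cs hg hg csS.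
have bg := corner_gen_bounded hg hg csS.
apply: (closed_span_comp bg bg cs).
move=> u v [u1 [u2 [[u3 [s [[i _ <-] Ss ->]]] [u4 [j _ <-] <-] ->]]].
move=> [v1 [v2 [[v3 [t [[k _ <-] St ->]]] [v4 [l _ <-] <-] ->]]].
have -> : (g i \o s \o adjoint (g j)) \o (g k \o t \o adjoint (g l)) =
   if j == k then g i \o (s \o t) \o adjoint (g l) else 0.
  apply/funext => x /=; rewrite (hb_coordE hg); case: eqP => // _.
  by rewrite (lin0 (proj1 (cs_bounded csS Ss))) (lin0 (proj1 (hb_bounded hg i))).
case: ifP => _; last exact: (sub0 (cs_lin cs)).
by apply: corner_mem => //; exact: mulS.
Qed.

Let bV' := adjoint_bounded bV.
Let nV' : onrm (adjoint V) <= 1. Proof. by rewrite onrm_adjoint. Qed.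
Let csCA := corner_cs he he csA.
Let csCB := corner_cs hf hf csB.

(** Conjugation by [V], read in coefficients. Neither [V] nor [adjoint V] increases matrix norms,
    and the two conjugations are inverse to each other on the corners, so both are completely
    isometric. Products are preserved because [adjoint V \o V] acts as the identity between the
    factors. *)
Lemma stably_isomorphic_corner :
  stably_isomorphic (concrete_algebra A) (concrete_algebra B).
Proof.
set CA := concrete_algebra A; set CB := concrete_algebra B.
have inj y y' : bounded_op y -> bounded_op y' ->
    coefficients e y = coefficients e y' -> y = y'.
  move=> by0 by1 E; have bB := subB (bounded_lin L L) by0 by1.
  apply/eqP; rewrite -subr_eq0; apply/eqP/onrm_eq0 => //.
  rewrite -(nrm_coefficients A he bB) coefficientsB // E -(coefficientsB he by1 by1) subrr.
  by rewrite nrm_coefficients ?onrm0 //; exact: (sub0 (bounded_lin L L)).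
(* [g] inverts [coefficients e], with arbitrary values outside of the carrier. *)
have /choice[g hg] : forall x, exists y, mcar (Kinf CA) x ->
    corner e A e y /\ coefficients e y = x.
  move=> x; have [hx|hx] := pselect (mcar (Kinf CA) x); last by exists 0.
  by have [y hy <-] := coefficients_onto csA he hx; exists y.
have gc x : mcar (Kinf CA) x -> corner e A e (g x) by move=> /hg[].
have gE x : mcar (Kinf CA) x -> coefficients e (g x) = x by move=> /hg[].
have gb x : mcar (Kinf CA) x -> bounded_op (g x) by move=> /gc; exact: (cs_bounded csCA).
have gK y : corner e A e y -> g (coefficients e y) = y.
  move=> hy; have hx := coefficients_Kinf csA he hy.
  by apply: inj; [exact: gb|exact: (cs_bounded csCA)|exact: gE].
pose W (z : L -> L) := V \o z \o adjoint V.
have bW z : bounded_op z -> bounded_op (W z).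
  by move=> bz; exact: (bounded_comp (bounded_comp bV bz) bV').
have WW z z' : corner e A e z -> corner e A e z' -> W (z \o z') = W z \o W z'.
  move=> hz hz'; have [E _] := fixA hz'; apply/funext => x.
  have := congr1 (fun h => h (adjoint V x)) E => /= E'.
  by rewrite /W /= E'.
exists (fun x => coefficients f (W (g x))); split; first split; first split.
- by move=> x hx; apply: coefficients_Kinf => //; apply: AB; exact: gc.
- move=> c x x' hx hx'.
  have E : g (c *: x + x') = c *: g x + g x'.
    rewrite -{1}(gE _ hx) -{1}(gE _ hx') -(coefficients_linear he c (gb _ hx) (gb _ hx')).
    by apply: gK; case: (cs_lin csCA) => _; apply; exact: gc.
  rewrite E -(coefficients_linear hf c (bW _ (gb _ hx)) (bW _ (gb _ hx'))).
  congr coefficients; apply/funext => z; have [lV _] := bV.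
  by rewrite /W /= !fctE lV.
- move=> p q x hx.
  have cY i j : corner e A e (map_mx g x i j) by rewrite mxE; exact: gc.
  have bY : mx_in (@bounded_op R L L) (map_mx g x).
    by move=> i j; exact: (cs_bounded csCA).
  have bWY : mx_in (@bounded_op R L' L') (map_mx W (map_mx g x)).
    by move=> i j; rewrite mxE; exact: bW.
  have -> : map_mx (fun x => coefficients f (W (g x))) x =
      map_mx (coefficients f) (map_mx W (map_mx g x)).
    by apply/matrixP => i j; rewrite !mxE.
  have {2}-> : x = map_mx (coefficients e) (map_mx g x).
    by apply/matrixP => i j; rewrite !mxE gE.
  rewrite -[LHS]/(@Minf_norm R (concrete_space B) p q _) (Minf_norm_coefficients hf bWY B).
  rewrite -[RHS]/(@Minf_norm R (concrete_space A) p q _) (Minf_norm_coefficients he bY A).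
  apply/eqP; rewrite eq_le opnorm_conj //=.
  (* [map_mx g x] is recovered from its conjugate, which gives the reverse inequality. *)
  have {1}-> : map_mx g x = map_mx (fun z : L' -> L' => adjoint V \o z \o V) (map_mx W (map_mx g x)).
    apply/matrixP => i j; rewrite [RHS]mxE [in RHS]mxE.
    have [E1 E2] := fixA (cY i j).
    by rewrite -[LHS]E2 -{1}E1.
  exact: opnorm_conj.
- apply/seteqP; split=> [_ [x hx <-]|z hz].
    by apply: coefficients_Kinf => //; apply: AB; exact: gc.
  have [w hw <-] := coefficients_onto csB hf hz.
  have hy := BA hw; exists (coefficients e (adjoint V \o w \o V)).
    exact: coefficients_Kinf.
  rewrite gK //; congr coefficients; have [E1 E2] := fixB hw.
  by rewrite -[RHS]E2 -{2}E1.
- move=> x x' hx hx'; have hc := gc _ hx; have hc' := gc _ hx'.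
  have hcc := corner_mul he csA mulA hc hc'.
  have E : mmul (Kinf CA) x x' = coefficients e (g x \o g x').
    by rewrite (coefficients_mul csA he mulA hc hc' hcc) !gE.
  rewrite E gK // WW //; apply: coefficients_mul => //; try exact: AB.
  by rewrite -WW //; exact: AB.
Qed.

End Conjugation.

(** * Operator algebras and bimodules of operators *)

Section ConcreteStructures.
Variables (R : realType).

Lemma bilinear_comp (G H K : hilbert R) (S : set (H -> K)) (T : set (G -> H)) :
  S `<=` @bounded_op R H K ->
  bilinear_on S T (fun (f : H -> K) (g : G -> H) => f \o g).
Proof.
move=> bS; split=> [g Tg|f Sf] c x y h1 h2; first by [].
by apply/funext => z; have [lf _] := bS _ Sf; rewrite /= !fctE lf.
Qed.

Lemma concrete_operator_algebra (H : hilbert R) (A : set (H -> H)) :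
  closed_subspace A -> (forall x y, A x -> A y -> A (x \o y)) ->
  operator_algebra (concrete_algebra A).
Proof.
move=> csA mulA; have bA := cs_bounded csA.
split.
- exact: concrete_os.
- exact: mulA.
- exact: bilinear_comp.
- by [].
- exists H, id; split; last by [].
  by split=> // p q x _; rewrite map_mx_id.
Qed.

Lemma concrete_operator_bimodule (H K : hilbert R) (B : set (K -> K)) (A : set (H -> H))
    (Z : set (H -> K)) : closed_subspace B -> closed_subspace A -> closed_subspace Z ->
  (forall b z, B b -> Z z -> Z (b \o z)) -> (forall z a, Z z -> A a -> Z (z \o a)) ->
  @operator_bimodule R (concrete_algebra B) (concrete_algebra A) (concrete_space Z)
    (fun (b : K -> K) (z : H -> K) => b \o z) (fun (z : H -> K) (a : H -> H) => z \o a).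
Proof.
move=> csB csA csZ BZ ZA; have bB := cs_bounded csB; have bA := cs_bounded csA.
have bZ := cs_bounded csZ; split.
- exact: concrete_os.
- by split=> //; exact: bilinear_comp.
- by split=> //; exact: bilinear_comp.
- by [].
- by move=> p r q x y hx hy; apply: opnorm_comp => i j; [exact/bB/hx|exact/bZ/hy].
- by move=> p r q x y hx hy; apply: opnorm_comp => i j; [exact/bZ/hx|exact/bA/hy].
Qed.

End ConcreteStructures.

Section Presentation.
Variables (R : realType) (A : malgebra R) (H : hilbert R) (a : A -> H -> H).
Hypotheses (hA : operator_algebra A) (ha : completely_isometric_representation a).
Let linA := os_subspace (oa_space hA).

Lemma representation_bounded : a @` mcar A `<=` @bounded_op R H H.
Proof. by have [[h _ _] _] := ha; move=> _ [x Ax <-]; exact: h. Qed.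

Lemma representation_closed x y : (a @` mcar A) x -> (a @` mcar A) y ->
  (a @` mcar A) (x \o y).
Proof.
have [_ h] := ha; move=> [u Au <-] [v Av <-]; exists (mmul A u v); last by rewrite h.
exact: (oa_closed hA).
Qed.

Lemma representation_norm x : mcar A x -> onrm (a x) = nrm x.
Proof.
have [[_ _ h] _] := ha; move=> Ax; rewrite /nrm -h; last by move=> i j; rewrite mxE.
by rewrite map_const_mx.
Qed.

(** The filter is pushed forward along [a], and the left half of the approximation is kept, in the
    form that [approxA] requires. *)
Lemma representation_unit : approximately_unital A ->
  exists F : set_system (H -> H), [/\ ProperFilter F,
    F [set e | (a @` mcar A) e /\ onrm e <= 1]
    & forall x, (a @` mcar A) x -> small_along F (fun e => onrm (e \o x - x))].
Proof.
move=> [F [pF F1 hF]]; exists (a @ F); split.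
- exact: fmap_proper_filter.
- apply: (@filterS _ F _ _ _ _ F1) => e [Ae e1]; split; first by exists e.
  by rewrite representation_norm.
move=> _ [x Ax <-] d d0; have [+ _] := hF x Ax.
move=> /cvgrPdist_lt /(_ _ d0) h; apply: filterS2 F1 h => e [Ae _] /=.
have Aex := oa_closed hA Ae Ax; have AB := subB linA Aex Ax.
have [[_ la _] ma] := ha.
rewrite sub0r normrN (ger0_norm (nrm_ge0 (os_pos (oa_space hA)) AB)).
rewrite -representation_norm // (lin_onB linA la Aex Ax).
by rewrite (ma _ _ Ae Ax).
Qed.

End Presentation.

Theorem corollary3p6 (R : realType) (A : malgebra R) (Y : mspace R)
    (r : Y -> A -> Y) (H K : hilbert R) (a : A -> H -> H) (M : set (H -> K))
    (hA : operator_algebra A) (hA1 : approximately_unital A)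
    (hY : operator_space Y) (hYA : right_module r)
    (hP : sigma_delta_presentation r a M) :
  let A0 := source_algebra a M in
  let B := target_algebra a M in
  let Z := concrete_space (rigged_restriction a M) in
  operator_algebra A0 /\ operator_algebra B /\
  BMP_bimodule (B := B) (A := A0) (Z := Z)
    (fun (b : K -> K) (z : H -> K) => b \o z)
    (fun (z : H -> K) (c : H -> H) => z \o c) /\
  stably_isomorphic A0 B.
Proof.
have [ha [hM _ [m [Mm lim_m contr_m]] [n [Mn lim_n contr_n]]] inv _] := hP.
have bA := representation_bounded ha.
have mulA := representation_closed hA ha.
have invA f g x : M f -> M g -> (a @` mcar A) x -> (a @` mcar A) (adjoint f \o g \o x).
  move=> Mf Mg Ax; apply: inv; exists (adjoint f \o g), x; split=> //.
  by exists (adjoint f), g; split=> //; exists f.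
have [F [pF F1 hF]] := representation_unit hA ha hA1.
have tm f : M f -> tends0 (fun k => onrm (\sum_(i < k) (m i \o adjoint (m i) \o f) - f)).
  by move=> Mf; apply/tends0P => [k|]; [exact: onrm_ge0|exact: lim_m].
have tn f : M f -> tends0 (fun k => onrm (\sum_(i < k) (f \o adjoint (n i) \o n i) - f)).
  by move=> Mf; apply/tends0P => [k|]; [exact: onrm_ge0|exact: lim_n].
have sm f Mf := cvg_small (fun k => onrm_ge0 _) (lim_m f Mf).
have sn f Mf := cvg_small (fun k => onrm_ge0 _) (lim_n f Mf).
have csA0 := csA0 hM bA; have csB := csB hM bA.
have csZ := csZ hM bA; have csX := csX hM bA.
have mulA0A0 := mulA0A0 hM bA mulA invA; have mulBB := mulBB hM bA mulA invA.
have mulBZ := mulBZ hM bA mulA invA; have mulZA0 := mulZA0 hM bA mulA invA.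
have mulA0X := mulA0X hM bA mulA invA; have mulXB := mulXB hM bA mulA invA.
have mulZX := mulZX hM bA mulA invA; have mulXZ := mulXZ hM bA mulA invA.
move=> A0 B Z; split; first exact: concrete_operator_algebra csA0 mulA0A0.
split; first exact: concrete_operator_algebra csB mulBB.
split.
  split; first exact: concrete_operator_bimodule csB csA0 csZ mulBZ mulZA0.
  exists (concrete_space (closed_span (genX M (a @` mcar A)))),
    (fun (c : H -> H) (x : K -> H) => c \o x), (fun (x : K -> H) (b : K -> K) => x \o b).
  split.
  - exact: concrete_operator_bimodule csA0 csB csX mulA0X mulXB.
  - apply: (iso_balanced_multiplication csZ csX csB mulZX mulZA0 mulA0X).
    exact: left_approximableZ hM bA invA F1 hF Mm sm contr_m Mn sn contr_n.
  - apply: (iso_balanced_multiplication csX csZ csA0 mulXZ mulXB mulBZ).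
    exact: left_approximableX hM bA invA F1 hF Mm sm contr_m Mn sn contr_n.
have [e [he1 [he2 he3]]] := l2_l2_hbasis H; have [f [hf1 [hf2 hf3]]] := l2_l2_hbasis K.
have bM g : M g -> bounded_op g by case: hM => h _ _; exact: h.
have [||||||||V [bV nV AB BA [fA fB]]] := @corner_equivalence R H K m n _ _ _ _ e f _ _
  (rigged_linked hM bA Mm tm contr_m Mn tn contr_n).
- by split.
- by split.
- by move=> i; exact: bM.
- by move=> i; exact: bM.
- move=> k y; rewrite -sqr_vn ler_pXn2r ?nnegrE ?vn_ge0 ?hnorm_ge0 //.
  exact: column_contraction hM Mm contr_m k y.
- move=> k x; rewrite -sqr_vn ler_pXn2r ?nnegrE ?vn_ge0 ?hnorm_ge0 //.
  exact: column_contraction_n hM Mn contr_n k x.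
- by move=> s; exact: tm.
- move=> s; apply: (approx_adj_n hM Mn tn); first by exists (n s).
exact: (stably_isomorphic_corner he1 hf1 csA0 csB mulA0A0 mulBB bV nV AB BA fA fB).
Qed.
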